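(* Assume the General Setup and Assumption 2.1 with the two summability conditions there replaced by $\sum_{n\ge1}n\,\varpi_{q,p}(n)<\infty$ and $\sum_{r\ge1}r\,(\beta_q(r))^\delta<\infty$, and suppose $q_1$ is linear. Let $k$ be such that $r_k=i_1$ (so $q_1,\dots,q_{i_1}$ are exactly the linear polynomials). Let $G=G(x_1,\dots,x_{i_1})$ satisfy the same Hölder and growth bounds as $F$ (with the same $K,\kappa,\iota$) and $\int G\,d\nu_1\cdots d\nu_k=0$ (variables grouped as $y_i=(x_{r_{i-1}+1},\dots,x_{r_i})$). Put $G_n=G(X(q_1(n)),\dots,X(q_{i_1}(n)))$ and $\sigma^2=\lim_{N\to\infty}\frac1N\mathrm{Var}(\sum_{n=1}^NG_n)$ (this limit exists). For $i=1,\dots,k$ let $Y^{(i)}=\{Y^{(i)}(n)\}_{n\ge1}$ be mutually independent processes such that $Y^{(i)}$ has the same distribution as $\{(X(n+d_{1,i}),\dots,X(n+d_{r_i-r_{i-1},i}))\}_{n\ge1}$, where $d_{j,i}=q_{r_{i-1}+j}-q_{r_{i-1}+1}$ (a constant). Let $Z_n=G(Y^{(1)}(q_1(n)),Y^{(2)}(q_{r_1+1}(n)),\dots,Y^{(k)}(q_{r_{k-1}+1}(n)))$ and $\Sigma_N=\sum_{n=1}^NZ_n$. Then $s^2=\lim_{N\to\infty}\frac1N\mathrm{Var}\,\Sigma_N$ exists; $\sigma^2>0$ if and only if $s^2>0$; and these hold if and only if there is no representation $Z_n=V_{n+1}-V_n$ ($n\ge0$) with $\{V_n\}_{n\ge0}$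 a square integrable weakly (wide sense) stationary process.
   Context: General Setup. Let $(\Omega,\mathcal F,P)$ be a probability space, $\{X(n)\}_{n\ge0}$ an $\mathbb R^\wp$-valued process, and $\{\mathcal F_{k,l}\}_{-\infty\le k\le l\le\infty}$ sub-$\sigma$-algebras with $\mathcal F_{k,l}\subset\mathcal F_{k',l'}$ if $k'\le k$, $l\le l'$. For sub-$\sigma$-algebras $\mathcal G,\mathcal H$ put $\varpi_{q,p}(\mathcal G,\mathcal H)=\sup\{\|E[g|\mathcal G]-Eg\|_p: g\in L^q(\Omega,\mathcal H,P),\|g\|_q\le1\}$, $\varpi_{q,p}(n)=\sup_{k\ge0}\varpi_{q,p}(\mathcal F_{-\infty,k},\mathcal F_{k+n,\infty})$ and $\beta_q(r)=\sup_{k\ge0}\|X(k)-E(X(k)|\mathcal F_{k-r,k+r})\|_q$. Let $q_1,\dots,q_\ell$ be nonconstant polynomials with $q_i(\mathbb N)\subset\mathbb N$ and $q_1(n)<\dots<q_\ell(n)$ for all large $n$; each difference $q_{i+1}-q_i$ is then either a positive constant or tends to $\infty$. Let $0<r_1<\dots<r_{\hat\ell-1}<\ell$ be all indices $i$ with $q_{i+1}(n)-q_i(n)\to\infty$, and $r_0=0$, $r_{\hat\ell}=\ell$. Let $\hat D=\{q_i-q_{r_s+1}:0\le s\le\hat\ell-1,\ r_s<i\le r_{s+1}\}$ (a finite set of nonnegative integers containing $0$). Stationarity: all $X(n)$ have a common distribution $\mu$, and for $k\le 2|\hat D|$ and $n_1\le\dots\le n_k$ the joint law of $(X(n_1),\dots,X(n_k))$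 depends only on the differences $n_{j}-n_{j-1}$. For $1\le i\le\hat\ell$ let $\nu_i$ be the law of $(X(0),X(q_{r_{i-1}+2}-q_{r_{i-1}+1}),\dots,X(q_{r_i}-q_{r_{i-1}+1}))$. Put $\gamma_\theta=(\int|x|^\theta d\mu(x))^{1/\theta}$. $F:(\mathbb R^\wp)^\ell\to\mathbb R$ satisfies, for some $K,\iota>0$, $\kappa\in(0,1]$: $|F(x)-F(z)|\le K[1+\sum_{i}(|x_i|^\iota+|z_i|^\iota)]\sum_i|x_i-z_i|^\kappa$ and $|F(x)|\le K[1+\sum_i|x_i|^\iota]$. Assumption 2.1: with $d=(\hat\ell-1)|\hat D|\wp$ there are $1\le p,q<\infty$ and $\delta,m>0$ with $\delta<\kappa-d/p$, $\sum_{n\ge1}\varpi_{q,p}(n)<\infty$, $\sum_{r\ge1}\beta_q(r)^\delta<\infty$, $\gamma_m<\infty$, $\gamma_{2q\iota}<\infty$, and $\frac12\ge\frac1p+\frac{\iota+2}m+\frac\delta q$. Degrees: $0=i_0<i_1<\dots<i_v=\ell$ and $m_1<\dots<m_v$ are such that $\deg q_i=m_k$ for $i_{k-1}<i\le i_k$ (each $i_k$ is some $r_s$).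
   Formalization: The processes Y^(i) are indexed by n≥0 (equality in distribution and independence include n=0), not n≥1, since Z_0 uses Y^(i)(q(0)), undefined e.g. for q_1(n)=n; N is read as containing 0, so q_i(0)≥0, and Z_n=V_{n+1}-V_n is understood almost surely. *)

(* Defs.v *)
From mathcomp Require Import all_boot all_order all_algebra.
From mathcomp Require Import all_classical all_reals all_analysis.
Import Order.TTheory GRing.Theory Num.Theory.



Unset Printing Implicit Defensive.

Local Open Scope classical_set_scope.
Local Open Scope ring_scope.
Local Open Scope ereal_scope.
Local Open Scope ring_scope.

(* Vectors of R^wp are represented as wp.-tuple R (measurable for the  *)
(* product sigma-algebra generated by the coordinates).               *)

Definition vnorm {R : realType} {wp : nat} (x : wp.-tuple R) : R :=
  Num.sqrt (\sum_(j < wp) (tnth x j) ^+ 2).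
Definition vdist {R : realType} {wp : nat} (x z : wp.-tuple R) : R :=
  Num.sqrt (\sum_(j < wp) (tnth x j - tnth z j) ^+ 2).

Definition holder_growth {R : realType} {wp : nat} (n : nat) (K iota kappa : R)
    (H : seq (wp.-tuple R) -> R) : Prop :=
  (forall x z : seq (wp.-tuple R), size x = n -> size z = n ->
     `|H x - H z| <=
       K * (1 + \sum_(xi <- x) powR (vnorm xi) iota
              + \sum_(zi <- z) powR (vnorm zi) iota)
         * \sum_(pr <- zip x z) powR (vdist pr.1 pr.2) kappa) /\
  (forall x : seq (wp.-tuple R), size x = n ->
     `|H x| <= K * (1 + \sum_(xi <- x) powR (vnorm xi) iota)).

(* The polynomials q_1 < ... < q_ell (indices 1..ell, as in the paper). *)
(* qp i is the polynomial q_i, qf i n = q_i(n) as a natural number.      *)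

Definition qdiverge (qf : nat -> nat -> nat) (i : nat) : Prop :=
  forall M : nat, exists N : nat, forall n : nat, (N <= n)%N ->
    (M <= qf i.+1 n - qf i n)%N.

Definition rlist (qf : nat -> nat -> nat) (ell : nat) : seq nat :=
  [seq i <- iota 1 ell.-1 | `[< qdiverge qf i >]].

Definition lhat (qf : nat -> nat -> nat) (ell : nat) : nat :=
  (size (rlist qf ell)).+1.

(* r_s, with r_0 = 0 and r_lhat = ell *)
Definition rr (qf : nat -> nat -> nat) (ell : nat) (s : nat) : nat :=
  nth ell (0 :: rlist qf ell) s.

(* Dhat = { q_i - q_{r_s+1} : 0 <= s <= lhat-1, r_s < i <= r_{s+1} } (these
   differences are constants, evaluated here at n = 0) *)
Definition Dhat (qf : nat -> nat -> nat) (ell : nat) : seq nat :=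
  undup [seq (qf i 0 - qf (rr qf ell s).+1 0)%N
        | s <- iota 0 (lhat qf ell),
          i <- iota (rr qf ell s).+1 (rr qf ell s.+1 - rr qf ell s)].

Definition blen (qf : nat -> nat -> nat) (ell : nat) (i : nat) : nat :=
  (rr qf ell i - rr qf ell i.-1)%N.

(* d_{j+1,i} = q_{r_{i-1}+j+1} - q_{r_{i-1}+1} (a constant), j = 0.. *)
Definition doff (qf : nat -> nat -> nat) (ell : nat) (i j : nat) : nat :=
  (qf (rr qf ell i.-1 + j.+1) 0 - qf (rr qf ell i.-1).+1 0)%N.

Definition blockX {R : realType} {wp : nat} {d} {Omega : measurableType d}
    (qf : nat -> nat -> nat) (ell : nat) (X : nat -> Omega -> wp.-tuple R)
    (i n : nat) (w : Omega) : (blen qf ell i).-tuple (wp.-tuple R) :=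
  [tuple X (n + doff qf ell i j)%N w | j < blen qf ell i].

Definition nu {R : realType} {wp : nat} {d} {Omega : measurableType d}
    (P : probability Omega R)
    (qf : nat -> nat -> nat) (ell : nat) (X : nat -> Omega -> wp.-tuple R)
    (i : nat) : set ((blen qf ell i).-tuple (wp.-tuple R)) -> \bar R :=
  pushforward P (blockX qf ell X i 0).

Fixpoint iint {R : realType} {wp : nat} (qf : nat -> nat -> nat) (ell : nat)
    (nus : forall i : nat, set ((blen qf ell i).-tuple (wp.-tuple R)) -> \bar R)
    (G : seq (wp.-tuple R) -> R) (m i : nat) (acc : seq (wp.-tuple R))
    : \bar R :=
  match m with
  | 0 => (G acc)%:E
  | m'.+1 => (\int[nus i]_y iint qf ell nus G m' i.+1 (acc ++ tval y))%E
  end.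

Definition Gmeasurable {d} {Omega : measurableType d} {R : realType}
    (Gs : set (set Omega)) (h : Omega -> R) : Prop :=
  forall B : set R, measurable B -> Gs (h @^-1` B).

Definition cexp_version {d} {Omega : measurableType d} {R : realType}
    (P : probability Omega R) (Gs : set (set Omega)) (g h : Omega -> R) : Prop :=
  Gmeasurable Gs h /\ P.-integrable setT (EFin \o h) /\
  forall A, Gs A ->
    (\int[P]_(x in A) (h x)%:E = \int[P]_(x in A) (g x)%:E)%E.

Definition varpi_sets {d} {Omega : measurableType d} {R : realType}
    (P : probability Omega R) (q p : R) (Gs Hs : set (set Omega)) : \bar R :=
  ereal_sup [set e : \bar R | exists g h : Omega -> R,
    [/\ Gmeasurable Hs g, (Lnorm P q%:E (EFin \o g) <= 1)%E,
        cexp_version P Gs g h &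
        e = Lnorm P p%:E (fun w => (h w - fine ('E_P[g]))%:E)]].

Definition varpi {d} {Omega : measurableType d} {R : realType}
    (P : probability Omega R) (Fam : \bar int -> \bar int -> set (set Omega))
    (q p : R) (n : nat) : \bar R :=
  ereal_sup [set varpi_sets P q p (Fam -oo%E (k%:Z)%:E) (Fam ((k + n)%N%:Z)%:E +oo%E)
            | k in [set: nat]].

Definition beta {d} {Omega : measurableType d} {R : realType} {wp : nat}
    (P : probability Omega R) (Fam : \bar int -> \bar int -> set (set Omega))
    (X : nat -> Omega -> wp.-tuple R) (q : R) (r : nat) : \bar R :=
  ereal_sup [set e : \bar R | exists (k : nat) (h : Omega -> wp.-tuple R),
    (forall j : 'I_wp, cexp_version P (Fam (k%:Z - r%:Z)%:E (k%:Z + r%:Z)%:E)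
                         (fun w => tnth (X k w) j) (fun w => tnth (h w) j)) /\
    e = Lnorm P q%:E (fun w => (vdist (X k w) (h w))%:E)].

Definition gammaX {d} {Omega : measurableType d} {R : realType} {wp : nat}
    (P : probability Omega R) (X : nat -> Omega -> wp.-tuple R) (theta : R)
    : \bar R :=
  poweR (\int[pushforward P (X 0%N)]_x (powR (vnorm x) theta)%:E)%E theta^-1.

(* The processes Y^(i) (i = 1..k), with Y i n : Omega' -> (R^wp)^(r_i - r_{i-1}),
   are mutually independent: the product rule holds for all finite-dimensional
   cylinder events (these form pi-systems generating sigma(Y^(i))). *)
Definition indep_processes {d'} {Omega' : measurableType d'} {R : realType}
    {wp : nat} (P' : probability Omega' R) (qf : nat -> nat -> nat) (ell k : nat)
    (Y : forall i : nat, nat -> Omega' -> (blen qf ell i).-tuple (wp.-tuple R))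
    : Prop :=
  forall (m : nat) (ns : m.-tuple nat)
         (A : forall i : nat, set (m.-tuple ((blen qf ell i).-tuple (wp.-tuple R)))),
    (forall i, measurable (A i)) ->
    P' (\bigcap_(i in [set i : nat | (1 <= i <= k)%N])
          ((fun w => map_tuple (fun n => Y i n w) ns) @^-1` A i))
    = (\prod_(i <- iota 1 k)
          P' ((fun w => map_tuple (fun n => Y i n w) ns) @^-1` A i))%E.

Definition weakly_stationary {d'} {Omega' : measurableType d'} {R : realType}
    (P' : probability Omega' R) (V : nat -> Omega' -> R) : Prop :=
  [/\ (forall n, measurable_fun setT (V n)),
      (forall n, P'.-integrable setT (fun w => (V n w ^+ 2)%:E)),
      (forall n, 'E_P'[V n] = 'E_P'[V 0%N]) &
      (forall n m t, covariance P' (V (n + t)%N) (V (m + t)%N)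
                     = covariance P' (V n) (V m))].

(* Main.v *)
From HB Require Import structures.
Require Import Defs.
From mathcomp Require Import all_boot all_order all_algebra.
From mathcomp Require Import all_classical all_reals all_analysis.
From mathcomp Require Import measurable_realfun.
From mathcomp Require Import ring lra zify.
Import Order.TTheory GRing.Theory Num.Theory numFieldNormedType.Exports.
Local Open Scope classical_set_scope.
Local Open Scope ereal_scope.
Local Open Scope ring_scope.

Set Implicit Arguments.
Unset Strict Implicit.


(** Group the linear polynomials into k blocks of common slope. Inside a block they differ by
    constants, and the slopes a_1 < ... < a_k strictly increase from block to block. Integrating the
    last k-i blocks out of G against their own laws gives functions that run from the constant 0
    (the full integral of G) to G itself ([partial_integral]). So G telescopes into k parts, the
    i-th of which depends on the first i blocks only and has mean zero in the i-th one.

    The engine is [decoupling]. If the coordinates W come at least 3r later than those in h and U,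
    and fbar(u) = E f(u,W), then E h (f(U,W) - fbar(U)) is at most a constant times ϖ_{q,p}(r) +
    beta_q(r)^delta, up to a summable padding. The coordinates are replaced by conditional
    expectations on windows of radius r. For a deterministic u the bound is then the definition of
    ϖ. It is made uniform over the random U by chaining through dyadic grids: uniformity over a
    D-dimensional grid costs D/p in the exponent, and the resulting geometric series converges
    because kappa > D/p ([chain_path]). Since block i at time n lies about n later than the
    preceding blocks, the covariance of part i at n with part j at m is at most v(h) whenever h <= n
    and a_j m + h <= a_i n, where the sum of h v(h) is finite.

    Covariances also converge along the lines (n + a_j t, m + a_i t). Coordinates of equal slope
    move rigidly, so their joint law is constant by stationarity, and those of different slopes
    become independent ([line_product_cvg]). Decay together with convergence along lines gives the
    density sigma^2 of the double sum of covariances ([double_sum_density]). When both times advance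
    by the same t, the limit is exactly the covariance of Z, because the Y^(i) are independent
    copies of the blocks ([spec_product]). Hence Z is centred with covariances c(n-m), the sum of h
    |c(h)| is finite, and Var Sigma_N - N s^2 converges ([stationary_double_sum]).

    To compare sigma^2 with s^2, consider the window AN <= n < AN+N with A above all slopes. Inside
    it, parts of different slopes live at times at least N apart, their mutual covariances add up to
    a bounded quantity, and the window sum has second moment N s^2 + o(N). This window sum is the
    difference of the sums up to (A+1)N and up to AN, so elementary inequalities between second
    moments show that sigma^2 and s^2 vanish together ([block_variance]).

    If s^2 = 0, the second moments of the partial sums S_n of Z converge, the Cesàro averages of the
    S_n converge in L^2 to some b, and V_n = S_n - b is weakly stationary with increments Z_n.
    Conversely the partial sums of a coboundary are bounded in L^2, which forces s^2 = 0
    ([coboundary_criterion]). *)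

(** * Real-valued expectation and its limit theorems *)

Section expectation.
Context {d : measure_display} {T : measurableType d} {R : realType}.
Variable P : probability T R.
Implicit Types (f g : T -> R) (A : set T).

Definition itg f := P.-integrable setT (EFin \o f).
Definition Ex f : R := fine (\int[P]_x (f x)%:E)%E.

Lemma itg_measurable f : itg f -> measurable_fun setT f.
Proof. by move=> /measurable_int /measurable_EFinP. Qed.

Lemma integral_Ex f : itg f -> (\int[P]_x (f x)%:E)%E = (Ex f)%:E.
Proof. by move=> fi; rewrite fineK//; exact: integrable_fin_num. Qed.

Lemma itg_dominated f g : measurable_fun setT f -> itg g ->
  (forall x, `|f x| <= g x) -> itg f.
Proof.
move=> mf gi fg; apply: (le_integrable _ _ _ gi) => //.
  exact/measurable_EFinP.
by move=> x _ /=; rewrite lee_fin (le_trans (fg x))// ler_norm.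
Qed.

Lemma itg_cst c : itg (fun=> c).
Proof. exact: finite_measure_integrable_cst. Qed.

Lemma itg_bounded f C : measurable_fun setT f -> (forall x, `|f x| <= C) -> itg f.
Proof. by move=> mf fC; apply: (itg_dominated mf (itg_cst C)). Qed.

Lemma itgD f g : itg f -> itg g -> itg (fun x => f x + g x).
Proof. by move=> fi gi; have := integrableD measurableT fi gi. Qed.

Lemma itgN f : itg f -> itg (fun x => - f x).
Proof. by move=> fi; have := integrableN fi. Qed.

Lemma itgB f g : itg f -> itg g -> itg (fun x => f x - g x).
Proof. by move=> fi gi; apply: itgD => //; exact: itgN. Qed.

Lemma itgZ c f : itg f -> itg (fun x => c * f x).
Proof. by move=> fi; have := integrableZl measurableT c fi. Qed.

Lemma itg_norm f : itg f -> itg (fun x => `|f x|).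
Proof. by move=> fi; have := integrable_abse fi. Qed.

Lemma itg_sum (I : Type) (s : seq I) (f : I -> T -> R) :
  (forall i, itg (f i)) -> itg (fun x => \sum_(i <- s) f i x).
Proof.
move=> fi; elim: s => [|i s IH].
  by under [X in itg X]eq_fun do rewrite big_nil; exact: itg_cst.
by under [X in itg X]eq_fun do rewrite big_cons; exact: itgD.
Qed.

Lemma ExD f g : itg f -> itg g -> Ex (fun x => f x + g x) = Ex f + Ex g.
Proof. by move=> fi gi; exact: (RintegralD measurableT fi gi). Qed.

Lemma ExB f g : itg f -> itg g -> Ex (fun x => f x - g x) = Ex f - Ex g.
Proof. by move=> fi gi; exact: (RintegralB measurableT fi gi). Qed.

Lemma ExZ c f : itg f -> Ex (fun x => c * f x) = c * Ex f.
Proof. by move=> fi; exact: (RintegralZl c measurableT fi). Qed.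

Lemma Ex_cst c : Ex (fun=> c) = c.
Proof. by rewrite /Ex integral_cst//= probability_setT mule1. Qed.

Lemma ExN f : itg f -> Ex (fun x => - f x) = - Ex f.
Proof.
by move=> fi; rewrite -mulN1r -ExZ//; congr Ex; apply/funext => x; rewrite mulN1r.
Qed.

Lemma Ex_sum (I : Type) (s : seq I) (f : I -> T -> R) :
  (forall i, itg (f i)) -> Ex (fun x => \sum_(i <- s) f i x) = \sum_(i <- s) Ex (f i).
Proof.
move=> fi; elim: s => [|i s IH].
  by rewrite big_nil; under eq_fun do rewrite big_nil; exact: Ex_cst.
rewrite big_cons -IH -ExD//; last exact: itg_sum.
by congr Ex; apply/funext => x; rewrite big_cons.
Qed.

Lemma le_Ex f g : itg f -> itg g -> (forall x, f x <= g x) -> Ex f <= Ex g.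
Proof. by move=> fi gi fg; apply: (le_Rintegral measurableT fi gi). Qed.

Lemma Ex_ge0 f : (forall x, 0 <= f x) -> 0 <= Ex f.
Proof. by move=> f0; apply: Rintegral_ge0. Qed.

Lemma norm_Ex f : itg f -> `|Ex f| <= Ex (fun x => `|f x|).
Proof. by move=> fi; exact: (le_normr_Rintegral measurableT fi). Qed.

Lemma norm_Ex_le f g : itg f -> itg g -> (forall x, `|f x| <= g x) -> `|Ex f| <= Ex g.
Proof. by move=> fi gi fg; rewrite (le_trans (norm_Ex fi))//; exact: le_Ex (itg_norm fi) _ _. Qed.

Lemma ae_eq_Ex f g : itg f -> measurable_fun setT g ->
  {ae P, forall x, f x = g x} -> itg g /\ Ex g = Ex f.
Proof.
move=> fi mg fg.
have fg' : ae_eq P setT (EFin \o f) (EFin \o g).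
  by apply: filterS fg => x /= -> _.
split; last first.
  congr fine; apply/esym; apply: ae_eq_integral => //.
  - by apply/measurable_EFinP; exact: itg_measurable fi.
  - exact/measurable_EFinP.
have mge : measurable_fun setT (EFin \o g) by exact/measurable_EFinP.
apply/integrableP; split => //; move/integrableP : fi => [mf].
rewrite (@ae_eq_integral _ _ _ P _ (fun x => `|(EFin \o f) x|%E) (fun x => `|(EFin \o g) x|%E))//.
- exact: measurableT_comp.
- exact: measurableT_comp.
- by apply: filterS fg => x /= -> _.
Qed.

Lemma fatou_Ex (f_ : nat -> T -> R) f C :
  (forall n, itg (f_ n)) -> (forall n x, 0 <= f_ n x) ->
  (forall x, f_ ^~ x @ \oo --> f x) -> (forall n, Ex (f_ n) <= C) ->
  itg f /\ Ex f <= C.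
Proof.
move=> fi f0 cv bd.
have mf : measurable_fun setT f.
  by apply: (@measurable_fun_cvg _ _ _ setT f_) => // n; exact: itg_measurable.
have fge0 x : 0 <= f x.
  rewrite -(cvg_lim _ (cv x))//; apply: limr_ge; first exact: cvgP (cv x).
  exact: nearW.
have fC : (\int[P]_x (f x)%:E <= C%:E)%E.
  have <- : (\int[P]_x limn_einf (fun n => (f_ n x)%:E) = \int[P]_x (f x)%:E)%E.
    have c x : (fun n => (f_ n x)%:E) @ \oo --> (f x)%:E.
      by apply: cvg_EFin; [exact: nearW|exact: cv].
    apply: eq_integral => x _; rewrite is_cvg_limn_einfE; first exact/cvg_lim.
    exact: cvgP (c x).
  apply: le_trans (fatou _ measurableT _ _) _.
  - by move=> n; apply/measurable_EFinP; exact: itg_measurable.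
  - by move=> n x _; rewrite lee_fin.
  rewrite limn_einf_lim; apply: lime_le; first exact: is_cvg_einfs.
  apply: nearW => n; apply: le_trans (ereal_inf_lbound _) _; first by exists n => //=.
  by rewrite integral_Ex// lee_fin.
split; last first.
  rewrite -lee_fin fineK//; apply/fin_numPlt; apply/andP; split.
    by rewrite (lt_le_trans (ltNyr 0))//; apply: integral_ge0 => x _; rewrite lee_fin.
  by rewrite (le_lt_trans fC)// ltry.
apply/integrableP; split; first exact/measurable_EFinP.
apply: le_lt_trans (ltry C); apply: le_trans fC.
rewrite le_eqVlt; apply/orP; left; apply/eqP.
by apply: eq_integral => x _ /=; rewrite ger0_norm.
Qed.

Lemma dominated_cvg_Ex (f_ : nat -> T -> R) f g :
  (forall n, measurable_fun setT (f_ n)) -> itg g ->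
  (forall n x, `|f_ n x| <= g x) -> (forall x, f_ ^~ x @ \oo --> f x) ->
  itg f /\ (fun n => Ex (f_ n)) @ \oo --> Ex f.
Proof.
move=> mf gi fg cv.
have mf' : measurable_fun setT f by exact: (@measurable_fun_cvg _ _ _ setT f_).
have h1 n : measurable_fun setT (fun x => (f_ n x)%:E) by exact/measurable_EFinP.
have h2 : measurable_fun setT (EFin \o f) by exact/measurable_EFinP.
have h3 : {ae P, forall x, setT x -> (fun n => (f_ n x)%:E) @ \oo --> (EFin \o f) x}.
  by apply: aeW => x _; apply: cvg_EFin; [exact: nearW|exact: cv].
have h4 : {ae P, forall x n, setT x -> (`|(f_ n x)%:E| <= (EFin \o g) x)%E}.
  by apply: aeW => x n _; rewrite /= lee_fin.
have [i _ c] := dominated_convergence measurableT h1 h2 h3 gi h4.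
split; first exact: i.
by apply: fine_cvg; rewrite fineK//; exact: integrable_fin_num.
Qed.

Lemma itg_indicM f A : measurable A -> itg f -> itg (fun x => \1_A x * f x).
Proof.
move=> mA fi; apply: (@itg_dominated _ (fun x => `|f x|)).
- by apply: measurable_funM => //; exact: itg_measurable.
- exact: itg_norm.
by move=> x; rewrite normrM ler_piMl// indicE; case: (_ \in _); rewrite ?normr1// normr0.
Qed.

Lemma Ex_indicM f A : measurable A ->
  Ex (fun x => \1_A x * f x) = fine (\int[P]_(x in A) (f x)%:E)%E.
Proof.
move=> mA; rewrite /Ex; congr fine; rewrite [in RHS]integral_mkcond.
apply: eq_integral => x _; rewrite /patch indicE.
by case: (_ \in _); rewrite ?mul1r ?mul0r.
Qed.

Lemma Ex_indic A : measurable A -> Ex \1_A = fine (P A).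
Proof. by move=> mA; rewrite /Ex integral_indic// setIT. Qed.

End expectation.

Section law.
Context {d1 d2 d3 : measure_display} {R : realType}.
Context {T1 : measurableType d1} {T2 : measurableType d2} {S : measurableType d3}.

Lemma eq_law_Ex (P1 : probability T1 R) (P2 : probability T2 R)
    (U1 : T1 -> S) (U2 : T2 -> S) (f : S -> R) :
  measurable_fun setT U1 -> measurable_fun setT U2 -> measurable_fun setT f ->
  (forall A, measurable A -> P1 (U1 @^-1` A) = P2 (U2 @^-1` A)) ->
  itg P2 (f \o U2) -> Ex P1 (f \o U1) = Ex P2 (f \o U2) /\ itg P1 (f \o U1).
Proof.
move=> m1 m2 mf law fi.
have pe g : measurable_fun setT g -> (forall x, 0 <= g x)%E ->
    (\int[P1]_x g (U1 x) = \int[P2]_x g (U2 x))%E.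
  move=> mg g0.
  have E1 := @ge0_integral_pushforward _ _ _ _ _ _ m1 P1 setT g measurableT mg (fun y _ => g0 y).
  have E2 := @ge0_integral_pushforward _ _ _ _ _ _ m2 P2 setT g measurableT mg (fun y _ => g0 y).
  rewrite !preimage_setT in E1 E2.
  rewrite -[LHS]E1 -[RHS]E2; apply: eq_measure_integral => A mA _.
  exact: law.
have mfE : measurable_fun setT (EFin \o f) by exact/measurable_EFinP.
have i1 : itg P1 (f \o U1).
  apply/integrableP; split; first by apply/measurable_EFinP; exact: measurableT_comp.
  move/integrableP : fi => [_]; apply: le_lt_trans.
  by rewrite (pe (fun y => `|(f y)%:E|%E))//; exact: measurableT_comp.
split => //; rewrite /Ex; congr fine.
have E1 := @integral_pushforward _ _ _ _ _ _ m1 P1 setT (EFin \o f) mfE i1 measurableT.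
have E2 := @integral_pushforward _ _ _ _ _ _ m2 P2 setT (EFin \o f) mfE fi measurableT.
rewrite !preimage_setT in E1 E2.
transitivity (\int[pushforward P1 U1]_y (EFin \o f) y)%E; first by rewrite E1.
transitivity (\int[pushforward P2 U2]_y (EFin \o f) y)%E; last by rewrite E2.
by apply: eq_measure_integral => A mA _; exact: law.
Qed.

End law.

Lemma squeeze_dist (R : realType) (u v : nat -> R) (l : R) :
  (forall n, `|u n - l| <= v n) -> v @ \oo --> 0 -> u @ \oo --> l.
Proof.
move=> uv /cvgrPdist_le v0; apply/cvgrPdist_le => e e0.
apply: filterS (v0 e e0) => n; rewrite sub0r normrN distrC => H.
by rewrite (le_trans (uv n))// (le_trans (ler_norm _)).
Qed.

Lemma cvgn_unique (R : realType) (u : nat -> R) (l l' : R) :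
  u @ \oo --> l -> u @ \oo --> l' -> l = l'.
Proof. by move=> c c'; rewrite -(cvg_lim _ c)// -(cvg_lim _ c'). Qed.

Lemma powR1x (R : realType) (e : R) : 1 `^ e = 1.
Proof. by rewrite powR1. Qed.

Lemma powRD_gt0 (R : realType) (x r s : R) : 0 < x -> x `^ (r + s) = x `^ r * x `^ s.
Proof. by move=> x0; rewrite powRD// (gt_eqF x0) implybT. Qed.

(** * Conditional expectation through Radon-Nikodym densities *)

Section radon_nikodym_factor.
Context {d d' : measure_display} {T : measurableType d} {T' : measurableType d'}
  {R : realType}.
Variables (P : probability T R) (phi : {mfun T >-> T'}).

(** The image under [phi] of the charge g dP is absolutely continuous with respect to the law of
    [phi]; its density is E(g | phi) as a function of the value of [phi]. *)
Lemma pushforward_density (g : T -> R) : itg P g -> exists h : T' -> R,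
  [/\ measurable_fun setT h, itg P (h \o phi) & forall A, measurable A ->
    (\int[P]_(x in phi @^-1` A) (h (phi x))%:E = \int[P]_(x in phi @^-1` A) (g x)%:E)%E].
Proof.
move=> gi.
have mphi : measurable_fun setT phi by [].
pose Q := distribution P phi.
pose nu : {charge set T' -> \bar R} :=
  measure_function_pushforward__canonical__charge_Charge (induced_charge gi) mphi.
have nuQ : nu `<< Q.
  apply/null_content_dominatesP => A mA QA0.
  rewrite /= /pushforward /induced_charge; apply: null_set_integral => //.
    by rewrite -[X in measurable X]setTI; exact (mphi measurableT A mA).
  by apply: measurable_funTS; exact: (measurable_int P).
have fi := Radon_Nikodym_integrable nuQ.
pose h : T' -> R := fun x => fine ((Radon_Nikodym nu Q) x).
have hE : EFin \o h = Radon_Nikodym nu Q.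
  by apply/funext => x /=; rewrite fineK//; exact: Radon_Nikodym_fin_num.
have mhE : measurable_fun setT (EFin \o h) by rewrite hE; exact: measurable_int fi.
have mh : measurable_fun setT h by exact/measurable_EFinP.
have hi : itg P (h \o phi).
  apply/integrableP; split.
    by apply/measurable_EFinP; exact: measurableT_comp.
  move/integrableP : fi => [_]; rewrite -hE; apply: le_lt_trans.
  rewrite (@ge0_integral_pushforward _ _ _ _ _ _ mphi P setT (abse \o (EFin \o h)))//; first exact: measurableT_comp.
  by move=> y _; exact: abse_ge0.
exists h; split => // A mA.
have := Radon_Nikodym_integral nuQ mA; rewrite -hE => E.
rewrite (_ : (\int[P]_(x in phi @^-1` A) (g x)%:E)%E = nu A)// E.
rewrite (@integral_pushforward _ _ _ _ _ _ mphi P A (EFin \o h))//.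
by apply: integrableS hi => //; rewrite -[X in measurable X]setTI; exact (mphi measurableT A mA).
Qed.

End radon_nikodym_factor.

Lemma dist_quotient_le (R : realFieldType) (a b y : R) :
  0 < b -> a <= b * y -> b * y <= a + 1 -> `|a / b - y| <= b^-1.
Proof.
move=> b0 l u; rewrite -(ler_pM2l b0) mulfV ?gt_eqF//.
rewrite -{1}(gtr0_norm b0) -normrM mulrBr mulrCA mulfV ?gt_eqF// mulr1.
by rewrite ler_norml; apply/andP; split; lra.
Qed.

Section conditional_expectation.
Context {d : measure_display} {T : measurableType d} {R : realType}.
Variable P : probability T R.
Variable Gs : set (set T).
Hypothesis sGs : sigma_algebra setT Gs.
Hypothesis Gsm : Gs `<=` measurable.
Implicit Types f g h : T -> R.

(** The same points carrying only the events of [Gs], so that [Gmeasurable] becomes ordinary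
    measurability on another type. *)
Let TG := g_sigma_algebraType Gs.

Lemma measurable_sub_sigma (A : set T) : measurable (A : set TG) <-> Gs A.
Proof. by rewrite measurable_g_measurableTypeE. Qed.

Lemma GmeasurableP f : Gmeasurable Gs f <-> measurable_fun setT (f : TG -> R).
Proof.
split=> [mf _ B mB|mf B mB]; first by rewrite setTI; apply/measurable_sub_sigma; exact: mf.
by apply/measurable_sub_sigma; rewrite -[X in measurable X]setTI; exact: mf.
Qed.

Lemma Gmeasurable_measurable f : Gmeasurable Gs f -> measurable_fun setT f.
Proof. by move=> mf _ B mB; rewrite setTI; apply: Gsm; exact: mf. Qed.

Let mid : measurable_fun setT (id : T -> TG).
Proof. by move=> _ A mA; rewrite setTI; apply: Gsm; exact/measurable_sub_sigma. Qed.

Lemma cexp_exists g : itg P g -> exists h, cexp_version P Gs g h.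
Proof.
move=> gi.
(* The identity into the coarser measurable space: a density along it is a [Gs]-measurable function
   on the original space. *)
pose X : {mfun T >-> TG} := HB.pack (id : T -> TG) (isMeasurableFun.Build _ _ _ _ _ mid).
have [h [mh hi hE]] := pushforward_density X gi.
exists h; split; [exact/GmeasurableP|split; first exact: hi] => A GA.
by apply: (hE A); exact/measurable_sub_sigma.
Qed.

Lemma GmeasurableM f h : Gmeasurable Gs f -> Gmeasurable Gs h ->
  Gmeasurable Gs (fun x => f x * h x).
Proof. by move=> /GmeasurableP mf /GmeasurableP mh; apply/GmeasurableP; exact: measurable_funM. Qed.

Lemma Gmeasurable_comp f (phi : R -> R) : Gmeasurable Gs f -> measurable_fun setT phi ->
  Gmeasurable Gs (phi \o f).
Proof. by move=> /GmeasurableP mf mphi; apply/GmeasurableP; exact: measurableT_comp. Qed.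

Lemma cexp_Ex_indic g h A : itg P g -> cexp_version P Gs g h -> Gs A ->
  Ex P (fun x => \1_A x * h x) = Ex P (fun x => \1_A x * g x).
Proof.
by move=> gi [_ [_ hE]] GA; rewrite !Ex_indicM ?hE//; exact: Gsm.
Qed.

Lemma cexp_Ex g h : itg P g -> cexp_version P Gs g h -> Ex P h = Ex P g.
Proof.
move=> gi ch; have GT : Gs setT by apply/measurable_sub_sigma.
have := cexp_Ex_indic gi ch GT.
by under eq_fun do rewrite indicT mul1r; under [in RHS]eq_fun do rewrite indicT mul1r.
Qed.

Lemma itgM_bounded (phi g : T -> R) C : measurable_fun setT phi ->
  (forall x, `|phi x| <= C) -> itg P g -> itg P (fun x => phi x * g x).
Proof.
move=> mphi bd gi.
apply: (@itg_dominated _ _ _ _ _ (fun x => C * `|g x|)).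
- by apply: measurable_funM => //; exact: itg_measurable gi.
- by apply: itgZ; exact: itg_norm.
by move=> x; rewrite normrM ler_wpM2r.
Qed.

(* [phi] is approximated by functions with finitely many values, the multiples of [1/n]. *)
Lemma cexp_pullout g h (phi : T -> R) C : itg P g -> cexp_version P Gs g h ->
  Gmeasurable Gs phi -> (forall x, `|phi x| <= C) ->
  Ex P (fun x => phi x * h x) = Ex P (fun x => phi x * g x).
Proof.
move=> gi ch Gphi bd.
have mphi := Gmeasurable_measurable Gphi.
have hi : itg P h by case: ch => _ [].
pose t (n : nat) x := Num.truncn (n.+1%:R * (phi x + C)).
have pos x : 0 <= phi x + C by have := bd x; rewrite ler_norml => /andP[+ _]; lra.
have tlt n x : (t n x < (Num.truncn (n.+1%:R * (2 * C))).+1)%N.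
  rewrite ltnS; apply: le_truncn; rewrite ler_pM2l ?ltr0n//.
  by have := bd x; rewrite ler_norml => /andP[_ +]; lra.
have Gt n j : Gs [set x | t n x = j].
  have -> : [set x | t n x = j] = (fun x => n.+1%:R * (phi x + C)) @^-1` `[j%:R, j.+1%:R[.
    apply/seteqP; split=> x /=; rewrite in_itv/= => H.
      by rewrite -H; apply: truncn_itv; rewrite mulr_ge0.
    by apply/eqP; rewrite truncn_eq// mulr_ge0.
  apply: (@Gmeasurable_comp phi (fun y => n.+1%:R * (y + C)) Gphi) => //.
  by apply: measurable_funM => //; exact: measurable_funD.
pose phin n x := (t n x)%:R / n.+1%:R - C.
have phinE n x : phin n x =
    \sum_(j < (Num.truncn (n.+1%:R * (2 * C))).+1) (j%:R / n.+1%:R - C) * \1_[set x | t n x = j] x.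
  rewrite (bigD1 (Ordinal (tlt n x)))//= big1 ?addr0.
    by rewrite indicE mem_set// mulr1.
  move=> j /negP jne; rewrite indicE memNset ?mulr0//= => tj.
  by apply: jne; apply/eqP/val_inj.
have mphin n : measurable_fun setT (phin n).
  rewrite (funext (phinE n)); apply: measurable_sum => j.
  by apply: measurable_funM => //; apply: measurable_indic; exact: Gsm.
have near n x : `|phin n x - phi x| <= n.+1%:R^-1.
  have /andP[l u] := truncn_itv (mulr_ge0 (ler0n R n.+1) (pos x)).
  rewrite -[(Num.truncn _).+1%:R]natr1 -/(t n x) in u; rewrite -/(t n x) in l.
  have -> : phin n x - phi x = (t n x)%:R / n.+1%:R - (phi x + C) by rewrite /phin; ring.
  by apply: dist_quotient_le; rewrite ?ltr0n// ltW.
have bdn n x : `|phin n x| <= C + 1.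
  have -> : phin n x = phi x + (phin n x - phi x) by ring.
  rewrite (le_trans (ler_normD _ _))// lerD// (le_trans (near n x))//.
  by rewrite invf_le1 ?ler1n ?ltr0n.
have cvphi f : itg P f -> (fun n => Ex P (fun x => phin n x * f x)) @ \oo --> Ex P (fun x => phi x * f x).
  move=> fi; have [||||_ //] := @dominated_cvg_Ex _ _ _ P (fun n x => phin n x * f x) (fun x => phi x * f x) (fun x => (C + 1) * `|f x|).
  - by move=> n; apply: measurable_funM => //; exact: itg_measurable fi.
  - by apply: itgZ; exact: itg_norm.
  - by move=> n x; rewrite normrM ler_wpM2r.
  move=> x; apply: cvgM; last exact: cvg_cst.
  by apply: (squeeze_dist (fun n => near n x)); exact: cvg_harmonic.
have eqn n : Ex P (fun x => phin n x * h x) = Ex P (fun x => phin n x * g x).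
  have E f : itg P f -> Ex P (fun x => phin n x * f x) =
     \sum_(j < (Num.truncn (n.+1%:R * (2 * C))).+1) (j%:R / n.+1%:R - C) *
        Ex P (fun x => \1_[set x | t n x = j] x * f x).
    move=> fi; under eq_fun do rewrite phinE mulr_suml.
    have mi j : itg P (fun x => \1_[set x | t n x = j] x * f x).
      by apply: itg_indicM => //; exact: Gsm.
    under eq_fun do under eq_bigr do rewrite -mulrA.
    by rewrite Ex_sum => [|j]; [apply: eq_bigr => j _; rewrite ExZ|exact: itgZ].
  by rewrite !E//; apply: eq_bigr => j _; rewrite (cexp_Ex_indic gi ch).
have := cvphi h hi; under eq_fun do rewrite eqn.
by move=> c; exact: cvgn_unique c (cvphi g gi).
Qed.

End conditional_expectation.

(** * Moments, L^p norms and the mixing coefficient *)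

Section moments.
Context {d : measure_display} {T : measurableType d} {R : realType}.
Variable P : probability T R.
Implicit Types f g h : T -> R.

Lemma measurable_norm_powR f (e : R) : measurable_fun setT f ->
  measurable_fun setT (fun x => `|f x| `^ e).
Proof.
move=> mf; apply: (measurableT_comp (measurable_powR e)).
exact: measurableT_comp.
Qed.

Lemma measurable_sg : measurable_fun setT (@Num.sg R).
Proof.
rewrite (_ : @Num.sg R = fun y => \1_`]0, +oo[%classic y - \1_`]-oo, 0[%classic y).
  by apply: measurable_funB; exact: measurable_indic.
apply/funext => y; rewrite !indicE /= !mem_setE !in_itv/= andbT.
by case: ltrgt0P => [y0|y0|->]; rewrite ?(gtr0_sg y0) ?(ltr0_sg y0) ?sgr0 ?subr0 ?sub0r.
Qed.

Lemma Lnorm_leP f (r C : R) : measurable_fun setT f -> 0 < r -> 0 <= C ->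
  (Lnorm P r%:E (EFin \o f) <= C%:E)%E ->
  itg P (fun x => `|f x| `^ r) /\ Ex P (fun x => `|f x| `^ r) <= C `^ r.
Proof.
move=> mf r0 C0; rewrite unlock /=.
pose I := (\int[P]_x (`|f x| `^ r)%:E)%E; rewrite -/I => IC.
have I0 : (0 <= I)%E by apply: integral_ge0 => x _; rewrite lee_fin powR_ge0.
have Ile : (I <= (C `^ r)%:E)%E.
  have -> : I = (I `^ r^-1 `^ r)%E.
    by rewrite -poweRrM mulVf ?poweRe1// gt_eqF.
  rewrite -poweR_EFin; apply: gt0_ler_poweR; rewrite ?(ltW r0)//.
  - by rewrite in_itv/= poweR_ge0 leey.
  - by rewrite in_itv/= lee_fin C0 leey.
have mfr : measurable_fun setT (fun x => `|f x| `^ r) by exact: measurable_norm_powR.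
have fi : itg P (fun x => `|f x| `^ r).
  apply/integrableP; split; first exact/measurable_EFinP.
  apply: le_lt_trans (ltry (C `^ r)); apply: le_trans Ile; rewrite le_eqVlt.
  by apply/orP; left; apply/eqP; apply: eq_integral => x _ /=; rewrite ger0_norm// powR_ge0.
by split => //; rewrite -lee_fin -integral_Ex.
Qed.

Lemma Lnorm_le f (r C : R) : measurable_fun setT f -> 0 < r -> 0 <= C ->
  itg P (fun x => `|f x| `^ r) -> Ex P (fun x => `|f x| `^ r) <= C `^ r ->
  (Lnorm P r%:E (EFin \o f) <= C%:E)%E.
Proof.
move=> mf r0 C0 fi fC; rewrite unlock /=.
rewrite -/(\int[P]_x (`|f x| `^ r)%:E)%E integral_Ex// poweR_EFin lee_fin.
rewrite -[leRHS](powRr1 C0) -(mulfV (lt0r_neq0 r0)) powRrM.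
by apply: ge0_ler_powR; rewrite ?nnegrE ?powR_ge0 ?invr_ge0 ?(ltW r0)//; apply: Ex_ge0 => x; rewrite powR_ge0.
Qed.

Lemma ler_powR_norm (a e e' : R) : 0 <= e -> e <= e' -> `|a| `^ e <= 1 + `|a| `^ e'.
Proof.
move=> e0 ee; have [a1|a1] := leP `|a| 1.
  rewrite (@le_trans _ _ 1) ?lerDl ?powR_ge0//.
  by rewrite -[leRHS](powR1x e); apply: ge0_ler_powR; rewrite ?nnegrE.
by rewrite (@le_trans _ _ (`|a| `^ e')) ?lerDr// ler_powR// ltW.
Qed.

Lemma itg_lower_moment f (e e' : R) : 0 <= e -> e <= e' -> measurable_fun setT f ->
  itg P (fun x => `|f x| `^ e') -> itg P (fun x => `|f x| `^ e).
Proof.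
move=> e0 ee mf fi; apply: (@itg_dominated _ _ _ _ _ (fun x => 1 + `|f x| `^ e')).
- exact: measurable_norm_powR.
- by apply: itgD => //; exact: itg_cst.
by move=> x; rewrite ger0_norm ?powR_ge0// ler_powR_norm.
Qed.

Lemma itg_moment f (e : R) : 1 <= e -> measurable_fun setT f ->
  itg P (fun x => `|f x| `^ e) -> itg P f.
Proof.
move=> e1 mf fi; have := itg_lower_moment ler01 e1 mf fi.
move=> /(itg_dominated mf); apply => x; by rewrite powRr1.
Qed.

(* Conditional Jensen inequality: the test function [sg h * |h|^(e-1)], cut off where
   [|h| > n], is paired with [g] by Young's inequality. *)
Lemma cexp_powR (Gs : set (set T)) g h (e : R) :
  sigma_algebra setT Gs -> Gs `<=` measurable -> 1 < e ->
  measurable_fun setT g -> itg P (fun x => `|g x| `^ e) -> cexp_version P Gs g h ->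
  itg P (fun x => `|h x| `^ e) /\ Ex P (fun x => `|h x| `^ e) <= Ex P (fun x => `|g x| `^ e).
Proof.
move=> sG Gm e1 mg ge ch.
have e0 : 0 < e by exact: lt_trans e1.
have gi : itg P g by apply: itg_moment ge => //; exact: ltW.
have [Gh [hi _]] := ch.
have mh : measurable_fun setT h by exact: itg_measurable hi.
pose A (n : nat) := [set x | `|h x| <= n%:R].
have mA n : measurable (A n).
  rewrite -[A n]setTI; apply: measurable_fun_le => //; exact: measurableT_comp.
pose phi n x := \1_(A n) x * (Num.sg (h x) * `|h x| `^ (e - 1)).
pose e' := e / (e - 1).
have e10 : 0 < e - 1 by rewrite subr_gt0.
have conj : e'^-1 + e^-1 = 1.
  by rewrite /e'; field; rewrite !gt_eqF.
have nphi n x : `|phi n x| = \1_(A n) x * `|h x| `^ (e - 1).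
  rewrite /phi !normrM ger0_norm ?indicE ?ler0n//; congr (_ * _).
  rewrite [X in _ * X](ger0_norm (powR_ge0 _ _)) normr_sg.
  case: eqP => [->|_]; last by rewrite mul1r.
  by rewrite normr0 powR0 ?mulr0// gt_eqF.
have phih n x : phi n x * h x = \1_(A n) x * `|h x| `^ e.
  rewrite /phi -!mulrA; congr (_ * _); rewrite mulrCA -normrEsg.
  have [->|h0] := eqVneq (h x) 0; first by rewrite normr0 mulr0 powR0 ?gt_eqF.
  rewrite -{2}(powRr1 (normr_ge0 (h x))) -powRD; last by rewrite normr_eq0 h0 implybT.
  by rewrite subrK.
have nphie n x : `|phi n x| `^ e' = \1_(A n) x * `|h x| `^ e.
  rewrite nphi powRM ?indicE ?ler0n ?powR_ge0// -powRrM.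
  have -> : (e - 1) * e' = e by rewrite /e'; field; rewrite gt_eqF.
  congr (_ * _); case: (_ \in _); first by rewrite powR1.
  by rewrite powR0// gt_eqF// divr_gt0.
have Gphi n : Gmeasurable Gs (phi n).
  apply: GmeasurableM => //.
    apply/GmeasurableP => //; apply: measurable_indic; apply/measurable_sub_sigma => //.
    have -> : A n = h @^-1` [set y | `|y| <= n%:R] by [].
    apply: Gh; rewrite -[X in measurable X]setTI.
    by apply: measurable_fun_le => //; exact: measurable_normr.
  apply: (@Gmeasurable_comp _ _ _ _ sG h (fun y => Num.sg y * `|y| `^ (e - 1))) => //.
  by apply: measurable_funM; [exact: measurable_sg|exact: (measurableT_comp (measurable_powR (e - 1)))].
have bphi n x : `|phi n x| <= n%:R `^ (e - 1).
  rewrite nphi indicE; case: (boolP (x \in A n)) => [|_]; last by rewrite mul0r powR_ge0.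
  by rewrite inE mul1r => hn; apply: ge0_ler_powR; rewrite ?nnegrE ?(ltW e10).
pose J n := Ex P (fun x => \1_(A n) x * `|h x| `^ e).
have Ji n : itg P (fun x => \1_(A n) x * `|h x| `^ e).
  apply: (@itg_bounded _ _ _ _ _ (n%:R `^ e)).
    by apply: measurable_funM; [exact: measurable_indic|exact: measurable_norm_powR].
  move=> x; rewrite indicE; case: (boolP (x \in A n)) => [|_]; last by rewrite mul0r normr0 powR_ge0.
  by rewrite inE mul1r ger0_norm ?powR_ge0// => hn; apply: ge0_ler_powR; rewrite ?nnegrE ?(ltW e0).
have JE n : J n <= Ex P (fun x => `|g x| `^ e).
  have : J n <= Ex P (fun x => (\1_(A n) x * `|h x| `^ e) / e' + `|g x| `^ e / e).
    rewrite /J; under eq_fun do rewrite -phih.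
    rewrite (cexp_pullout sG Gm gi ch (Gphi n) (bphi n)).
    apply: le_Ex.
    - apply: itgM_bounded (bphi n) gi; exact: Gmeasurable_measurable (Gphi n).
    - by apply: itgD; under eq_fun do rewrite mulrC; apply: itgZ.
    move=> x; rewrite (le_trans (ler_norm _))// normrM -nphie.
    by apply: conjugate_powR => //; rewrite divr_gt0.
  rewrite ExD; [|by under eq_fun do rewrite mulrC; apply: itgZ..].
  under eq_fun do rewrite mulrC; under [X in _ + Ex _ X]eq_fun do rewrite mulrC.
  rewrite !ExZ// -/(J n) -lerBlDl -{1}[J n]mul1r -mulrBl -conj.
  by rewrite [e'^-1 + _]addrC addrK ler_pM2l// invr_gt0.
apply: (fatou_Ex Ji) => [n x|x|//].
  by rewrite mulr_ge0 ?powR_ge0// indicE ler0n.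
apply: cvg_near_cst; exists (Num.bound `|h x|) => // n /= hn.
rewrite indicE mem_set ?mul1r//= /A /=.
by rewrite (le_trans (ltW (archi_boundP _)))// ler_nat.
Qed.

(* The witness of the supremum [varpi_sets], rescaled from the unit ball of [L^q]. *)
Lemma varpi_sets_version (Gs Hs : set (set T)) (q p v C : R) g :
  sigma_algebra setT Gs -> Gs `<=` measurable ->
  sigma_algebra setT Hs -> Hs `<=` measurable ->
  1 <= p -> 1 <= q -> 0 <= v -> 0 < C ->
  (varpi_sets P q p Gs Hs <= v%:E)%E -> Gmeasurable Hs g ->
  itg P (fun x => `|g x| `^ q) -> Ex P (fun x => `|g x| `^ q) <= C `^ q ->
  exists h, [/\ cexp_version P Gs g h, itg P (fun x => `|h x - Ex P g| `^ p) &
    Ex P (fun x => `|h x - Ex P g| `^ p) <= (v * C) `^ p].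
Proof.
move=> sG Gm sH Hm p1 q1 v0 C0 vle Hg gqi gqC.
have mg := Gmeasurable_measurable Hm Hg.
have gi : itg P g by exact: itg_moment gqi.
have [h ch] := cexp_exists sG Gm gi; exists h.
have [Gh [hi hE]] := ch.
have hi' : itg P h := hi.
pose g1 x := C^-1 * g x; pose h1 x := C^-1 * h x.
have q0 : 0 < q by exact: lt_le_trans q1.
have p0 : 0 < p by exact: lt_le_trans p1.
have g1q x : `|g1 x| `^ q = (C `^ q)^-1 * `|g x| `^ q.
  rewrite /g1 normrM gtr0_norm ?invr_gt0// powRM ?invr_ge0 ?(ltW C0)//.
  by rewrite -powRN -[in LHS]powR_inv1 ?(ltW C0)// -powRrM mulN1r.
have Lg1 : (Lnorm P q%:E (EFin \o g1) <= 1)%E.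
  apply: Lnorm_le => //; first exact: measurable_funM.
    by rewrite (funext g1q); exact: itgZ.
  rewrite (funext g1q) ExZ// powR1x -ler_pdivlMl ?invr_gt0 ?powR_gt0//.
  by rewrite invrK mulr1.
have Eg1 : Ex P g1 = C^-1 * Ex P g by rewrite ExZ.
have c1 : cexp_version P Gs g1 h1.
  split.
    by apply: (@Gmeasurable_comp _ _ _ _ sG h (fun y => C^-1 * y)) => //; exact: measurable_funM.
  split; first exact: itgZ.
  move=> A GA; have mA := Gm _ GA.
  under eq_integral do rewrite EFinM; under [RHS]eq_integral do rewrite EFinM.
  rewrite !integralZl// ?hE//; first by apply: integrableS gi.
  by apply: integrableS hi.
have : (Lnorm P p%:E (fun w => (h1 w - fine ('E_P[g1]))%:E) <= v%:E)%E.
  apply: le_trans vle; apply: ereal_sup_ubound; exists g1, h1; split => //.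
  by apply: (@Gmeasurable_comp _ _ _ _ sH g (fun y => C^-1 * y)) => //; exact: measurable_funM.
have -> : fine ('E_P[g1])%R = Ex P g1 by rewrite unlock.
have mh := Gmeasurable_measurable Gm Gh.
move=> /Lnorm_leP -/(_ _ p0 v0) [].
  by apply: measurable_funB => //; exact: measurable_funM.
have e1 x : `|h1 x - Ex P g1| `^ p = (C `^ p)^-1 * `|h x - Ex P g| `^ p.
  rewrite Eg1 /h1 -mulrBr normrM gtr0_norm ?invr_gt0// powRM ?invr_ge0 ?(ltW C0)//.
  by rewrite -powRN -[in LHS]powR_inv1 ?(ltW C0)// -powRrM mulN1r.
rewrite (funext e1) => i b.
have Cp : C `^ p != 0 by rewrite gt_eqF// powR_gt0.
have i' : itg P (fun x => `|h x - Ex P g| `^ p).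
  have := itgZ (C `^ p) i; congr itg.
  by apply/funext => x; rewrite mulrA divff// mul1r.
split => //.
rewrite ExZ// in b; rewrite powRM ?(ltW C0)//.
by rewrite -ler_pdivrMr ?powR_gt0// mulrC.
Qed.

End moments.

(** * Hölder functions of polynomial growth on lists of reals *)

Section holder_functions.
Variable R : realType.
Implicit Types (x z u : seq R) (f g : seq R -> R) (n : nat) (lam C c : R).

(** This single weight replaces the sums of powers in [holder_growth]. It is at least 1 and
    submultiplicative under concatenation, so freezing or averaging out some of the variables only
    changes constants. *)
Definition wt x : R := 1 + \sum_(a <- x) `|a|.
Definition sdist x z : R := \sum_(pr <- zip x z) `|pr.1 - pr.2|.

Lemma wt_ge1 x : 1 <= wt x.
Proof. by rewrite lerDl sumr_ge0. Qed.

Lemma wt_gt0 x : 0 < wt x.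
Proof. exact: lt_le_trans (wt_ge1 x). Qed.

Lemma wt_cons a x : wt (a :: x) = `|a| + wt x.
Proof. by rewrite /wt big_cons; ring. Qed.

Lemma wt_cat x z : wt (x ++ z) = wt x + wt z - 1.
Proof. by rewrite /wt big_cat/=; ring. Qed.

Lemma wt_cat_le x z : wt (x ++ z) <= wt x * wt z.
Proof.
rewrite wt_cat -subr_ge0.
have -> : wt x * wt z - (wt x + wt z - 1) = (wt x - 1) * (wt z - 1) by ring.
by rewrite mulr_ge0// subr_ge0 wt_ge1.
Qed.

Lemma wt_catl x z : wt x <= wt (x ++ z).
Proof. by rewrite wt_cat; have := wt_ge1 z; lra. Qed.

Lemma wt_catr x z : wt z <= wt (x ++ z).
Proof. by rewrite wt_cat; have := wt_ge1 x; lra. Qed.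

Lemma norm_le_wt x a : a \in x -> `|a| <= wt x.
Proof.
elim: x => // b x IH; rewrite inE wt_cons => /orP[/eqP ->|/IH ax].
  by rewrite lerDl ltW// wt_gt0.
by rewrite (le_trans ax)// lerDr.
Qed.

Lemma sdist_ge0 x z : 0 <= sdist x z.
Proof. exact: sumr_ge0. Qed.

Lemma sdist_cons a b x z : sdist (a :: x) (b :: z) = `|a - b| + sdist x z.
Proof. by rewrite /sdist /= big_cons. Qed.

Lemma sdist_cat x z x' z' : size x = size z ->
  sdist (x ++ x') (z ++ z') = sdist x z + sdist x' z'.
Proof. by move=> xz; rewrite /sdist zip_cat// big_cat. Qed.

Lemma sdistxx x : sdist x x = 0.
Proof.
by elim: x => [|a x IH]; rewrite ?sdist_cons ?IH ?subrr ?normr0 ?addr0// /sdist big_nil.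
Qed.

Lemma wt_powR_ge1 x (e : R) : 0 <= e -> 1 <= wt x `^ e.
Proof.
move=> e0; rewrite -[leLHS](powR1x e); apply: ge0_ler_powR; rewrite ?nnegrE ?wt_ge1//.
exact: ltW (wt_gt0 _).
Qed.

(** The constant is a parameter because the decoupling constant has to be uniform over all functions
    with the same [C]. *)
Definition hol (kappa : R) n (lam C : R) f :=
  (forall x z, size x = n -> size z = n ->
     `|f x - f z| <= C * (wt x + wt z) `^ lam * sdist x z `^ kappa) /\
  (forall x, size x = n -> `|f x| <= C * wt x `^ lam).

Variable kappa : R.
Hypothesis kappa01 : 0 < kappa <= 1.
Let k0 : 0 < kappa. Proof. by case/andP: kappa01. Qed.
Let k1 : kappa <= 1. Proof. by case/andP: kappa01. Qed.

Lemma ler_powRl (a b e : R) : 0 <= e -> 0 <= a -> a <= b -> a `^ e <= b `^ e.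
Proof. by move=> e0 a0 ab; apply: ge0_ler_powR; rewrite ?nnegrE// (le_trans a0). Qed.

Lemma hol_constant_ge0 n lam C f : hol kappa n lam C f -> 0 <= C.
Proof.
move=> [_ /(_ (nseq n 0))]; rewrite size_nseq => /(_ erefl) H.
rewrite -(@pmulr_lge0 _ (wt (nseq n 0) `^ lam)) ?powR_gt0 ?wt_gt0//.
exact: le_trans (normr_ge0 _) H.
Qed.

Lemma hol_weaken n lam C lam' C' f : lam <= lam' -> C <= C' ->
  hol kappa n lam C f -> hol kappa n lam' C' f.
Proof.
move=> ll CC hf; have C0 := hol_constant_ge0 hf; case: hf => f1 f2.
split=> [x z sx sz|x sx].
  rewrite (le_trans (f1 _ _ sx sz))// ler_wpM2r ?powR_ge0//.
  apply: ler_pM; rewrite ?powR_ge0//; apply: ler_powR => //.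
  by have := wt_ge1 x; have := wt_ge1 z; lra.
rewrite (le_trans (f2 _ sx))//; apply: ler_pM; rewrite ?powR_ge0//.
exact/ler_powR/ll/wt_ge1.
Qed.

Lemma holD n lam C C' f g : hol kappa n lam C f -> hol kappa n lam C' g ->
  hol kappa n lam (C + C') (fun x => f x + g x).
Proof.
move=> [f1 f2] [g1 g2]; split=> [x z sx sz|x sx].
  have -> : f x + g x - (f z + g z) = (f x - f z) + (g x - g z) by ring.
  by rewrite (le_trans (ler_normD _ _))// !mulrDl lerD ?f1 ?g1.
by rewrite (le_trans (ler_normD _ _))// mulrDl lerD ?f2 ?g2.
Qed.

Lemma holN n lam C f : hol kappa n lam C f -> hol kappa n lam C (fun x => - f x).
Proof.
move=> [f1 f2]; split=> [x z sx sz|x sx]; last by rewrite normrN f2.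
by rewrite -opprD normrN f1.
Qed.

Lemma holB n lam C C' f g : hol kappa n lam C f -> hol kappa n lam C' g ->
  hol kappa n lam (C + C') (fun x => f x - g x).
Proof. by move=> hf hg; apply: holD hf _; exact: holN. Qed.

Lemma hol_cst n lam c : 0 <= lam -> hol kappa n lam `|c| (fun=> c).
Proof.
move=> l0; split=> [x z _ _|x _]; first by rewrite subrr normr0 !mulr_ge0 ?powR_ge0.
by rewrite ler_peMr// wt_powR_ge1.
Qed.

Lemma holM n lam lam' C C' f g : 0 <= lam -> 0 <= lam' ->
  hol kappa n lam C f -> hol kappa n lam' C' g ->
  hol kappa n (lam + lam') (2 * C * C') (fun x => f x * g x).
Proof.
move=> l0 l0' hf hg.
have C0 := hol_constant_ge0 hf; have C0' := hol_constant_ge0 hg.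
case: hf hg => [f1 f2] [g1 g2].
split=> [x z sx sz|x sx].
  have -> : f x * g x - f z * g z = f x * (g x - g z) + g z * (f x - f z) by ring.
  rewrite (le_trans (ler_normD _ _))// !normrM.
  have wx := wt_gt0 x; have wz := wt_gt0 z.
  rewrite (powRD_gt0 lam lam' (addr_gt0 wx wz)).
  have E (a b s : R) : 2 * C * C' * (a * b) * s =
    (C * a) * (C' * b * s) + (C' * b) * (C * a * s) by ring.
  rewrite {}E.
  apply: lerD; apply: ler_pM => //; rewrite ?f1 ?g1//.
    by rewrite (le_trans (f2 _ sx))// ler_wpM2l// ler_powRl ?(ltW wx)// lerDl ltW.
  by rewrite (le_trans (g2 _ sz))// ler_wpM2l// ler_powRl ?(ltW wz)// lerDr ltW.
rewrite normrM; have wx := wt_gt0 x.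
rewrite (@le_trans _ _ ((C * wt x `^ lam) * (C' * wt x `^ lam')))//.
  by apply: ler_pM => //; rewrite ?f2 ?g2.
rewrite powRD_gt0//.
have -> : (C * wt x `^ lam) * (C' * wt x `^ lam') = C * C' * (wt x `^ lam * wt x `^ lam') by ring.
by rewrite ler_wpM2r ?mulr_ge0 ?powR_ge0//; have := mulr_ge0 C0 C0'; lra.
Qed.

Lemma hol_section n1 n2 lam C f u : 0 <= lam -> size u = n1 ->
  hol kappa (n1 + n2) lam C f ->
  hol kappa n2 lam (C * wt u `^ lam) (fun x => f (u ++ x)).
Proof.
move=> l0 su hf; have C0 := hol_constant_ge0 hf; case: hf => f1 f2.
have wu := ltW (wt_gt0 u).
split=> [x z sx sz|x sx].
  rewrite (le_trans (f1 _ _ _ _)) ?size_cat ?su ?sx ?sz//.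
  rewrite sdist_cat// sdistxx add0r ler_wpM2r ?powR_ge0// -mulrA ler_wpM2l//.
  have wx := wt_gt0 x; have wz := wt_gt0 z.
  rewrite -powRM ?wu ?(addr_ge0 (ltW wx) (ltW wz))//; apply: ler_powRl => //.
    by rewrite addr_ge0// ltW ?wt_gt0.
  by rewrite mulrDr lerD// wt_cat_le.
rewrite (le_trans (f2 _ _)) ?size_cat ?su ?sx// -mulrA ler_wpM2l//.
rewrite -powRM ?(ltW (wt_gt0 _))//; apply: ler_powRl => //; first exact: ltW (wt_gt0 _).
exact: wt_cat_le.
Qed.

Definition select (I : seq nat) x := [seq nth 0 x i | i <- I].

Lemma size_select I x : size (select I x) = size I.
Proof. exact: size_map. Qed.

Lemma norm_nth_le_wt x i : `|nth 0 x i| <= wt x.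
Proof.
have [ix|ix] := ltnP i (size x); first by rewrite norm_le_wt// mem_nth.
by rewrite nth_default// normr0 ltW// wt_gt0.
Qed.

Lemma wt_select I x : wt (select I x) <= (size I).+1%:R * wt x.
Proof.
elim: I => [|i I IH]; first by rewrite /select /= mul1r /wt big_nil addr0 wt_ge1.
rewrite /select /= wt_cons -[(size I).+2]addn1 natrD mulrDl mul1r addrC lerD//.
exact: norm_nth_le_wt.
Qed.

Lemma norm_nth_le_sdist x z i : size x = size z -> `|nth 0 x i - nth 0 z i| <= sdist x z.
Proof.
elim: x z i => [|a x IH] [|b z] [|i]//= => [_|_|_|[xz]]; rewrite ?subrr ?normr0 ?sdist_ge0//.
  by rewrite sdist_cons lerDl sdist_ge0.
by rewrite sdist_cons (le_trans (IH _ _ xz))// lerDr.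
Qed.

Lemma sdist_select I x z : size x = size z ->
  sdist (select I x) (select I z) <= (size I).+1%:R * sdist x z.
Proof.
move=> xz; elim: I => [|i I IH]; first by rewrite /select /= {1}/sdist big_nil mulr_ge0 ?sdist_ge0.
rewrite /select /= sdist_cons -[(size I).+2]addn1 natrD mulrDl mul1r addrC lerD//.
exact: norm_nth_le_sdist.
Qed.

(** Lets functions of different groups of variables be read as functions of one concatenated list,
    so that their products and differences stay in the class. *)
Lemma hol_select n N lam C f I : 0 <= lam -> size I = n -> hol kappa n lam C f ->
  hol kappa N lam (C * n.+1%:R `^ (lam + 1)) (fun x => f (select I x)).
Proof.
move=> l0 sI hf; have C0 := hol_constant_ge0 hf; case: hf => f1 f2.
have n1 : 1 <= n.+1%:R :> R by rewrite ler1n.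
have n0 : 0 < n.+1%:R :> R by rewrite ltr0n.
have nn : n.+1%:R `^ (lam + 1) = n.+1%:R `^ lam * n.+1%:R :> R.
  by rewrite powRD_gt0// powRr1// ltW.
split=> [x z sx sz|x sx].
  rewrite (le_trans (f1 _ _ _ _)) ?size_select//.
  have -> : C * n.+1%:R `^ (lam + 1) * (wt x + wt z) `^ lam * sdist x z `^ kappa =
     (C * (n.+1%:R `^ lam * (wt x + wt z) `^ lam)) * (n.+1%:R * sdist x z `^ kappa).
    by rewrite nn; ring.
  have wx := wt_gt0 x; have wz := wt_gt0 z.
  apply: ler_pM; rewrite ?mulr_ge0 ?powR_ge0//.
    rewrite ler_wpM2l// -powRM ?(addr_ge0 (ltW wx) (ltW wz)) ?(ltW n0)//; apply: ler_powRl => //.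
      by rewrite addr_ge0// ltW ?wt_gt0.
    by rewrite mulrDr lerD// -sI wt_select.
  rewrite (@le_trans _ _ ((n.+1%:R * sdist x z) `^ kappa))//.
    by apply: ler_powRl; rewrite ?(ltW k0) ?sdist_ge0// -sI sdist_select// sx sz.
  rewrite powRM ?(ltW n0) ?sdist_ge0// ler_wpM2r ?powR_ge0//.
  by rewrite -[leRHS](powRr1 (ltW n0)) ler_powR.
rewrite (le_trans (f2 _ _)) ?size_select// -mulrA ler_wpM2l//.
rewrite (@le_trans _ _ (n.+1%:R `^ lam * wt x `^ lam))//.
  rewrite -powRM ?(ltW n0) ?(ltW (wt_gt0 _))//; apply: ler_powRl => //.
    exact: ltW (wt_gt0 _).
  by rewrite -sI wt_select.
by rewrite ler_wpM2r ?powR_ge0// ler_powR// lerDl.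
Qed.

End holder_functions.

(** * Approximation of Hölder functions by sums of products *)

Section interpolation.
Variable R : realType.
Implicit Types (x z u : seq R) (f g : seq R -> R) (n : nat) (lam C c : R).

Definition clamp01 (y : R) : R := Num.max 0 (Num.min 1 y).

Lemma clamp01_le0 y : y <= 0 -> clamp01 y = 0.
Proof. by move=> y0; rewrite /clamp01 min_r ?max_l// (le_trans y0). Qed.

Lemma clamp01_ge1 y : 1 <= y -> clamp01 y = 1.
Proof. by move=> y1; rewrite /clamp01 min_l// max_r. Qed.

Lemma clamp01_id y : 0 <= y -> y <= 1 -> clamp01 y = y.
Proof. by move=> y0 y1; rewrite /clamp01 min_r// max_r. Qed.

Lemma clamp01_itv y : 0 <= clamp01 y <= 1.
Proof.
have [y0|/ltW y0] := leP y 0; first by rewrite clamp01_le0// lexx ler01.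
by have [y1|/ltW y1] := leP y 1; [rewrite clamp01_id// y0|rewrite clamp01_ge1// ler01 lexx].
Qed.

Lemma clamp01_lipschitz y y' : `|clamp01 y - clamp01 y'| <= `|y - y'|.
Proof.
wlog yy : y y' / y <= y'.
  move=> H; have [/H//|/ltW/H] := leP y y'.
  by rewrite distrC [`|y' - y|]distrC.
rewrite [leRHS]ler0_norm ?subr_le0// opprB.
have h := clamp01_itv y; have h' := clamp01_itv y'.
have [y0|/ltW y0] := leP y 0.
  rewrite (clamp01_le0 y0) sub0r normrN.
  have [y0'|/ltW y0'] := leP y' 0; first by rewrite clamp01_le0// normr0 subr_ge0.
  rewrite ger0_norm; last by case/andP: h'.
  have [y1|/ltW y1] := leP y' 1; last by rewrite clamp01_ge1//; lra.
  by rewrite clamp01_id//; lra.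
have [y1|/ltW y1] := leP y' 1.
  have y0' := le_trans y0 yy; have y1' := le_trans yy y1.
  by rewrite !clamp01_id// distrC ger0_norm// subr_ge0.
rewrite (clamp01_ge1 y1); have [z1|/ltW z1] := leP y 1.
  by rewrite clamp01_id// distrC ger0_norm ?subr_ge0//; lra.
by rewrite clamp01_ge1// subrr normr0 subr_ge0.
Qed.

(** Piecewise linear interpolation written as a sum of ramps: each summand is a node increment times
    a bounded Lipschitz function of y, which is the separated form wanted below. *)
Definition interp (a : nat -> R) (M : nat) (y : R) :=
  a 0%N + \sum_(j < M) (a j.+1 - a j) * clamp01 (y - j%:R).

Lemma interpS a M y :
  interp a M.+1 y = interp a M y + (a M.+1 - a M) * clamp01 (y - M%:R).
Proof. by rewrite /interp big_ord_recr/= addrA. Qed.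

Lemma interp_ge a M y : M%:R <= y -> interp a M y = a M.
Proof.
elim: M => [|M IH] My; first by rewrite /interp big_ord0 addr0.
rewrite interpS IH; last by rewrite (le_trans _ My)// ler_nat.
rewrite clamp01_ge1 ?mulr1 ?subrKC//.
by move: My; rewrite -natr1; lra.
Qed.

Lemma dist_convex (t a b th e : R) : 0 <= th -> th <= 1 ->
  `|t - a| <= e -> `|t - b| <= e -> `|t - (a + (b - a) * th)| <= e.
Proof.
move=> th0 th1 ta tb.
have -> : t - (a + (b - a) * th) = (1 - th) * (t - a) + th * (t - b) by ring.
have th1' : 0 <= 1 - th by rewrite subr_ge0.
rewrite (le_trans (ler_normD _ _))// !normrM (ger0_norm th0) (ger0_norm th1').
have -> : e = (1 - th) * e + th * e by ring.
by rewrite lerD// ler_wpM2l.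
Qed.

(* The piecewise linear interpolation of [a] at [y] only involves [a j] with [|y - j| <= 1],
   or the endpoint values when [y] lies outside [0, M]. *)
Lemma dist_interp (a : nat -> R) M (y t e : R) :
  (forall j, (j <= M)%N ->
    [\/ `|y - j%:R| <= 1, (j == 0%N) && (y <= 0) | (j == M) && (M%:R <= y)] -> `|t - a j| <= e) ->
  `|t - interp a M y| <= e.
Proof.
have [yM|My] := leP M%:R y.
  by move=> H; rewrite interp_ge//; apply: H => //; apply: Or33; rewrite eqxx.
elim: M My => [|M IH] My H.
  by rewrite /interp big_ord0 addr0; apply: H => //; apply: Or32; rewrite eqxx ltW.
rewrite interpS; have [yM|yM] := ltP y M%:R.
  rewrite clamp01_le0 ?mulr0 ?addr0; last by rewrite subr_le0 ltW.
  apply: IH => // j jM [h|h|h]; apply: H; rewrite ?(leq_trans jM)//; [exact: Or31|exact: Or32|].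
  by case/andP: h.
rewrite interp_ge//; rewrite -natr1 in My.
have My' : y - M%:R <= 1 by lra.
have M0 : 0 <= y - M%:R by rewrite subr_ge0.
apply: dist_convex.
- by case/andP: (clamp01_itv (y - M%:R)).
- by case/andP: (clamp01_itv (y - M%:R)).
- by apply: H => //; apply: Or31; rewrite ger0_norm.
by apply: H => //; apply: Or31; rewrite -natr1 ler0_norm; lra.
Qed.

Definition blip (phi : R -> R) := measurable_fun setT phi /\
  exists2 Lc : R, 0 <= Lc &
    forall a b, `|phi a| <= 1 /\ `|phi a - phi b| <= Lc * `|a - b|.

Lemma blip1 : blip (fun=> 1).
Proof. by split=> //; exists 0 => // a b; rewrite normr1 subrr normr0 mul0r. Qed.

Lemma blip_clamp01 (r s : R) : blip (fun a => clamp01 (r * a + s)).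
Proof.
split.
  apply: measurable_maxr; first exact: measurable_cst.
  apply: measurable_minr; first exact: measurable_cst.
  by apply: measurable_funD => //; exact: measurable_funM.
exists `|r| => // a b; split.
  by have /andP[c0 c1] := clamp01_itv (r * a + s); rewrite ger0_norm.
rewrite (le_trans (clamp01_lipschitz _ _))// -normrM.
by rewrite (_ : _ - _ = r * (a - b)) //; ring.
Qed.

(* Linear combinations of products of bounded Lipschitz functions of one coordinate each. *)
Inductive sepfun n : (seq R -> R) -> Prop :=
| sepfun_prod c (phi : nat -> R -> R) : (forall j, blip (phi j)) ->
    sepfun n (fun x => c * \prod_(j < n) phi j (nth 0 x j))
| sepfun_add f g : sepfun n f -> sepfun n g -> sepfun n (fun x => f x + g x).

Lemma sepfun_cons n f (s : R -> R) : blip s -> sepfun n f ->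
  sepfun n.+1 (fun x => s (nth 0 x 0) * f (behead x)).
Proof.
move=> bs; elim=> [c phi bphi|g h _ IHg _ IHh].
  have -> : (fun x => s (nth 0 x 0) * (c * \prod_(j < n) phi j (nth 0 (behead x) j))) =
      (fun x => c * \prod_(j < n.+1) (if j : nat is j'.+1 then phi j' else s) (nth 0 x j)).
    apply/funext => x; rewrite big_ord_recl/= mulrCA; congr (_ * (_ * _)).
    by apply: eq_bigr => j _; rewrite nth_behead.
  by apply: (@sepfun_prod n.+1 c (fun j => if j is j'.+1 then phi j' else s)); case.
have -> : (fun x => s (nth 0 x 0) * (g (behead x) + h (behead x))) =
   (fun x => s (nth 0 x 0) * g (behead x) + s (nth 0 x 0) * h (behead x)).
  by apply/funext => x; rewrite mulrDr.
exact: sepfun_add.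
Qed.

Variable kappa : R.
Hypothesis kappa01 : 0 < kappa <= 1.
Let k0 : 0 < kappa. Proof. by case/andP: kappa01. Qed.
Let k1 : kappa <= 1. Proof. by case/andP: kappa01. Qed.

(** The extra power of [wt] makes room for the region outside a large box, where interpolation on
    finitely many nodes is not accurate. *)
Definition sep_approximable n lam f := forall eps : R, 0 < eps ->
  exists2 h, sepfun n h & forall x, size x = n -> `|f x - h x| <= eps * wt x `^ (lam + 1).

Lemma sep_sum n lam (g : nat -> seq R -> R) (s : nat -> R -> R) (M : nat) :
  0 <= lam ->
  (forall j, sep_approximable n lam (g j)) -> (forall j, blip (s j)) ->
  forall eps : R, 0 < eps -> exists2 h, sepfun n.+1 h &
    forall a x, size x = n ->
      `|\sum_(j < M) g j x * s j a - h (a :: x)| <= eps * wt (a :: x) `^ (lam + 1).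
Proof.
move=> l0 ag bs; elim: M => [|M IH] eps e0.
  exists (fun x => 0 * \prod_(j < n.+1) (fun (_ : nat) (_ : R) => 1) j (nth 0 x j)).
    by apply: (@sepfun_prod n.+1 0 (fun _ _ => 1)) => _; exact: blip1.
  by move=> a x _; rewrite big_ord0 mul0r subrr normr0 mulr_ge0 ?powR_ge0// ltW.
have e20 : 0 < eps / 2 by rewrite divr_gt0.
have [h sh hE] := IH _ e20; have [h' sh' hE'] := ag M _ e20.
exists (fun x => h x + s M (nth 0 x 0) * h' (behead x)).
  exact: sepfun_add sh (sepfun_cons (bs M) sh').
move=> a x sx; rewrite big_ord_recr/=.
have -> : \sum_(i < M) g i x * s i a + g M x * s M a - (h (a :: x) + s M a * h' x) =
  (\sum_(i < M) g i x * s i a - h (a :: x)) + s M a * (g M x - h' x) by ring.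
rewrite (le_trans (ler_normD _ _))// [eps]splitr mulrDl lerD ?hE//.
rewrite normrM; case: (bs M) => _ [Lc _ /(_ a a)[sa _]].
rewrite (@le_trans _ _ (1 * `|g M x - h' x|))//; first by rewrite ler_wpM2r.
rewrite mul1r (le_trans (hE' _ sx))// ler_wpM2l ?(ltW e20)//.
apply: ler_powRl; [exact: addr_ge0|exact: ltW (wt_gt0 _)|].
rewrite wt_cons; have := normr_ge0 a; lra.
Qed.

(** Where |a| >= B the quotient wt/B is at least 1, so the trivial growth bound gains the small
    factor 1/B at the price of one power of the weight. *)
Lemma hol_dist_large n lam C f a b x (B : R) : 0 <= lam ->
  hol kappa n.+1 lam C f -> size x = n -> 0 < B -> B <= `|a| -> `|b| <= `|a| ->
  `|f (a :: x) - f (b :: x)| <= 2 * C / B * wt (a :: x) `^ (lam + 1).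
Proof.
move=> l0 hf sx B0 Ba ba; have C0 := hol_constant_ge0 hf; case: hf => _ f2.
have w0 := wt_gt0 (a :: x); have wl : 0 <= wt (a :: x) `^ lam by exact: powR_ge0.
rewrite (@le_trans _ _ (2 * C * wt (a :: x) `^ lam))//.
  have := f2 (a :: x); have := f2 (b :: x); rewrite /= sx => /(_ erefl) h1 /(_ erefl) h2.
  rewrite (le_trans (ler_normB _ _))//.
  have -> : 2 * C * wt (a :: x) `^ lam = C * wt (a :: x) `^ lam + C * wt (a :: x) `^ lam by ring.
  rewrite lerD// (le_trans h1)// ler_wpM2l// ler_powRl ?(ltW (wt_gt0 _))//.
  by rewrite !wt_cons lerD2r.
rewrite (powRD_gt0 _ _ w0) powRr1 ?(ltW w0)//.
have -> : 2 * C / B * (wt (a :: x) `^ lam * wt (a :: x)) =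
   (2 * C * wt (a :: x) `^ lam) * (wt (a :: x) / B) by field; rewrite gt_eqF.
rewrite ler_peMr ?mulr_ge0// ler_pdivlMr// mul1r (le_trans Ba)// wt_cons lerDl.
exact: ltW (wt_gt0 _).
Qed.

Lemma hol_dist_close n lam C f a b x (eta : R) : 0 <= lam ->
  hol kappa n.+1 lam C f -> size x = n -> eta <= 1 -> `|a - b| <= eta ->
  `|f (a :: x) - f (b :: x)| <= 3 `^ lam * C * eta `^ kappa * wt (a :: x) `^ (lam + 1).
Proof.
move=> l0 hf sx eta1 ab; have C0 := hol_constant_ge0 hf; case: hf => f1 _.
have w0 := wt_gt0 (a :: x); have w1 := wt_ge1 (a :: x).
have := f1 (a :: x) (b :: x); rewrite /= sx => /(_ erefl erefl) H.
rewrite (le_trans H)// sdist_cons sdistxx addr0.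
have -> : 3 `^ lam * C * eta `^ kappa * wt (a :: x) `^ (lam + 1) =
  C * (3 `^ lam * wt (a :: x) `^ (lam + 1)) * eta `^ kappa by ring.
apply: ler_pM; rewrite ?mulr_ge0 ?powR_ge0//; last first.
  by apply: ler_powRl; rewrite ?(ltW k0).
rewrite ler_wpM2l// (@le_trans _ _ (3 `^ lam * wt (a :: x) `^ lam))//; last first.
  by rewrite ler_wpM2l ?powR_ge0// ler_powR// lerDl.
rewrite -powRM ?(ltW w0)//; apply: ler_powRl => //.
  by rewrite addr_ge0// ltW ?wt_gt0.
have h : wt (b :: x) <= wt (a :: x) + 1.
  rewrite !wt_cons; have -> : b = a - (a - b) by ring.
  have := ler_normB a (a - b); lra.
by move: w1 h; set A := wt (a :: x); set B := wt (b :: x); lra.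
Qed.

Lemma pow_small (eps C : R) : 0 < eps -> 0 <= C ->
  exists N : nat, C * (N.+1%:R^-1) `^ kappa <= eps /\ C * (N.+1%:R^-1) <= eps.
Proof.
move=> e0 C0; have C1 : 0 < C + 1 by rewrite ltr_wpDl.
pose y := ((C + 1) / eps) `^ kappa^-1.
exists (Num.bound y); set N := Num.bound y.
have n0 : 0 < N.+1%:R :> R by rewrite ltr0n.
have yN : y <= N.+1%:R.
  by rewrite ltW// (lt_le_trans (archi_boundP (powR_ge0 _ _)))// ler_nat.
have Ny : (C + 1) / eps <= N.+1%:R `^ kappa.
  have -> : (C + 1) / eps = y `^ kappa.
    by rewrite /y -powRrM mulVf ?(gt_eqF k0)// powRr1// divr_ge0// ltW.
  by apply: ler_powRl => //; rewrite ?(ltW k0) ?powR_ge0.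
have H : C * (N.+1%:R^-1) `^ kappa <= eps.
  rewrite -[X in X `^ kappa]powR_inv1 ?(ltW n0)// -powRrM mulN1r powRN.
  rewrite ler_pdivrMr ?powR_gt0// mulrC -ler_pdivrMr//.
  by rewrite (le_trans _ Ny)// ler_wpM2r ?invr_ge0 ?(ltW e0)// lerDl.
split=> //; rewrite (le_trans _ H)// ler_wpM2l//.
have i1 : N.+1%:R^-1 <= 1 :> R by rewrite invf_le1 ?ler1n.
rewrite -[leLHS]powRr1 ?invr_ge0 ?(ltW n0)//; apply: ger_powR => //.
by rewrite invr_gt0 n0.
Qed.

(** Induction on the number of variables. Interpolating in the first variable gives ramps whose
    coefficients are differences of sections of f; these are Hölder in the remaining variables and
    are approximated by induction. *)
Lemma holder_interpolation n lam C f : 0 <= lam -> hol kappa n lam C f ->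
  sep_approximable n lam f.
Proof.
move=> l0; elim: n C f => [|n IH] C f hf eps e0.
  exists (fun x => f [::] * \prod_(j < 0) (fun (_ : nat) (_ : R) => 1) j (nth 0 x j)).
    by apply: (@sepfun_prod 0 (f [::]) (fun _ _ => 1)) => _; exact: blip1.
  move=> x /size0nil ->; rewrite big_ord0 mulr1 subrr normr0.
  by rewrite mulr_ge0 ?powR_ge0// ltW.
have C0 := hol_constant_ge0 hf.
have D0 : 0 <= (3 `^ lam + 2) * C by rewrite mulr_ge0 ?addr_ge0 ?powR_ge0.
have e20 : 0 < eps / 2 by rewrite divr_gt0.
have [N [N1 N2]] := pow_small e20 D0.
(* The nodes run from -B to B with spacing eta = 1/B, which takes M = 2 B^2 steps; B(a+B) is the
   position of a in units of the spacing. *)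
set eta := N.+1%:R^-1 in N1 N2; pose B : R := N.+1%:R; pose M := (2 * N.+1 * N.+1)%N.
have B0 : 0 < B by rewrite ltr0n.
have eta0 : 0 < eta by rewrite invr_gt0.
have eta1 : eta <= 1 by rewrite invf_le1 ?ler1n.
have etaB : eta * B = 1 by rewrite mulVf// gt_eqF.
pose c (j : nat) := - B + j%:R * eta.
have cM : c M = B.
  rewrite /c /M !natrM -/B; have -> : 2 * B * B * eta = 2 * B * (eta * B) by ring.
  by rewrite etaB; ring.
pose g (j : nat) x := if j is j'.+1 then f (c j'.+1 :: x) - f (c j' :: x) else f (c 0%N :: x).
have hc b : hol kappa n lam (C * wt [:: b] `^ lam) (fun x => f (b :: x)).
  by apply: (@hol_section _ _ 1 n lam C f [:: b]).
have ag j : sep_approximable n lam (g j).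
  by case: j => [|j]; [exact: IH (hc _)|exact: IH (holB (hc _) (hc _))].
pose s (j : nat) (a : R) := if j is j'.+1 then clamp01 (B * a + (B * B - j'%:R)) else 1.
have bs j : blip (s j) by case: j => [|j]; [exact: blip1|exact: blip_clamp01].
have [h sh hE] := sep_sum M.+1 l0 ag bs e20.
exists h => // -[|a x]// [sx].
rewrite [eps]splitr mulrDl.
have -> : f (a :: x) - h (a :: x) = (f (a :: x) - \sum_(j < M.+1) g j x * s j a) +
   (\sum_(j < M.+1) g j x * s j a - h (a :: x)) by ring.
rewrite (le_trans (ler_normD _ _))// lerD ?hE//.
have -> : \sum_(j < M.+1) g j x * s j a = interp (fun j => f (c j :: x)) M (B * (a + B)).
  rewrite big_ord_recl/= mulr1; congr (_ + _); apply: eq_bigr => j _ /=.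
  by congr (_ * clamp01 _); ring.
have w0 := powR_ge0 (wt (a :: x)) (lam + 1).
apply: dist_interp => j jM H.
(* Either a lies outside (-B, B) and c_j is the end of the grid on its side, or c_j is within one
   spacing of a. *)
have [[Ba ca]|ac] : (B <= `|a| /\ `|c j| <= `|a|) \/ `|a - c j| <= eta.
  case: H => [h1|/andP[/eqP -> h1]|/andP[/eqP -> h1]].
  - right; have -> : a - c j = eta * (B * (a + B) - j%:R).
      rewrite /c; have -> : eta * (B * (a + B) - j%:R) = (eta * B) * (a + B) - j%:R * eta by ring.
      by rewrite etaB; ring.
    by rewrite normrM gtr0_norm// ler_piMr// ltW.
  - left; rewrite pmulr_rle0// in h1; rewrite /c mul0r addr0 normrN (gtr0_norm B0).
    by rewrite ler0_norm; lra.
  left; rewrite cM (gtr0_norm B0).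
  have : 2 * B <= a + B.
    rewrite -(ler_pM2l B0); apply: le_trans h1; rewrite /M !natrM -/B.
    by rewrite (_ : B * (2 * B) = 2 * B * B)//; ring.
  by move=> h2; have : B <= a by [lra]; move=> h3; rewrite ger0_norm//; lra.
- rewrite (le_trans (hol_dist_large l0 hf sx B0 Ba ca))// ler_wpM2r// (le_trans _ N2)//.
  by rewrite ler_wpM2r ?(ltW eta0)// ler_wpM2r// lerDr powR_ge0.
rewrite (le_trans (hol_dist_close l0 hf sx eta1 ac))// ler_wpM2r// (le_trans _ N1)//.
by rewrite ler_wpM2r ?powR_ge0// ler_wpM2r// lerDl.
Qed.

End interpolation.

Section measurability.
Context {d : measure_display} {T : measurableType d} {R : realType}.
Implicit Types (us : seq (T -> R)).

Definition ev us (w : T) : seq R := [seq u w | u <- us].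

Lemma size_ev us w : size (ev us w) = size us.
Proof. exact: size_map. Qed.

Lemma ev_cat us vs w : ev (us ++ vs) w = ev us w ++ ev vs w.
Proof. exact: map_cat. Qed.

Definition mseq us := forall i, measurable_fun setT (nth (fun=> 0) us i).

Lemma nth_ev us w i : nth 0 (ev us w) i = nth (fun=> 0) us i w.
Proof.
have [h|h] := ltnP i (size us); first by rewrite (nth_map (fun=> 0)).
by rewrite !nth_default ?size_ev.
Qed.

Lemma sepfun_measurable n f us : sepfun n f -> mseq us ->
  measurable_fun setT (fun w => f (ev us w)).
Proof.
move=> sf mus; elim: sf => [c phi bphi|g h _ IHg _ IHh]; last exact: measurable_funD.
apply: measurable_funM => //; apply: measurable_prod => j _.
under eq_fun do rewrite nth_ev.
by apply: measurableT_comp => //; case: (bphi j).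
Qed.

(** A pointwise limit of separated functions, which are measurable one coordinate at a time. The
    sigma-algebra is arbitrary, so the lemma also yields measurability with respect to the
    sub-sigma-algebras of the mixing condition. *)
Lemma holder_measurable (kappa : R) n lam C f us : 0 < kappa <= 1 -> 0 <= lam ->
  hol kappa n lam C f -> size us = n -> mseq us ->
  measurable_fun setT (fun w => f (ev us w)).
Proof.
move=> k01 l0 hf sn mus.
have e0 k : 0 < k.+1%:R^-1 :> R by rewrite invr_gt0 ltr0n.
have ap k : exists h, sepfun n h /\ forall x, size x = n -> `|f x - h x| <= k.+1%:R^-1 * wt x `^ (lam + 1).
  by have [h sh hE] := holder_interpolation k01 l0 hf (e0 k); exists h.
have [h hP] := choice ap.
apply: (@measurable_fun_cvg _ _ _ setT (fun k w => h k (ev us w))).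
  by move=> k; apply: sepfun_measurable (hP k).1 mus.
move=> w _; apply: (@squeeze_dist _ _ (fun k => k.+1%:R^-1 * wt (ev us w) `^ (lam + 1))).
  by move=> k; rewrite distrC; apply: (hP k).2; rewrite size_ev.
rewrite -[X in _ --> X](mul0r (wt (ev us w) `^ (lam + 1))).
by apply: cvgM; [exact: cvg_harmonic|exact: cvg_cst].
Qed.

End measurability.

(** Comparison with the largest term; unlike convexity this covers exponents below 1 as well. *)
Lemma powR_sum_le (R : realType) (s : seq R) (e : R) : 0 < e -> {in s, forall a, 0 <= a} ->
  (\sum_(a <- s) a) `^ e <= (size s)%:R `^ e * \sum_(a <- s) a `^ e.
Proof.
move=> e0 s0.
have [m [m0 sm me]] : exists m, [/\ 0 <= m, {in s, forall a, a <= m} & m `^ e <= \sum_(a <- s) a `^ e].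
  elim: s s0 => [|a s IH] s0.
    by exists 0; rewrite big_nil powR0 ?gt_eqF.
  have a0 : 0 <= a by apply: s0; rewrite mem_head.
  have [|m [m0 sm me]] := IH; first by move=> b bs; apply: s0; rewrite inE bs orbT.
  rewrite big_cons; have S0 : 0 <= \sum_(j <- s) j `^ e by apply: sumr_ge0 => j _; exact: powR_ge0.
  have [am|/ltW ma] := leP a m.
    exists m; split => //; last by rewrite (le_trans me)// lerDr powR_ge0.
    by move=> b; rewrite inE => /orP[/eqP ->//|/sm].
  exists a; split => //; last by rewrite lerDl.
  by move=> b; rewrite inE => /orP[/eqP ->//|/sm bm]; exact: le_trans ma.
have h1 : \sum_(a <- s) a <= (size s)%:R * m.
  elim: s sm {s0 me} => [|a s IH] sm; first by rewrite big_nil mul0r.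
  rewrite big_cons /= -natr1 mulrDl mul1r addrC lerD//; last by apply: sm; rewrite mem_head.
  by apply: IH => b bs; apply: sm; rewrite inE bs orbT.
have h2 : 0 <= \sum_(a <- s) a by rewrite big_seq; apply: sumr_ge0 => a /s0.
rewrite (le_trans (ler_powRl (ltW e0) h2 h1))// powRM//.
by rewrite ler_wpM2l// powR_ge0.
Qed.

(** * Hölder functions of random vectors *)

Section random_vectors.
Context {d : measure_display} {T : measurableType d} {R : realType}.
Variable P : probability T R.
Implicit Types (us vs : seq (T -> R)) (f : seq R -> R) (n : nat) (lam C M a e : R).

Definition mom e M (u : T -> R) := [/\ measurable_fun setT u,
  itg P (fun w => `|u w| `^ e) & Ex P (fun w => `|u w| `^ e) <= M].
Definition moms e M us := forall i, mom e M (nth (fun=> 0) us i).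

Lemma moms_mseq e M us : moms e M us -> mseq us.
Proof. by move=> h i; have [] := h i. Qed.

Lemma mom_cst0 e M : 0 < e -> 0 <= M -> mom e M (fun=> 0).
Proof.
move=> e0 M0; have E : (fun w : T => `|(fun=> 0 : R) w| `^ e) = fun=> 0.
  by apply/funext => w; rewrite normr0 powR0 ?gt_eqF.
by split=> //; rewrite E; [exact: itg_cst|rewrite Ex_cst].
Qed.

Lemma moms_ge0 e M us : moms e M us -> 0 <= M.
Proof. by move=> /(_ 0%N)[_ _]; apply: le_trans; apply: Ex_ge0 => w; exact: powR_ge0. Qed.

Lemma moms_cat e M us vs : moms e M us -> moms e M vs -> moms e M (us ++ vs).
Proof. by move=> hu hv i; rewrite nth_cat; case: ifP. Qed.

(** Bounds the moments, of order at most e, of the weight of n variables whose e-th absolute moments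
    are at most M. *)
Definition wtC n e M : R := n.+1%:R `^ e * (1 + n%:R * M).

Lemma wtC_ge0 n e M : 0 <= M -> 0 <= wtC n e M.
Proof. by move=> M0; rewrite mulr_ge0 ?powR_ge0// addr_ge0// mulr_ge0. Qed.

Lemma mseq_wt us : mseq us -> measurable_fun setT (fun w => wt (ev us w)).
Proof.
move=> mus; rewrite /wt.
under eq_fun do rewrite (big_nth 0) size_ev big_mkord.
apply: measurable_funD => //; apply: measurable_sum => i.
under eq_fun do rewrite nth_ev.
by apply: measurableT_comp => //.
Qed.

Lemma mseq_wt_powR us a : mseq us -> measurable_fun setT (fun w => wt (ev us w) `^ a).
Proof. by move=> mus; apply: (measurableT_comp (measurable_powR a)); exact: mseq_wt. Qed.

Lemma wt_powR_le (x : seq R) e : 0 < e ->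
  wt x `^ e <= (size x).+1%:R `^ e * (1 + \sum_(i < size x) `|nth 0 x i| `^ e).
Proof.
move=> e0; have := @powR_sum_le R (1 :: [seq `|a| | a <- x]) e e0.
rewrite !big_cons !big_map /= size_map powR1x -/(wt x) => H.
rewrite (big_nth 0) big_mkord in H; apply: H.
by move=> a; rewrite inE => /orP[/eqP ->//|/mapP[b _ ->]].
Qed.

Lemma wt_moment e M us a : 0 < e -> moms e M us -> a <= e ->
  itg P (fun w => wt (ev us w) `^ a) /\ Ex P (fun w => wt (ev us w) `^ a) <= wtC (size us) e M.
Proof.
move=> e0 hus ae.
pose g w := (size us).+1%:R `^ e * (1 + \sum_(i < size us) `|nth (fun=> 0) us i w| `^ e).
have gi : itg P g.
  apply: itgZ; apply: itgD; first exact: itg_cst.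
  by apply: (itg_sum _ (f := fun (i : 'I_(size us)) w => `|nth (fun=> 0) us i w| `^ e)) => i; case: (hus i).
have le w : wt (ev us w) `^ a <= g w.
  rewrite (@le_trans _ _ (wt (ev us w) `^ e)) ?ler_powR ?wt_ge1//.
  rewrite (le_trans (wt_powR_le _ e0))// size_ev /g.
  by under eq_bigr do rewrite nth_ev.
have i : itg P (fun w => wt (ev us w) `^ a).
  apply: itg_dominated gi _; first exact/mseq_wt_powR/(moms_mseq hus).
  by move=> w; rewrite ger0_norm ?powR_ge0.
split => //; rewrite (le_trans (le_Ex i gi le))//.
have si j : itg P (fun w => `|nth (fun=> 0) us j w| `^ e) by case: (hus j).
rewrite /g ExZ; last first.
  apply: itgD; first exact: itg_cst.
  exact: (itg_sum _ (f := fun (i : 'I_(size us)) w => `|nth (fun=> 0) us i w| `^ e)).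
rewrite ler_wpM2l ?powR_ge0// ExD ?Ex_cst; [|exact: itg_cst|]; last first.
  exact: (itg_sum _ (f := fun (i : 'I_(size us)) w => `|nth (fun=> 0) us i w| `^ e)).
rewrite lerD2l (Ex_sum _ (f := fun (i : 'I_(size us)) w => `|nth (fun=> 0) us i w| `^ e))//.
rewrite (@le_trans _ _ (\sum_(i < size us) M))//; last by rewrite sumr_const card_ord mulr_natl.
by apply: ler_sum => j _; case: (hus j).
Qed.

Variable kappa : R.
Hypothesis kappa01 : 0 < kappa <= 1.
Let k0 : 0 < kappa. Proof. by case/andP: kappa01. Qed.
Let k1 : kappa <= 1. Proof. by case/andP: kappa01. Qed.

Lemma hol_itg n lam C f us e M : 0 <= lam -> hol kappa n lam C f -> size us = n ->
  0 < e -> lam <= e -> moms e M us ->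
  itg P (fun w => f (ev us w)) /\ Ex P (fun w => `|f (ev us w)|) <= C * wtC n e M.
Proof.
move=> l0 hf sn e0 le hus.
have [wi wE] := wt_moment e0 hus le.
have C0 := hol_constant_ge0 hf.
have fw w : `|f (ev us w)| <= C * wt (ev us w) `^ lam by apply: hf.2; rewrite size_ev.
have fi : itg P (fun w => f (ev us w)).
  by apply: itg_dominated (itgZ C wi) fw; apply: holder_measurable hf sn (moms_mseq hus).
split=> //; rewrite (le_trans (le_Ex (itg_norm fi) (itgZ C wi) fw))//.
by rewrite ExZ// ler_wpM2l// -sn.
Qed.

(** By submultiplicativity the weight of the random variables splits off as a factor, and its moment
    goes into the constant. *)
Lemma hol_mean n1 n2 lam C f vs e M : 0 <= lam -> hol kappa (n1 + n2) lam C f ->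
  size vs = n2 -> 0 < e -> lam <= e -> moms e M vs ->
  hol kappa n1 lam (C * wtC n2 e M) (fun x => Ex P (fun w => f (x ++ ev vs w))).
Proof.
move=> l0 hf sn e0 le hvs; have C0 := hol_constant_ge0 hf.
have [wi wE] := wt_moment e0 hvs le; rewrite sn in wE.
have fi x : size x = n1 -> itg P (fun w => f (x ++ ev vs w)).
  move=> sx; have hs := hol_section l0 sx hf.
  exact: (hol_itg l0 hs sn e0 le hvs).1.
split=> [x z sx sz|x sx].
  rewrite -ExB ?fi//.
  pose K := C * (wt x + wt z) `^ lam * sdist x z `^ kappa.
  rewrite (@le_trans _ _ (Ex P (fun w => K * wt (ev vs w) `^ lam)))//.
    apply: norm_Ex_le; [by apply: itgB; exact: fi|exact: itgZ|].
    move=> w; rewrite (le_trans (hf.1 _ _ _ _)) ?size_cat ?sx ?sz ?size_ev ?sn//.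
    rewrite sdist_cat ?sx// sdistxx addr0 /K [leRHS]mulrAC -(mulrA C _ (wt _ `^ _)).
    rewrite ler_wpM2r ?powR_ge0// ler_wpM2l//.
    have wx := wt_gt0 x; have wz := wt_gt0 z.
    rewrite -powRM ?(ltW (wt_gt0 _)) ?(addr_ge0 (ltW wx) (ltW wz))//.
    apply: ler_powRl => //; first by apply: addr_ge0; exact: ltW (wt_gt0 _).
    by rewrite mulrDl lerD// wt_cat_le.
  rewrite ExZ// /K [leRHS](_ : _ = C * (wt x + wt z) `^ lam * sdist x z `^ kappa * wtC n2 e M).
    by rewrite ler_wpM2l ?mulr_ge0 ?powR_ge0.
  by ring.
have hs := hol_section l0 sx hf.
have [i b] := hol_itg l0 hs sn e0 le hvs.
rewrite (le_trans (norm_Ex i))// (le_trans b)// [leRHS](_ : _ = C * wt x `^ lam * wtC n2 e M)//.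
by ring.
Qed.

(** Young's inequality with exponents 1/(1 - delta/q) and q/delta for b^lam and a^delta / w. The
    scaling by w makes the right side linear in w as soon as E a^q <= w^(q/delta). *)
Lemma young_split (a b w delta q e lam : R) : 0 <= a -> 0 <= b -> 0 < w -> 0 < delta -> delta < q ->
  1 <= b -> 0 <= lam -> lam / (1 - delta / q) <= e ->
  b `^ lam * a `^ delta <= w * (b `^ e + w `^ (- (q / delta)) * a `^ q).
Proof.
move=> a0 b0 w0 d0 dq b1 l0 le.
have q0 : 0 < q by exact: lt_trans dq.
have dq0 : 0 < 1 - delta / q by rewrite subr_gt0 ltr_pdivrMr// mul1r.
have -> : b `^ lam * a `^ delta = w * (b `^ lam * (w^-1 * a `^ delta)) by field; rewrite gt_eqF.
rewrite ler_wpM2l ?(ltW w0)//.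
have := @conjugate_powR R (b `^ lam) (w^-1 * a `^ delta) ((1 - delta / q)^-1) (q / delta).
rewrite powR_ge0 mulr_ge0 ?invr_ge0 ?powR_ge0 ?(ltW w0)// invr_gt0 dq0 divr_gt0//.
rewrite invrK invf_div subrK => /(_ isT isT isT isT erefl) H.
rewrite (le_trans H)//; apply: lerD.
  rewrite -powRrM (@le_trans _ _ (b `^ (lam / (1 - delta / q))))//; last exact: ler_powR.
  by rewrite ler_piMr ?powR_ge0// gerBl divr_ge0// ltW.
rewrite powRM ?invr_ge0 ?powR_ge0 ?(ltW w0)// -(powRrM a).
have -> : delta * (q / delta) = q by field; rewrite gt_eqF.
rewrite -[w^-1]powR_inv1 ?(ltW w0)// -(powRrM w) mulN1r.
by rewrite ler_piMr ?mulr_ge0 ?powR_ge0// ler_pdivrMr// mul1r ltW.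
Qed.

Definition approxC n e M (q : R) : R := 2 `^ e * (wtC n e M + wtC n e M) + n%:R `^ q * n%:R.

(** Price of replacing variables by approximants at L^q distance at most w^(1/delta): linear in w.
    This is how beta_q(r)^delta enters the estimates. *)
Lemma hol_approx n lam C f us vs e M (delta q w : R) :
  0 <= lam -> hol kappa n lam C f -> size us = n -> size vs = n -> 0 < e ->
  moms e M us -> moms e M vs -> 0 < delta -> delta <= kappa -> delta < q -> 0 < w ->
  (lam + 1) / (1 - delta / q) <= e ->
  (forall i, (i < n)%N -> let D := fun x => `|nth (fun=> 0) us i x - nth (fun=> 0) vs i x| `^ q in
     itg P D /\ Ex P D <= w `^ (q / delta)) ->
  `|Ex P (fun x => f (ev us x)) - Ex P (fun x => f (ev vs x))| <= C * approxC n e M q * w.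
Proof.
move=> l0 hf su sv e0 hus hvs d0 dk dq w0 le HD; have C0 := hol_constant_ge0 hf.
have q0 : 0 < q by exact: lt_trans dq.
have dq1 : 0 < 1 - delta / q by rewrite subr_gt0 ltr_pdivrMr// mul1r.
have lame : lam <= e.
  apply: le_trans le; rewrite ler_pdivlMr//; apply: (@le_trans _ _ lam); last by rewrite lerDl.
  by rewrite ler_piMr// gerBl divr_ge0// ltW.
have [fu _] := hol_itg l0 hf su e0 lame hus.
have [fv _] := hol_itg l0 hf sv e0 lame hvs.
have [wu wuE] := wt_moment e0 hus (lexx e); have [wv wvE] := wt_moment e0 hvs (lexx e).
rewrite su in wuE; rewrite sv in wvE.
rewrite -ExB//.
pose D i x := `|nth (fun=> 0) us i x - nth (fun=> 0) vs i x| `^ q.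
have Di (i : 'I_n) : itg P (D i) by case: (HD i (ltn_ord i)).
pose g x := C * w * (2 `^ e * (wt (ev us x) `^ e + wt (ev vs x) `^ e) +
   w `^ (- (q / delta)) * (n%:R `^ q * \sum_(i < n) D i x)).
have sDi : itg P (fun x => \sum_(i < n) D i x) by exact: (itg_sum _ (f := fun (i : 'I_n) x => D i x)).
have gi : itg P g.
  apply: itgZ; apply: itgD; first by apply: itgZ; exact: itgD.
  by apply: itgZ; exact: itgZ.
rewrite (le_trans (norm_Ex_le (itgB fu fv) gi _))//; last first.
  rewrite /g ExZ; last by apply: itgD; [apply: itgZ; exact: itgD|by apply: itgZ; exact: itgZ].
  rewrite ExD; [|by apply: itgZ; exact: itgD|by apply: itgZ; exact: itgZ].
  rewrite (ExZ (2 `^ e) (itgD wu wv)) (ExZ _ (itgZ _ sDi)) (ExZ _ sDi).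
  rewrite ExD// (Ex_sum _ (f := fun (i : 'I_n) x => D i x))//.
  rewrite [leRHS](_ : _ = C * w * approxC n e M q); last by ring.
  rewrite ler_wpM2l ?mulr_ge0 ?(ltW w0)// /approxC lerD//.
    exact (ler_wpM2l (powR_ge0 2 e) (lerD wuE wvE)).
  rewrite mulrCA ler_wpM2l ?powR_ge0// powRN ler_pdivrMl ?powR_gt0//.
  rewrite (@le_trans _ _ (\sum_(i < n) w `^ (q / delta)))//.
    by apply: ler_sum => i _; case: (HD i (ltn_ord i)).
  by rewrite sumr_const card_ord mulr_natr.
move=> x; set a := ev us x; set b := ev vs x.
have sa : size a = n by rewrite size_ev.
have sb : size b = n by rewrite size_ev.
rewrite (le_trans (hf.1 _ _ sa sb))//.
have wa := wt_ge1 a; have wb := wt_ge1 b.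
have S1 : 1 <= wt a + wt b by rewrite (le_trans wa)// lerDl (le_trans ler01).
have S0 : 0 <= wt a + wt b by exact: le_trans S1.
have sd0 := sdist_ge0 a b.
have sdS : sdist a b <= wt a + wt b.
  rewrite /sdist (@le_trans _ _ (\sum_(pr <- zip a b) (`|pr.1| + `|pr.2|)))//.
    by apply: ler_sum => pr _; exact: ler_normB.
  rewrite big_split/= -(big_map fst xpredT (fun y => `|y|)) -(big_map snd xpredT (fun y => `|y|)).
  rewrite -/unzip1 -/unzip2 unzip1_zip ?sa ?sb// unzip2_zip ?sa ?sb//.
  by rewrite /wt lerD// lerDr.
(* Part of the distance is bounded by the weight: kappa - delta <= 1 powers of it are traded for one
   power of [wt], leaving the exponent delta that [young_split] can handle. *)
have step : (wt a + wt b) `^ lam * sdist a b `^ kappa <= (wt a + wt b) `^ (lam + 1) * sdist a b `^ delta.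
  have [->|sdn] := eqVneq (sdist a b) 0.
    by rewrite !powR0 ?gt_eqF// !mulr0.
  have sp : 0 < sdist a b by rewrite lt_neqAle eq_sym sdn.
  have -> : kappa = (kappa - delta) + delta by ring.
  rewrite powRD_gt0// mulrA ler_wpM2r ?powR_ge0//.
  rewrite (powRD_gt0 lam 1 (lt_le_trans ltr01 S1)) ler_wpM2l ?powR_ge0//.
  rewrite (@le_trans _ _ ((wt a + wt b) `^ (kappa - delta)))//.
    by apply: ler_powRl; rewrite ?subr_ge0.
  by rewrite ler_powR// lerBlDr (le_trans k1)// lerDl ltW.
rewrite -mulrA /g -mulrA ler_wpM2l// (le_trans step)//.
rewrite (le_trans (young_split sd0 S0 w0 d0 dq S1 _ le)) ?addr_ge0//.
rewrite ler_wpM2l ?(ltW w0)// lerD//.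
  have := @powR_sum_le R [:: wt a; wt b] e e0; rewrite !big_cons !big_nil !addr0 /=; apply.
  by move=> y; rewrite !inE => /orP[]/eqP ->; exact: ltW (wt_gt0 _).
rewrite ler_wpM2l ?powR_ge0//.
have := @powR_sum_le R [seq `|pr.1 - pr.2| | pr <- zip a b] q q0.
rewrite !big_map size_map size_zip sa sb minnn -/(sdist a b) => H.
rewrite (le_trans (H _))//; first by move=> y /mapP[pr _ ->].
rewrite ler_wpM2l ?powR_ge0// (big_nth (0, 0)) size_zip sa sb minnn big_mkord.
by apply: ler_sum => i _; rewrite nth_zip ?sa ?sb//= !nth_ev.
Qed.

End random_vectors.

(** * Mixing, uniformly over a finite family *)

Section one_level.
Context {d : measure_display} {T : measurableType d} {R : realType}.
Variable P : probability T R.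
Variables (Gs Hs : set (set T)) (p q v : R).
Hypothesis sG : sigma_algebra setT Gs.
Hypothesis Gm : Gs `<=` measurable.
Hypothesis sH : sigma_algebra setT Hs.
Hypothesis Hm : Hs `<=` measurable.
Hypothesis p1 : 1 < p.
Hypothesis q1 : 1 <= q.
Hypothesis v0 : 0 < v.

(** The form in which a bound v on the coefficient ϖ_{q,p}(Gs, Hs) is used; [varpi_sets_version]
    supplies it. *)
Definition mixing_bound := forall (g : T -> R) (C : R), 0 < C -> Gmeasurable Hs g ->
  itg P (fun x => `|g x| `^ q) -> Ex P (fun x => `|g x| `^ q) <= C `^ q ->
  exists h, [/\ cexp_version P Gs g h, itg P (fun x => `|h x - Ex P g| `^ p) &
    Ex P (fun x => `|h x - Ex P g| `^ p) <= (v * C) `^ p].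
Hypothesis mixing : mixing_bound.

Let p' := p / (p - 1).
Let p0 : 0 < p. Proof. exact: lt_trans p1. Qed.
Let p'0 : 0 < p'. Proof. by rewrite divr_gt0 ?subr_gt0. Qed.
Let pp' : p'^-1 + p^-1 = 1.
Proof. by rewrite /p'; field; rewrite !gt_eqF ?subr_gt0. Qed.

Lemma young_scaled (a b s : R) : 0 <= a -> 0 <= b -> 0 < s ->
  a * b <= s * (a `^ p' + (b / s) `^ p).
Proof.
move=> a0 b0 s0; have bs0 : 0 <= b / s by rewrite divr_ge0// ltW.
have -> : a * b = s * (a * (b / s)) by field; rewrite gt_eqF.
rewrite ler_wpM2l ?(ltW s0)// (le_trans (conjugate_powR a0 bs0 p'0 p0 pp'))//.
have i1 : p'^-1 <= 1 by rewrite -pp' lerDl invr_ge0 ltW.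
have i2 : p^-1 <= 1 by rewrite -pp' lerDr invr_ge0 ltW.
by rewrite lerD// ler_piMr ?powR_ge0.
Qed.

Variables (J : eqType) (tau : T -> J) (cs : seq J) (g : J -> T -> R) (kap om : J -> R).
Variables (H : T -> R) (B eps : R).
Hypothesis ucs : uniq cs.
Hypothesis Gtau : forall c, Gs [set x | tau x = c].
Hypothesis Hg : forall c, Gmeasurable Hs (g c).
Hypothesis kap0 : forall c, 0 < kap c.
Hypothesis om0 : forall c, 0 < om c.
Hypothesis gq : forall c, c \in cs -> itg P (fun x => `|g c x| `^ q) /\ Ex P (fun x => `|g c x| `^ q) <= kap c `^ q.
Hypothesis GH : Gmeasurable Gs H.
Hypothesis HB : forall x, `|H x| <= B.
Hypothesis Hcs : forall x, H x != 0 -> tau x \in cs.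
Hypothesis eps0 : 0 < eps.

(** The label [tau] is known to [Gs], so on each of its cells g_c may be replaced by its conditional
    expectation, which is close to E g_c in L^p. A weighted Young inequality separates H from the
    deviations, and the deviation at the random label is dominated by the sum over all labels. The
    weights [om] make that sum converge, and [eps] balances the two terms. *)
Lemma one_level :
  itg P (fun x => (`|H x| / om (tau x)) `^ p') ->
  `|Ex P (fun x => H x * (g (tau x) x - Ex P (g (tau x))))| <=
  v * eps * (Ex P (fun x => (`|H x| / om (tau x)) `^ p') +
             \sum_(c <- cs) (kap c * om c / eps) `^ p).
Proof.
move=> iH.
have hex c : exists h, c \in cs -> [/\ cexp_version P Gs (g c) h,
    itg P (fun x => `|h x - Ex P (g c)| `^ p) &
    Ex P (fun x => `|h x - Ex P (g c)| `^ p) <= (v * kap c) `^ p].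
  have [cc|cc] := boolP (c \in cs); last by exists (fun=> 0).
  have [gi gE] := gq cc.
  by have [h hh] := mixing (kap0 c) (Hg c) gi gE; exists h => _.
have [h hP] := choice hex.
have ve0 : 0 < v * eps by rewrite mulr_gt0.
pose I c x : R := \1_[set x | tau x = c] x.
have I01 c x : 0 <= I c x <= 1 by rewrite /I indicE; case: (_ \in _); rewrite ?lexx ler01.
have GI c : Gmeasurable Gs (I c).
  by apply/GmeasurableP => //; apply: measurable_indic; apply/measurable_sub_sigma.
have GHI c : Gmeasurable Gs (fun x => H x * I c x) by exact: GmeasurableM.
have bHI c x : `|H x * I c x| <= B.
  have /andP[i0 i1] := I01 c x.
  by rewrite normrM (ger0_norm i0) (le_trans _ (HB x))// ler_piMr.
have mHI c : measurable_fun setT (fun x => H x * I c x) by exact: (Gmeasurable_measurable Gm (GHI c)).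
have split_tau (F : J -> T -> R) x : H x * F (tau x) x = \sum_(c <- cs) H x * I c x * F c x.
  have [H0|H0] := eqVneq (H x) 0.
    by rewrite H0 mul0r big1// => c _; rewrite !mul0r.
  rewrite (bigD1_seq (tau x))//= ?Hcs// /I indicE mem_set// mulr1 big1 ?addr0// => c ct.
  by rewrite indicE memNset ?mulr0 ?mul0r//= => tc; rewrite tc eqxx in ct.
have gi c : c \in cs -> itg P (g c).
  move=> cc; apply: (itg_moment q1) (gq cc).1; exact: Gmeasurable_measurable (Hg c).
have hi c : c \in cs -> itg P (h c) by move=> /hP[[_ []]].
have E1 : Ex P (fun x => H x * (g (tau x) x - Ex P (g (tau x)))) =
    Ex P (fun x => \sum_(c <- cs) H x * I c x * (h c x - Ex P (g c))).
  under eq_fun do rewrite (split_tau (fun c x => g c x - Ex P (g c))).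
  have iE (f : J -> T -> R) c : c \in cs -> itg P (f c) ->
     itg P (fun x => H x * I c x * (f c x - Ex P (g c))).
    by move=> cc fi; apply: itgM_bounded (bHI c) _ => //; apply: itgB => //; exact: itg_cst.
  have Es (f : J -> T -> R) : (forall c, c \in cs -> itg P (f c)) ->
     Ex P (fun x => \sum_(c <- cs) H x * I c x * (f c x - Ex P (g c))) =
     \sum_(c <- cs) Ex P (fun x => H x * I c x * (f c x - Ex P (g c))).
    move=> fi; pose F c x := if c \in cs then H x * I c x * (f c x - Ex P (g c)) else 0.
    transitivity (Ex P (fun x => \sum_(c <- cs) F c x)).
      by congr Ex; apply/funext => x; apply: eq_big_seq => c cc; rewrite /F cc.
    rewrite Ex_sum => [|c]; last first.
      by rewrite /F; case: (boolP (c \in cs)) => cc; [apply: iE => //; exact: fi|exact: itg_cst].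
    by apply: eq_big_seq => c cc; rewrite /F cc.
  rewrite !Es//; apply: eq_big_seq => c cc.
  have [ch _ _] := hP c cc.
  have spl f : itg P f -> Ex P (fun x => H x * I c x * (f x - Ex P (g c))) =
     Ex P (fun x => H x * I c x * f x) - Ex P (fun x => H x * I c x * Ex P (g c)).
    move=> fi; rewrite -ExB.
    - by congr Ex; apply/funext => x; rewrite mulrBr.
    - exact: itgM_bounded (bHI c) fi.
    - by apply: itgM_bounded (bHI c) _ => //; exact: itg_cst.
  rewrite !spl ?gi ?hi// (cexp_pullout sG Gm _ ch (GHI c) (bHI c))//; exact: gi.
rewrite E1.
pose D c x := `|h c x - Ex P (g c)|.
(* Off [cs] nothing is known about [h c], whence the default 0. *)
pose F c x := if c \in cs then (om c / (v * eps)) `^ p * D c x `^ p else 0.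
have Fi c : itg P (F c).
  rewrite /F; case: (boolP (c \in cs)) => cc; last exact: itg_cst.
  by apply: itgZ; case: (hP c cc).
pose G x := v * eps * ((`|H x| / om (tau x)) `^ p' + \sum_(c <- cs) F c x).
have Gi : itg P G.
  by apply: itgZ; apply: itgD => //; exact: itg_sum.
have mS : measurable_fun setT (fun x => \sum_(c <- cs) H x * I c x * (h c x - Ex P (g c))).
  have -> : (fun x => \sum_(c <- cs) H x * I c x * (h c x - Ex P (g c))) =
     (fun x => \sum_(c <- cs) if c \in cs then H x * I c x * (h c x - Ex P (g c)) else 0).
    by apply/funext => x; apply: eq_big_seq => c ->.
  apply: measurable_sum => c; case: (boolP (c \in cs)) => cc => //.
  apply: measurable_funM => //; apply: measurable_funB => //.
  exact: itg_measurable (hi c cc).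
have bd x : `|\sum_(c <- cs) H x * I c x * (h c x - Ex P (g c))| <= G x.
  rewrite -(split_tau (fun c x => h c x - Ex P (g c))) /G.
  have [H0|H0] := eqVneq (H x) 0.
    rewrite H0 mul0r normr0 mulr_ge0 ?(ltW ve0)// addr_ge0 ?powR_ge0// sumr_ge0// => c _.
    by rewrite /F; case: ifP => // _; rewrite mulr_ge0 ?powR_ge0.
  have tc := Hcs H0; set c := tau x in tc *.
  have oc := om0 c.
  rewrite normrM; have -> : `|H x| * `|h c x - Ex P (g c)| = (`|H x| / om c) * (om c * D c x).
    by rewrite /D; field; rewrite gt_eqF.
  have A0 : 0 <= `|H x| / om c by rewrite divr_ge0// ltW.
  have B0 : 0 <= om c * D c x by rewrite mulr_ge0 ?(ltW oc)// /D.
  rewrite (le_trans (young_scaled A0 B0 ve0))// ler_wpM2l ?(ltW ve0)// lerD2l.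
  rewrite (bigD1_seq c)//= {1}/F tc.
  have -> : om c * D c x / (v * eps) = om c / (v * eps) * D c x by ring.
  rewrite powRM ?divr_ge0 ?(ltW oc) ?(ltW ve0)// ?/D// lerDl sumr_ge0// => c' _.
  by rewrite /F; case: ifP => // _; rewrite mulr_ge0 ?powR_ge0.
have Si := itg_dominated mS Gi bd.
rewrite (le_trans (norm_Ex_le Si Gi bd))// /G ExZ; last first.
  by apply: itgD => //; exact: itg_sum.
rewrite ler_wpM2l ?(ltW ve0)// ExD//; last exact: itg_sum.
rewrite lerD2l Ex_sum// big_seq [leRHS]big_seq; apply: ler_sum => c cc.
have [_ Di DE] := hP c cc.
rewrite {1}/F cc ExZ// (le_trans (ler_wpM2l (powR_ge0 _ _) DE))//.
have oc := ltW (om0 c); have kc := ltW (kap0 c).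
rewrite -powRM ?divr_ge0 ?mulr_ge0 ?(ltW v0) ?(ltW eps0)//.
rewrite (_ : om c / (v * eps) * (v * kap c) = kap c * om c / eps)//.
by field; rewrite !gt_eqF.
Qed.

End one_level.

(** * Dyadic grids *)

Section dyadic_grid.
Variable R : realType.
Implicit Types (l M D : nat) (a : R).

Definition fl l a : R := (Num.floor (2 ^+ l * a))%:~R / 2 ^+ l.

Let e2 l : 0 < 2 ^+ l :> R. Proof. by rewrite exprn_gt0. Qed.

Lemma fl_itv l a : fl l a <= a /\ a <= fl l a + (2 ^+ l)^-1.
Proof.
have /andP[h1 h2] := floor_itv (2 ^+ l * a); rewrite /fl; split.
  by rewrite ler_pdivrMr// [a * _]mulrC.
rewrite -[X in _ + X]mul1r -mulrDl ler_pdivlMr// [a * _]mulrC.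
by apply: ltW; move: h2; rewrite intrD.
Qed.

Lemma dist_fl l a : `|a - fl l a| <= (2 ^+ l)^-1.
Proof.
have [h1 h2] := fl_itv l a.
by rewrite ger0_norm ?subr_ge0//; lra.
Qed.

(** Rounding down makes the grids nested: the coarser rounding is a function of the finer one, so a
    chaining increment is determined by the finer grid point alone. *)
Lemma fl_nested l a : fl l (fl l.+1 a) = fl l a.
Proof.
rewrite /fl; congr (_%:~R / _); apply: floor_def.
have /andP[h1 h2] := floor_itv (2 ^+ l * a).
have -> : 2 ^+ l * ((Num.floor (2 ^+ l.+1 * a))%:~R / 2 ^+ l.+1) =
   (Num.floor (2 ^+ l.+1 * a))%:~R / 2 :> R.
  by rewrite exprS; field; rewrite gt_eqF.
apply/andP; split.
  rewrite ler_pdivlMr// -[2]/(2%:~R) -intrM ler_int floor_ge_int intrM exprS.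
  by rewrite -mulrA mulrC ler_wpM2l.
apply: le_lt_trans h2; rewrite ler_pdivrMr//.
have /andP[h3 _] := floor_itv (2 ^+ l.+1 * a).
by rewrite (le_trans h3)// exprS -mulrA mulrC.
Qed.

Definition grid1 l M : seq R :=
  [seq j%:R / 2 ^+ l | j <- iota 0 M] ++ [seq - (j.+1%:R) / 2 ^+ l | j <- iota 0 M].

Lemma mem_grid1 l a (B : R) : `|a| <= B -> fl l a \in grid1 l (Num.bound (2 ^+ l * B)).
Proof.
move=> aB; have B0 : 0 <= B by exact: le_trans (normr_ge0 a) aB.
have E0 : 0 <= 2 ^+ l * B by rewrite mulr_ge0 ?(ltW (e2 l)).
have Mlt := archi_boundP E0; set M := Num.bound _ in Mlt *.
have /andP[h1 h2] := floor_itv (2 ^+ l * a).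
move: aB; rewrite ler_norml => /andP[a1 a2].
have a1' : - (2 ^+ l * B) <= 2 ^+ l * a by rewrite -mulrN ler_wpM2l ?(ltW (e2 l)).
have a2' : 2 ^+ l * a <= 2 ^+ l * B by rewrite ler_wpM2l ?(ltW (e2 l)).
rewrite mem_cat /fl; move: h1 h2; case: (Num.floor _) => j h1 h2; apply/orP.
  left; apply/mapP; exists j => //; rewrite mem_iota add0n -(ltr_nat R).
  by rewrite (le_lt_trans h1)// (le_lt_trans a2').
right; apply/mapP; exists j; last by rewrite NegzE rmorphN.
rewrite mem_iota add0n -(ltr_nat R); move: h2; rewrite NegzE.
have -> : (- j.+1%:Z + 1)%:~R = - j%:R :> R by rewrite -addn1 PoszD opprD addrK rmorphN.
by move=> h2; apply: le_lt_trans Mlt; lra.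
Qed.

(** A Riemann sum of (1+|a|)^(-2), with 2 for each half line. With D_j = 1 + j eta and eta <= 1,
    each term is at most twice the telescoping difference 1/D_j - 1/D_(j+1). *)
Lemma grid1_sum l M : \sum_(a <- grid1 l M) (2 ^+ l)^-1 * (1 + `|a|) ^- 2 <= 4 :> R.
Proof.
set eta := (2 ^+ l)^-1; have eta0 : 0 < eta by rewrite invr_gt0.
have eta1 : eta <= 1 by rewrite invf_le1// exprn_ege1// ler1n.
pose D j : R := 1 + j%:R * eta.
have D0 j : 0 < D j by rewrite ltr_wpDr// mulr_ge0// ltW.
have DS j : D j.+1 = D j + eta by rewrite /D -natr1; ring.
have D1 j : 1 <= D j by rewrite lerDl mulr_ge0// ltW.
have step j : eta * D j ^- 2 <= 2 * ((D j)^-1 - (D j.+1)^-1).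
  have -> : 2 * ((D j)^-1 - (D j.+1)^-1) = eta * (2 / (D j * D j.+1)).
    by rewrite DS; field; rewrite -DS !gt_eqF.
  rewrite ler_pM2l// ler_pdivlMr ?mulr_gt0// mulrC ler_pdivrMr ?exprn_gt0//.
  by rewrite DS; have := D1 j; have := D0 j; nra.
have half : \sum_(j <- iota 0 M) eta * D j ^- 2 <= 2.
  rewrite (@le_trans _ _ (\sum_(j <- iota 0 M) 2 * ((D j)^-1 - (D j.+1)^-1)))//.
    by apply: ler_sum => j _; exact: step.
  have -> : \sum_(j <- iota 0 M) 2 * ((D j)^-1 - (D j.+1)^-1) = 2 * ((D 0)^-1 - (D M)^-1).
    elim: M => [|M IH]; first by rewrite big_nil subrr mulr0.
    by rewrite -(addn1 M) iotaD big_cat IH big_cons big_nil add0n addn1 /=; ring.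
  have : 0 <= (D M)^-1 by rewrite invr_ge0 ltW.
  by rewrite /D mul0r addr0 invr1; lra.
rewrite /grid1 big_cat !big_map /=.
have -> : 4 = 2 + 2 :> R by ring.
apply: lerD.
  apply: le_trans half; apply: ler_sum => j _.
  by rewrite /D ger0_norm// divr_ge0// ltW.
apply: le_trans half; apply: ler_sum => j _.
rewrite ler_pM2l// mulNr normrN ger0_norm ?divr_ge0 ?(ltW (e2 l))// -/eta -/(D j.+1).
by rewrite lef_pV2 ?posrE ?exprn_gt0// lerXn2r ?nnegrE ?(ltW (D0 _))// DS lerDl ltW.
Qed.

Fixpoint gridn l M D : seq (seq R) :=
  if D is D'.+1 then [seq a :: s | a <- grid1 l M, s <- gridn l M D'] else [:: [::]].

Lemma size_gridn l M D s : s \in gridn l M D -> size s = D.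
Proof.
elim: D s => [|D IH] s /=; first by rewrite inE => /eqP ->.
by move=> /allpairsP[[a t]] /= [_ /IH <- ->].
Qed.

Lemma mem_gridn l (B : R) (x : seq R) : (forall a, a \in x -> `|a| <= B) ->
  map (fl l) x \in gridn l (Num.bound (2 ^+ l * B)) (size x).
Proof.
have := @mem_grid1 l ^~ B; move: (Num.bound _) => M gM.
elim: x => [|a x IH] xB //=; apply/allpairsP; exists (fl l a, map (fl l) x) => /=.
split => //; first by apply: gM; apply: xB; rewrite mem_head.
by apply: IH => b bx; apply: xB; rewrite inE bx orbT.
Qed.

Lemma gridn_sum l M D :
  \sum_(s <- gridn l M D) ((2 ^+ l)^-1 ^+ D * \prod_(a <- s) (1 + `|a|) ^- 2) <= 4 ^+ D :> R.
Proof.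
elim: D => [|D IH]; first by rewrite big_seq1 !expr0 mul1r big_nil.
rewrite /= big_allpairs_dep /=.
have -> : \sum_(a <- grid1 l M) \sum_(s <- gridn l M D)
     (2 ^+ l)^-1 ^+ D.+1 * \prod_(b <- a :: s) (1 + `|b|) ^- 2 =
   (\sum_(a <- grid1 l M) (2 ^+ l)^-1 * (1 + `|a|) ^- 2) *
   (\sum_(s <- gridn l M D) ((2 ^+ l)^-1 ^+ D * \prod_(a <- s) (1 + `|a|) ^- 2)).
  rewrite mulr_suml; apply: eq_bigr => a _; rewrite mulr_sumr; apply: eq_bigr => s _.
  by rewrite big_cons exprS; ring.
rewrite exprS; apply: ler_pM => //; last exact: grid1_sum.
  apply: sumr_ge0 => a _; apply: mulr_ge0; rewrite invr_ge0 exprn_ge0//.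
apply: sumr_ge0 => s _; apply: mulr_ge0; first by rewrite exprn_ge0 ?invr_ge0 ?exprn_ge0.
by apply: prodr_ge0 => a _; rewrite invr_ge0 exprn_ge0// addr_ge0.
Qed.

Lemma wt_powR_prod D (p : R) (s : seq R) : size s = D -> D%:R <= p ->
  wt s `^ (- (2 * p)) <= \prod_(a <- s) (1 + `|a|) ^- 2.
Proof.
move=> sD Dp; have w1 := wt_ge1 s; have w0 := wt_gt0 s.
have wle : {in s, forall a, 1 + `|a| <= wt s}.
  elim: s {sD w1 w0} => // b s IH a; rewrite inE wt_cons => /orP[/eqP ->|/IH h].
    by have := wt_ge1 s; lra.
  by have := normr_ge0 b; lra.
rewrite (@le_trans _ _ (wt s ^- (2 * D)))//.
  rewrite -powR_invn ?(ltW w0)//; apply: ler_powR => //.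
  by rewrite natrM lerN2 ler_wpM2l.
rewrite exprM -sD; move: (wt s) w0 wle => W w0 {sD w1}.
elim: s => [|a x IH] wle; first by rewrite big_nil expr0 invr1.
rewrite big_cons /= exprS invfM; apply: ler_pM; rewrite ?invr_ge0 ?exprn_ge0 ?exprn_ge0 ?(ltW w0)//.
  have a1 : 0 < 1 + `|a| by rewrite ltr_wpDr.
  rewrite lef_pV2 ?posrE ?exprn_gt0// lerXn2r ?nnegrE ?(ltW w0) ?(ltW a1)//.
  by apply: wle; rewrite mem_head.
by apply: IH => b bx; apply: wle; rewrite inE bx orbT.
Qed.

Lemma sum_undup_le (J : eqType) (s : seq J) (F : J -> R) : (forall x, 0 <= F x) ->
  \sum_(x <- undup s) F x <= \sum_(x <- s) F x.
Proof.
move=> F0; elim: s => [|x s IH] //=; rewrite big_cons; case: ifP => _.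
  by rewrite (le_trans IH)// lerDr.
by rewrite big_cons lerD2l.
Qed.

(** The bound depends neither on the mesh nor on the range M, which is what lets the range be
    truncated arbitrarily far in the chaining. Duplicates are removed because [one_level] asks for
    distinct labels. *)
Lemma grid_sum l M D (p : R) : D%:R <= p ->
  \sum_(s <- undup (gridn l M D)) (2 ^+ l)^-1 ^+ D * wt s `^ (- (2 * p)) <= 4 ^+ D.
Proof.
move=> Dp; apply: le_trans (gridn_sum l M D); apply: le_trans (sum_undup_le _ _) _.
  by move=> s; rewrite mulr_ge0 ?powR_ge0 ?exprn_ge0 ?invr_ge0 ?exprn_ge0.
rewrite big_seq [leRHS]big_seq; apply: ler_sum => s /size_gridn sD.
by rewrite ler_wpM2l ?exprn_ge0 ?invr_ge0 ?exprn_ge0// (wt_powR_prod sD).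
Qed.

Lemma measurable_fl l : measurable_fun setT (fl l).
Proof.
apply: nondecreasing_measurable => // x y xy; rewrite /fl.
rewrite ler_wpM2r ?invr_ge0 ?(ltW (e2 l))// ler_int; apply: le_floor.
by rewrite ler_wpM2l ?(ltW (e2 l)).
Qed.

Lemma sdist_fl l (x : seq R) : sdist x (map (fl l) x) <= (size x)%:R * (2 ^+ l)^-1.
Proof.
elim: x => [|a x IH] /=; first by rewrite /sdist big_nil mul0r.
rewrite sdist_cons -natr1 mulrDl mul1r addrC lerD//; exact: dist_fl.
Qed.

Lemma wt_fl l (x : seq R) : wt (map (fl l) x) <= (size x).+1%:R * wt x.
Proof.
have i1 : (2 ^+ l)^-1 <= 1 :> R by rewrite invf_le1// exprn_ege1// ler1n.
elim: x => [|a x IH] /=; first by rewrite mul1r.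
rewrite !wt_cons -natr1.
have h : `|fl l a| <= `|a| + 1.
  have -> : fl l a = a - (a - fl l a) by ring.
  by rewrite (le_trans (ler_normB _ _))// lerD// (le_trans (dist_fl l a)).
have w1 := wt_ge1 x; have a0 := normr_ge0 a.
move: IH; set s := (size x).+1%:R; set W := wt (map _ _) => IH.
have s1 : 1 <= s by rewrite ler1n.
by nra.
Qed.

End dyadic_grid.

Section chaining.
Context {d : measure_display} {T : measurableType d} {R : realType}.
Variable P : probability T R.
Variables (kappa p q lam C e M A : R) (D n : nat).
Hypothesis kappa01 : 0 < kappa <= 1.
Hypothesis p1 : 1 < p.
Hypothesis q1 : 1 <= q.
Hypothesis lam0 : 0 <= lam.
Hypothesis e0 : 0 < e.
Hypothesis le : lam * q <= e.
Hypothesis Dp : D%:R / p < kappa.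

Let p' := p / (p - 1).
Let k0 : 0 < kappa. Proof. by case/andP: kappa01. Qed.
Let k1 : kappa <= 1. Proof. by case/andP: kappa01. Qed.
Let p0 : 0 < p. Proof. exact: lt_trans p1. Qed.
Let q0 : 0 < q. Proof. exact: lt_le_trans q1. Qed.
Let p'0 : 0 <= p'. Proof. by rewrite divr_ge0 ?subr_ge0 ?(ltW p0) ?(ltW p1). Qed.
Let lame : lam <= e. Proof. by apply: le_trans le; rewrite ler_peMr. Qed.

(** Net gain per dyadic level: kappa comes from Hölder continuity, and D/p is lost to uniformity
    over a grid with about 2^(lD) points. *)
Let theta := kappa - D%:R / p.
Let theta0 : 0 < theta. Proof. by rewrite subr_gt0. Qed.
Let eta (l : nat) : R := (2 ^+ l)^-1.
Let eta0 l : 0 < eta l. Proof. by rewrite invr_gt0 exprn_gt0. Qed.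
Let eta1 l : eta l <= 1. Proof. by rewrite invf_le1 ?exprn_gt0// exprn_ege1// ler1n. Qed.
Let etaS l : eta l = 2 * eta l.+1.
Proof. by rewrite /eta exprS; field; rewrite gt_eqF// exprn_gt0. Qed.

Let W := 1 + wtC n e M.
Let C1 := C * D.+2%:R `^ (lam + 1).
Let C2 := 2 * C1 * W + 1.
Let C3 := D.+1%:R `^ ((lam + 2) * p') * A + C2 `^ p * 4 ^+ D.

Definition chainC := C3 / (1 - (2^-1) `^ theta).

Section fixed.
Variables (Gs Hs : set (set T)) (v : R).
Hypothesis sG : sigma_algebra setT Gs.
Hypothesis Gm : Gs `<=` measurable.
Hypothesis sH : sigma_algebra setT Hs.
Hypothesis Hm : Hs `<=` measurable.
Hypothesis v0 : 0 < v.
Hypothesis mixing : mixing_bound P Gs Hs p q v.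
Variables (f : seq R -> R) (us vs : seq (T -> R)) (H : T -> R) (B B' : R).
Hypothesis hf : hol kappa (D + n) lam C f.
Hypothesis sus : size us = D.
Hypothesis svs : size vs = n.
Hypothesis Gus : forall i, Gmeasurable Gs (nth (fun=> 0) us i).
Hypothesis Hvs : forall i, Gmeasurable Hs (nth (fun=> 0) vs i).
Hypothesis mvs : moms P e M vs.
Hypothesis GH : Gmeasurable Gs H.
Hypothesis HB' : forall x, `|H x| <= B'.
Hypothesis HB : forall x, H x != 0 -> wt (ev us x) <= B.
Hypothesis HA : itg P (fun x => (`|H x| * wt (ev us x) `^ (lam + 2)) `^ p') /\
  Ex P (fun x => (`|H x| * wt (ev us x) `^ (lam + 2)) `^ p') <= A.

Let fbar x := Ex P (fun w => f (x ++ ev vs w)).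
Let C0 : 0 <= C. Proof. exact: hol_constant_ge0 hf. Qed.
Let M0 : 0 <= M. Proof. exact: moms_ge0 mvs. Qed.
Let W1 : 1 <= W. Proof. by rewrite lerDl wtC_ge0. Qed.
Let C10 : 0 <= C1. Proof. by rewrite mulr_ge0 ?powR_ge0. Qed.
Let C20 : 0 < C2. Proof. by rewrite ltr_wpDl ?ltr01// !mulr_ge0// (le_trans ler01). Qed.
Let mH : measurable_fun setT H. Proof. exact: Gmeasurable_measurable GH. Qed.
Let mus : mseq us. Proof. by move=> i; exact: Gmeasurable_measurable (Gus i). Qed.

Let hfbar : hol kappa D lam (C * wtC n e M) fbar.
Proof. exact: hol_mean hf svs e0 lame mvs. Qed.

Let itg_section c : size c = D -> itg P (fun w => f (c ++ ev vs w)).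
Proof. by move=> sc; exact: (hol_itg kappa01 lam0 (hol_section lam0 sc hf) svs e0 lame mvs).1. Qed.

Let usl l := [seq (fun w => fl l (u w)) | u <- us].
Let ev_usl l w : ev (usl l) w = map (fl l) (ev us w).
Proof. by rewrite /ev /usl -!map_comp. Qed.
Let musl l : mseq (usl l).
Proof.
move=> i; have [ius|ius] := ltnP i (size us); last by rewrite nth_default ?size_map.
by rewrite (nth_map (fun=> 0))//; apply: measurableT_comp (mus i); exact: measurable_fl.
Qed.

Let wtusl l w : wt (ev (usl l) w) <= D.+1%:R * wt (ev us w).
Proof. by rewrite ev_usl (le_trans (wt_fl l _))// size_ev sus. Qed.

(* [us'] stands for [us] or one of its roundings. *)
Let itg_product us' : size us' = D -> mseq us' ->
  (forall w, wt (ev us' w) <= D.+1%:R * wt (ev us w)) ->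
  itg P (fun w => H w * (f (ev us' w ++ ev vs w) - fbar (ev us' w))).
Proof.
move=> su mu wu.
have [wi _] := wt_moment e0 mvs lame.
have B0 (w : T) : H w != 0 -> 0 <= B by move=> /HB; apply: le_trans; exact: ltW (wt_gt0 _).
pose K := B' * (C * (D.+1%:R * B) `^ lam).
apply: (@itg_dominated _ _ _ _ _ (fun w => `|K| * (wt (ev vs w) `^ lam + wtC n e M))).
- apply: measurable_funM => //; apply: measurable_funB.
    under eq_fun do rewrite -ev_cat.
    apply: (holder_measurable kappa01 lam0 hf); first by rewrite size_cat su svs.
    move=> i; rewrite nth_cat; case: ifP => _; first exact: mu.
    exact: moms_mseq mvs _.
  exact: (holder_measurable kappa01 lam0 hfbar).
- by apply: itgZ; apply: itgD => //; exact: itg_cst.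
move=> w; have [Hw|Hw] := eqVneq (H w) 0.
  by rewrite Hw mul0r normr0 mulr_ge0// addr_ge0 ?powR_ge0 ?wtC_ge0.
have Bw := HB Hw; have B0' := B0 _ Hw.
have wb : wt (ev us' w) <= D.+1%:R * B by rewrite (le_trans (wu w))// ler_wpM2l.
have wb' : wt (ev us' w) `^ lam <= (D.+1%:R * B) `^ lam.
  by apply: ler_powRl => //; exact: ltW (wt_gt0 _).
have h1 : `|f (ev us' w ++ ev vs w)| <= C * (D.+1%:R * B) `^ lam * wt (ev vs w) `^ lam.
  rewrite (le_trans (hf.2 _ _)) ?size_cat ?size_ev ?su ?svs//.
  rewrite -mulrA ler_wpM2l// (@le_trans _ _ ((wt (ev us' w) * wt (ev vs w)) `^ lam))//.
    by apply: ler_powRl; [exact: lam0|exact: ltW (wt_gt0 _)|exact: wt_cat_le].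
  by rewrite powRM ?(ltW (wt_gt0 _))// ler_wpM2r ?powR_ge0.
have h2 : `|fbar (ev us' w)| <= C * (D.+1%:R * B) `^ lam * wtC n e M.
  rewrite (le_trans (hfbar.2 _ _)) ?size_ev//.
  by rewrite [leLHS]mulrAC ler_wpM2r ?wtC_ge0// ler_wpM2l.
have B'0 : 0 <= B' by exact: le_trans (normr_ge0 _) (HB' w).
rewrite normrM (@le_trans _ _ (B' * (C * (D.+1%:R * B) `^ lam * (wt (ev vs w) `^ lam + wtC n e M))))//.
  apply: ler_pM => //; rewrite (le_trans (ler_normB _ _))// mulrDr; exact: lerD.
by rewrite mulrA ler_wpM2r ?addr_ge0 ?powR_ge0 ?wtC_ge0// ler_norm.
Qed.

Let Phi us' w := f (ev us' w ++ ev vs w) - fbar (ev us' w).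
Let S l := Ex P (fun w => H w * Phi (usl l) w).

(** Chaining increment between the grid point c of level l and its rounding at level l-1; level 0
    starts the chain with the whole function. *)
Let delta l c w := f (c ++ ev vs w) - (if l is l'.+1 then f (map (fl l') c ++ ev vs w) else 0).

Let hol_close c c' x l : size c = D -> size c' = D -> size x = n ->
  wt c' <= D.+1%:R * wt c -> sdist c c' <= D%:R * eta l ->
  `|f (c ++ x) - f (c' ++ x)| <= C1 * eta l `^ kappa * wt c `^ lam * wt x `^ lam.
Proof.
move=> sc sc' sx wc cc.
rewrite (le_trans (hf.1 _ _ _ _)) ?size_cat ?sc ?sc' ?sx//.
rewrite sdist_cat ?sc// sdistxx addr0.
have D2 : 0 < D.+2%:R :> R by rewrite ltr0n.
have -> : C1 * eta l `^ kappa * wt c `^ lam * wt x `^ lam =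
  C * (D.+2%:R `^ lam * (wt c `^ lam * wt x `^ lam)) * (D.+2%:R * eta l `^ kappa).
  by rewrite /C1 (powRD_gt0 lam 1 D2) (powRr1 (ltW D2)); ring.
have wc0 := wt_gt0 c; have wx0 := wt_gt0 x; have wc'0 := wt_gt0 c'.
apply: ler_pM; rewrite ?mulr_ge0 ?powR_ge0//.
  rewrite ler_wpM2l//.
  rewrite -(powRM lam (ltW wc0) (ltW wx0)) -(powRM lam (ltW D2) (mulr_ge0 (ltW wc0) (ltW wx0))).
  apply: ler_powRl; first exact: lam0.
    by apply: addr_ge0; exact: ltW (wt_gt0 _).
  have := wt_cat_le c x; have := wt_cat_le c' x.
  move: wc wc0 wx0 wc'0; rewrite -[D.+2%:R]natr1.
  move: (wt c) (wt c') (wt x) (D.+1%:R : R) => a b y dd h1 h2 h3 h4 h5 h6.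
  have : b * y <= dd * a * y by rewrite ler_wpM2r// ltW.
  by have -> : (dd + 1) * (a * y) = dd * a * y + a * y by [ring]; lra.
rewrite (@le_trans _ _ ((D.+2%:R * eta l) `^ kappa))//.
  apply: ler_powRl; [exact: ltW|exact: sdist_ge0|].
  by rewrite (le_trans cc)// ler_wpM2r ?(ltW (eta0 l))// ler_nat -addn2 leq_addr.
rewrite (powRM kappa (ltW D2) (ltW (eta0 l))) ler_wpM2r ?powR_ge0//.
by rewrite -[leRHS](powRr1 (ltW D2)) ler_powR// ler1n.
Qed.

Let delta_bound l c w : size c = D ->
  `|delta l c w| <= 2 * C1 * eta l `^ kappa * wt c `^ lam * wt (ev vs w) `^ lam.
Proof.
move=> sc; have sx : size (ev vs w) = n by rewrite size_ev.
rewrite /delta; case: l => [|l].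
  rewrite subr0 (le_trans (hf.2 _ _)) ?size_cat ?sc ?sx//.
  have -> : eta 0 = 1 by rewrite /eta expr0 invr1.
  rewrite powR1x mulr1 -mulrA; apply: ler_pM; rewrite ?powR_ge0//.
    have D1 : 1 <= D.+2%:R `^ (lam + 1) :> R.
      by rewrite -[leLHS](powR1x (lam + 1)); apply: ler_powRl; rewrite ?addr_ge0// ler1n.
    rewrite /C1 mulrA; apply: (@le_trans _ _ (2 * C)); last by rewrite ler_peMr// mulr_ge0.
    by rewrite ler_peMl// ler1n.
  rewrite -(powRM lam (ltW (wt_gt0 _)) (ltW (wt_gt0 _))).
  by apply: ler_powRl; [exact: lam0|exact: ltW (wt_gt0 _)|exact: wt_cat_le].
rewrite (le_trans (hol_close (l := l) sc _ sx _ _)) ?size_map//.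
- by rewrite (le_trans (wt_fl l _))// sc.
- by rewrite (le_trans (sdist_fl l _))// sc.
have h : eta l `^ kappa <= 2 * eta l.+1 `^ kappa.
  rewrite etaS (powRM kappa (ler0n R 2) (ltW (eta0 _))) ler_wpM2r ?powR_ge0//.
  by rewrite -[leRHS](powRr1 (ler0n R 2)) ler_powR// ler1n.
have -> : 2 * C1 * eta l.+1 `^ kappa = C1 * (2 * eta l.+1 `^ kappa) by ring.
by rewrite !ler_wpM2r ?powR_ge0// ler_wpM2l.
Qed.

Let kap l c := C2 * eta l `^ kappa * wt c `^ lam.

Let measurable_delta l c : size c = D -> Gmeasurable Hs (delta l c).
Proof.
move=> sc; apply/GmeasurableP => //.
have mf c' : size c' = D -> measurable_fun setT
    ((fun w => f (c' ++ ev vs w)) : g_sigma_algebraType Hs -> R).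
  move=> sc'; have hs := hol_section lam0 sc' hf.
  apply: (@holder_measurable _ (g_sigma_algebraType Hs) R kappa n lam _ _ vs kappa01 lam0 hs svs).
  by move=> i; apply/GmeasurableP => //; exact: Hvs.
rewrite /delta; case: l => [|l]; first by under eq_fun do rewrite subr0; exact: mf.
by apply: measurable_funB; apply: mf => //; rewrite size_map.
Qed.

Let delta_moment l c : size c = D ->
  itg P (fun w => `|delta l c w| `^ q) /\ Ex P (fun w => `|delta l c w| `^ q) <= kap l c `^ q.
Proof.
move=> sc; have [wi wE] := wt_moment e0 mvs le; rewrite svs in wE.
pose K := 2 * C1 * eta l `^ kappa * wt c `^ lam.
have K0 : 0 <= K by rewrite !mulr_ge0 ?powR_ge0.
have bd w : `|delta l c w| `^ q <= K `^ q * wt (ev vs w) `^ (lam * q).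
  rewrite powRrM -(powRM q K0 (powR_ge0 _ _)).
  by apply: ler_powRl; [exact: ltW q0|exact: normr_ge0|exact: delta_bound].
have md : measurable_fun setT (delta l c).
  exact: (Gmeasurable_measurable Hm (measurable_delta l sc)).
have i : itg P (fun w => `|delta l c w| `^ q).
  apply: itg_dominated (itgZ _ wi) _; first exact: measurable_norm_powR.
  by move=> w; rewrite ger0_norm ?powR_ge0// bd.
split=> //; rewrite (le_trans (le_Ex i (itgZ _ wi) bd))// ExZ//.
rewrite (@le_trans _ _ (K `^ q * W `^ q))//.
  rewrite ler_wpM2l ?powR_ge0// (le_trans wE)// (@le_trans _ _ W)//; first by rewrite lerDr.
  by rewrite -[leLHS](powRr1 (le_trans ler01 W1)) ler_powR.
rewrite -(powRM q K0 (le_trans ler01 W1)); apply: ler_powRl.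
- exact: ltW q0.
- by rewrite mulr_ge0// (le_trans ler01 W1).
rewrite /K /kap; have -> : 2 * C1 * eta l `^ kappa * wt c `^ lam * W = 2 * C1 * W * eta l `^ kappa * wt c `^ lam by ring.
by rewrite !ler_wpM2r ?powR_ge0// lerDl.
Qed.

Let kap0 l c : 0 < kap l c.
Proof. by rewrite !mulr_gt0 ?powR_gt0 ?wt_gt0. Qed.

Let Gusl l i : Gmeasurable Gs (nth (fun=> 0) (usl l) i).
Proof.
have [ius|ius] := ltnP i (size us).
  rewrite (nth_map (fun=> 0))//; apply: (Gmeasurable_comp sG (Gus i)); exact: measurable_fl.
rewrite nth_default ?size_map//; apply/GmeasurableP => //.
Qed.

Let Gmeasurable_level l c : Gs [set w | ev (usl l) w = c].
Proof.
apply/measurable_sub_sigma => //.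
have : forall (ws : seq (T -> R)), (forall i, Gmeasurable Gs (nth (fun=> 0) ws i)) ->
   measurable ([set w | ev ws w = c] : set (g_sigma_algebraType Gs)).
  elim: c => [|a c IH] [|u ws] Gw.
  - by rewrite (_ : [set w | _] = setT); [exact: measurableT|apply/seteqP; split].
  - by rewrite (_ : [set w | _] = set0); [exact: measurable0|apply/seteqP; split].
  - by rewrite (_ : [set w | _] = set0); [exact: measurable0|apply/seteqP; split].
  have -> : [set w | ev (u :: ws) w = a :: c] = u @^-1` [set a] `&` [set w | ev ws w = c].
    by apply/seteqP; split => w /=; [case=> <- <-|case=> -> <-].
  apply: measurableI; last by apply: IH => i; exact: (Gw i.+1).
  by apply/measurable_sub_sigma => //; exact: (Gw 0%N).
by apply => i; exact: Gusl.
Qed.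

(** [one_level] with the rounded value of [us] as label, weights wt^(-(lam+2)) and eps = eta^theta.
    With these choices kap om / eps = C2 eta^(D/p) wt^(-2), whose p-th power has a grid sum bounded
    by [grid_sum]. *)
Let level_bound l :
  `|Ex P (fun w => H w * (delta l (ev (usl l) w) w - Ex P (delta l (ev (usl l) w))))| <=
  v * eta l `^ theta * C3.
Proof.
pose cs := undup (gridn R l (Num.bound (2 ^+ l * B)) D).
pose om (c : seq R) := wt c `^ (- (lam + 2)).
have om0 c : 0 < om c by rewrite powR_gt0// wt_gt0.
pose g (c : seq R) := if size c == D then delta l c else fun=> 0.
have Hg c : Gmeasurable Hs (g c).
  rewrite /g; case: eqP => [sc|_]; first exact: measurable_delta.
  by apply/GmeasurableP.
have gq c : c \in cs -> itg P (fun x => `|g c x| `^ q) /\ Ex P (fun x => `|g c x| `^ q) <= kap l c `^ q.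
  rewrite mem_undup => /size_gridn sc; rewrite /g sc eqxx; exact: delta_moment.
have Hcs x : H x != 0 -> ev (usl l) x \in cs.
  move=> Hx; rewrite mem_undup ev_usl -[D in gridn _ _ _ D]sus -(size_ev us x).
  by apply: mem_gridn => a ax; rewrite (le_trans (norm_le_wt ax))// HB.
have eps0 : 0 < eta l `^ theta by rewrite powR_gt0.
have pb w : (`|H w| / om (ev (usl l) w)) `^ p' <=
    D.+1%:R `^ ((lam + 2) * p') * (`|H w| * wt (ev us w) `^ (lam + 2)) `^ p'.
  rewrite powRrM -powRM ?mulr_ge0 ?powR_ge0//; apply: ler_powRl => //.
    by rewrite mulr_ge0// invr_ge0 powR_ge0.
  rewrite /om powRN invrK mulrCA ler_wpM2l// -powRM ?(ltW (wt_gt0 _))//.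
  by apply: ler_powRl; [exact: addr_ge0|exact: ltW (wt_gt0 _)|exact: wtusl].
have iH : itg P (fun w => (`|H w| / om (ev (usl l) w)) `^ p').
  apply: itg_dominated (itgZ _ HA.1) _; last by move=> w; rewrite ger0_norm ?powR_ge0// pb.
  apply: (measurableT_comp (measurable_powR p')).
  apply: measurable_funM; first exact: measurableT_comp.
  rewrite /om; under eq_fun do rewrite powRN invrK.
  exact: mseq_wt_powR.
have := @one_level _ _ _ P Gs Hs p q v sG Gm Hm p1 q1 v0 mixing _ (ev (usl l)) cs g (kap l) om H B' _
  (undup_uniq _) (Gmeasurable_level l) Hg (kap0 l) om0 gq GH HB' Hcs eps0 iH.
have -> : (fun x => H x * (g (ev (usl l) x) x - Ex P (g (ev (usl l) x)))) =
   (fun w => H w * (delta l (ev (usl l) w) w - Ex P (delta l (ev (usl l) w)))).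
  by apply/funext => w; rewrite /g size_ev size_map sus eqxx.
move=> h; apply: (le_trans h); rewrite ler_wpM2l ?mulr_ge0 ?(ltW v0) ?(ltW eps0)//.
rewrite /C3 lerD//.
  rewrite (le_trans (le_Ex iH (itgZ _ HA.1) pb))// ExZ; last exact: HA.1.
  by rewrite ler_wpM2l ?powR_ge0//; exact: HA.2.
have Dpp : D%:R <= p.
  have : D%:R / p < 1 by exact: lt_le_trans Dp k1.
  by rewrite ltr_pdivrMr// mul1r; exact: ltW.
rewrite (@le_trans _ _ (\sum_(c <- cs) C2 `^ p * ((2 ^+ l)^-1 ^+ D * wt c `^ (- (2 * p)))))//; last first.
  by rewrite -mulr_sumr ler_wpM2l ?powR_ge0// grid_sum.
apply: ler_sum => c _; rewrite le_eqVlt; apply/orP; left; apply/eqP.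
have w0 := wt_gt0 c; have e0' := eta0 l.
have -> : kap l c * om c / eta l `^ theta = C2 * (eta l `^ (D%:R / p) * wt c `^ (- 2)).
  rewrite /kap /om; have -> : kappa = theta + D%:R / p by rewrite /theta; ring.
  rewrite (powRD_gt0 _ _ e0'); have -> : wt c `^ (- 2) = wt c `^ lam * wt c `^ (- (lam + 2)).
    by rewrite -(powRD_gt0 _ _ w0); congr (_ `^ _); ring.
  by field; rewrite gt_eqF// powR_gt0.
rewrite powRM ?(ltW C20) ?mulr_ge0 ?powR_ge0//; congr (_ * _).
rewrite powRM ?powR_ge0// -!powRrM; congr (_ * _); last by congr (_ `^ _); ring.
by rewrite divfK ?gt_eqF// powR_mulrn ?(ltW e0').
Qed.

Let S_bound l : `|S l| <= v * C3 * \sum_(j < l.+1) eta j `^ theta.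
Proof.
elim: l => [|l IH].
  rewrite big_ord_recl big_ord0 addr0 [leRHS]mulrAC.
  have := level_bound 0; rewrite /S /Phi /delta /fbar.
  under eq_fun do rewrite subr0.
  by under [X in `|Ex P X| <= _ -> _]eq_fun do (under [X in Ex P X]eq_fun do rewrite subr0).
have -> : S l.+1 = S l + Ex P (fun w => H w * (delta l.+1 (ev (usl l.+1) w) w - Ex P (delta l.+1 (ev (usl l.+1) w)))).
  have i1 := itg_product (us' := usl l.+1) (etrans (size_map _ _) sus) (musl l.+1) (wtusl l.+1).
  have i2 := itg_product (us' := usl l) (etrans (size_map _ _) sus) (musl l) (wtusl l).
  apply/eqP; rewrite -subr_eq' || rewrite addrC -subr_eq; apply/eqP.
  rewrite /S /Phi -ExB//; congr Ex; apply/funext => w; rewrite -mulrBr; congr (_ * _).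
  have fle : map (fl l) (ev (usl l.+1) w) = ev (usl l) w.
    by rewrite !ev_usl -map_comp; apply: eq_map => a /=; rewrite fl_nested.
  rewrite /delta fle ExB; [|by apply: itg_section; rewrite size_ev size_map..].
  by rewrite -/(fbar _) -/(fbar _); ring.
rewrite big_ord_recr/= mulrDr (le_trans (ler_normD _ _))// lerD//.
by rewrite mulrAC; exact: level_bound.
Qed.

(** The constant depends on the cut-offs B and B', which is harmless: l tends to infinity with the
    cut-offs fixed. *)
Let S_limit l : `|Ex P (fun w => H w * Phi us w) - S l| <=
  B' * (C1 * `|B| `^ lam * (wtC n e M + wtC n e M)) * eta l `^ kappa.
Proof.
have wtus w : wt (ev us w) <= D.+1%:R * wt (ev us w).
  by rewrite ler_peMl ?ler1n// ltW// wt_gt0.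
have i1 := itg_product sus mus wtus.
have i2 := itg_product (us' := usl l) (etrans (size_map _ _) sus) (musl l) (wtusl l).
have [wi wE] := wt_moment e0 mvs lame; rewrite svs in wE.
rewrite /S -ExB//.
pose K := B' * (C1 * `|B| `^ lam) * eta l `^ kappa.
have gi : itg P (fun w => K * (wt (ev vs w) `^ lam + wtC n e M)).
  by apply: itgZ; apply: itgD => //; exact: itg_cst.
have B'0 : 0 <= B' by exact: le_trans (normr_ge0 _) (HB' point).
have K0 : 0 <= K by rewrite !mulr_ge0 ?powR_ge0.
rewrite (le_trans (norm_Ex_le (itgB i1 i2) gi _))//; last first.
  rewrite ExZ ?ExD ?Ex_cst//; [|exact: itg_cst|by apply: itgD => //; exact: itg_cst].
  rewrite [leRHS](_ : _ = K * (wtC n e M + wtC n e M)); last by rewrite /K; ring.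
  by rewrite ler_wpM2l// lerD2r.
move=> w; rewrite -mulrBr normrM.
have [Hw|Hw] := eqVneq (H w) 0.
  by rewrite Hw normr0 mul0r mulr_ge0// addr_ge0 ?powR_ge0 ?wtC_ge0.
have Bw : wt (ev us w) `^ lam <= `|B| `^ lam.
  apply: ler_powRl; [exact: lam0|exact: ltW (wt_gt0 _)|].
  exact: le_trans (HB Hw) (ler_norm _).
have sw : size (ev us w) = D by rewrite size_ev.
have cl x : size x = n -> `|f (ev us w ++ x) - f (ev (usl l) w ++ x)| <=
    C1 * eta l `^ kappa * `|B| `^ lam * wt x `^ lam.
  move=> sx; rewrite (le_trans (hol_close (l := l) sw _ sx _ _)) ?size_ev ?size_map//.
  - by rewrite ev_usl -[in X in _ <= X]sw sdist_fl.
  by rewrite ler_wpM2r ?powR_ge0// ler_wpM2l// mulr_ge0 ?powR_ge0.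
have fb : `|fbar (ev us w) - fbar (ev (usl l) w)| <= C1 * eta l `^ kappa * `|B| `^ lam * wtC n e M.
  rewrite /fbar -ExB; [|by apply: itg_section; rewrite size_ev ?size_map..].
  apply: le_trans (norm_Ex_le (g := fun y => C1 * eta l `^ kappa * `|B| `^ lam * wt (ev vs y) `^ lam) _ _ _) _.
  - by apply: itgB; apply: itg_section; rewrite size_ev ?size_map.
  - exact: itgZ.
  - by move=> y; apply: cl; rewrite size_ev.
  by rewrite ExZ// ler_wpM2l// !mulr_ge0 ?powR_ge0.
have fw := cl (ev vs w) (etrans (size_ev _ _) svs).
have -> : K * (wt (ev vs w) `^ lam + wtC n e M) =
   B' * (C1 * eta l `^ kappa * `|B| `^ lam * wt (ev vs w) `^ lam + C1 * eta l `^ kappa * `|B| `^ lam * wtC n e M).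
  by rewrite /K; ring.
apply: ler_pM => //.
rewrite /Phi; set a := f _; set b := fbar _; set a' := f _; set b' := fbar _.
have -> : a - b - (a' - b') = (a - a') - (b - b') by ring.
by rewrite (le_trans (ler_normB _ _))// lerD.
Qed.

(** Telescoping over the levels leaves a geometric series in 2^(-theta). H is bounded and vanishes
    unless [us] lies in a box, so each level involves finitely many grid points; [chainC] depends on
    neither cut-off. *)
Lemma chain_path :
  `|Ex P (fun w => H w * (f (ev us w ++ ev vs w) - Ex P (fun w' => f (ev us w ++ ev vs w'))))| <=
  chainC * v.
Proof.
have x01 : 0 < (2^-1 : R) `^ theta by rewrite powR_gt0// invr_gt0.
have x1 : (2^-1 : R) `^ theta < 1.
  rewrite -[ltRHS](powR1x theta); apply: gt0_ltr_powR; rewrite ?nnegrE ?invr_ge0//.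
  by rewrite invf_lt1// ltr1n.
have A0 : 0 <= A by apply: le_trans HA.2; apply: Ex_ge0 => w; exact: powR_ge0.
have C30 : 0 <= C3 by rewrite addr_ge0 ?mulr_ge0 ?powR_ge0 ?exprn_ge0.
have etaE j : eta j `^ theta = ((2^-1) `^ theta) ^+ j.
  rewrite /eta -powR_mulrn ?powR_ge0// -powRrM [theta * _]mulrC powRrM.
  by rewrite powR_mulrn ?invr_ge0// exprVn.
have geo l : \sum_(j < l) eta j `^ theta <= (1 - (2^-1) `^ theta)^-1.
  under eq_bigr do rewrite etaE.
  have := subrX1 ((2^-1 : R) `^ theta) l; move=> /(congr1 -%R); rewrite opprB => h.
  rewrite -[leRHS]mul1r ler_pdivlMr ?subr_gt0//.
  have -> : (\sum_(i < l) ((2^-1) `^ theta) ^+ i) * (1 - (2^-1) `^ theta) = 1 - ((2^-1) `^ theta) ^+ l :> R.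
    by rewrite h; ring.
  by rewrite gerBl exprn_ge0// ltW.
have Sb l : `|S l| <= chainC * v.
  rewrite (le_trans (S_bound l))// /chainC; have -> : C3 / (1 - 2^-1 `^ theta) * v = v * C3 * (1 - 2^-1 `^ theta)^-1 by ring.
  by rewrite ler_wpM2l ?mulr_ge0 ?(ltW v0).
rewrite -/(Phi us _); apply/ler_addgt0Pr => ep ep0.
set K := B' * (C1 * `|B| `^ lam * (wtC n e M + wtC n e M)).
have B'0 : 0 <= B' by exact: le_trans (normr_ge0 _) (HB' point).
have K0 : 0 <= K by rewrite !mulr_ge0 ?addr_ge0 ?wtC_ge0 ?powR_ge0.
have [N [N1 _]] := pow_small kappa01 ep0 K0.
have := S_limit N; rewrite -/K => h.
have -> : Ex P (fun w => H w * Phi us w) = S N + (Ex P (fun w => H w * Phi us w) - S N) by ring.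
rewrite (le_trans (ler_normD _ _))// lerD// (le_trans h)// (le_trans _ N1)//.
rewrite ler_wpM2l//; apply: ler_powRl; [exact: ltW|exact: ltW|].
rewrite lef_pV2 ?posrE ?exprn_gt0// -natrX ler_nat ltn_expl//.
Qed.

End fixed.
End chaining.

(** * Decoupling a future group of coordinates from the past *)

Section decoupling.
Context {d : measure_display} {T : measurableType d} {R : realType}.
Variables (P : probability T R) (J : eqType).
Variables (xi : nat * J -> T -> R) (Fam : \bar int -> \bar int -> set (set T)).
Variables (kappa p q delta e M : R) (vr wr : nat -> R).
Implicit Types (k : nat * J) (ks tH tU tW : seq (nat * J)) (lam C : R).

Definition xs ks : seq (T -> R) := [seq xi k | k <- ks].

(** Abstracts the conditional expectations on windows of radius r. The exponent q/delta says that
    the delta-th power of the L^q error is at most w_r, matching beta_q(r)^delta. *)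
Definition approximants r (xr : nat * J -> T -> R) := forall k,
  [/\ mom P e M (xr k), Gmeasurable (Fam (k.1%:Z - r%:Z)%:E (k.1%:Z + r%:Z)%:E) (xr k),
      itg P (fun w => `|xi k w - xr k w| `^ q) &
      Ex P (fun w => `|xi k w - xr k w| `^ q) <= wr r `^ (q / delta)].

Definition mixing_process :=
  [/\ forall a b, sigma_algebra setT (Fam a b) /\ Fam a b `<=` measurable,
      forall a b a' b', (a' <= a)%E -> (b <= b')%E -> Fam a b `<=` Fam a' b',
      forall k, mom P e M (xi k),
      forall r, (0 < r)%N -> 0 < wr r /\ exists xr, approximants r xr &
      forall r, (0 < r)%N -> 0 < vr r /\
        forall t : nat, mixing_bound P (Fam -oo%E (t%:Z)%:E) (Fam ((t + r)%N%:Z)%:E +oo%E) p q (vr r)].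

Hypothesis mproc : mixing_process.
Hypothesis kappa01 : 0 < kappa <= 1.
Hypothesis p1 : 1 < p.
Hypothesis q1 : 1 <= q.
Hypothesis d0 : 0 < delta.
Hypothesis dk : delta <= kappa.
Hypothesis dq : delta < q.
Hypothesis e0 : 0 < e.
Hypothesis M0 : 0 <= M.

Let p' := p / (p - 1).
Let p0 : 0 < p. Proof. exact: lt_trans p1. Qed.
Let p'1 : 1 <= p'.
Proof. by rewrite ler_pdivlMr ?subr_gt0// mul1r gerBl. Qed.
Let q0 : 0 < q. Proof. exact: lt_le_trans q1. Qed.
Let dq1 : 0 < 1 - delta / q. Proof. by rewrite subr_gt0 ltr_pdivrMr// mul1r. Qed.

Lemma moms_map (y : nat * J -> T -> R) ks : (forall k, mom P e M (y k)) ->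
  moms P e M [seq y k | k <- ks].
Proof.
move=> my; elim: ks => [|k ks IH] [|i] //=; exact: mom_cst0.
Qed.

Lemma select_catl (x z : seq R) n : size x = n -> select (iota 0 n) (x ++ z) = x.
Proof.
move=> sx; apply: (@eq_from_nth _ 0); rewrite size_select size_iota// => i ni.
by rewrite (nth_map 0%N) ?size_iota// nth_iota// add0n nth_cat sx ni.
Qed.

Lemma select_catr (x z : seq R) n n' : size x = n -> size z = n' ->
  select (iota n n') (x ++ z) = z.
Proof.
move=> sx sz; apply: (@eq_from_nth _ 0); rewrite size_select size_iota// => i ni.
by rewrite (nth_map 0%N) ?size_iota// nth_iota// nth_cat sx -ltn_subRL subnn addKn.
Qed.

Definition prodC (n1 n2 : nat) lam C : R :=
  2 * (C * n1.+1%:R `^ (lam + 1)) * (C * n2.+1%:R `^ (lam + 1)).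

Lemma prodC_ge0 n1 n2 lam C : 0 <= C -> 0 <= prodC n1 n2 lam C.
Proof.
by move=> C0; do 2!(apply: mulr_ge0; last by apply: mulr_ge0 => //; exact: powR_ge0).
Qed.

Lemma hol_cat_product n1 n2 lam C f g : 0 <= lam -> hol kappa n1 lam C f -> hol kappa n2 lam C g ->
  hol kappa (n1 + n2) (lam + lam) (prodC n1 n2 lam C)
    (fun x => f (select (iota 0 n1) x) * g (select (iota n1 n2) x)).
Proof.
by move=> l0 hf hg; apply: holM => //; apply: hol_select; rewrite ?size_iota.
Qed.

(** Constants for passing to approximants in the joint expectation, in the decoupled one, and inside
    the averaged function; [CA] is the moment bound handed to the chaining. *)
Let C1 nH nU nW lam C := prodC nH (nU + nW) lam C * approxC (nH + (nU + nW)) e M q.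
Let C2 nH nU nW lam C :=
  prodC nH nU lam (C + C * wtC nW e M) * approxC (nH + nU) e M q.
Let C3 nH nU nW lam C := C * (C * approxC nW e M q) * wtC (nH + nU) e M.
Let CA nH nU C := C `^ p' * wtC (nH + nU) e M.

Definition decouplingC nH nU nW lam C :=
  C1 nH nU nW lam C + C2 nH nU nW lam C + C3 nH nU nW lam C +
  chainC kappa p lam C e M (CA nH nU C) nU nW.

Lemma approxC_ge0 n : 0 <= approxC n e M q.
Proof. by rewrite addr_ge0// mulr_ge0 ?powR_ge0 ?addr_ge0 ?wtC_ge0. Qed.

Section fixed_gap.
Variables (nH nU nW : nat) (lam C : R) (r T0 : nat) (tH tU tW : seq (nat * J)).
Variables (h f : seq R -> R).
Hypothesis lam0 : 0 <= lam.
Hypothesis lamp : (2 * lam + 4) * p' <= e.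
Hypothesis lamd : (2 * lam + 4) / (1 - delta / q) <= e.
Hypothesis lamq : lam * q <= e.
Hypothesis nUp : nU%:R / p < kappa.
Hypothesis r0 : (0 < r)%N.
Hypothesis stH : size tH = nH.
Hypothesis stU : size tU = nU.
Hypothesis stW : size tW = nW.
Hypothesis tHT : {in tH, forall k, k.1 <= T0}%N.
Hypothesis tUT : {in tU, forall k, k.1 <= T0}%N.
Hypothesis tWT : {in tW, forall k, T0 + 3 * r <= k.1}%N.
Hypothesis hh : hol kappa nH lam C h.
Hypothesis hf : hol kappa (nU + nW) lam C f.
Variable xr : nat * J -> T -> R.
Hypothesis xrP : approximants r xr.

Let ys ks := [seq xr k | k <- ks].
Let mxi k : mom P e M (xi k). Proof. by case: mproc. Qed.
Let mxr k : mom P e M (xr k). Proof. by case: (xrP k). Qed.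
Let wr0 : 0 < wr r. Proof. by case: mproc => _ _ _ /(_ r r0)[]. Qed.
Let vr0 : 0 < vr r. Proof. by case: mproc => _ _ _ _ /(_ r r0)[]. Qed.
Let Fsig a b : sigma_algebra setT (Fam a b). Proof. by case: mproc => /(_ a b)[]. Qed.
Let Fmeas a b : Fam a b `<=` measurable. Proof. by case: mproc => /(_ a b)[]. Qed.
Let mono_Fam a b a' b' : (a' <= a)%E -> (b <= b')%E -> Fam a b `<=` Fam a' b'.
Proof. by case: mproc => _ + _ _ _; apply. Qed.
Let C0 : 0 <= C. Proof. exact: hol_constant_ge0 hh. Qed.
Let mxs ks : moms P e M (xs ks). Proof. exact: moms_map. Qed.
Let mys ks : moms P e M (ys ks). Proof. exact: moms_map. Qed.

Let lam2e : 2 * lam + 4 <= e.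
Proof. by apply: le_trans lamp; rewrite ler_peMr// addr_ge0// mulr_ge0. Qed.
Let lame : lam <= e. Proof. by apply: le_trans lam2e; move: lam0; lra. Qed.
Let lamd2 : (lam + lam + 1) / (1 - delta / q) <= e.
Proof. by apply: le_trans lamd; rewrite ler_pM2r ?invr_gt0//; lra. Qed.
Let lamd1 : (lam + 1) / (1 - delta / q) <= e.
Proof. by apply: le_trans lamd; rewrite ler_pM2r ?invr_gt0//; move: lam0; lra. Qed.
Let dist_xs_ys ks i : (i < size ks)%N ->
  let D := fun x => `|nth (fun=> 0) (xs ks) i x - nth (fun=> 0) (ys ks) i x| `^ q in
  itg P D /\ Ex P D <= wr r `^ (q / delta).
Proof.
move=> isk; case: ks isk => [//|k0 ks] isk.
by rewrite /xs /ys; rewrite !(nth_map k0)//; case: (xrP (nth k0 (k0 :: ks) i)).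
Qed.

Let sxs ks : size (xs ks) = size ks. Proof. exact: size_map. Qed.
Let sys ks : size (ys ks) = size ks. Proof. exact: size_map. Qed.
Let xs_cat ks ks' : xs (ks ++ ks') = xs ks ++ xs ks'. Proof. exact: map_cat. Qed.
Let ys_cat ks ks' : ys (ks ++ ks') = ys ks ++ ys ks'. Proof. exact: map_cat. Qed.

Let approx n l C' (g : seq R -> R) ks : 0 <= l -> (l + 1) / (1 - delta / q) <= e ->
  size ks = n -> hol kappa n l C' g ->
  `|Ex P (fun x => g (ev (xs ks) x)) - Ex P (fun x => g (ev (ys ks) x))| <= C' * approxC n e M q * wr r.
Proof.
move=> l0 le sk hg.
apply: (hol_approx kappa01 l0 hg (etrans (sxs _) sk) (etrans (sys _) sk) e0 (mxs ks) (mys ks) d0 dk dq wr0 le).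
by move=> i isk; apply: dist_xs_ys; rewrite sk.
Qed.

Let fbar x := Ex P (fun w => f (x ++ ev (xs tW) w)).
Let fbarr x := Ex P (fun w => f (x ++ ev (ys tW) w)).

Let hfbar : hol kappa nU lam (C * wtC nW e M) fbar.
Proof. exact: (hol_mean kappa01 lam0 hf (etrans (sxs _) stW) e0 lame (mxs tW)). Qed.
Let hfbarr : hol kappa nU lam (C * wtC nW e M) fbarr.
Proof. exact: (hol_mean kappa01 lam0 hf (etrans (sys _) stW) e0 lame (mys tW)). Qed.

Let ev_xs ks ks' w : ev (xs (ks ++ ks')) w = ev (xs ks) w ++ ev (xs ks') w.
Proof. by rewrite xs_cat ev_cat. Qed.
Let ev_ys ks ks' w : ev (ys (ks ++ ks')) w = ev (ys ks) w ++ ev (ys ks') w.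
Proof. by rewrite ys_cat ev_cat. Qed.

Let step1 :
  `|Ex P (fun w => h (ev (xs tH) w) * f (ev (xs tU) w ++ ev (xs tW) w)) -
    Ex P (fun w => h (ev (ys tH) w) * f (ev (ys tU) w ++ ev (ys tW) w))| <= C1 nH nU nW lam C * wr r.
Proof.
have hp := hol_cat_product lam0 hh hf.
have stUW : size (tH ++ (tU ++ tW)) = (nH + (nU + nW))%N by rewrite !size_cat stH stU stW.
have := approx (addr_ge0 lam0 lam0) lamd2 stUW hp.
under eq_fun do rewrite ev_xs ev_xs select_catl ?size_ev ?sxs// select_catr ?size_cat ?size_ev ?sxs ?stU ?stW//.
by under [X in _ - Ex P X]eq_fun do rewrite ev_ys ev_ys select_catl ?size_ev ?sys// select_catr ?size_cat ?size_ev ?sys ?stU ?stW//.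
Qed.

Let step2 :
  `|Ex P (fun w => h (ev (xs tH) w) * fbar (ev (xs tU) w)) -
    Ex P (fun w => h (ev (ys tH) w) * fbar (ev (ys tU) w))| <= C2 nH nU nW lam C * wr r.
Proof.
have hf' : hol kappa nU lam (C + C * wtC nW e M) fbar.
  by apply: hol_weaken hfbar => //; rewrite lerDr.
have hh' : hol kappa nH lam (C + C * wtC nW e M) h.
  by apply: hol_weaken hh => //; rewrite lerDl mulr_ge0// wtC_ge0.
have hp := hol_cat_product lam0 hh' hf'.
have stHU : size (tH ++ tU) = (nH + nU)%N by rewrite !size_cat stH stU.
have := approx (addr_ge0 lam0 lam0) lamd2 stHU hp.
under eq_fun do rewrite ev_xs select_catl ?size_ev ?sxs// select_catr ?size_ev ?sxs//.
by under [X in _ - Ex P X]eq_fun do rewrite ev_ys select_catl ?size_ev ?sys// select_catr ?size_ev ?sys//.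
Qed.

Let hys ks n (g : seq R -> R) l C' : 0 <= l -> l <= e -> size ks = n -> hol kappa n l C' g ->
  itg P (fun w => g (ev (ys ks) w)).
Proof.
by move=> l0 lle sk hg; apply: (hol_itg kappa01 l0 hg (etrans (sys _) sk) e0 lle (mys ks)).1.
Qed.

Let lam2e' : lam + lam <= e. Proof. by apply: le_trans lam2e; lra. Qed.

Let itg_prod (g : seq R -> R) C' : hol kappa nU lam C' g ->
  itg P (fun w => h (ev (ys tH) w) * g (ev (ys tU) w)).
Proof.
move=> hg; have C'0 := hol_constant_ge0 hg.
have hg' : hol kappa nU lam (C + C') g by apply: hol_weaken hg => //; rewrite lerDr.
have hh' : hol kappa nH lam (C + C') h by apply: hol_weaken hh => //; rewrite lerDl.
have hp := hol_cat_product lam0 hh' hg'.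
have stHU : size (tH ++ tU) = (nH + nU)%N by rewrite !size_cat stH stU.
have := hys (addr_ge0 lam0 lam0) lam2e' stHU hp.
by under [X in itg P X]eq_fun do rewrite ev_ys select_catl ?size_ev ?sys// select_catr ?size_ev ?sys//.
Qed.

Let step3 :
  `|Ex P (fun w => h (ev (ys tH) w) * fbar (ev (ys tU) w)) -
    Ex P (fun w => h (ev (ys tH) w) * fbarr (ev (ys tU) w))| <= C3 nH nU nW lam C * wr r.
Proof.
have i1 := itg_prod hfbar; have i2 := itg_prod hfbarr.
rewrite -ExB//.
have [wi wE] := wt_moment e0 (mys (tH ++ tU)) lam2e'.
rewrite sys size_cat stH stU in wE.
pose K := C * (C * approxC nW e M q) * wr r.
have K0 : 0 <= K by rewrite !mulr_ge0 ?approxC_ge0// ltW.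
apply: le_trans (norm_Ex_le (g := fun w => K * wt (ev (ys (tH ++ tU)) w) `^ (lam + lam)) (itgB i1 i2) (itgZ _ wi) _) _.
  move=> w; rewrite -mulrBr normrM.
  have sH : size (ev (ys tH) w) = nH by rewrite size_ev sys.
  have sU : size (ev (ys tU) w) = nU by rewrite size_ev sys.
  have hb := hh.2 _ sH.
  have fb : `|fbar (ev (ys tU) w) - fbarr (ev (ys tU) w)| <=
      C * wt (ev (ys tU) w) `^ lam * approxC nW e M q * wr r.
    exact: (approx lam0 lamd1 stW (hol_section lam0 sU hf)).
  rewrite (le_trans (ler_pM _ _ hb fb))// ev_ys.
  set a := ev (ys tH) w; set b := ev (ys tU) w.
  rewrite (powRD_gt0 lam lam (wt_gt0 _)) /K.
  have -> : C * wt a `^ lam * (C * wt b `^ lam * approxC nW e M q * wr r) =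
     C * (C * approxC nW e M q) * wr r * (wt a `^ lam * wt b `^ lam) by ring.
  rewrite ler_wpM2l//; apply: ler_pM; rewrite ?powR_ge0//; apply: ler_powRl; rewrite ?wt_catl ?wt_catr//.
    exact: ltW (wt_gt0 _).
  exact: ltW (wt_gt0 _).
rewrite ExZ// (le_trans (ler_wpM2l K0 wE))// /K /C3 le_eqVlt; apply/orP; left; apply/eqP; ring.
Qed.

(** The gap 3r is spent in thirds: the windows of the approximants take r on either side, and the
    mixing coefficient at distance r covers the rest. *)
Let Gs := Fam -oo%E ((T0 + r)%N%:Z)%:E.
Let Hs := Fam ((T0 + r + r)%N%:Z)%:E +oo%E.

Let Gys t i : {in t, forall k, k.1 <= T0}%N -> Gmeasurable Gs (nth (fun=> 0) (ys t) i).
Proof.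
move=> tT; have [it|it] := ltnP i (size t); last first.
  by rewrite nth_default ?sys//; apply/(GmeasurableP (Fsig _ _)).
case: t tT it => [//|k0 t] tT it; rewrite (nth_map k0)//.
set k := nth _ _ _; have kt : k \in k0 :: t by exact: mem_nth.
have [_ G _ _] := xrP k.
have a1 : (-oo <= (k.1%:Z - r%:Z)%:E)%E by exact: leNye.
have a2 : ((k.1%:Z + r%:Z)%:E <= ((T0 + r)%N%:Z)%:E)%E.
  by rewrite lee_fin -PoszD lez_nat leq_add2r; exact: tT.
by move=> B mB; exact (mono_Fam a1 a2 (G B mB)).
Qed.

Let Hys i : Gmeasurable Hs (nth (fun=> 0) (ys tW) i).
Proof.
have [it|it] := ltnP i (size tW); last first.
  by rewrite nth_default ?sys//; apply/(GmeasurableP (Fsig _ _)).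
case: tW tWT it => [//|k0 t] tT it; rewrite (nth_map k0)//.
set k := nth _ _ _; have kt : k \in k0 :: t by exact: mem_nth.
have [_ G _ _] := xrP k.
have a1 : (((T0 + r + r)%N%:Z)%:E <= (k.1%:Z - r%:Z)%:E)%E.
  rewrite lee_fin lerBrDr -PoszD lez_nat (leq_trans _ (tT k kt))//.
  by rewrite -!addnA leq_add2l mulSn mul2n -addnn.
have a2 : ((k.1%:Z + r%:Z)%:E <= +oo)%E by exact: leey.
by move=> B mB; exact (mono_Fam a1 a2 (G B mB)).
Qed.

Let Gcomp t n (g : seq R -> R) l C' : {in t, forall k, k.1 <= T0}%N -> size t = n -> 0 <= l ->
  hol kappa n l C' g -> Gmeasurable Gs (fun w => g (ev (ys t) w)).
Proof.
move=> tT st l0 hg; apply/(GmeasurableP (Fsig _ _)).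
apply: (@holder_measurable _ (g_sigma_algebraType Gs) R kappa n l C' g (ys t) kappa01 l0 hg).
  by rewrite sys.
by move=> i; apply/(GmeasurableP (Fsig _ _)); exact: Gys.
Qed.

Let Phi w := f (ev (ys tU) w ++ ev (ys tW) w) - fbarr (ev (ys tU) w).

Let itg_hf : itg P (fun w => h (ev (ys tH) w) * f (ev (ys tU) w ++ ev (ys tW) w)).
Proof.
have hp := hol_cat_product lam0 hh hf.
have stUW : size (tH ++ (tU ++ tW)) = (nH + (nU + nW))%N by rewrite !size_cat stH stU stW.
have := hys (addr_ge0 lam0 lam0) lam2e' stUW hp.
by under [X in itg P X]eq_fun do rewrite ev_ys ev_ys select_catl ?size_ev ?sys// select_catr ?size_cat ?size_ev ?sys ?stU ?stW//.
Qed.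

Let itg_hPhi : itg P (fun w => h (ev (ys tH) w) * Phi w).
Proof.
have := itgB itg_hf (itg_prod hfbarr); rewrite /Phi.
by under [X in itg P X -> _]eq_fun do rewrite -mulrBr.
Qed.

Let A := CA nH nU C.

(** Produces the bounded, compactly supported factor that [chain_path] asks for. The bound does not
    depend on B, so [step4] removes the truncation by dominated convergence. *)
Let cut (B : nat) w : R := \1_[set w | `|h (ev (ys tH) w)| <= B%:R /\ wt (ev (ys tU) w) <= B%:R] w.

Let cut_le1 B w : 0 <= cut B w <= 1.
Proof. by rewrite /cut indicE; case: (_ \in _); rewrite ?lexx ?ler01. Qed.

Let Gcut B : Gmeasurable Gs (cut B).
Proof.
apply/(GmeasurableP (Fsig _ _)); apply: measurable_indic.
have m1 : measurable_fun setT ((fun w => h (ev (ys tH) w)) : g_sigma_algebraType Gs -> R).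
  by apply/(GmeasurableP (Fsig _ _)); exact: (Gcomp tHT stH lam0 hh).
have m2 : measurable_fun setT ((fun w => wt (ev (ys tU) w)) : g_sigma_algebraType Gs -> R).
  apply: (@mseq_wt _ (g_sigma_algebraType Gs) R) => i; apply/(GmeasurableP (Fsig _ _)); exact: Gys.
apply: measurableI.
  rewrite -[X in measurable X]setTI; apply: (@measurable_fun_le _ (g_sigma_algebraType Gs) R setT) => //.
  by apply: (measurableT_comp _ m1).
by rewrite -[X in measurable X]setTI; apply: (@measurable_fun_le _ (g_sigma_algebraType Gs) R setT).
Qed.

Let moment_cut B (g := fun w => (`|h (ev (ys tH) w) * cut B w| * wt (ev (ys tU) w) `^ (lam + 2)) `^ p') :
  itg P g /\ Ex P g <= A.
Proof.
have lam2p : (2 * lam + 2) * p' <= e.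
  by apply: le_trans lamp; rewrite ler_pM2r ?(lt_le_trans ltr01 p'1)//; lra.
have [wi wE] := wt_moment e0 (mys (tH ++ tU)) lam2p.
rewrite sys size_cat stH stU in wE.
have p'0 : 0 <= p' by exact: le_trans p'1.
have bd w : g w <= C `^ p' * wt (ev (ys (tH ++ tU)) w) `^ ((2 * lam + 2) * p').
  rewrite powRrM -(powRM p' C0 (powR_ge0 _ _)) /g; apply: ler_powRl => //.
    by rewrite mulr_ge0 ?powR_ge0.
  have sH : size (ev (ys tH) w) = nH by rewrite size_ev sys.
  have /andP[c0 c1] := cut_le1 B w.
  rewrite normrM (ger0_norm c0) ev_ys.
  set a := ev (ys tH) w in sH *; set b := ev (ys tU) w.
  have -> : 2 * lam + 2 = lam + (lam + 2) by ring.
  rewrite (powRD_gt0 lam (lam + 2) (wt_gt0 (a ++ b))) mulrA.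
  apply: ler_pM; [by rewrite mulr_ge0|exact: powR_ge0| |].
    apply: (@le_trans _ _ `|h a|); first by rewrite ler_piMr.
    rewrite (le_trans (hh.2 _ sH))// ler_wpM2l//; apply: ler_powRl; rewrite ?wt_catl//.
    exact: ltW (wt_gt0 _).
  apply: ler_powRl; rewrite ?wt_catr//; first exact: addr_ge0.
  exact: ltW (wt_gt0 _).
have mh : measurable_fun setT (fun w => h (ev (ys tH) w)).
  exact: (Gmeasurable_measurable (@Fmeas _ _) (Gcomp tHT stH lam0 hh)).
have mc : measurable_fun setT (cut B) by exact: (Gmeasurable_measurable (@Fmeas _ _) (Gcut B)).
have gi : itg P g.
  apply: itg_dominated (itgZ _ wi) _; last by move=> w; rewrite ger0_norm ?powR_ge0.
  apply: (measurableT_comp (measurable_powR p')); apply: measurable_funM.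
    by apply: measurableT_comp => //; exact: measurable_funM.
  by apply: mseq_wt_powR => i; exact: (Gmeasurable_measurable (@Fmeas _ _) (Gys i tUT)).
split => //; rewrite (le_trans (le_Ex gi (itgZ _ wi) bd))// ExZ//.
by rewrite ler_wpM2l ?powR_ge0.
Qed.

Let step4_cut B : `|Ex P (fun w => h (ev (ys tH) w) * cut B w * Phi w)| <=
  chainC kappa p lam C e M A nU nW * vr r.
Proof.
have mix : mixing_bound P Gs Hs p q (vr r).
  by case: mproc => _ _ _ _ /(_ r r0)[_ /(_ (T0 + r)%N)].
have h1 : Gmeasurable Gs (fun w => h (ev (ys tH) w) * cut B w).
  exact: (GmeasurableM (Fsig _ _) (Gcomp tHT stH lam0 hh) (Gcut B)).
have h2 w : `|h (ev (ys tH) w) * cut B w| <= B%:R.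
  rewrite /cut indicE normrM; case: (boolP (_ \in _)) => [|_].
    by rewrite inE /= normr1 mulr1 => -[].
  by rewrite normr0 mulr0.
have h3 w : h (ev (ys tH) w) * cut B w != 0 -> wt (ev (ys tU) w) <= B%:R.
  rewrite /cut indicE; case: (boolP (_ \in _)) => [|_].
    by rewrite inE /= => -[].
  by rewrite mulr0 eqxx.
exact: (@chain_path _ _ _ P kappa p q lam C e M A nU nW kappa01 p1 q1 lam0 e0 lamq nUp Gs Hs
  (vr r) (Fsig _ _) (@Fmeas _ _) (Fsig _ _) (@Fmeas _ _) vr0 mix f (ys tU) (ys tW)
  (fun w => h (ev (ys tH) w) * cut B w) B%:R B%:R hf (etrans (sys _) stU) (etrans (sys _) stW)
  (fun i => Gys i tUT) Hys (mys tW) h1 h2 h3 (moment_cut B)).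
Qed.

Let step4 : `|Ex P (fun w => h (ev (ys tH) w) * Phi w)| <=
  chainC kappa p lam C e M A nU nW * vr r.
Proof.
have [||||_ cv] := @dominated_cvg_Ex _ _ _ P (fun B w => h (ev (ys tH) w) * cut B w * Phi w)
   (fun w => h (ev (ys tH) w) * Phi w) (fun w => `|h (ev (ys tH) w) * Phi w|).
- move=> B; have -> : (fun w => h (ev (ys tH) w) * cut B w * Phi w) =
      (fun w => cut B w * (h (ev (ys tH) w) * Phi w)) by apply/funext => w; ring.
  apply: measurable_funM; last exact: itg_measurable itg_hPhi.
  exact: (Gmeasurable_measurable (@Fmeas _ _) (Gcut B)).
- exact: itg_norm.
- move=> B w; have /andP[c0 c1] := cut_le1 B w.
  by rewrite mulrAC normrM (ger0_norm c0) ler_piMr.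
- move=> w; apply: cvg_near_cst.
  exists (maxn (Num.bound `|h (ev (ys tH) w)|) (Num.bound (wt (ev (ys tU) w)))) => // B /=.
  rewrite geq_max => /andP[b1 b2]; rewrite /cut indicE mem_set ?mulr1//=; split.
    by rewrite (le_trans (ltW (archi_boundP _)))// ler_nat.
  by rewrite (le_trans (ltW (archi_boundP _))) ?ler_nat// ltW// wt_gt0.
have cv' : (fun B => `|Ex P (fun w => h (ev (ys tH) w) * cut B w * Phi w)|) @ \oo -->
    `|Ex P (fun w => h (ev (ys tH) w) * Phi w)| by exact: cvg_norm.
rewrite -(cvg_lim _ cv')//.
by apply: limr_le; [exact: cvgP cv'|exact: nearW].
Qed.

Lemma decoupling_fixed :
  `|Ex P (fun w => h (ev (xs tH) w) *
     (f (ev (xs tU) w ++ ev (xs tW) w) - Ex P (fun w' => f (ev (xs tU) w ++ ev (xs tW) w'))))| <=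
  decouplingC nH nU nW lam C * (vr r + wr r).
Proof.
have hp := hol_cat_product lam0 hh hf.
have hf' : hol kappa nU lam (C + C * wtC nW e M) fbar.
  by apply: hol_weaken hfbar => //; rewrite lerDr.
have hh' : hol kappa nH lam (C + C * wtC nW e M) h.
  by apply: hol_weaken hh => //; rewrite lerDl mulr_ge0// wtC_ge0.
have hp' := hol_cat_product lam0 hh' hf'.
have stUW : size (tH ++ (tU ++ tW)) = (nH + (nU + nW))%N by rewrite !size_cat stH stU stW.
have stHU : size (tH ++ tU) = (nH + nU)%N by rewrite !size_cat stH stU.
have l2 : 0 <= lam + lam by exact: addr_ge0.
have i1 : itg P (fun w => h (ev (xs tH) w) * f (ev (xs tU) w ++ ev (xs tW) w)).
  have := (hol_itg kappa01 l2 hp (etrans (sxs _) stUW) e0 lam2e' (mxs _)).1.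
  by under [X in itg P X]eq_fun do rewrite ev_xs ev_xs select_catl ?size_ev ?sxs// select_catr ?size_cat ?size_ev ?sxs ?stU ?stW//.
have i2 : itg P (fun w => h (ev (xs tH) w) * fbar (ev (xs tU) w)).
  have := (hol_itg kappa01 l2 hp' (etrans (sxs _) stHU) e0 lam2e' (mxs _)).1.
  by under [X in itg P X]eq_fun do rewrite ev_xs select_catl ?size_ev ?sxs// select_catr ?size_ev ?sxs//.
under eq_fun do rewrite mulrBr.
rewrite (ExB i1 i2) -/fbar.
have e4 : Ex P (fun w => h (ev (ys tH) w) * Phi w) =
    Ex P (fun w => h (ev (ys tH) w) * f (ev (ys tU) w ++ ev (ys tW) w)) -
    Ex P (fun w => h (ev (ys tH) w) * fbarr (ev (ys tU) w)).
  rewrite -(ExB itg_hf (itg_prod hfbarr)); congr Ex.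
  by apply/funext => w; rewrite mulrBr.
move: step1 step2 step3 step4; rewrite e4.
set a1 := Ex P _; set b1 := Ex P _; set a2 := Ex P _; set b2 := Ex P _; set c := Ex P _.
move=> s1 s2 s3 s4.
(* Here a stands for the true variables, b for the approximants, and c has approximants also inside
   the averaged function; b1 - c is the mixing term, the other differences are approximation
   errors. *)
have -> : a1 - a2 = (a1 - b1) - (a2 - b2) - (b2 - c) + (b1 - c) by ring.
have CW : 0 <= C * wtC nW e M by rewrite mulr_ge0 ?wtC_ge0.
have K1 : C1 nH nU nW lam C * wr r <= C1 nH nU nW lam C * (vr r + wr r).
  apply: ler_wpM2l; last by rewrite lerDr ltW.
  by apply: mulr_ge0; [exact: prodC_ge0|exact: approxC_ge0].
have K2 : C2 nH nU nW lam C * wr r <= C2 nH nU nW lam C * (vr r + wr r).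
  apply: ler_wpM2l; last by rewrite lerDr ltW.
  by apply: mulr_ge0; [apply: prodC_ge0; exact: addr_ge0|exact: approxC_ge0].
have K3 : C3 nH nU nW lam C * wr r <= C3 nH nU nW lam C * (vr r + wr r).
  apply: ler_wpM2l; last by rewrite lerDr ltW.
  apply: mulr_ge0; last exact: wtC_ge0.
  by do 2!apply: mulr_ge0 => //; exact: approxC_ge0.
have K4 : chainC kappa p lam C e M A nU nW * vr r <= chainC kappa p lam C e M A nU nW * (vr r + wr r).
  apply: ler_wpM2l; rewrite ?lerDl ?(ltW wr0)//.
  rewrite -(pmulr_lge0 _ vr0); exact: le_trans (normr_ge0 _) s4.
rewrite /decouplingC -/A !mulrDl.
apply: le_trans (ler_normD _ _) _; apply: lerD; last exact: le_trans s4 K4.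
apply: le_trans (ler_normB _ _) _; apply: lerD; last exact: le_trans s3 K3.
apply: le_trans (ler_normB _ _) _; apply: lerD; last exact: le_trans s2 K2.
exact: le_trans s1 K1.
Qed.

End fixed_gap.

(** Up to an error of order v_r + w_r, the late variables W may be replaced by an independent copy.
    The dimension condition bears on U alone, because chaining runs over U; h may depend on any
    number of past variables. *)
Theorem decoupling nH nU nW lam C r T0 tH tU tW (h f : seq R -> R) :
  0 <= lam -> (2 * lam + 4) * (p / (p - 1)) <= e -> (2 * lam + 4) / (1 - delta / q) <= e ->
  lam * q <= e -> nU%:R / p < kappa -> (0 < r)%N ->
  size tH = nH -> size tU = nU -> size tW = nW ->
  {in tH, forall k, k.1 <= T0}%N -> {in tU, forall k, k.1 <= T0}%N ->
  {in tW, forall k, T0 + 3 * r <= k.1}%N ->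
  hol kappa nH lam C h -> hol kappa (nU + nW) lam C f ->
  `|Ex P (fun w => h (ev (xs tH) w) *
     (f (ev (xs tU) w ++ ev (xs tW) w) - Ex P (fun w' => f (ev (xs tU) w ++ ev (xs tW) w'))))| <=
  decouplingC nH nU nW lam C * (vr r + wr r).
Proof.
move=> l0 lp ld lq Up r0 sH sU sW HT UT WT hh hf.
have [_ _ _ /(_ r r0)[_ [xr xrP]] _] := mproc.
exact: (decoupling_fixed l0 lp ld lq Up r0 sH sU sW HT UT WT hh hf xrP).
Qed.

End decoupling.

(** * Double sums of covariances up to o(N) *)

Section sublinear_sums.
Variable R : realType.
Implicit Types (a f g : nat -> R) (psi chi : nat -> R) (b : nat -> nat -> R).

Definition summable a := exists S : R, forall N, \sum_(n < N) a n <= S.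

Lemma summable_tail a : (forall n, 0 <= a n) -> summable a -> forall eps : R, 0 < eps ->
  exists H, forall N, \sum_(n < N | (H <= n)%N) a n <= eps.
Proof.
move=> a0 [S aS] eps eps0.
pose s (N : nat) : R := \sum_(n < N) a n.
have nd : nondecreasing_seq s.
  apply/nondecreasing_seqP => N; rewrite /s big_ord_recr/= lerDl; exact: a0.
have bs : has_ubound (range s) by exists S => _ [N _ <-]; exact: aS.
have cv := nondecreasing_cvgn nd bs; set l := sup _ in cv.
have sl N : s N <= l by apply: ub_le_sup => //; exists N.
move/cvgrPdist_le : cv => /(_ _ eps0)[H _ HP]; exists H => N.
have := HP H (leqnn H); rewrite /= ger0_norm ?subr_ge0// => hH.
have [NH|HN] := leqP N H.
  rewrite big1 ?(ltW eps0)// => i Hi; have := ltn_ord i; lia.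
rewrite (_ : \sum_(n < N | (H <= n)%N) a n = s N - s H).
  by rewrite (le_trans _ hH)// lerB.
rewrite /s [X in _ = X - _](bigID (fun n : 'I_N => (H <= n)%N))/= -[LHS]addr0 -addrA; congr (_ + _).
apply/esym/eqP; rewrite subr_eq0; apply/eqP; apply/esym.
rewrite -(big_mkord xpredT a) -(big_mkord (fun n => ~~ (H <= n)%N) a).
rewrite (big_cat_nat (n := H) (leq0n _) (ltnW HN))//=.
rewrite [X in _ = _ + X]big_nat_cond [X in _ = _ + X]big1 ?addr0; last by move=> i; lia.
by rewrite [LHS]big_nat_cond [RHS]big_nat_cond; apply: eq_bigl => i; lia.
Qed.

Lemma summable_vanishes a : (forall n, 0 <= a n) -> summable a -> a @ \oo --> 0.
Proof.
move=> a0 sa; apply/cvgrPdist_le => e e0; have [H HP] := summable_tail a0 sa e0.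
exists H => // n /= Hn; rewrite sub0r normrN ger0_norm//.
have := HP n.+1; rewrite big_mkcond big_ord_recr/= Hn; apply: le_trans.
by rewrite lerDr sumr_ge0// => i _; case: ifP.
Qed.

Lemma summable_le a a' : (forall n, a n <= a' n) -> summable a' -> summable a.
Proof. by move=> aa [S h]; exists S => N; apply: le_trans (h N); apply: ler_sum. Qed.

Lemma summableD a a' : summable a -> summable a' -> summable (fun n => a n + a' n).
Proof. by move=> [S h] [S' h']; exists (S + S') => N; rewrite big_split lerD. Qed.

Lemma summableZ (c : R) a : 0 <= c -> summable a -> summable (fun n => c * a n).
Proof. by move=> c0 [S h]; exists (c * S) => N; rewrite -mulr_sumr ler_wpM2l. Qed.

Lemma summable_cvg a : summable (fun n => `|a n|) -> exists l : R, (fun N => \sum_(n < N) a n) @ \oo --> l.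
Proof.
move=> [S h].
pose p (n : nat) : R := `|a n| + a n; pose s (f : nat -> R) (N : nat) : R := \sum_(n < N) f n.
have cv f : (forall n, 0 <= f n) -> (exists B, forall N, s f N <= B) -> exists l : R, s f @ \oo --> l.
  move=> f0 [B fB]; exists (sup (range (s f))); apply: nondecreasing_cvgn.
    by apply/nondecreasing_seqP => N; rewrite /s big_ord_recr/= lerDl.
  by exists B => _ [N _ <-].
have [l1 c1] : exists l : R, s (fun n => `|a n|) @ \oo --> l by apply: cv => //; exists S.
have [l2 c2] : exists l : R, s p @ \oo --> l.
  apply: cv => [n|]; first by rewrite /p; have := ler_norm (- a n); rewrite normrN; lra.
  exists (S + S) => N; rewrite /s /p big_split lerD ?h//.
  by apply: le_trans (h N); apply: ler_sum => i _; exact: ler_norm.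
exists (l2 - l1); have -> : (fun N => \sum_(n < N) a n) = (fun N => s p N - s (fun n => `|a n|) N).
  by apply/funext => N; rewrite /s /p big_split/=; ring.
exact: cvgB.
Qed.

(** The relation f(N) = o(N), written as an affine bound valid for all N so that sums and affine
    substitutions need no thresholds. *)
Definition sublinear f := forall eps : R, 0 < eps -> exists C : R, forall N : nat, `|f N| <= eps * N%:R + C.

Lemma sublinear_le f g : (forall N, `|f N| <= g N) -> sublinear g -> sublinear f.
Proof.
move=> fg sg e e0; have [C h] := sg _ e0; exists C => N.
by rewrite (le_trans (fg N))// (le_trans (ler_norm _)).
Qed.

Lemma sublinear_bounded f (C : R) : (forall N, `|f N| <= C) -> sublinear f.
Proof.
move=> fC e e0; exists C => N; by rewrite (le_trans (fC N))// lerDr mulr_ge0// ltW.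
Qed.

Lemma sublinearD f g : sublinear f -> sublinear g -> sublinear (fun N => f N + g N).
Proof.
move=> sf sg e e0; have e20 : 0 < e / 2 by rewrite divr_gt0.
have [C h] := sf _ e20; have [C' h'] := sg _ e20; exists (C + C') => N.
rewrite (le_trans (ler_normD _ _))//; have := h N; have := h' N.
set x := e / 2 * N%:R; have -> : e * N%:R = x + x by rewrite /x {1}[e]splitr mulrDl.
by lra.
Qed.

Lemma sublinearZ (c : R) f : sublinear f -> sublinear (fun N => c * f N).
Proof.
move=> sf e e0; have c0 : 0 < `|c| + 1 by rewrite ltr_wpDl.
have [C h] := sf _ (divr_gt0 e0 c0); exists ((`|c| + 1) * C) => N.
rewrite normrM (@le_trans _ _ ((`|c| + 1) * `|f N|))//; first by rewrite ler_wpM2r// lerDl.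
rewrite (le_trans (ler_wpM2l (ltW c0) (h N)))// mulrDr lerD2r mulrA.
by rewrite [(`|c| + 1) * _]mulrC divfK// gt_eqF.
Qed.

Lemma sublinear_sum (I : Type) (s : seq I) (f : I -> nat -> R) :
  (forall i, sublinear (f i)) -> sublinear (fun N => \sum_(i <- s) f i N).
Proof.
move=> sf; elim: s => [|i s IH].
  by apply: (@sublinear_bounded _ 0) => N; rewrite big_nil normr0.
have -> : (fun N => \sum_(j <- i :: s) f j N) = (fun N => f i N + \sum_(j <- s) f j N).
  by apply/funext => N; rewrite big_cons.
exact: sublinearD.
Qed.

Lemma sublinear_comp f (k c : nat) : sublinear f -> sublinear (fun N => f (k * N + c)%N).
Proof.
move=> sf e e0; have k0 : 0 < k%:R + 1 :> R by rewrite ltr_wpDl.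
have [C h] := sf _ (divr_gt0 e0 k0); exists (e / (k%:R + 1) * c%:R + C) => N.
rewrite (le_trans (h _))// addrA lerD2r natrD natrM mulrDr lerD2r.
rewrite mulrA ler_wpM2r//.
have -> : e / (k%:R + 1) * k%:R = e * (k%:R / (k%:R + 1)) by ring.
by rewrite ler_piMr ?(ltW e0)// ler_pdivrMr// mul1r lerDl.
Qed.

Lemma sublinear_cvg f (L : R) : sublinear (fun N => f N - N%:R * L) ->
  (fun N => f N / N%:R) @ \oo --> L.
Proof.
move=> sf; apply/cvgrPdist_le => e e0.
have e20 : 0 < e / 2 by rewrite divr_gt0.
have [C h] := sf _ e20.
have C0 : 0 <= C.
  by have := h 0%N; rewrite mulr0 add0r; apply: le_trans.
have KP := archi_boundP (divr_ge0 C0 (ltW e20)); move: (Num.bound _) KP => K KP.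
exists K.+1 => // N /= hN.
have N0 : 0 < N%:R :> R by rewrite ltr0n; lia.
have CN : C <= e / 2 * N%:R.
  by rewrite mulrC -ler_pdivrMr// (le_trans (ltW KP))// ler_nat ltnW.
have -> : L - f N / N%:R = - ((f N - N%:R * L) / N%:R) by field; rewrite gt_eqF.
rewrite normrN normrM [X in _ * X]gtr0_norm ?invr_gt0// ler_pdivrMr//.
by rewrite (le_trans (h N))// {2}[e]splitr mulrDl lerD2l.
Qed.

Lemma cvg_sublinear f (L : R) : (fun N => f N / N%:R) @ \oo --> L ->
  sublinear (fun N => f N - N%:R * L).
Proof.
move=> /cvgrPdist_le cv e e0; have [N0 _ h] := cv e e0.
exists (\sum_(N < N0.+1) `|f N - N%:R * L|) => N.
have S0 (n : nat) : 0 <= \sum_(i < n) `|f i - i%:R * L| by apply: sumr_ge0.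
have [NN|NN] := ltnP N N0.+1.
  rewrite (bigD1 (Ordinal NN))//= addrCA lerDl addr_ge0 ?mulr_ge0 ?(ltW e0)//.
  exact: sumr_ge0.
rewrite (@le_trans _ _ (e * N%:R)) ?lerDl//.
have N0' : 0 < N%:R :> R by rewrite ltr0n; lia.
have := h N (ltnW NN).
have -> : f N - N%:R * L = - ((L - f N / N%:R) * N%:R) by field; rewrite gt_eqF.
by rewrite normrN normrM (gtr0_norm N0') ler_pM2r.
Qed.

Lemma cesaro0 a : a @ \oo --> 0 -> sublinear (fun N => \sum_(n < N) a n).
Proof.
move=> /cvgrPdist_le cv e e0; have [N0 _ h] := cv e e0.
exists (\sum_(n < N0) `|a n|) => N.
rewrite (le_trans (ler_norm_sum _ _ _))//.
elim: N => [|N IH].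
  by rewrite big_ord0 mulr0 add0r sumr_ge0.
rewrite big_ord_recr/=; have [NN|NN] := leqP N0 N.
  rewrite -natr1 mulrDr mulr1 addrAC lerD//.
  by have := h N NN; rewrite sub0r normrN.
rewrite ler_wpDl ?mulr_ge0 ?(ltW e0)//.
rewrite -(big_ord_recr N (fun n => `|a n|)) /=.
rewrite -(big_mkord xpredT (fun n => `|a n|)) -(big_mkord xpredT (fun n => `|a n|)).
rewrite [leRHS](big_cat_nat (n := N.+1))//= lerDl.
by apply: sumr_ge0.
Qed.

Lemma periodic_average g (k : nat) : (0 < k)%N -> (forall n, g (n + k)%N = g n) ->
  exists L : R, sublinear (fun N => \sum_(n < N) g n - N%:R * L).
Proof.
move=> k0 gk; pose L := (\sum_(n < k) g n) / k%:R; exists L.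
pose D (N : nat) := \sum_(n < N) g n - N%:R * L.
have kn : k%:R != 0 :> R by rewrite pnatr_eq0; lia.
have DS N : D (N + k)%N = D N.
  rewrite /D; elim: N => [|N IH].
    rewrite add0n big_ord0 mul0r subr0 /L mulrC divfK// subrr//.
  rewrite addSn !big_ord_recr/= gk -!natr1 !mulrDl mul1r.
  by move: IH; set X := \sum_(i < N + k) _; set Y := \sum_(i < N) _; lra.
have Dm N : D N = D (N %% k)%N.
  rewrite {1}(divn_eq N k); elim: (N %/ k)%N => [|t IH]; first by rewrite mul0n.
  by rewrite mulSn -addnA addnC DS.
apply: (@sublinear_bounded _ (\sum_(n < k) `|D n|)) => N.
rewrite -/(D N) Dm (bigD1 (Ordinal (ltn_pmod N k0)))//= lerDl.
exact: sumr_ge0.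
Qed.

(** The sequence differs from a k-periodic one by a null sequence, and both have Cesàro means. *)
Lemma residue_average a (k : nat) : (0 < k)%N ->
  (forall r, exists l : R, (fun t => a (r + k * t)%N) @ \oo --> l) ->
  exists L : R, sublinear (fun N => \sum_(n < N) a n - N%:R * L).
Proof.
move=> k0 /choice[l lP].
pose g n := l (n %% k)%N.
have gk n : g (n + k)%N = g n by rewrite /g modnDr.
have [L LP] := periodic_average k0 gk; exists L.
have -> : (fun N => \sum_(n < N) a n - N%:R * L) =
   (fun N => \sum_(n < N) (a n - g n) + (\sum_(n < N) g n - N%:R * L)).
  by apply/funext => N; rewrite sumrB; ring.
apply: sublinearD => //; apply: (cesaro0 (a := fun n => a n - g n)).
apply/cvgrPdist_le => e e0.
have H r : exists t0, forall t, (t0 <= t)%N -> `|l r - a (r + k * t)%N| <= e.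
  by move/cvgrPdist_le : (lP r) => /(_ e e0)[t0 _ h]; exists t0.
have [t0 t0P] := choice H.
exists (k * (\max_(r < k) t0 r).+1)%N => // n /= hn; rewrite sub0r normrN distrC /g.
rewrite {2}(divn_eq n k) addnC mulnC; apply: t0P.
have := leq_bigmax (F := fun r : 'I_k => t0 r) (Ordinal (ltn_pmod n k0)).
move=> /leq_trans; apply; move: hn; set m := \max_(r < k) t0 r => hn.
by rewrite leq_divRL// mulnC (leq_trans _ hn)// leq_mul2l ltnW ?orbT.
Qed.

Definition ndist (n m : nat) : nat := (n - m + (m - n))%N.

Lemma ndistC n m : ndist n m = ndist m n.
Proof. by rewrite /ndist addnC. Qed.

(* Reindexing a sum along an injection into [H, +oo[. *)
Lemma sum_inj_tail (I : eqType) (s : seq I) (phi : I -> nat) chi (H : nat) (S : R) :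
  (forall h, 0 <= chi h) -> uniq s -> {in s &, injective phi} -> {in s, forall i, H <= phi i}%N ->
  (forall N, \sum_(h < N | (H <= h)%N) chi h <= S) -> \sum_(i <- s) chi (phi i) <= S.
Proof.
move=> c0 us inj Hphi hS; rewrite -(big_map phi xpredT chi).
have um : uniq (map phi s) by rewrite map_inj_in_uniq.
have [N NP] : exists N, {in map phi s, forall h, h < N}%N.
  by exists (\max_(h <- map phi s) h).+1 => h hs; rewrite ltnS; exact: leq_bigmax_seq.
apply: le_trans (hS N).
rewrite -(big_mkord (fun h => (H <= h)%N)) /index_iota subn0.
rewrite [leRHS](bigID (fun h => h \in map phi s))/= -[leLHS]addr0; apply: lerD; last first.
  by apply: sumr_ge0.
rewrite -[leRHS]big_filter le_eqVlt; apply/orP; left; apply/eqP; apply: perm_big.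
apply: uniq_perm; [exact: um|by rewrite filter_uniq ?iota_uniq|].
move=> h; rewrite mem_filter mem_iota add0n.
apply/idP/idP => [hs|/andP[/andP[_ ->]]//].
rewrite hs andbT /= NP// andbT.
by have /mapP[i si ->] := hs; exact: Hphi.
Qed.

(** For fixed n the distance |al n - be m| is injective in m on either side of the line, so a row
    picks each term of the tail at most twice. *)
Lemma sum_line_tail (al be n M H : nat) chi (S : R) : (0 < be)%N -> (forall h, 0 <= chi h) ->
  (forall N, \sum_(h < N | (H <= h)%N) chi h <= S) ->
  \sum_(m < M | (H <= ndist (al * n) (be * m))%N) chi (ndist (al * n) (be * m)) <= S + S.
Proof.
move=> be0 c0 hS.
rewrite -(big_mkord (fun m => (H <= ndist (al * n) (be * m))%N) (fun m => chi (ndist (al * n) (be * m)))).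
rewrite (bigID (fun m => (be * m <= al * n)%N))/=; apply: lerD.
  rewrite -big_filter; apply: (sum_inj_tail (H := H)) => //.
  - by rewrite filter_uniq ?iota_uniq.
  - move=> m m'; rewrite !mem_filter => /andP[/andP[_ h1] _] /andP[/andP[_ h2] _].
    rewrite /ndist => h; have : (be * m = be * m')%N by lia.
    by move=> /eqP; rewrite eqn_pmul2l// => /eqP.
  by move=> m; rewrite mem_filter => /andP[/andP[]].
rewrite -big_filter; apply: (sum_inj_tail (H := H)) => //.
- by rewrite filter_uniq ?iota_uniq.
- move=> m m'; rewrite !mem_filter => /andP[/andP[_ h1] _] /andP[/andP[_ h2] _].
  rewrite /ndist => h; have : (be * m = be * m')%N by lia.
  by move=> /eqP; rewrite eqn_pmul2l// => /eqP.
by move=> m; rewrite mem_filter => /andP[/andP[]].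
Qed.

Lemma cvg_approx a : (forall eps : R, 0 < eps -> exists2 a' : nat -> R,
    (exists l : R, a' @ \oo --> l) & exists N, forall n, (N <= n)%N -> `|a n - a' n| <= eps) ->
  exists l : R, a @ \oo --> l.
Proof.
move=> H.
suff : cvg (a @ \oo) by move=> c; exists (lim (a @ \oo)).
apply/cauchy_cvgP/cauchy_exP => e e0.
have e40 : 0 < e / 5 by rewrite divr_gt0.
have [a' [l /cvgrPdist_le/(_ _ e40)[N1 _ h1]] [N2 h2]] := H _ e40.
exists (a (maxn N1 N2)); exists (maxn N1 N2) => // m /= hm; set n := maxn N1 N2.
have : (maxn N1 N2 <= n)%N by [].
move: hm; rewrite !geq_max => /andP[m1 m2] /andP[n1 n2].
rewrite /ball /=.
have -> : a n - a m = (a n - a' n) - (a m - a' m) - (l - a' n) + (l - a' m) by ring.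
have := h1 n n1; have := h1 m m1; have := h2 n n2; have := h2 m m2.
set A := a n - _; set B := a m - _; set C := l - _; set D := l - _.
move=> hB hA hD hC.
have := ler_normD (A - B - C) D; have := ler_normB (A - B) C; have := ler_normB A B.
move: hA hB hC hD; move: (`|A|) (`|B|) (`|C|) (`|D|) (`|A - B|) (`|A - B - C|) (`|A - B - C + D|) => *.
have : e / 5 + e / 5 + e / 5 + e / 5 < e by lra.
by lra.
Qed.

Lemma cvg_shift a (J : nat) (l : R) : (fun t => a (t + J)%N) @ \oo --> l -> a @ \oo --> l.
Proof. by move=> h; rewrite -(cvg_shiftn J). Qed.

Lemma cvg_sum_ex (I : Type) (s : seq I) (f : I -> nat -> R) :
  (forall i, exists l : R, f i @ \oo --> l) -> exists l : R, (fun t => \sum_(i <- s) f i t) @ \oo --> l.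
Proof.
move=> cv; elim: s => [|i s [l lP]].
  by exists 0; under eq_fun do rewrite big_nil; exact: cvg_cst.
have [l' lP'] := cv i; exists (l' + l); under eq_fun do rewrite big_cons.
exact: cvgD.
Qed.

Section row.
Variables (psi chi : nat -> R) (b : nat -> nat -> R) (al be : nat).
Hypothesis psi0 : forall n, 0 <= psi n.
Hypothesis chi0 : forall n, 0 <= chi n.
Hypothesis spsi : summable (fun n => n.+1%:R * psi n).
Hypothesis schi : summable chi.
Hypothesis al0 : (0 < al)%N.
Hypothesis be0 : (0 < be)%N.
Hypothesis bd : forall n m, `|b n m| <= psi (maxn n m) + chi (ndist (al * n) (be * m)).
Hypothesis lines : forall n0 m0, exists l : R, (fun t => b (n0 + be * t) (m0 + al * t))%N @ \oo --> l.
Hypothesis bup : forall n m, (n < m)%N -> b n m = 0.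

(** Along n = n0 + be t, the band |al n - be m| < H is a window of fixed shape translated by al t,
    so its finitely many terms converge one by one. Outside the band a row contributes at most (n+1)
    psi(n) plus twice a tail of chi; the vanishing of b for m > n gives the row its n+1 terms and
    makes n the maximum. *)
Lemma row_sum_cvg n0 : exists l : R,
  (fun t => \sum_(m < (n0 + be * t).+1) b (n0 + be * t)%N m) @ \oo --> l.
Proof.
apply: cvg_approx => e e0; have e40 : 0 < e / 4 by rewrite divr_gt0.
have [H HP] := summable_tail chi0 schi e40.
(* Half-width of a window of 2J+1 columns centred at al (J + t), large enough to contain the band; t
   is shifted by J to keep the columns nonnegative. *)
pose J := (H + al * n0)%N.
pose near n m := (ndist (al * n) (be * m) < H)%N.
exists (fun t => \sum_(m < (n0 + be * t).+1 | near (n0 + be * t)%N m) b (n0 + be * t)%N m).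
  pose G t := \sum_(j <- iota 0 (2 * J).+1)
      (fun j : nat => if near (n0 + be * J)%N (al * J - J + j)%N then
         (fun t => b ((n0 + be * J) + be * t)%N ((al * J - J + j) + al * t)%N) else (fun=> 0)) j t.
  have step : exists l : R, G @ \oo --> l.
    apply: cvg_sum_ex => j; case: ifP => _; first exact: lines.
    by exists 0; exact: cvg_cst.
  suff GE t : \sum_(m < (n0 + be * (t + J)).+1 | near (n0 + be * (t + J))%N m) b (n0 + be * (t + J))%N m = G t.
    by have [l lP] := step; exists l; apply: (@cvg_shift _ J); under eq_fun do rewrite GE.
  have JJ : (J <= al * J)%N by rewrite leq_pmull.
  set n := (n0 + be * (t + J))%N.
  have nE : n = (n0 + be * J + be * t)%N by rewrite /n; lia.
  pose base := (al * J - J + al * t)%N.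
  pose N := maxn n.+1 (base + (2 * J).+1).
  have e1 : \sum_(m < n.+1 | near n m) b n m = \sum_(0 <= m < N | near n m) b n m.
    rewrite -(big_mkord (near n) (b n)) [RHS](big_cat_nat (n := n.+1)) ?leq_maxl//=.
    rewrite [X in _ = _ + X]big_nat_cond [X in _ = _ + X]big1 ?addr0// => m /andP[/andP[nm _] _].
    exact: bup.
  rewrite e1.
  have far m : near n m -> (base <= m < base + (2 * J).+1)%N.
    rewrite /near /ndist nE /base => h.
    have bJ : (J.+1 <= be * J.+1)%N by rewrite leq_pmull.
    have E1 : (al * (n0 + be * J + be * t) = al * n0 + be * (al * J + al * t))%N.
      by rewrite !mulnDr !mulnA [(al * be)%N]mulnC; lia.
    rewrite E1 in h.
    have u : (be * m < be * (al * J + al * t + J.+1))%N.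
      by rewrite mulnDr; move: h bJ; rewrite {1}/J; lia.
    have v : (be * (al * J + al * t) < be * (m + J.+1))%N.
      by rewrite [X in (_ < X)%N]mulnDr; move: h bJ; rewrite {1}/J; lia.
    by rewrite ltn_pmul2l// in u; rewrite ltn_pmul2l// in v; lia.
  rewrite (big_cat_nat (n := base)) ?leq_max ?leq_addr ?orbT//=.
  rewrite [X in X + _]big_nat_cond big1 ?add0r; last first.
    by move=> m /andP[/andP[_ mb] /far]; lia.
  rewrite (big_cat_nat (n := (base + (2 * J).+1)%N)) ?leq_addr ?leq_maxr//=.
  rewrite [X in _ + X]big_nat_cond [X in _ + X]big1 ?addr0; last first.
    by move=> m /andP[/andP[mb _] /far]; lia.
  rewrite -{1}[base]add0n big_addn addKn /index_iota subn0 big_mkcond /G; apply: eq_bigr => j _.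
  have -> : (j + base = al * J - J + j + al * t)%N by rewrite /base; lia.
  transitivity (if near (n0 + be * J)%N (al * J - J + j)%N then b n (al * J - J + j + al * t)%N else 0);
    last by rewrite nE; case: ifP.
  congr (if _ then _ else _); rewrite /near; congr (_ < _)%N; rewrite /ndist nE !mulnDr.
  have -> : (al * (be * t) = be * (al * t))%N by rewrite mulnCA.
  lia.
have vn := summable_vanishes (fun n => mulr_ge0 (ler0n R n.+1) (psi0 n)) spsi.
move/cvgrPdist_le : vn => /(_ _ e40)[N0 _ vn]; exists N0 => t tN.
set n := (n0 + be * t)%N.
have nN : (N0 <= n)%N by rewrite (leq_trans tN)// /n (leq_trans _ (leq_addl _ _))// leq_pmull.
rewrite [X in `|X - _|](bigID (fun m : 'I_n.+1 => near n m))/=.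
have xyx (x y : R) : x + y - x = y by ring.
rewrite xyx.
rewrite (le_trans (ler_norm_sum _ _ _))//.
rewrite (@le_trans _ _ (\sum_(m < n.+1 | ~~ near n m) (psi n + chi (ndist (al * n) (be * m)))))//.
  apply: ler_sum => m _; rewrite (le_trans (bd _ _))// lerD2r.
  by rewrite (maxn_idPl _)// -ltnS.
rewrite big_split/= (@le_trans _ _ (e / 4 + (e / 4 + e / 4)))//; last by lra.
apply: lerD.
  have := vn n nN; rewrite /= sub0r normrN ger0_norm ?mulr_ge0// => h.
  apply: le_trans h; rewrite big_mkcond (@le_trans _ _ (\sum_(m < n.+1) psi n))//.
    by apply: ler_sum => m _; case: ifP.
  by rewrite sumr_const card_ord mulr_natl.
rewrite [leLHS](eq_bigl (fun m : 'I_n.+1 => (H <= ndist (al * n) (be * m))%N)).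
  exact: sum_line_tail.
by move=> m; rewrite /near -leqNgt.
Qed.

End row.

Lemma cvg_eventually_if (c : nat -> bool) (f : nat -> R) (c0 : bool) :
  (exists N, forall t, (N <= t)%N -> c t = c0) -> (exists l : R, f @ \oo --> l) ->
  exists l : R, (fun t => if c t then f t else 0) @ \oo --> l.
Proof.
move=> [N cN] [l fl]; exists (if c0 then l else 0).
have : (fun t => if c0 then f t else 0) @ \oo --> (if c0 then l else 0).
  by case: {cN} c0 => //; exact: cvg_cst.
apply: cvg_trans; apply: near_eq_cvg; exists N => // t /= Nt.
by rewrite cN.
Qed.

Lemma leq_lines_eventually (al be m0 n0 : nat) :
  exists c0 N, forall t, (N <= t)%N -> (m0 + al * t <= n0 + be * t)%N = c0.
Proof.
have [h|h|h] := ltngtP al be.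
- exists true, m0 => t mt; have : (al.+1 * t <= be * t)%N by rewrite leq_mul2r h orbT.
  by rewrite mulSn; lia.
- exists false, n0.+1 => t mt; have : (be.+1 * t <= al * t)%N by rewrite leq_mul2r h orbT.
  by rewrite mulSn; lia.
by exists (m0 <= n0)%N, 0%N => t _; rewrite h leq_add2r.
Qed.

Definition dominated b psi chi (al be : nat) :=
  forall n m, `|b n m| <= psi (maxn n m) + chi (ndist (al * n) (be * m)).

(** The triangles m <= n and m > n are summed separately, the second after transposition; in each,
    row sums converge along residue classes modulo [be], respectively [al], and [residue_average]
    applies. *)
Lemma double_sum_density b psi chi (al be : nat) :
  (forall n, 0 <= psi n) -> (forall n, 0 <= chi n) ->
  summable (fun n => n.+1%:R * psi n) -> summable chi -> (0 < al)%N -> (0 < be)%N ->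
  dominated b psi chi al be ->
  (forall n0 m0, exists l : R, (fun t => b (n0 + be * t) (m0 + al * t))%N @ \oo --> l) ->
  exists L : R, sublinear (fun N => \sum_(n < N) \sum_(m < N) b n m - N%:R * L).
Proof.
move=> psi0 chi0 spsi schi al0 be0 bd lines.
pose b1 n m := if (m <= n)%N then b n m else 0.
pose b2 n m := if (m.+1 <= n)%N then b m n else 0.
have bd1 : dominated b1 psi chi al be.
  by move=> n m; rewrite /b1; case: ifP => _; [exact: bd|rewrite normr0 addr_ge0].
have bd2 : dominated b2 psi chi be al.
  move=> n m; rewrite /b2; case: ifP => _; last by rewrite normr0 addr_ge0.
  by rewrite maxnC ndistC; exact: bd.
have l1 n0 m0 : exists l : R, (fun t => b1 (n0 + be * t) (m0 + al * t))%N @ \oo --> l.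
  have [c0 h] := leq_lines_eventually al be m0 n0.
  by apply: cvg_eventually_if (lines n0 m0); exact: h.
have l2 n0 m0 : exists l : R, (fun t => b2 (n0 + al * t) (m0 + be * t))%N @ \oo --> l.
  have [c0 h] := leq_lines_eventually be al m0.+1 n0.
  by apply: cvg_eventually_if (lines m0 n0); exact: h.
have up1 n m : (n < m)%N -> b1 n m = 0 by rewrite /b1 ltnNge => /negbTE ->.
have up2 n m : (n < m)%N -> b2 n m = 0 by move=> nm; rewrite /b2 ltnNge (ltnW nm).
have [L1 r1] := residue_average (a := fun n => \sum_(m < n.+1) b1 n m) be0 (row_sum_cvg psi0 chi0 spsi schi al0 be0 bd1 l1 up1).
have [L2 r2] := residue_average (a := fun n => \sum_(m < n.+1) b2 n m) al0 (row_sum_cvg psi0 chi0 spsi schi be0 al0 bd2 l2 up2).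
exists (L1 + L2).
have -> : (fun N => \sum_(n < N) \sum_(m < N) b n m - N%:R * (L1 + L2)) =
  (fun N => (\sum_(n < N) \sum_(m < n.+1) b1 n m - N%:R * L1) +
            (\sum_(n < N) \sum_(m < n.+1) b2 n m - N%:R * L2)).
  apply/funext => N; suff -> : \sum_(n < N) \sum_(m < N) b n m =
    \sum_(n < N) \sum_(m < n.+1) b1 n m + \sum_(n < N) \sum_(m < n.+1) b2 n m by ring.
  elim: N => [|N IH]; first by rewrite !big_ord0 addr0.
  rewrite [in RHS]big_ord_recr /= [X in _ = _ + X]big_ord_recr /= addrACA -IH.
  rewrite big_ord_recr/=; under eq_bigr do rewrite big_ord_recr/=.
  rewrite big_split/= -addrA; congr (_ + _); rewrite addrC; congr (_ + _).
    by apply: eq_bigr => m _; rewrite /b1 -ltnS ltn_ord.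
  rewrite big_ord_recr/= {2}/b2 ltnn addr0; apply: eq_bigr => m _.
  by rewrite /b2 ltn_ord.
exact: sublinearD.
Qed.

Lemma sum_max_le psi (K N : nat) : (forall n, 0 <= psi n) ->
  \sum_(n < N) \sum_(m < N) psi (maxn (K + n) (K + m)) <= 2 * \sum_(j < K + N) j.+1%:R * psi j.
Proof.
move=> psi0; elim: N => [|N IH].
  by rewrite big_ord0 mulr_ge0// sumr_ge0// => i _; rewrite mulr_ge0.
rewrite addnS [in leRHS]big_ord_recr/= mulrDr.
rewrite big_ord_recr/=; under eq_bigr do rewrite big_ord_recr/=.
rewrite big_split/= -addrA lerD//.
have e1 : \sum_(n < N) psi (maxn (K + n) (K + N)) = N%:R * psi (K + N)%N.
  under eq_bigr => n _ do rewrite (maxn_idPr _) ?leq_add2l ?(ltnW (ltn_ord n))//.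
  by rewrite sumr_const card_ord mulr_natl.
have e2 : \sum_(n < N.+1) psi (maxn (K + N) (K + n)) = N.+1%:R * psi (K + N)%N.
  under eq_bigr => n _ do rewrite (maxn_idPl _) ?leq_add2l -1?ltnS//.
  by rewrite sumr_const card_ord mulr_natl.
rewrite e1 e2 -mulrDl mulrA ler_wpM2r// -natrM -natrD ler_nat; lia.
Qed.

Lemma sum_interval_le (F : nat -> R) (n N H : nat) : (forall m, 0 <= F m) ->
  \sum_(m < N | (n <= m < n + H)%N) F m <= \sum_(h < H) F (n + h)%N.
Proof.
move=> F0; elim: H => [|H IH].
  rewrite big_ord0 big1// => m; lia.
rewrite big_ord_recr/= (bigID (fun m : 'I_N => (m < n + H)%N))/=; apply: lerD.
  by apply: le_trans IH; rewrite le_eqVlt; apply/orP; left; apply/eqP; apply: eq_bigl => m; lia.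
have [nN|nN] := ltnP (n + H) N.
  rewrite (bigD1 (Ordinal nN))/=; last by lia.
  by rewrite big1 ?addr0// => m /andP[h /eqP ne]; case: ne; apply/val_inj => /=; lia.
by rewrite big1// => m h; have := ltn_ord m; lia.
Qed.

Lemma ndistE n m : ndist n m = if (n <= m)%N then (m - n)%N else (n - m)%N.
Proof. by rewrite /ndist; case: ifP => h; lia. Qed.

(** Within a fixed distance H of the diagonal, d converges to c lag by lag and Cesàro averaging
    gives o(N). Farther away both d and c are controlled by a tail of chi, up to the bounded
    contribution of psi. *)
Lemma window_sum (d : nat -> nat -> R) (c : nat -> R) psi chi (A : nat) :
  (forall n, 0 <= psi n) -> (forall n, 0 <= chi n) ->
  summable (fun n => n.+1%:R * psi n) -> summable chi ->
  dominated d psi chi 1 1 ->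
  (forall h, (fun n => d n (n + h)%N) @ \oo --> c h) ->
  (forall h, (fun n => d (n + h)%N n) @ \oo --> c h) ->
  sublinear (fun N => \sum_(n < N) \sum_(m < N)
     (d (A * N + n)%N (A * N + m)%N - c (ndist n m))).
Proof.
move=> psi0 chi0 spsi schi bd c1 c2.
have psiv : psi @ \oo --> 0.
  have := summable_vanishes (fun n => mulr_ge0 (ler0n R n.+1) (psi0 n)) spsi.
  move=> /cvgrPdist_le h; apply/cvgrPdist_le => e e0; have [N _ hN] := h e e0.
  exists N => // n Nn; have := hN n Nn; rewrite /= !sub0r !normrN !ger0_norm ?mulr_ge0//.
  by apply: le_trans; rewrite ler_peMl// ler1n.
have cchi h : `|c h| <= chi h.
  have cv : (fun n => `|d n (n + h)%N|) @ \oo --> `|c h| by apply: cvg_norm; exact: c1.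
  have cv' : (fun n => psi (n + h)%N + chi h) @ \oo --> 0 + chi h.
    by apply: cvgD; [rewrite (cvg_shiftn h)|exact: cvg_cst].
  rewrite -[chi h]add0r -(cvg_lim _ cv)// -(cvg_lim _ cv')//; apply: ler_lim.
  - exact: cvgP cv.
  - exact: cvgP cv'.
  apply: nearW => n; apply: le_trans (bd _ _) _; rewrite (maxn_idPr _) ?leq_addr//.
  by rewrite /ndist !mul1n addKn (_ : (n - (n + h) = 0)%N)//; lia.
have [S hS] := spsi.
pose g N n m := `|d (A * N + n)%N (A * N + m)%N - c (ndist n m)|.
apply: (@sublinear_le _ (fun N => \sum_(n < N) \sum_(m < N) g N n m)).
  move=> N; apply: le_trans (ler_norm_sum _ _ _) _; apply: ler_sum => n _.
  exact: ler_norm_sum.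
move=> e e0; have e80 : 0 < e / 8 by rewrite divr_gt0.
have [H HP] := summable_tail chi0 schi e80.
pose eH (k : nat) : R := \sum_(h < H) (`|d k (k + h)%N - c h| + `|d (k + h)%N k - c h|).
have eH0 : eH @ \oo --> 0.
  have -> : (0 : R) = \sum_(h < H) (0 + 0) by rewrite big1// => i _; rewrite addr0.
  have z (f : nat -> R) l : f @ \oo --> l -> (fun k => `|f k - l|) @ \oo --> 0.
    move=> fl; have : (fun k => `|f k - l|) @ \oo --> `|l - l| by apply: cvg_norm; apply: cvgB => //; exact: cvg_cst.
    by rewrite subrr normr0.
  rewrite /eH; elim: (H) => [|H' IH].
    by under eq_fun do rewrite big_ord0; rewrite big_ord0; exact: cvg_cst.
  under eq_fun do rewrite big_ord_recr/=; rewrite big_ord_recr/=.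
  by apply: cvgD => //; apply: cvgD; apply: z; [exact: c1|exact: c2].
have e20 : 0 < e / 2 by rewrite divr_gt0.
have sl : sublinear (fun N => \sum_(k < A.+1 * N + 0) eH k).
  exact: (@sublinear_comp (fun N => \sum_(k < N) eH k) A.+1 0 (cesaro0 eH0)).
have [C hC] := sl _ e20.
exists (C + (S + S)) => N.
have eHge k : 0 <= eH k by apply: sumr_ge0 => i _; exact: addr_ge0.
rewrite ger0_norm; last by apply: sumr_ge0 => n _; apply: sumr_ge0 => m _; exact: normr_ge0.
have near_le : \sum_(n < N) \sum_(m < N | (ndist n m < H)%N) g N n m <= \sum_(n < N) eH (A * N + n)%N.
  have -> : \sum_(n < N) \sum_(m < N | (ndist n m < H)%N) g N n m =
     \sum_(n < N) \sum_(m < N | (n <= m < n + H)%N) g N n m +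
     \sum_(n < N) \sum_(m < N | (n < m < n + H)%N) g N m n.
    rewrite [X in _ = _ + X](exchange_big_dep xpredT)//= -big_split/=; apply: eq_bigr => n _.
    rewrite (bigID (fun m : 'I_N => (n <= m)%N))/=; congr (_ + _); apply: eq_bigl => m.
      by rewrite /ndist; lia.
    by rewrite /ndist; lia.
  rewrite -big_split/=; apply: ler_sum => n _; rewrite /eH big_split/=; apply: lerD.
    apply: le_trans (sum_interval_le n N H (F := fun m => g N n m) (fun m => normr_ge0 _)) _.
    apply: ler_sum => h _; rewrite /g addnA ndistE leq_addr addKn//.
  rewrite (@le_trans _ _ (\sum_(m < N | (n <= m < n + H)%N) g N m n))//.
    by rewrite big_mkcond [leRHS]big_mkcond; apply: ler_sum => m _; case: ifP => h1; case: ifP => h2; rewrite ?lexx ?normr_ge0//; exfalso; move: h1 h2; lia.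
  apply: le_trans (sum_interval_le n N H (F := fun m => g N m n) (fun m => normr_ge0 _)) _.
  by apply: ler_sum => h _; rewrite /g addnA ndistC ndistE leq_addr addKn.
have far_le : \sum_(n < N) \sum_(m < N | ~~ (ndist n m < H)%N) g N n m <= e / 2 * N%:R + (S + S).
  rewrite (@le_trans _ _ (\sum_(n < N) \sum_(m < N | ~~ (ndist n m < H)%N)
      (psi (maxn (A * N + n) (A * N + m)) + 2 * chi (ndist n m))))//.
    apply: ler_sum => n _; apply: ler_sum => m _; rewrite /g.
    apply: le_trans (ler_normB _ _) _; have := bd (A * N + n)%N (A * N + m)%N; have := cchi (ndist n m).
    rewrite !mul1n /ndist !subnDl; lra.
  under eq_bigr do rewrite big_split/=; rewrite big_split/= addrC; apply: lerD.
    have t n : \sum_(m < N | ~~ (ndist n m < H)%N) 2 * chi (ndist n m) <= e / 2.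
      have := sum_line_tail 1 n N (ltn0Sn 0) chi0 HP; rewrite -mulr_sumr mul1n.
      under eq_bigl do rewrite mul1n leqNgt; under eq_bigr do rewrite mul1n.
      by move: (\sum_(m < N | _) _) => X; lra.
    rewrite (@le_trans _ _ (\sum_(n < N) (e / 2)))//; first by apply: ler_sum => n _; exact: t.
    by rewrite sumr_const card_ord mulr_natr.
  apply: (@le_trans _ _ (\sum_(n < N) \sum_(m < N) psi (maxn (A * N + n) (A * N + m)))).
    by apply: ler_sum => n _; rewrite big_mkcond; apply: ler_sum => m _; case: ifP.
  apply: le_trans (sum_max_le (A * N) N psi0) _.
  by have := hS (A * N + N)%N; move: (\sum_(j < _) _) => X; lra.
have -> : \sum_(n < N) \sum_(m < N) g N n m = \sum_(n < N) \sum_(m < N | (ndist n m < H)%N) g N n m +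
   \sum_(n < N) \sum_(m < N | ~~ (ndist n m < H)%N) g N n m.
  by rewrite -big_split/=; apply: eq_bigr => n _; exact: (bigID (fun m : 'I_N => (ndist n m < H)%N)).
have hN := hC N.
have eHN : \sum_(n < N) eH (A * N + n)%N <= \sum_(k < A.+1 * N + 0) eH k.
  rewrite addn0 mulSn addnC big_split_ord/= lerDr; exact: sumr_ge0.
rewrite ger0_norm in hN; last exact: sumr_ge0.
have := le_trans near_le (le_trans eHN hN).
have -> : e * N%:R = e / 2 * N%:R + e / 2 * N%:R by rewrite -mulrDl -splitr.
move: far_le; move: (\sum_(n < N) _) (\sum_(n < N) _) (e / 2 * N%:R) => X Y Z; lra.
Qed.

(** For indices in [AN, AN+N) with A above both slopes, distinct slopes force |al n - be m| >= N.
    Each of the N rows is then at most a tail of chi beyond N, which is O(1/N) thanks to the weight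
    n in the summability condition. *)
Lemma offdiagonal_window b psi chi (al be A : nat) :
  (forall n, 0 <= psi n) -> (forall n, 0 <= chi n) ->
  summable (fun n => n.+1%:R * psi n) -> summable (fun n => n.+1%:R * chi n) ->
  (0 < al)%N -> (0 < be)%N -> al != be -> (al < A)%N -> (be < A)%N ->
  dominated b psi chi al be ->
  exists C : R, forall N, `|\sum_(n < N) \sum_(m < N) b (A * N + n)%N (A * N + m)%N| <= C.
Proof.
move=> psi0 chi0 [S hS] [S' hS'] al0 be0 albe alA beA bd.
exists (S + S + (S' + S')) => -[|N].
  have := hS 0%N; have := hS' 0%N; rewrite !big_ord0 normr0; lra.
set M := N.+1; have M0 : 0 < M%:R :> R by rewrite ltr0n.
(* Markov's inequality for the weighted sum. *)
have tail K : \sum_(h < K | (M <= h)%N) chi h <= S' / M%:R.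
  rewrite ler_pdivlMr// mulr_suml; apply: le_trans (hS' K); rewrite [leLHS]big_mkcond.
  apply: ler_sum => h _; case: ifP => Mh; last exact: mulr_ge0.
  by rewrite mulrC ler_wpM2r// ler_nat ltnW.
apply: le_trans (ler_norm_sum _ _ _) _.
rewrite (@le_trans _ _ (\sum_(n < M) \sum_(m < M) (psi (maxn (A * M + n) (A * M + m)) +
    chi (ndist (al * (A * M + n)) (be * (A * M + m))))))//.
  apply: ler_sum => n _; apply: le_trans (ler_norm_sum _ _ _) _; apply: ler_sum => m _; exact: bd.
under eq_bigr do rewrite big_split/=; rewrite big_split/=; apply: lerD.
  apply: le_trans (sum_max_le (A * M) M psi0) _.
  by have := hS (A * M + M)%N; move: (\sum_(j < _) _) => X; lra.
have -> : S' + S' = \sum_(n < M) (S' / M%:R + S' / M%:R).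
  have h : (S' / M%:R) *+ M = S' by rewrite -(mulr_natr (S' / M%:R)) divfK// gt_eqF.
  by rewrite sumr_const card_ord mulrnDl h.
apply: ler_sum => n _.
apply: le_trans (sum_line_tail al (A * M + n) (A * M + M) be0 chi0 tail).
have F0 j : 0 <= chi (ndist (al * (A * M + n)) (be * j)) by [].
rewrite [leRHS]big_mkcond [leRHS]big_split_ord/= ler_wpDl//.
  by apply: sumr_ge0 => j _ /=; case: ifP.
apply: ler_sum => m _.
suff -> : (M <= ndist (al * (A * M + n)) (be * (A * M + m)))%N by [].
have key (a c : nat) (i j : 'I_M) : (a < c)%N -> (a < A)%N ->
    (M <= c * (A * M + i) - a * (A * M + j))%N.
  move=> ac aA; have jM := ltn_ord j.
  have h1 : (a * (A * M + j) <= a * (A * M) + a * M)%N.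
    by rewrite mulnDr leq_add2l leq_mul2l (ltnW jM) orbT.
  have h2 : (a * (A * M) + A * M <= c * (A * M + i))%N.
    by rewrite -mulSnr; apply: leq_mul => //; exact: leq_addr.
  have h3 : (a * M + M <= A * M)%N by rewrite -mulSnr leq_mul2r aA orbT.
  lia.
rewrite /ndist; have [h|h|h] := ltngtP al be.
- by have := key _ _ m n h alA; lia.
- by have := key _ _ n m h beA; lia.
by rewrite h eqxx in albe.
Qed.

(** The increment of the double sum at n is c_0 + 2(c_1 + ... + c_n), which tends to s2. Its errors
    are tails of the series, and their sum is controlled by the sum of h |c_h|, so even the
    correction beyond N s2 has a limit. *)
Lemma stationary_double_sum (c : nat -> R) : summable (fun h => h%:R * `|c h|) ->
  exists s2 beta : R,
    (fun N => \sum_(n < N) \sum_(m < N) c (ndist n m) - N%:R * s2) @ \oo --> beta.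
Proof.
move=> [S hS].
pose B (N : nat) := \sum_(n < N) \sum_(m < N) c (ndist n m).
pose sg (n : nat) := c 0%N + 2 * \sum_(h < n) c h.+1.
have BS N : B N.+1 = B N + sg N.
  rewrite /B big_ord_recr/=; under eq_bigr do rewrite big_ord_recr/=.
  rewrite big_split/= -addrA; congr (_ + _).
  rewrite big_ord_recr/=; have -> : ndist N N = 0%N by rewrite /ndist subnn.
  have e1 : \sum_(i < N) c (ndist i N) = \sum_(h < N) c h.+1.
    rewrite (reindex_inj rev_ord_inj)/=; apply: eq_bigr => i _; congr c.
    by rewrite /ndist; have := ltn_ord i; lia.
  have e2 : \sum_(i < N) c (ndist N i) = \sum_(h < N) c h.+1.
    by rewrite -e1; apply: eq_bigr => i _; rewrite ndistC.
  by rewrite e1 e2 /sg; ring.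
have [s hs] : exists s : R, (fun n => \sum_(h < n) c h.+1) @ \oo --> s.
  apply: (summable_cvg (a := fun h => c h.+1)); exists S => N; apply: le_trans (hS N.+1).
  rewrite big_ord_recl/= mul0r add0r; apply: ler_sum => i _.
  by rewrite ler_peMl// ler1n.
pose s2 := c 0%N + 2 * s.
have sgs : sg @ \oo --> s2.
  by apply: cvgD; [exact: cvg_cst|apply: cvgM => //; exact: cvg_cst].
have bK N K : (N <= K)%N -> \sum_(n < N) `|sg n - sg K| <= 2 * S.
  move=> NK.
  rewrite (@le_trans _ _ (\sum_(n < N) 2 * \sum_(h < K | (n <= h)%N) `|c h.+1|))//.
    apply: ler_sum => n _; rewrite /sg.
    have nK : (n <= K)%N by have := ltn_ord n; lia.
    rewrite -(big_mkord xpredT (fun h => c h.+1)) -(big_mkord xpredT (fun h => c h.+1)).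
    rewrite [X in _ - (_ + 2 * X)](big_cat_nat (n := n))//=.
    set X := \sum_(0 <= i < n) _; set Y := \sum_(n <= i < K) _.
    have -> : c 0%N + 2 * X - (c 0%N + 2 * (X + Y)) = - (2 * Y) by ring.
    rewrite normrN normrM ger0_norm// ler_wpM2l// (le_trans (ler_norm_sum _ _ _))//.
    rewrite -(big_mkord (fun h => (n <= h)%N) (fun h => `|c h.+1|)).
    rewrite [leRHS](big_cat_nat (n := n))//= ler_wpDl ?sumr_ge0//.
    rewrite le_eqVlt; apply/orP; left; apply/eqP.
    by rewrite big_nat_cond [RHS]big_nat_cond; apply: eq_bigl => i; lia.
  rewrite -mulr_sumr ler_wpM2l// (exchange_big_dep xpredT)//=.
  apply: le_trans (hS K.+1); rewrite big_ord_recl/= mul0r add0r; apply: ler_sum => h _.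
  apply: le_trans (sum_interval_le 0 N h.+1 (F := fun=> `|c h.+1|) (fun m => normr_ge0 _)) _.
  by rewrite sumr_const card_ord mulr_natl.
have absS : summable (fun n => `|sg n - s2|).
  exists (2 * S) => N.
  have cv : (fun K => \sum_(n < N) `|sg n - sg K|) @ \oo --> \sum_(n < N) `|sg n - s2|.
    elim: {bK} N => [|N IH].
      by under eq_fun do rewrite big_ord0; rewrite big_ord0; exact: cvg_cst.
    under eq_fun do rewrite big_ord_recr/=; rewrite big_ord_recr/=.
    apply: cvgD => //; apply: cvg_norm; apply: cvgB => //; exact: cvg_cst.
  rewrite -(cvg_lim _ cv)//; apply: limr_le; first exact: cvgP cv.
  by exists N => // K /= NK; exact: bK.
have [beta hb] := summable_cvg (a := fun n => sg n - s2) absS.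
exists s2, beta; have -> : (fun N => \sum_(n < N) \sum_(m < N) c (ndist n m) - N%:R * s2) =
   (fun N => \sum_(n < N) (sg n - s2)) => //.
apply/funext => N; rewrite -/(B N); elim: N => [|N IH].
  by rewrite /B !big_ord0 mul0r subrr.
by rewrite big_ord_recr/= -IH BS -natr1; ring.
Qed.

End sublinear_sums.

(** * Square integrable variables *)

Section square_integrable.
Context {d : measure_display} {T : measurableType d} {R : realType}.
Variable P : probability T R.
Implicit Types f g : T -> R.

Definition l2 f := measurable_fun setT f /\ itg P (fun w => f w ^+ 2).

(** The free parameter t lets this pointwise bound do the work of the Cauchy-Schwarz inequality. *)
Lemma normM_le_sqr (x y t : R) : 0 < t -> `|x * y| <= x ^+ 2 / t + t * y ^+ 2.
Proof.
move=> t0; rewrite normrM -[x ^+ 2]real_normK ?num_real// -[y ^+ 2]real_normK ?num_real//.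
have a0 := normr_ge0 x; have b0 := normr_ge0 y; move: (`|x|) (`|y|) a0 b0 => a b a0 b0.
rewrite -(ler_pM2l t0); have -> : t * (a ^+ 2 / t + t * b ^+ 2) = a ^+ 2 + (t * b) ^+ 2.
  by field; rewrite gt_eqF.
by have := sqr_ge0 (a - t * b); nra.
Qed.

Lemma l2M f g : l2 f -> l2 g -> itg P (fun w => f w * g w).
Proof.
move=> [mf fi] [mg gi]; apply: (@itg_dominated _ _ _ _ _ (fun w => f w ^+ 2 + g w ^+ 2)).
- exact: measurable_funM.
- exact: itgD.
by move=> w; have := normM_le_sqr (f w) (g w) ltr01; rewrite divr1 mul1r.
Qed.

Lemma l2_cst (c : R) : l2 (fun=> c).
Proof. by split => //; exact: itg_cst. Qed.

Lemma l2_itg f : l2 f -> itg P f.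
Proof. by move=> lf; have := l2M lf (l2_cst 1); under eq_fun do rewrite mulr1. Qed.

Lemma l2D f g : l2 f -> l2 g -> l2 (fun w => f w + g w).
Proof.
move=> lf lg; split; first by apply: measurable_funD; [exact: lf.1|exact: lg.1].
have -> : (fun w => (f w + g w) ^+ 2) = (fun w => f w ^+ 2 + (2 * (f w * g w) + g w ^+ 2)).
  by apply/funext => w; ring.
by apply: itgD; [exact: lf.2|apply: itgD; [apply: itgZ; exact: l2M|exact: lg.2]].
Qed.

Lemma l2Z (c : R) f : l2 f -> l2 (fun w => c * f w).
Proof.
move=> lf; split; first by apply: measurable_funM => //; exact: lf.1.
have -> : (fun w => (c * f w) ^+ 2) = (fun w => c ^+ 2 * f w ^+ 2) by apply/funext => w; ring.
by apply: itgZ; exact: lf.2.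
Qed.

Lemma l2B f g : l2 f -> l2 g -> l2 (fun w => f w - g w).
Proof.
move=> lf lg; have := l2D lf (l2Z (-1) lg).
by under eq_fun do rewrite mulN1r.
Qed.

Lemma l2_sum (I : Type) (s : seq I) (f : I -> T -> R) :
  (forall i, l2 (f i)) -> l2 (fun w => \sum_(i <- s) f i w).
Proof.
move=> lf; elim: s => [|i s IH].
  by under [X in l2 X]eq_fun do rewrite big_nil; exact: l2_cst.
by under [X in l2 X]eq_fun do rewrite big_cons; exact: l2D.
Qed.

Lemma sqr_sum_Ex (I J : Type) (s : seq I) (t : seq J) (f : I -> T -> R) (g : J -> T -> R) :
  (forall i, l2 (f i)) -> (forall j, l2 (g j)) ->
  Ex P (fun w => (\sum_(i <- s) f i w) * (\sum_(j <- t) g j w)) =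
  \sum_(i <- s) \sum_(j <- t) Ex P (fun w => f i w * g j w).
Proof.
move=> lf lg.
transitivity (Ex P (fun w => \sum_(i <- s) \sum_(j <- t) f i w * g j w)).
  by congr Ex; apply/funext => w; rewrite mulr_suml; apply: eq_bigr => i _; rewrite mulr_sumr.
rewrite Ex_sum => [|i]; last by apply: itg_sum => j; exact: l2M.
by apply: eq_bigr => i _; rewrite Ex_sum// => j; exact: l2M.
Qed.

Lemma expectation_Ex f : itg P f -> ('E_P[f])%E = (Ex P f)%:E.
Proof. by move=> fi; rewrite unlock integral_Ex. Qed.

Lemma covariance_Ex f g : l2 f -> l2 g ->
  covariance P f g = (Ex P (fun w => f w * g w) - Ex P f * Ex P g)%:E.
Proof.
move=> lf lg; rewrite unlock.
have fi := l2_itg lf; have gi := l2_itg lg.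
rewrite (expectation_Ex fi) (expectation_Ex gi) /=.
have -> : ((f \- cst (Ex P f)) * (g \- cst (Ex P g))) =
   (fun w => f w * g w - (Ex P g * f w + (Ex P f * g w - Ex P f * Ex P g))).
  by apply/funext => w; rewrite mulrfctE /=; ring.
have i1 := l2M lf lg; have i2 := itgZ (Ex P g) fi; have i3 := itgZ (Ex P f) gi.
have i4 : itg P (fun w => Ex P f * g w - Ex P f * Ex P g) by apply: itgB => //; exact: itg_cst.
rewrite expectation_Ex; last by apply: itgB => //; exact: itgD.
rewrite ExB//; last exact: itgD.
rewrite ExD// ExZ// ExB//; last exact: itg_cst.
by rewrite ExZ// Ex_cst; congr (_%:E); ring.
Qed.

Lemma Ex_sqrD_le f g : l2 f -> l2 g ->
  Ex P (fun w => (f w + g w) ^+ 2) <= 2 * Ex P (fun w => f w ^+ 2) + 2 * Ex P (fun w => g w ^+ 2).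
Proof.
move=> lf lg; rewrite -!ExZ ?lf.2 ?lg.2//; try exact: lf.2; try exact: lg.2.
rewrite -ExD; [|by apply: itgZ; exact: lf.2|by apply: itgZ; exact: lg.2].
apply: le_Ex; first exact: (l2D lf lg).2.
  by apply: itgD; apply: itgZ; [exact: lf.2|exact: lg.2].
by move=> w; have := sqr_ge0 (f w - g w); nra.
Qed.

(** Riesz-Fischer: a fast subsequence has increments D_j with E|D_j| <= 2 * 2^(-j), hence converges
    almost everywhere, and Fatou's lemma identifies the pointwise limit as the limit in L^2. *)
Lemma l2_complete (a : nat -> T -> R) : (forall n, l2 (a n)) ->
  (forall eps : R, 0 < eps -> exists N, forall n m, (N <= n)%N -> (N <= m)%N ->
     Ex P (fun w => (a n w - a m w) ^+ 2) <= eps) ->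
  exists2 b, l2 b & (fun n => Ex P (fun w => (a n w - b w) ^+ 2)) @ \oo --> 0.
Proof.
move=> la cau.
have e0 j : 0 < (4 ^+ j)^-1 :> R by rewrite invr_gt0 exprn_gt0.
have [N0 N0P] := choice (fun j => cau _ (e0 j)).
(* Accumulating the moduli makes the subsequence nondecreasing. *)
pose N (j : nat) := (\sum_(i < j.+1) N0 i)%N.
have Nmono i j : (i <= j)%N -> (N i <= N j)%N.
  move=> /subnKC <-; elim: (j - i)%N => [|k IH]; first by rewrite addn0.
  by rewrite addnS (leq_trans IH)// /N [leqRHS]big_ord_recr/= leq_addr.
have NN j : (N0 j <= N j)%N by rewrite /N big_ord_recr/= leq_addl.
have NP j n m : (N j <= n)%N -> (N j <= m)%N -> Ex P (fun w => (a n w - a m w) ^+ 2) <= (4 ^+ j)^-1.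
  by move=> jn jm; apply: N0P; [exact: leq_trans jn|exact: leq_trans jm].
pose D j w := a (N j.+1) w - a (N j) w.
have lD j : l2 (D j) by exact: l2B.
have ED j : Ex P (fun w => `|D j w|) <= 2 * (2 ^+ j)^-1.
  have iD : itg P (fun w => `|D j w|) by apply: itg_norm; exact: l2_itg.
  have t0 : 0 < (2 ^+ j)^-1 :> R by rewrite invr_gt0 exprn_gt0.
  have iD2 : itg P (fun w => D j w ^+ 2 / (2 ^+ j)^-1 + (2 ^+ j)^-1).
    apply: itgD; last exact: itg_cst.
    by under eq_fun do rewrite mulrC; apply: itgZ; exact: (lD j).2.
  apply: (@le_trans _ _ (Ex P (fun w => D j w ^+ 2 / (2 ^+ j)^-1 + (2 ^+ j)^-1))).
    apply: le_Ex => // w; have := normM_le_sqr (D j w) 1 t0; rewrite mulr1 expr1n mulr1.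
    by [].
  rewrite ExD; [|by under eq_fun do rewrite mulrC; apply: itgZ; exact: (lD j).2|exact: itg_cst].
  rewrite Ex_cst; under eq_fun do rewrite mulrC; rewrite ExZ; last exact: (lD j).2.
  have := NP j (N j.+1) (N j) (Nmono _ _ (leqnSn j)) (leqnn _).
  rewrite -/(D j) invrK => h; rewrite mulr2n mulrDl mul1r lerD2r.
  rewrite -ler_pdivlMl ?exprn_gt0//; apply: le_trans h _.
  by rewrite -invfM -exprMn (_ : 2 * 2 = 4 :> R)//; ring.
pose s N w := \sum_(j < N) `|D j w|.
have si N' : itg P (s N') by apply: (itg_sum _ (f := fun (j : 'I_N') w => `|D j w|)) => j; apply: itg_norm; exact: l2_itg.
have Es N' : Ex P (s N') <= 4.
  rewrite /s (Ex_sum _ (f := fun (j : 'I_N') w => `|D j w|)); last by move=> j; apply: itg_norm; exact: l2_itg.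
  apply: (@le_trans _ _ (\sum_(j < N') 2 * (2 ^+ j)^-1)); first by apply: ler_sum => j _; exact: ED.
  have -> : \sum_(j < N') 2 * (2 ^+ j)^-1 = 4 - 4 * (2 ^+ N')^-1 :> R.
    elim: N' => [|n IH]; first by rewrite big_ord0 expr0 invr1 mulr1 subrr.
    by rewrite big_ord_recr/= IH exprS; field; rewrite gt_eqF// exprn_gt0.
  by rewrite gerBl mulr_ge0// invr_ge0 exprn_ge0.
pose G w := limn (fun n => (s n w)%:E).
have nds w : nondecreasing_seq (fun n => (s n w)%:E).
  by apply/nondecreasing_seqP => n; rewrite lee_fin /s big_ord_recr/= lerDl.
have cG w : (fun n => (s n w)%:E) @ \oo --> G w by exact: ereal_nondecreasing_is_cvgn.
have ms n : measurable_fun setT (fun w => (s n w)%:E).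
  by apply/measurable_EFinP; exact: itg_measurable (si n).
have mG : measurable_fun setT G by apply: (emeasurable_fun_cvg (fun n w => (s n w)%:E)) => // w _; exact: cG.
have G0 w : (0 <= G w)%E.
  apply: lime_ge; first exact: ereal_nondecreasing_is_cvgn.
  by apply: nearW => n; rewrite lee_fin; apply: sumr_ge0.
have iG : (\int[P]_w G w <= 4%:E)%E.
  rewrite /G (@monotone_convergence _ _ _ P setT measurableT (fun n w => (s n w)%:E))//.
  - apply: lime_le.
      apply: ereal_nondecreasing_is_cvgn => n m nm; apply: ge0_le_integral => //.
      + by move=> w _; rewrite lee_fin; apply: sumr_ge0.
      + by move=> w _; exact: nds.
    by apply: nearW => n; rewrite integral_Ex// lee_fin.
  - by move=> n w _; rewrite lee_fin; apply: sumr_ge0.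
have GI : P.-integrable setT G.
  apply/integrableP; split => //; apply: le_lt_trans (ltry 4).
  by apply: le_trans iG; rewrite le_eqVlt; apply/orP; left; apply/eqP; apply: eq_integral => w _; rewrite gee0_abs.
pose F := [set w | G w \is a fin_num].
have mF : measurable F.
  have -> : F = setT `&` G @^-1` [set` `]-oo%E, +oo%E[].
    apply/seteqP; split => w; rewrite /F /= in_itv/= fin_numElt => h; first by split.
    by case: h.
  by apply: mG => //; exact: emeasurable_itv.
have aeF : {ae P, forall w, F w}.
  by have := integrable_ae measurableT GI; apply: filterS => w /= h; exact: h.
(* Off the full-measure set [F] the sequence is set to 0, so it converges at every point and the
   limit is measurable. *)
pose a' j w := \1_F w * a (N j) w.
have cva w : exists l : R, a' ^~ w @ \oo --> l.
  rewrite /a'; have [wF|wF] := boolP (w \in F); last first.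
    have z : \1_F w = 0 :> R by rewrite indicE (negbTE wF).
    by exists 0; under eq_fun do rewrite z mul0r; exact: cvg_cst.
  have z : \1_F w = 1 :> R by rewrite indicE wF.
  have -> : (fun j => \1_F w * a (N j) w) = (fun j => a (N j) w) by apply/funext => j; rewrite z mul1r.
  have /(summable_cvg (a := D ^~ w))[l hl] : summable (fun j => `|D j w|).
    exists (fine (G w)) => n; rewrite -lee_fin fineK; last by rewrite inE in wF.
    rewrite -/(s n w); apply: lime_ge; first exact: ereal_nondecreasing_is_cvgn.
    by exists n => // m /= nm; exact: nds.
  exists (a (N 0%N) w + l).
  have -> : (fun j => a (N j) w) = (fun n => a (N 0%N) w + \sum_(j < n) D j w).
    apply/funext; elim => [|n IH]; first by rewrite big_ord0 addr0.
    by rewrite big_ord_recr/= addrA -IH /D; ring.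
  by apply: cvgD => //; exact: cvg_cst.
have [b bP] := choice cva.
have ma' j : measurable_fun setT (a' j).
  by apply: measurable_funM; [exact: measurable_indic|exact: (la (N j)).1].
have aea j : {ae P, forall w, a (N j) w = a' j w}.
  by apply: filterS aeF => w Fw; rewrite /a' indicE mem_set// mul1r.
have la' j : l2 (a' j).
  split; first exact: ma'.
  apply: (ae_eq_Ex (la (N j)).2 _ _).1; first exact: measurable_funX.
  by apply: filterS (aea j) => w ->.
have Eaa i j : Ex P (fun w => (a' j w - a' i w) ^+ 2) = Ex P (fun w => (a (N j) w - a (N i) w) ^+ 2).
  apply: (ae_eq_Ex (l2B (la (N j)) (la (N i))).2 _ _).2.
    by apply: measurable_funX; exact: measurable_funB.
  by apply: filterS2 (aea j) (aea i) => w -> ->.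
have bnd i : itg P (fun w => (b w - a' i w) ^+ 2) /\ Ex P (fun w => (b w - a' i w) ^+ 2) <= (4 ^+ i)^-1.
  apply: (fatou_Ex (f_ := fun j w => (a' (j + i)%N w - a' i w) ^+ 2)).
  - by move=> j; exact: (l2B (la' _) (la' _)).2.
  - by move=> j w; exact: sqr_ge0.
  - move=> w; have c : (fun j => a' (j + i)%N w) @ \oo --> b w.
      by have := bP w; rewrite -(cvg_shiftn i).
    by rewrite !expr2; apply: cvgM; apply: cvgB => //; exact: cvg_cst.
  - by move=> j; rewrite Eaa; apply: NP => //; exact/Nmono/leq_addl.
have mb : measurable_fun setT b by apply: (@measurable_fun_cvg _ _ _ setT a').
have lba : l2 (fun w => b w - a' 0%N w) by split; [exact: measurable_funB|exact: (bnd 0%N).1].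
have lb : l2 b.
  by have := l2D lba (la' 0%N); under eq_fun do rewrite subrK.
exists b => //; apply/cvgrPdist_le => e ep.
have [j jP] : exists j, 4 * (4 ^+ j)^-1 <= e.
  exists (Num.bound (4 / e)); rewrite ler_pdivrMr ?exprn_gt0// mulrC -ler_pdivrMr//.
  rewrite (le_trans (ltW (archi_boundP _))) ?divr_ge0 ?(ltW ep)//.
  by rewrite -natrX ler_nat ltnW// ltn_expl.
exists (N j) => // n /= jn; rewrite sub0r normrN ger0_norm; last by apply: Ex_ge0 => w; exact: sqr_ge0.
have lan : l2 (fun w => a n w - a (N j) w) by exact: l2B.
have lbn : l2 (fun w => a (N j) w - b w) by exact: l2B.
have E2 : Ex P (fun w => (a (N j) w - b w) ^+ 2) <= (4 ^+ j)^-1.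
  have mm : measurable_fun setT (fun w => (a (N j) w - b w) ^+ 2) by exact: measurable_funX lbn.1.
  rewrite ((ae_eq_Ex (f := fun w => (b w - a' j w) ^+ 2) (bnd j).1 mm) _).2; first exact: (bnd j).2.
  by apply: filterS (aea j) => w ->; ring.
have -> : (fun w => (a n w - b w) ^+ 2) = (fun w => ((a n w - a (N j) w) + (a (N j) w - b w)) ^+ 2).
  by apply/funext => w; ring.
apply: le_trans (Ex_sqrD_le lan lbn) _.
have := NP j n (N j) jn (leqnn _); move: E2 jP; move: (Ex P _) (Ex P _) ((4 ^+ j)^-1 : R) => x y z; lra.
Qed.

Lemma l2_cvg_inner (a : nat -> T -> R) b g : (forall n, l2 (a n)) -> l2 b -> l2 g ->
  (fun n => Ex P (fun w => (a n w - b w) ^+ 2)) @ \oo --> 0 ->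
  (fun n => Ex P (fun w => a n w * g w)) @ \oo --> Ex P (fun w => b w * g w).
Proof.
move=> la lb lg /cvgrPdist_le cv; apply/cvgrPdist_le => e e0.
set G := Ex P (fun w => g w ^+ 2).
have G0 : 0 <= G by apply: Ex_ge0 => w; exact: sqr_ge0.
pose t := e / 2 / (G + 1).
have G1 : 0 < G + 1 by rewrite ltr_wpDl.
have t0 : 0 < t by rewrite !divr_gt0.
have te : 0 < e / 2 * t by rewrite mulr_gt0// divr_gt0.
have [N _ NP] := cv _ te; exists N => // n /= Nn.
have := NP n Nn; rewrite /= sub0r normrN ger0_norm; last by apply: Ex_ge0 => w; exact: sqr_ge0.
move=> h; have lab : l2 (fun w => a n w - b w) by exact: l2B.
rewrite distrC -ExB; [|exact: l2M..].
have iab : itg P (fun w => (a n w - b w) ^+ 2 / t) by under eq_fun do rewrite mulrC; apply: itgZ; exact: lab.2.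
apply: (@le_trans _ _ (Ex P (fun w => (a n w - b w) ^+ 2 / t + t * g w ^+ 2))).
  apply: norm_Ex_le.
  - by apply: itgB; exact: l2M.
  - by apply: itgD => //; apply: itgZ; exact: lg.2.
  - by move=> w; rewrite -mulrBl; exact: normM_le_sqr.
rewrite ExD//; last by apply: itgZ; exact: lg.2.
under eq_fun do rewrite mulrC; rewrite ExZ; last exact: lab.2.
rewrite ExZ; last exact: lg.2.
rewrite -/G [e]splitr; apply: lerD; first by rewrite mulrC ler_pdivrMr.
have -> : t * G = e / 2 * (G / (G + 1)) by rewrite /t; ring.
by rewrite ler_piMr ?divr_ge0 ?(ltW e0)// ler_pdivrMr// mul1r lerDl.
Qed.

End square_integrable.

(** * Coboundaries and vanishing asymptotic variance *)

Section stationary_averages.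
Variable R : realType.
Implicit Types u e : nat -> R.

Lemma cvg_is_sublinear u (l : R) : u @ \oo --> l -> sublinear u.
Proof.
move=> /cvgrPdist_le/(_ 1 ltr01)[N0 _ h].
apply: (@sublinear_bounded _ _ (`|l| + 1 + \sum_(n < N0) `|u n|)) => N.
have s0 : 0 <= \sum_(n < N0) `|u n| by apply: sumr_ge0.
have [NN|NN] := ltnP N N0.
  rewrite (bigD1 (Ordinal NN))//= addrCA lerDl; apply: addr_ge0; first exact: addr_ge0.
  exact: sumr_ge0.
have := h N NN => /= hN.
have -> : u N = l - (l - u N) by ring.
by rewrite (le_trans (ler_normB _ _))//; move: hN s0; lra.
Qed.

(** The constant does not depend on M; this uniformity is what the double averages of the Gram
    matrix need. *)
Lemma null_sum_ndist e : e @ \oo --> 0 -> forall eps : R, 0 < eps ->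
  exists2 C : R, 0 <= C & forall M K, \sum_(L < K) `|e (ndist M L)| <= eps * K%:R + C.
Proof.
move=> /cvgrPdist_le he eps eps0; have [H _ HP] := he _ eps0.
pose chi h : R := if (h < H)%N then `|e h| else 0.
have chi0 h : 0 <= chi h by rewrite /chi; case: ifP.
pose S := \sum_(h < H) `|e h|.
have S0 : 0 <= S by exact: sumr_ge0.
have hS N : \sum_(h < N | (0 <= h)%N) chi h <= S.
  rewrite (@le_trans _ _ (\sum_(h < N | (0 <= h < 0 + H)%N) `|e h|))//.
    by rewrite [leRHS]big_mkcond; apply: ler_sum => h _; rewrite /chi add0n; case: ifP.
  exact: (sum_interval_le 0 N H (F := fun h => `|e h|) (fun=> normr_ge0 _)).
exists (S + S); first exact: addr_ge0.
move=> M K.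
have := sum_line_tail 1 M K (ltn0Sn 0) chi0 hS; rewrite mul1n => h.
rewrite (@le_trans _ _ (\sum_(L < K) (eps + chi (ndist M L))))//.
  apply: ler_sum => L _; rewrite /chi; case: ltnP => hh; first by rewrite lerDr ltW.
  by have := HP _ hh; rewrite /= sub0r normrN addr0.
rewrite big_split/= sumr_const card_ord mulr_natr lerD2l.
apply: le_trans h; rewrite le_eqVlt; apply/orP; left; apply/eqP.
by apply: eq_big => L //; rewrite mul1n.
Qed.

End stationary_averages.

Section coboundary.
Context {d : measure_display} {T : measurableType d} {R : realType}.
Variables (P : probability T R) (Z : nat -> T -> R) (c : nat -> R) (s2 beta : R).
Hypothesis lZ : forall n, l2 P (Z n).
Hypothesis EZ : forall n, Ex P (Z n) = 0.
Hypothesis cZ : forall n m, Ex P (fun w => Z n w * Z m w) = c (ndist n m).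

Let B (N : nat) := \sum_(n < N) \sum_(m < N) c (ndist n m).
Hypothesis hB : (fun N => B N - N%:R * s2) @ \oo --> beta.

Let S (n : nat) w := \sum_(j < n) Z j w.
Let Q n m := Ex P (fun w => S n w * S m w).

Let lS n : l2 P (S n).
Proof. exact: (l2_sum _ (f := fun (j : 'I_n) w => Z j w)). Qed.

Let QE n : Q n n = B n.
Proof.
rewrite /Q /S (sqr_sum_Ex _ _ (f := fun (j : 'I_n) w => Z j w) (g := fun (j : 'I_n) w => Z j w))//.
by apply: eq_bigr => i _; apply: eq_bigr => j _; rewrite cZ.
Qed.

Let Q_shift m k : Ex P (fun w => (S (m + k) w - S m w) ^+ 2) = B k.
Proof.
have -> : (fun w => (S (m + k) w - S m w) ^+ 2) =
   (fun w => (\sum_(j < k) Z (m + j)%N w) * (\sum_(j < k) Z (m + j)%N w)).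
  apply/funext => w; rewrite expr2 /S big_split_ord/=.
  by have xyx (x y : R) : x + y - x = y by [ring]; rewrite xyx.
rewrite (sqr_sum_Ex _ _ (f := fun (j : 'I_k) w => Z (m + j)%N w) (g := fun (j : 'I_k) w => Z (m + j)%N w))//.
by apply: eq_bigr => i _; apply: eq_bigr => j _; rewrite cZ /ndist !subnDl.
Qed.

Let sqr_diff n m : Ex P (fun w => (S n w - S m w) ^+ 2) = B (ndist n m).
Proof.
wlog mn : n m / (m <= n)%N.
  move=> H; have [/H//|/ltnW/H] := leqP m n; rewrite ndistC => <-.
  by congr Ex; apply/funext => w; ring.
by rewrite -{1}(subnKC mn) Q_shift /ndist (_ : (m - n = 0)%N) ?addn0//; apply/eqP.
Qed.

Let Ex_sqrB f g : l2 P f -> l2 P g -> Ex P (fun w => (f w - g w) ^+ 2) =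
  Ex P (fun w => f w * f w) - 2 * Ex P (fun w => f w * g w) + Ex P (fun w => g w * g w).
Proof.
move=> lf lg.
have -> : (fun w => (f w - g w) ^+ 2) = (fun w => (f w * f w - 2 * (f w * g w)) + g w * g w).
  by apply/funext => w; ring.
have i1 := l2M lf lf; have i2 := itgZ 2 (l2M lf lg); have i3 := l2M lg lg.
by rewrite ExD ?ExB ?ExZ//; [exact: l2M|exact: itgB].
Qed.

(** Polarization: by stationarity the Gram matrix of the partial sums is determined by the sequence
    of their second moments. *)
Let QB n m : Q n m = (B n + B m - B (ndist n m)) / 2.
Proof.
have := sqr_diff n m; rewrite (Ex_sqrB (lS n) (lS m)) -/(Q n n) -/(Q n m) -/(Q m m) !QE.
by move=> <-; field.
Qed.

Let B_ge0 n : 0 <= B n.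
Proof. by rewrite -QE; apply: Ex_ge0 => w; rewrite -expr2 sqr_ge0. Qed.

Lemma coboundary_variance_cvg : (fun N => B N / N%:R) @ \oo --> s2.
Proof. exact/sublinear_cvg/(cvg_is_sublinear hB). Qed.

Lemma coboundary_variance_ge0 : 0 <= s2.
Proof.
have cv := coboundary_variance_cvg; rewrite -(cvg_lim _ cv)//; apply: limr_ge; first exact: cvgP cv.
by apply: nearW => n; rewrite divr_ge0.
Qed.

Section degenerate.
Hypothesis s20 : s2 = 0.
Let e n := B n - beta.
Let e0 : e @ \oo --> 0.
Proof.
have := hB; rewrite s20; under eq_fun do rewrite mulr0 subr0; move=> h.
by rewrite -(subrr beta); apply: cvgB => //; exact: cvg_cst.
Qed.

(** When s2 = 0 the partial sums are bounded in L^2 but need not converge; their Cesàro averages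
    do. *)
Let A (n : nat) w := n.+1%:R^-1 * \sum_(M < n.+1) S M w.
Let lA n : l2 P (A n).
Proof. by apply: l2Z; exact: (l2_sum _ (f := fun (j : 'I_n.+1) w => S j w)). Qed.

Let EAA N K : Ex P (fun w => A N w * A K w) =
  N.+1%:R^-1 * K.+1%:R^-1 * \sum_(M < N.+1) \sum_(L < K.+1) Q M L.
Proof.
have -> : (fun w => A N w * A K w) = (fun w => N.+1%:R^-1 * K.+1%:R^-1 *
   ((\sum_(M < N.+1) S M w) * (\sum_(L < K.+1) S L w))) by apply/funext => w; rewrite /A; ring.
have lN n : l2 P (fun w => \sum_(M < n) S M w) by exact: (l2_sum _ (f := fun (j : 'I_n) w => S j w)).
rewrite ExZ; last exact: l2M.
by rewrite (sqr_sum_Ex _ _ (f := fun (j : 'I_N.+1) w => S j w) (g := fun (j : 'I_K.+1) w => S j w)).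
Qed.

Let EAS N m : Ex P (fun w => A N w * S m w) = N.+1%:R^-1 * \sum_(M < N.+1) Q M m.
Proof.
have -> : (fun w => A N w * S m w) = (fun w => N.+1%:R^-1 * \sum_(M < N.+1) (S M w * S m w)).
  by apply/funext => w; rewrite /A -mulrA mulr_suml.
by rewrite ExZ ?(Ex_sum _ (f := fun (j : 'I_N.+1) w => S j w * S m w))//;
  [move=> j; exact: l2M|apply: (itg_sum _ (f := fun (j : 'I_N.+1) w => S j w * S m w)) => j; exact: l2M].
Qed.

(** With e_n = B_n - beta one has Q(M,L) - beta/2 = (e_M + e_L - e_|M-L|)/2, and each of the three
    terms is small on average. *)
Let EAA_dist eps C : 0 <= eps -> 0 <= C -> (forall M K, \sum_(L < K) `|e (ndist M L)| <= eps * K%:R + C) ->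
  forall N K, `|Ex P (fun w => A N w * A K w) - beta / 2| <= 2 * eps + C / N.+1%:R + C / K.+1%:R.
Proof.
move=> eps0 C0 hC N K; rewrite EAA.
have N0 : 0 < N.+1%:R :> R by rewrite ltr0n.
have K0 : 0 < K.+1%:R :> R by rewrite ltr0n.
set x : R := N.+1%:R in N0 *; set y : R := K.+1%:R in K0 *.
have ex n : \sum_(L < n) `|e L| <= eps * n%:R + C.
  apply: le_trans (hC 0%N n); rewrite le_eqVlt; apply/orP; left; apply/eqP.
  by apply: eq_bigr => L _; rewrite /ndist sub0n subn0.
have E1 : \sum_(M < N.+1) \sum_(L < K.+1) (Q M L - beta / 2) =
    \sum_(M < N.+1) \sum_(L < K.+1) Q M L - x * y * (beta / 2).
  under eq_bigr do rewrite sumrB sumr_const card_ord.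
  rewrite sumrB sumr_const card_ord -mulrnA -[X in _ - X]mulr_natl natrM /x /y.
  by congr (_ - _); ring.
have -> : x^-1 * y^-1 * (\sum_(M < N.+1) \sum_(L < K.+1) Q M L) - beta / 2 =
   x^-1 * y^-1 * \sum_(M < N.+1) \sum_(L < K.+1) (Q M L - beta / 2).
  by rewrite E1; field; rewrite !gt_eqF.
have xy0 : 0 <= x^-1 * y^-1 by rewrite mulr_ge0 ?invr_ge0 ?(ltW N0) ?(ltW K0).
rewrite normrM (ger0_norm xy0).
have bnd : `|\sum_(M < N.+1) \sum_(L < K.+1) (Q M L - beta / 2)| <=
    (y * (eps * x + C) + (x * (eps * y + C) + x * (eps * y + C))) / 2.
  apply: le_trans (ler_norm_sum _ _ _) _.
  apply: (@le_trans _ _ (\sum_(M < N.+1) \sum_(L < K.+1) (`|e M| + (`|e L| + `|e (ndist M L)|)) / 2)).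
    apply: ler_sum => M _; apply: le_trans (ler_norm_sum _ _ _) _; apply: ler_sum => L _.
    have -> : Q M L - beta / 2 = (e M + (e L - e (ndist M L))) / 2 by rewrite QB /e; field.
    rewrite normrM (ger0_norm (_ : 0 <= 2^-1)) ?invr_ge0// ler_wpM2r ?invr_ge0//.
    by rewrite (le_trans (ler_normD _ _))// lerD2l ler_normB.
  under eq_bigr do rewrite -mulr_suml; rewrite -mulr_suml ler_wpM2r ?invr_ge0//.
  under eq_bigr do rewrite big_split/= big_split/= sumr_const card_ord.
  rewrite big_split/= big_split/=; apply: lerD.
    under eq_bigr do rewrite -mulr_natl; rewrite -mulr_sumr -/y.
    by apply: ler_wpM2l; [exact: ltW|exact: ex].
  apply: lerD.
    by rewrite sumr_const card_ord -mulr_natl -/x; apply: ler_wpM2l; [exact: ltW|exact: ex].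
  apply: (@le_trans _ _ (\sum_(M < N.+1) (eps * y + C))).
    by apply: ler_sum => M _; exact: hC.
  by rewrite sumr_const card_ord -mulr_natl.
apply: le_trans (ler_wpM2l xy0 bnd) _.
have -> : x^-1 * y^-1 * ((y * (eps * x + C) + (x * (eps * y + C) + x * (eps * y + C))) / 2) =
   3 / 2 * eps + C / x / 2 + C / y by field; rewrite !gt_eqF.
have Cx : 0 <= C / x by rewrite divr_ge0// ltW.
have Cy : 0 <= C / y by rewrite divr_ge0// ltW.
by move: (C / x) (C / y) Cx Cy eps0 => a b; lra.
Qed.

Let cvg_average (u : nat -> R) (l k : R) : 0 <= k -> (forall eps C, 0 <= eps -> 0 <= C ->
  (forall M K, \sum_(L < K) `|e (ndist M L)| <= eps * K%:R + C) ->
  forall N, `|u N - l| <= k * eps + k * C / N.+1%:R) -> u @ \oo --> l.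
Proof.
move=> k0 hu; apply/cvgrPdist_le => eps eps0.
pose k1 := k + 1; have k10 : 0 < k1 by rewrite /k1; lra.
pose eps' := eps / k1 / 2; have eps'0 : 0 < eps' by rewrite !divr_gt0.
have [C C0 hC] := null_sum_ndist e0 eps'0.
have cvC : (fun N => k * C / N.+1%:R) @ \oo --> 0.
  by rewrite -[X in _ --> X](mulr0 (k * C)); apply: cvgMr; exact: cvg_harmonic.
move/cvgrPdist_le : cvC => /(_ (eps / 2)) [|N0 _ hN0]; first by rewrite divr_gt0.
exists N0 => // N /= NN; rewrite distrC (le_trans (hu _ _ (ltW eps'0) C0 hC N))//.
have := hN0 N NN; rewrite /= sub0r normrN => /(le_trans (ler_norm _)) hh.
have : k * eps' <= eps / 2.
  rewrite /eps' mulrA ler_pM2r ?invr_gt0// mulrCA ger_pMr// ler_pdivrMr// mul1r /k1; lra.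
by move: hh; move: (k * C / _) => a; lra.
Qed.

Let EAA_cvg : (fun N => Ex P (fun w => A N w * A N w)) @ \oo --> beta / 2.
Proof.
apply: (cvg_average (k := 2)) => // eps C ee C0 hC N.
have := EAA_dist ee C0 hC N N.
have -> : 2 * C / N.+1%:R = C / N.+1%:R + C / N.+1%:R by move: (N.+1%:R^-1) => x; ring.
by rewrite addrA.
Qed.

Let EAS_cvg m : (fun N => Ex P (fun w => A N w * S m w)) @ \oo --> B m / 2.
Proof.
apply: (cvg_average (k := 2)) => // eps C ee C0 hC N; rewrite EAS.
have N0 : 0 < N.+1%:R :> R by rewrite ltr0n.
have -> : N.+1%:R^-1 * (\sum_(M < N.+1) Q M m) - B m / 2 =
   N.+1%:R^-1 * \sum_(M < N.+1) (Q M m - B m / 2).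
  by rewrite sumrB sumr_const card_ord -mulr_natl; field; rewrite gt_eqF.
rewrite normrM ger0_norm ?invr_ge0// mulrC ler_pdivrMr// mulrDl divfK ?gt_eqF//.
apply: le_trans (ler_norm_sum _ _ _) _.
apply: (@le_trans _ _ (\sum_(M < N.+1) (`|e M| + `|e (ndist m M)|))).
  apply: ler_sum => M _; have -> : Q M m - B m / 2 = (e M - e (ndist m M)) / 2.
    by rewrite QB /e (ndistC m); field.
  rewrite normrM [`|2^-1|]ger0_norm ?invr_ge0//.
  by have := ler_normB (e M) (e (ndist m M)); have := normr_ge0 (e M - e (ndist m M)); lra.
rewrite big_split/=.
have h1 := hC m N.+1; have h2 := hC 0%N N.+1.
have -> : 2 * eps * N.+1%:R + 2 * C = (eps * N.+1%:R + C) + (eps * N.+1%:R + C) by ring.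
apply: lerD h1; apply: le_trans h2; rewrite le_eqVlt; apply/orP; left; apply/eqP.
by apply: eq_bigr => L _; rewrite /ndist sub0n subn0.
Qed.

Let A_cauchy eps : 0 < eps -> exists N, forall n m, (N <= n)%N -> (N <= m)%N ->
  Ex P (fun w => (A n w - A m w) ^+ 2) <= eps.
Proof.
move=> eps0; have eps'0 : 0 < eps / 16 by rewrite divr_gt0.
have [C C0 hC] := null_sum_ndist e0 eps'0.
have cvC : (fun N => C / N.+1%:R) @ \oo --> 0.
  by rewrite -[X in _ --> X](mulr0 C); apply: cvgMr; exact: cvg_harmonic.
move/cvgrPdist_le : cvC => /(_ (eps / 16) eps'0) [N0 _ hN0].
have {}hN0 n : (N0 <= n)%N -> C / n.+1%:R <= eps / 16.
  by move=> /hN0 /=; rewrite sub0r normrN => /(le_trans (ler_norm _)).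
exists N0 => n m /hN0 n0 /hN0 m0; rewrite Ex_sqrB//.
have := EAA_dist (ltW eps'0) C0 hC n n; have := EAA_dist (ltW eps'0) C0 hC n m.
have := EAA_dist (ltW eps'0) C0 hC m m.
move: n0 m0; move: (C / n.+1%:R) (C / m.+1%:R) (Ex P (fun w => A n w * A m w)) => a b x.
move: (Ex P (fun w => A n w * A n w)) (Ex P (fun w => A m w * A m w)) => y z.
by rewrite !ler_norml => ? ? /andP[? ?] /andP[? ?] /andP[? ?]; lra.
Qed.

(** V_n = S_n - b with b the L^2 limit of the averages. Passing to the limit gives E b S_m = B_m/2
    and E b^2 = beta/2, so that E V_n V_m = beta/2 - B_|n-m|/2 depends on the lag only. *)
Lemma coboundary_of_null : exists V : nat -> T -> R,
  weakly_stationary P V /\ forall n, {ae P, forall w, Z n w = V n.+1 w - V n w}.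
Proof.
have [b lb cvb] := l2_complete lA A_cauchy.
have EbS m : Ex P (fun w => b w * S m w) = B m / 2.
  exact: (cvgn_unique (l2_cvg_inner lA lb (lS m) cvb) (@EAS_cvg m)).
have Ebb : Ex P (fun w => b w * b w) = beta / 2.
  have c1 := l2_cvg_inner lA lb lb cvb.
  have : (fun N => Ex P (fun w => A N w * A N w)) @ \oo --> Ex P (fun w => b w * b w).
    have -> : (fun N => Ex P (fun w => A N w * A N w)) = (fun N =>
       Ex P (fun w => (A N w - b w) ^+ 2) + 2 * Ex P (fun w => A N w * b w) - Ex P (fun w => b w * b w)).
      by apply/funext => N; rewrite Ex_sqrB//; ring.
    rewrite -[X in _ --> X](_ : 0 + 2 * Ex P (fun w => b w * b w) - Ex P (fun w => b w * b w) = _); last by ring.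
    apply: cvgB; last exact: cvg_cst.
    by apply: cvgD => //; exact: cvgMr.
  by move=> h; exact: (cvgn_unique h EAA_cvg).
pose V n w := S n w - b w.
have lV n : l2 P (V n) by exact: l2B.
have EV n : Ex P (V n) = - Ex P b.
  rewrite /V ExB; [|exact: l2_itg|exact: l2_itg].
  rewrite /S (Ex_sum _ (f := fun (j : 'I_n) w => Z j w)); last by move=> j; exact: l2_itg.
  by rewrite big1 ?sub0r// => j _; exact: EZ.
have EVV n m' : Ex P (fun w => V n w * V m' w) = beta / 2 - B (ndist n m') / 2.
  have -> : (fun w => V n w * V m' w) =
      (fun w => (S n w * S m' w - b w * S n w) + (b w * b w - b w * S m' w)).
    by apply/funext => w; rewrite /V; ring.
  have ? := l2M (lS n) (lS m'); have ? := l2M lb (lS n); have ? := l2M lb (lS m'); have ? := l2M lb lb.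
  by rewrite ExD ?ExB//; try exact: itgB; rewrite -/(Q n m') QB !EbS Ebb; field.
exists V; split; last first.
  by move=> n; apply: aeW => w; rewrite /V /S big_ord_recr/=; ring.
split.
- by move=> n; exact: (lV n).1.
- by move=> n; exact: (lV n).2.
- by move=> n; rewrite !expectation_Ex ?EV//; exact: l2_itg.
- move=> n m' t; rewrite !covariance_Ex// !EVV !EV; congr ((_ - _ / _ - _)%:E); congr B.
  by rewrite /ndist !subnDr.
Qed.

End degenerate.

(** Telescoping gives S_N = V_N - V_0 almost everywhere, so E S_N^2 is at most 4 E V_0^2, whereas E
    S_N^2 / N tends to s2. *)
Lemma null_of_coboundary (V : nat -> T -> R) :
  weakly_stationary P V -> (forall n, {ae P, forall w, Z n w = V n.+1 w - V n w}) -> s2 = 0.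
Proof.
move=> [mV iV EV cV] hZ.
have lV n : l2 P (V n) by split; [exact: mV|exact: iV].
have V2 n : Ex P (fun w => V n w ^+ 2) = Ex P (fun w => V 0 w ^+ 2).
  have := cV 0%N 0%N n; rewrite !covariance_Ex// !add0n => -[].
  have := EV n; rewrite !expectation_Ex; [|exact: l2_itg|exact: l2_itg].
  by move=> [->] /addIr; rewrite /=; under eq_fun do rewrite -expr2; move=> ->; congr Ex; apply/funext => w; rewrite expr2.
have SV N : {ae P, forall w, S N w = V N w - V 0 w}.
  elim: N => [|N IH]; first by apply: aeW => w; rewrite /S big_ord0 subrr.
  by move: IH (hZ N); apply: filterS2 => w IH hw; rewrite /S big_ord_recr/= -/(S N w) IH hw; ring.
have BV N : B N <= 4 * Ex P (fun w => V 0 w ^+ 2).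
  have [||_ EE] := ae_eq_Ex (P := P) (f := fun w => S N w * S N w)
    (g := fun w => (V N w + (-1) * V 0%N w) ^+ 2) (l2M (lS N) (lS N)).
  - by have [] := l2D (lV N) (l2Z (-1) (lV 0%N)) => h _; apply: measurable_funX.
  - by move: (SV N); apply: filterS => w ->; ring.
  rewrite -QE /Q -EE; apply: le_trans (Ex_sqrD_le (lV N) (l2Z (-1) (lV 0%N))) _.
  rewrite V2; under [X in _ + 2 * Ex P X]eq_fun do rewrite mulN1r sqrrN.
  by rewrite /=; lra.
have cv := coboundary_variance_cvg.
apply: (cvgn_unique cv).
have -> : (fun N => B N / N%:R) = (fun N => (B N - N%:R * 0) / N%:R) by apply/funext => N; rewrite mulr0 subr0.
apply/cvgrPdist_le => eps eps0.
have : (fun N => (4 * Ex P (fun w => V 0 w ^+ 2)) / N%:R) @ \oo --> 0.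
  have := @sublinear_cvg R (fun=> 4 * Ex P (fun w => V 0 w ^+ 2)) 0.
  apply; apply: (@sublinear_bounded _ _ `|4 * Ex P (fun w => V 0 w ^+ 2)|) => N.
  by rewrite mulr0 subr0.
move=> /cvgrPdist_le/(_ _ eps0)[N0 _ h]; exists N0 => // N /= NN.
apply: le_trans (h N NN) => /=; rewrite !sub0r !normrN mulr0 subr0 !ger0_norm//.
- by rewrite ler_wpM2r ?invr_ge0.
- by rewrite divr_ge0// (le_trans _ (BV 0%N)).
- by rewrite divr_ge0.
Qed.

Theorem coboundary_criterion : 0 < s2 <->
  ~ exists V : nat -> T -> R, weakly_stationary P V /\
      forall n, {ae P, forall w, Z n w = V n.+1 w - V n w}.
Proof.
split=> [s20 [V [sV hV]]|nV]; first by have := null_of_coboundary sV hV => h; rewrite h ltxx in s20.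
rewrite lt_neqAle coboundary_variance_ge0 andbT; apply/eqP => s20.
by apply: nV; exact: coboundary_of_null.
Qed.

End coboundary.

(** * Products of bounded Lipschitz functions as test functions *)

Section bounded_products.
Variable R : realType.
Implicit Types (phis : seq (R -> R)) (x z : seq R).

Definition bprod phis x : R := \prod_(pr <- zip phis x) pr.1 pr.2.

Definition blips phis := forall i, blip (nth (fun=> 1) phis i).

Lemma blips_behead phi phis : blips (phi :: phis) -> blip phi /\ blips phis.
Proof. by move=> h; split; [exact: (h 0%N)|move=> i; exact: (h i.+1)]. Qed.

Lemma bprod_nil x : bprod [::] x = 1.
Proof. by rewrite /bprod; case: x => [|? ?]; rewrite big_nil. Qed.

Lemma bprod_cons phi phis a x : bprod (phi :: phis) (a :: x) = phi a * bprod phis x.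
Proof. by rewrite /bprod big_cons. Qed.

Lemma norm_bprod phis x : blips phis -> `|bprod phis x| <= 1.
Proof.
elim: phis x => [|phi phis IH] [|a x] h; rewrite ?bprod_cons ?bprod_nil ?normr1//.
  by rewrite /bprod big_nil normr1.
have [[_ [Lc _ /(_ a a)[ha _]]] hp] := blips_behead h.
by rewrite normrM mulr_ile1// IH.
Qed.

Lemma bprod_lipschitz phis : blips phis -> exists2 Lc : R, 0 <= Lc &
  forall x z, size x = size phis -> size z = size phis ->
    `|bprod phis x - bprod phis z| <= Lc * sdist x z.
Proof.
elim: phis => [|phi phis IH] h.
  by exists 0 => // x z _ _; rewrite !bprod_nil subrr normr0 mul0r.
have [[_ [L1 L10 hL1]] hp] := blips_behead h; have [L2 L20 hL2] := IH hp.
exists (L1 + L2); first exact: addr_ge0.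
case=> [|a x] [|b z]//= [sx] [sz]; rewrite !bprod_cons sdist_cons.
have -> : phi a * bprod phis x - phi b * bprod phis z =
  (phi a - phi b) * bprod phis x + phi b * (bprod phis x - bprod phis z) by ring.
have [pa pab] := hL1 a b; have [pb _] := hL1 b a.
apply: le_trans (ler_normD _ _) _; rewrite !normrM.
have := hL2 x z sx sz; have := norm_bprod x hp; have s0 := sdist_ge0 x z.
have := normr_ge0 (bprod phis x); have := normr_ge0 (bprod phis x - bprod phis z).
have := normr_ge0 (phi a - phi b); have := normr_ge0 (phi b); have := normr_ge0 (a - b).
move: {pa} pab pb s0; move: (`|phi a - phi b|) (`|phi b|) (`|a - b|) (`|bprod phis x|).
move: (`|bprod phis x - bprod phis z|) (sdist x z) => D s A B E F AB B1 s0 E0 B0 A0 D0 F0 F1 Ds.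
have : A * F <= L1 * E by rewrite (le_trans _ AB)// ler_piMr.
have : B * D <= L2 * s by rewrite (le_trans _ Ds)// ler_piMl.
have : 0 <= L1 * s by exact: mulr_ge0.
have : 0 <= L2 * E by exact: mulr_ge0.
by rewrite mulrDl !mulrDr; lra.
Qed.

(** At distance at most 1 the Lipschitz bound is also a kappa-Hölder bound; beyond, the oscillation
    is at most 2. *)
Lemma bprod_hol (kappa lam : R) phis : 0 < kappa <= 1 -> 0 <= lam -> blips phis ->
  exists C, hol kappa (size phis) lam C (bprod phis).
Proof.
move=> /andP[k0 k1] l0 h; have [Lc Lc0 hL] := bprod_lipschitz h.
exists (2 + Lc); have C1 : 1 <= 2 + Lc by lra.
apply: (hol_weaken l0 (lexx _)); split=> [x z sx sz|x sx]; last first.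
  by rewrite powRr0 mulr1 (le_trans (norm_bprod _ h)).
rewrite powRr0 mulr1; have s0 := sdist_ge0 x z; have [s1|s1] := leP (sdist x z) 1.
  rewrite (le_trans (hL _ _ sx sz))// ler_pM//; first lra.
  have [->|sn] := eqVneq (sdist x z) 0; first exact: powR_ge0.
  rewrite -{1}[sdist x z]powRr1//; apply: ger_powR => //.
  by rewrite s1 andbT lt_neqAle eq_sym sn.
have : 1 <= sdist x z `^ kappa by rewrite -[1](powR1x kappa); apply: ler_powRl; [exact: ltW|exact: ler01|exact: ltW].
move=> p1; rewrite (le_trans (ler_normB _ _))//.
have := norm_bprod x h; have := norm_bprod z h.
by move: p1; move: (_ `^ kappa) => y; nra.
Qed.

Lemma bprod_cat phis phis' x x' : size x = size phis ->
  bprod (phis ++ phis') (x ++ x') = bprod phis x * bprod phis' x'.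
Proof. by move=> s; rewrite /bprod zip_cat// big_cat. Qed.

Lemma sepfun_bprod n (phi : nat -> R -> R) (c : R) x : size x = n ->
  c * \prod_(j < n) phi j (nth 0 x j) = c * bprod (mkseq phi n) x.
Proof.
move=> sx; congr (_ * _); rewrite /bprod (big_nth (fun=> 1, 0)) size_zip size_mkseq sx minnn big_mkord.
apply: eq_bigr => j _; rewrite nth_zip ?size_mkseq//= nth_mkseq//.
Qed.

End bounded_products.

Section separable_convergence.
Context {d : measure_display} {T : measurableType d} {R : realType}.
Variables (P : probability T R) (kappa lam e M : R) (n : nat).
Hypothesis kappa01 : 0 < kappa <= 1.
Hypothesis lam0 : 0 <= lam.
Hypothesis lame : lam + 1 <= e.

Let e0 : 0 < e. Proof. by move: lam0 lame; lra. Qed.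

Lemma sepfun_itg us h : moms P e M us -> size us = n -> sepfun n h -> itg P (fun w => h (ev us w)).
Proof.
move=> mus sus; elim=> [c phi bphi|f g _ IHf _ IHg]; last exact: itgD.
apply: itgZ; apply: (@itg_bounded _ _ _ _ _ 1).
  apply: measurable_prod => j _; under eq_fun do rewrite nth_ev.
  by apply: measurableT_comp; [case: (bphi j)|exact: (moms_mseq mus)].
move=> w; rewrite normr_prod; apply: prodr_ile1 => j; rewrite normr_ge0 /=.
by case: (bphi j) => _ [Lc _ hL]; case: (hL (nth 0 (ev us w) j) 0).
Qed.

Lemma sepfun_approx_Ex us f h C eps : moms P e M us -> size us = n -> hol kappa n lam C f ->
  sepfun n h -> 0 <= eps -> (forall x, size x = n -> `|f x - h x| <= eps * wt x `^ (lam + 1)) ->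
  `|Ex P (fun w => f (ev us w)) - Ex P (fun w => h (ev us w))| <= eps * wtC n e M.
Proof.
move=> mus sus hf sh eps0 fh.
have le : lam <= e by move: lame; lra.
have [fi _] := hol_itg kappa01 lam0 hf sus e0 le mus; have hi := sepfun_itg mus sus sh.
have [wi wE] := wt_moment e0 mus lame; rewrite sus in wE.
have fh' w : `|f (ev us w) - h (ev us w)| <= eps * wt (ev us w) `^ (lam + 1).
  by apply: fh; rewrite size_ev.
rewrite -ExB//; apply: le_trans (norm_Ex_le (itgB fi hi) (itgZ eps wi) fh') _.
by rewrite ExZ// ler_wpM2l.
Qed.

Variable us : nat -> seq (T -> R).
Hypothesis mus : forall t, moms P e M (us t).
Hypothesis sus : forall t, size (us t) = n.

Let wtC1_gt0 : 0 < wtC n e M + 1.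
Proof. by have := wtC_ge0 n e (moms_ge0 (mus 0)); move: (wtC n e M) => a; lra. Qed.

Let small (eps : R) : 0 < eps -> 0 < eps / (wtC n e M + 1) /\
  eps / (wtC n e M + 1) * wtC n e M <= eps.
Proof.
move=> eps0; split; first exact: divr_gt0.
by rewrite mulrAC ler_pdivrMr// ler_pM2l// lerDl.
Qed.

(** Uniform moments make the error of the separated approximation uniform in t, so convergence only
    has to be tested on products, where independence acts factor by factor. *)
Lemma hol_cvg_of_products f C : hol kappa n lam C f ->
  (forall phis, size phis = n -> blips phis -> exists l : R,
    (fun t => Ex P (fun w => bprod phis (ev (us t) w))) @ \oo --> l) ->
  exists l : R, (fun t => Ex P (fun w => f (ev (us t) w))) @ \oo --> l.
Proof.
move=> hf hl; apply: cvg_approx => eps eps0; have [eps'0 eps'E] := small eps0.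
have [h sh fh] := holder_interpolation kappa01 lam0 hf eps'0.
exists (fun t => Ex P (fun w => h (ev (us t) w))); last first.
  by exists 0%N => t _; apply: le_trans eps'E; exact: (sepfun_approx_Ex (mus t) (sus t) hf sh (ltW eps'0) fh).
elim: {fh} sh => [c phi bphi|f1 f2 s1 [l1 h1] s2 [l2 h2]]; last first.
  exists (l1 + l2); have -> : (fun t => Ex P (fun w => f1 (ev (us t) w) + f2 (ev (us t) w))) =
    (fun t => Ex P (fun w => f1 (ev (us t) w)) + Ex P (fun w => f2 (ev (us t) w))).
    by apply/funext => t; rewrite ExD//; [exact: (sepfun_itg (mus t))|exact: (sepfun_itg (mus t))].
  exact: cvgD.
have bm : blips (mkseq phi n).
  move=> i; have [ni|ni] := ltnP i n; first by rewrite nth_mkseq.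
  by rewrite nth_default ?size_mkseq//; exact: blip1.
have [l hl'] := hl _ (size_mkseq _ _) bm; exists (c * l).
have -> : (fun t => Ex P (fun w => c * \prod_(j < n) phi j (nth 0 (ev (us t) w) j))) =
  (fun t => c * Ex P (fun w => bprod (mkseq phi n) (ev (us t) w))).
  apply/funext => t; rewrite -ExZ.
    by congr Ex; apply/funext => w; rewrite sepfun_bprod// size_ev.
  have := sepfun_itg (mus t) (sus t) (sepfun_prod n 1 bphi); congr itg; apply/funext => w.
  by rewrite sepfun_bprod ?mul1r// size_ev.
exact: cvgMr.
Qed.


End separable_convergence.

Lemma hol_cvg_of_products_to d (T : measurableType d) (R : realType) (P : probability T R)
    d' (T' : measurableType d') (P' : probability T' R) (kappa lam e M : R) n
    (us : nat -> seq (T -> R)) (us' : seq (T' -> R)) f C :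
  0 < kappa <= 1 -> 0 <= lam -> lam + 1 <= e ->
  (forall t, moms P e M (us t)) -> (forall t, size (us t) = n) ->
  moms P' e M us' -> size us' = n -> hol kappa n lam C f ->
  (forall phis, size phis = n -> blips phis ->
    (fun t => Ex P (fun w => bprod phis (ev (us t) w))) @ \oo --> Ex P' (fun w => bprod phis (ev us' w))) ->
  (fun t => Ex P (fun w => f (ev (us t) w))) @ \oo --> Ex P' (fun w => f (ev us' w)).
Proof.
move=> kappa01 lam0 lame mus sus mus' sus' hf hl; apply/cvgrPdist_le => eps eps0.
have wC0 := wtC_ge0 n e (moms_ge0 mus'); set W := wtC n e M in wC0.
have W1 : 0 < W + 1 by lra.
have eps'0 : 0 < eps / 3 / (W + 1) by rewrite !divr_gt0.
have eps'E : eps / 3 / (W + 1) * W <= eps / 3.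
  by rewrite mulrAC ler_pdivrMr// ler_pM2l ?divr_gt0// lerDl.
have [h sh fh] := holder_interpolation kappa01 lam0 hf eps'0.
have cvh : (fun t => Ex P (fun w => h (ev (us t) w))) @ \oo --> Ex P' (fun w => h (ev us' w)).
  elim: {fh} sh => [c phi bphi|f1 f2 s1 h1 s2 h2]; last first.
    have -> : (fun t => Ex P (fun w => f1 (ev (us t) w) + f2 (ev (us t) w))) =
      (fun t => Ex P (fun w => f1 (ev (us t) w)) + Ex P (fun w => f2 (ev (us t) w))).
      by apply/funext => t; rewrite ExD//; [exact: (sepfun_itg (mus t))|exact: (sepfun_itg (mus t))].
    rewrite ExD; first exact: (cvgD h1 h2).
      exact: (sepfun_itg mus' sus' s1).
    exact: (sepfun_itg mus' sus' s2).
  have bm : blips (mkseq phi n).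
    move=> i; have [ni|ni] := ltnP i n; first by rewrite nth_mkseq.
    by rewrite nth_default ?size_mkseq//; exact: blip1.
  have EZ d0 (T0 : measurableType d0) (P0 : probability T0 R) us0 : moms P0 e M us0 -> size us0 = n ->
      Ex P0 (fun w => c * \prod_(j < n) phi j (nth 0 (ev us0 w) j)) =
      c * Ex P0 (fun w => bprod (mkseq phi n) (ev us0 w)).
    move=> m0 s0; rewrite -ExZ.
      by congr Ex; apply/funext => w; rewrite sepfun_bprod// size_ev.
    have := sepfun_itg m0 s0 (sepfun_prod n 1 bphi); congr itg; apply/funext => w.
    by rewrite sepfun_bprod ?mul1r// size_ev.
  rewrite EZ//; under eq_fun do rewrite EZ//.
  by apply: cvgMr; apply: hl => //; rewrite size_mkseq.
move/cvgrPdist_le : cvh => /(_ (eps / 3)) [|N0 _ hN]; first by rewrite divr_gt0.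
exists N0 => // t /hN /=.
have := sepfun_approx_Ex kappa01 lam0 lame mus' sus' hf sh (ltW eps'0) fh.
have := sepfun_approx_Ex kappa01 lam0 lame (mus t) (sus t) hf sh (ltW eps'0) fh.
rewrite -/W => /le_trans/(_ eps'E) + /le_trans/(_ eps'E); rewrite !ler_norml.
move: (Ex P _) (Ex P _) (Ex P' _) (Ex P' _) => a b c' d0.
by move=> /andP[? ?] /andP[? ?] /andP[? ?]; apply/andP; split; lra.
Qed.

Lemma third_gap (t c : nat) : (0 < (t - c) %/ 3)%N -> (3 * ((t - c) %/ 3) + c <= t)%N.
Proof. by have := leq_divM (t - c) 3; move: ((t - c) %/ 3)%N => x; lia. Qed.

(** * Limits along families of lines *)

Section line_limits.
Context {d : measure_display} {T : measurableType d} {R : realType}.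
Variables (P : probability T R) (J : eqType) (xi : nat * J -> T -> R).
Variables (kappa lam e M : R) (N0 : nat) (u : nat -> R).
Implicit Types (ks tH tU tW : seq (nat * J)) (C : R).

(** Interface to [decoupling] with the exponents fixed: the constant depends on the numbers of
    variables and on [C], never on the gap, the times or the functions. *)
Definition decoupled := forall nH nU nW C, (nU <= N0)%N -> exists2 K : R, 0 <= K &
  forall r T0 tH tU tW (h f : seq R -> R), (0 < r)%N ->
  size tH = nH -> size tU = nU -> size tW = nW ->
  {in tH, forall k, k.1 <= T0}%N -> {in tU, forall k, k.1 <= T0}%N ->
  {in tW, forall k, T0 + 3 * r <= k.1}%N ->
  hol kappa nH lam C h -> hol kappa (nU + nW) lam C f ->
  `|Ex P (fun w => h (ev (xs xi tH) w) * (f (ev (xs xi tU) w ++ ev (xs xi tW) w) -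
      Ex P (fun w' => f (ev (xs xi tU) w ++ ev (xs xi tW) w'))))| <= K * u r.

Definition shift s ks := [seq (k.1 + s, k.2)%N | k <- ks].

Definition shift_invariant ks := forall s C l (f : seq R -> R), 0 <= l -> l <= e ->
  hol kappa (size ks) l C f ->
  Ex P (fun w => f (ev (xs xi (shift s ks)) w)) = Ex P (fun w => f (ev (xs xi ks) w)).

Hypothesis kappa01 : 0 < kappa <= 1.
Hypothesis lam0 : 0 <= lam.
Hypothesis lame : 2 * lam + 1 <= e.
Hypothesis M0 : 0 <= M.
Hypothesis mxi : forall k, mom P e M (xi k).
Hypothesis dec : decoupled.
Hypothesis u_ge0 : forall r, 0 <= u r.
Hypothesis u_cvg0 : u @ \oo --> 0.

(** A triple holds a slope, an intercept and a coordinate. *)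
Definition on_line (t : nat) (s : nat * nat * J) : nat * J := ((s.1.1 * t + s.1.2)%N, s.2).

Definition line_product (L : seq (nat * nat * J * (R -> R))) t w : R :=
  \prod_(l <- L) l.2 (xi (on_line t l.1) w).

Definition line_class A (L : seq (nat * nat * J * (R -> R))) := [seq l <- L | l.1.1.1 == A].

Lemma line_product_bprod L t w :
  line_product L t w = bprod (unzip2 L) (ev (xs xi [seq on_line t l.1 | l <- L]) w).
Proof. by rewrite /line_product /bprod /ev /xs -!map_comp zip_map big_map. Qed.

Lemma blips_filter (p : pred (nat * nat * J * (R -> R))) (L : seq (nat * nat * J * (R -> R))) : blips (unzip2 L) -> blips (unzip2 [seq l <- L | p l]).
Proof.
elim: L => [|l L IH] h; first by [].
have [hl hL] := blips_behead h; rewrite /=; case: (p l); last exact: IH.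
by case=> [|i]//=; exact: IH.
Qed.

Let u_decreasing_line (K : R) (c : nat) : 0 <= K ->
  (fun t => if (0 < (t - c) %/ 3)%N then K * u ((t - c) %/ 3)%N else 2) @ \oo --> 0.
Proof.
move=> K0; apply/cvgrPdist_le => eps eps0.
have : (fun r => K * u r) @ \oo --> 0 by rewrite -[X in _ --> X](mulr0 K); exact: cvgMr.
move=> /cvgrPdist_le/(_ _ eps0)[N _ hN].
exists (c + 3 * N.+1)%N => // t /= ht.
have tN : (N.+1 <= (t - c) %/ 3)%N by rewrite leq_divRL//; lia.
rewrite (leq_ltn_trans _ tN)//; apply: hN => /=; exact: ltnW.
Qed.

Lemma line_product_itg L t : blips (unzip2 L) -> itg P (line_product L t).
Proof.
move=> bL; have [C hC] := bprod_hol kappa01 (lexx 0) bL.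
have e0 : 0 < e by move: lam0 lame; lra.
have -> : line_product L t = (fun w => bprod (unzip2 L) (ev (xs xi [seq on_line t l.1 | l <- L]) w)).
  by apply/funext => w; rewrite line_product_bprod.
by have [] := hol_itg kappa01 (lexx 0) hC (us := xs xi [seq on_line t l.1 | l <- L]) (M := M)
  _ e0 (ltW e0) (moms_map e0 M0 _ mxi); rewrite ?size_map.
Qed.

Lemma norm_line_product L t w : blips (unzip2 L) -> `|line_product L t w| <= 1.
Proof. by move=> bL; rewrite line_product_bprod norm_bprod. Qed.

Lemma norm_Ex_line_product L t : blips (unzip2 L) -> `|Ex P (line_product L t)| <= 1.
Proof.
move=> bL; rewrite -(Ex_cst P 1); apply: norm_Ex_le.
- exact: line_product_itg.
- exact: itg_cst.
- by move=> w; exact: norm_line_product.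
Qed.

(** The factors of the steepest slope N come later than all the others by t up to a constant;
    decoupling with an empty U splits them off. *)
Lemma line_product_step L N : (0 < N)%N -> blips (unzip2 L) -> all (fun l => l.1.1.1 <= N)%N L ->
  exists2 v : nat -> R, v @ \oo --> 0 & forall t,
  `|Ex P (line_product L t) -
    Ex P (line_product [seq l <- L | l.1.1.1 != N] t) * Ex P (line_product (line_class N L) t)| <= v t.
Proof.
move=> N00 bL aL; set L1 := [seq l <- L | _]; set L2 := line_class N L.
have b1 : blips (unzip2 L1) by exact: blips_filter.
have b2 : blips (unzip2 L2) by exact: blips_filter.
have [C1 h1] := bprod_hol kappa01 lam0 b1; have [C2 h2] := bprod_hol kappa01 lam0 b2.
pose C := Num.max C1 C2.
have c1 : C1 <= C by rewrite /C le_max lexx.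
have c2 : C2 <= C by rewrite /C le_max lexx orbT.
have h1' := hol_weaken (lexx lam) c1 h1.
have h2' := hol_weaken (lexx lam) c2 h2.
have [K K0 hK] := dec (size L1) (size L2) C (leq0n N0).
pose c := \sum_(l <- L) l.1.1.2.
(* Lines of slope N and of slope at most N-1 are at least t - c apart, where c bounds all
   intercepts; a third of that is the admissible r. While it is 0, the trivial bound 2 for products
   bounded by 1 is used. *)
exists (fun t => if (0 < (t - c) %/ 3)%N then K * u ((t - c) %/ 3)%N else 2); first exact: u_decreasing_line.
move=> t; have split w : line_product L t w = line_product L1 t w * line_product L2 t w.
  rewrite /line_product (bigID (fun l => l.1.1.1 == N))/= mulrC; congr (_ * _); by rewrite big_filter.
have i1 := line_product_itg t b1; have i2 := line_product_itg t b2.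
case: ifPn => [r0|_]; last first.
  rewrite (le_trans (ler_normB _ _))// normrM (_ : 2 = 1 + 1)//; apply: lerD.
    exact: norm_Ex_line_product.
  by rewrite mulr_ile1// norm_Ex_line_product.
have lec : all (fun l => l.1.1.2 <= c)%N L.
  rewrite /c; elim: (L) => //= l' L' IH; rewrite big_cons leq_addr /=.
  by apply: sub_all IH => l h; rewrite (leq_trans h)// leq_addl.
have tc := third_gap r0.
have E1 L' : [seq on_line t l.1 | l <- L'] = [seq on_line t l | l <- unzip1 L'] by rewrite -map_comp.
have cond (Q : pred (nat * J)) (q : pred (nat * nat * J * (R -> R))) : 
    all (fun l => q l ==> Q (on_line t l.1)) L -> {in [seq on_line t l.1 | l <- L & q l], forall k, Q k}.
  by move=> h; apply/allP; rewrite all_map all_filter.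
have sz L' : size (unzip2 L') = size L' by exact: size_map.
rewrite !sz in h1' h2'.
have := hK ((t - c) %/ 3)%N (N.-1 * t + c)%N [seq on_line t l.1 | l <- L1] [::]
   [seq on_line t l.1 | l <- L2] (bprod (unzip2 L1)) (bprod (unzip2 L2)) r0 (size_map _ _) erefl (size_map _ _).
have hT1 : {in [seq on_line t l.1 | l <- L1], forall k, k.1 <= N.-1 * t + c}%N.
  apply: cond; apply: sub_all (_ : all (fun l => (l.1.1.1 <= N) && (l.1.1.2 <= c))%N L).
    move=> [[[a b] j] phi] /= /andP[aN bc]; apply/implyP => na.
    by apply: leq_add => //; rewrite leq_mul2r; apply/orP; right; move: aN na; rewrite leq_eqVlt => /orP[->//|]; case: (N) N00.
  by rewrite all_predI aL.
have hT2 : {in [seq on_line t l.1 | l <- L2], forall k, N.-1 * t + c + 3 * ((t - c) %/ 3) <= k.1}%N.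
  apply: cond; apply: sub_all (_ : all predT L); last exact: all_predT.
  move=> [[[a b] j] phi] /= _; apply/implyP => /eqP ->.
  apply: (@leq_trans (t + N.-1 * t)%N); last by rewrite -mulSn prednK// leq_addr.
  by rewrite -addnA addnC (addnC c) leq_add2r.
have hT0 : {in [::] : seq (nat * J), forall k, k.1 <= N.-1 * t + c}%N by [].
move=> /(_ hT1 hT0 hT2 h1' h2') /=; apply: le_trans.
have E2 L' : (fun w => bprod (unzip2 L') (ev (xs xi [seq on_line t l.1 | l <- L']) w)) = line_product L' t.
  by apply/funext => w; rewrite line_product_bprod.
rewrite E2; under eq_fun do rewrite -line_product_bprod -line_product_bprod.
have -> : (fun w => line_product L1 t w * (line_product L2 t w - Ex P (line_product L2 t))) =
   (fun w => line_product L t w - Ex P (line_product L2 t) * line_product L1 t w).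
  by apply/funext => w; rewrite split; ring.
rewrite ExB; [|exact: line_product_itg|by apply: itgZ].
by rewrite ExZ// [in leRHS]mulrC.
Qed.

Lemma line_product_factor L N : blips (unzip2 L) -> all (fun l => 0 < l.1.1.1 <= N)%N L ->
  (fun t => Ex P (line_product L t) - \prod_(A < N) Ex P (line_product (line_class A.+1 L) t)) @ \oo --> 0.
Proof.
elim: N L => [|N IH] L bL aL.
  have -> : L = [::] by case: L aL {bL} => // l L /= /andP[]; case: l.1.1.1.
  have E0 t : line_product [::] t = fun=> 1 by apply/funext => w; rewrite /line_product big_nil.
  by under eq_fun do rewrite big_ord0 E0 Ex_cst subrr; exact: cvg_cst.
have aN : all (fun l => l.1.1.1 <= N.+1)%N L by apply: sub_all aL => l /andP[].
have [v v0 vP] := line_product_step (ltn0Sn N) bL aN; set L1 := [seq l <- L | _] in vP.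
have bL1 : blips (unzip2 L1) by exact: blips_filter.
have aL1 : all (fun l => 0 < l.1.1.1 <= N)%N L1.
  rewrite all_filter; apply: sub_all aL => l /andP[l0 lN]; apply/implyP => ln.
  by rewrite l0 -ltnS ltn_neqAle ln.
have {}IH := IH _ bL1 aL1.
have cE A : (A < N)%N -> line_class A.+1 L1 = line_class A.+1 L.
  move=> AN; rewrite /line_class /L1 -filter_predI; apply: eq_filter => l /=.
  by case: eqP => //= ->; rewrite eqSS ltn_eqF.
have : (fun t => v t + `|Ex P (line_product L1 t) -
    \prod_(A < N) Ex P (line_product (line_class A.+1 L1) t)|) @ \oo --> 0.
  rewrite -[X in _ --> X](addr0 0); apply: cvgD => //; rewrite -[X in _ --> X](normr0 R).
  exact: cvg_norm.
apply: squeeze_dist => t; rewrite subr0 big_ord_recr /=.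
have -> : \prod_(A < N) Ex P (line_product (line_class A.+1 L) t) =
   \prod_(A < N) Ex P (line_product (line_class A.+1 L1) t).
  by apply: eq_bigr => A _; rewrite cE.
set a := Ex P (line_product L t); set b := Ex P (line_product L1 t).
set x := Ex P (line_product _ t); set y := \prod_(A < N) _.
have -> : a - y * x = (a - b * x) + (b - y) * x by ring.
rewrite (le_trans (ler_normD _ _))// lerD//; first exact: vP.
rewrite normrM ler_piMr//; apply: norm_Ex_line_product; exact: blips_filter.
Qed.

Lemma line_class_shift A L t : [seq on_line t l.1 | l <- line_class A L] =
  shift (A * t) [seq on_line 0 l.1 | l <- line_class A L].
Proof.
rewrite /shift -map_comp /line_class; elim: L => //= l L IH; case: ifP => [/eqP lA|//].
by rewrite /= IH /on_line lA muln0 add0n addnC.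
Qed.

(** Different slopes become independent, while advancing t translates a single slope class rigidly,
    so by stationarity each factor is constant in t. *)
Lemma line_product_cvg L N : blips (unzip2 L) -> all (fun l => 0 < l.1.1.1 <= N)%N L ->
  (forall A, shift_invariant [seq on_line 0 l.1 | l <- line_class A L]) ->
  (fun t => Ex P (line_product L t)) @ \oo -->
    \prod_(A < N) Ex P (line_product (line_class A.+1 L) 0).
Proof.
move=> bL aL sL; have := line_product_factor bL aL.
have e0 : 0 < e by move: lam0 lame; lra.
have E A t : Ex P (line_product (line_class A L) t) = Ex P (line_product (line_class A L) 0).
  have b2 : blips (unzip2 (line_class A L)) by exact: blips_filter.
  have [C hC] := bprod_hol kappa01 (lexx 0) b2.
  have E2 t' : line_product (line_class A L) t' = (fun w => bprod (unzip2 (line_class A L))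
      (ev (xs xi [seq on_line t' l.1 | l <- line_class A L]) w)).
    by apply/funext => w; rewrite line_product_bprod.
  rewrite !E2 line_class_shift; apply: (sL A _ C 0 _ (lexx 0) (ltW e0)).
  by move: hC; rewrite !size_map.
under eq_fun do under eq_bigr do rewrite E; set y := \prod_(A < N) _ => h.
by apply/subr_cvg0.
Qed.

Variables (S : seq (nat * nat * J)) (N : nat).
Hypothesis S_slopes : all (fun s => 0 < s.1.1 <= N)%N S.
Hypothesis S_stat : forall A, shift_invariant [seq on_line 0 s | s <- S & s.1.1 == A].

Let us t := xs xi [seq on_line t s | s <- S].
Let sus t : size (us t) = size S. Proof. by rewrite !size_map. Qed.
Let e0 : 0 < e. Proof. by move: lam0 lame; lra. Qed.
Let mus t : moms P e M (us t). Proof. exact: moms_map. Qed.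

Let lineE phis t : size phis = size S ->
  (fun w => bprod phis (ev (us t) w)) = line_product (zip S phis) t.
Proof.
move=> sp; apply/funext => w; rewrite line_product_bprod /us unzip2_zip ?sp//; congr (bprod _ (ev (xs xi _) w)).
rewrite -[S in LHS](@unzip1_zip _ _ S phis) ?sp// -map_comp; exact: eq_map.
Qed.

Let all_zip (Q : pred (nat * nat * J)) (phis : seq (R -> R)) : size phis = size S ->
  all (fun l => Q l.1) (zip S phis) = all Q S.
Proof. by move=> sp; rewrite -[S in RHS](@unzip1_zip _ _ S phis) ?sp// all_map. Qed.

Let filter_zip (Q : pred (nat * nat * J)) (phis : seq (R -> R)) : size phis = size S ->
  unzip1 [seq l <- zip S phis | Q l.1] = [seq s <- S | Q s].
Proof.
by move=> sp; rewrite -[S in RHS](@unzip1_zip _ _ S phis) ?sp// filter_map.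
Qed.

Let products_cvg phis : size phis = size S -> blips phis ->
  (fun t => Ex P (fun w => bprod phis (ev (us t) w))) @ \oo -->
    \prod_(A < N) Ex P (line_product (line_class A.+1 (zip S phis)) 0).
Proof.
move=> sp bp; have -> : (fun t => Ex P (fun w => bprod phis (ev (us t) w))) =
  (fun t => Ex P (line_product (zip S phis) t)) by apply/funext => t; rewrite lineE.
apply: line_product_cvg.
- by rewrite unzip2_zip// sp.
- by rewrite (all_zip (fun s => 0 < s.1.1 <= N)%N sp).
- move=> A; rewrite (_ : [seq on_line 0 l.1 | l <- _] = [seq on_line 0 s | s <- S & s.1.1 == A])//.
  by rewrite -(filter_zip (fun s => s.1.1 == A) sp) -map_comp.
Qed.

Lemma line_cvg f l C : 0 <= l -> l + 1 <= e -> hol kappa (size S) l C f ->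
  exists L : R, (fun t => Ex P (fun w => f (ev (us t) w))) @ \oo --> L.
Proof.
move=> l0 le hf; apply: (hol_cvg_of_products kappa01 l0 le mus sus hf) => phis sp bp.
by eexists; exact: products_cvg.
Qed.

(** Identifies the limit law: it suffices that [us'] has the product law over slope classes on the
    product test functions. *)
Lemma line_cvg_to d' (T' : measurableType d') (P' : probability T' R) (us' : seq (T' -> R)) f l C :
  0 <= l -> l + 1 <= e -> hol kappa (size S) l C f ->
  moms P' e M us' -> size us' = size S ->
  (forall phis, size phis = size S -> blips phis -> Ex P' (fun w => bprod phis (ev us' w)) =
     \prod_(A < N) Ex P (line_product (line_class A.+1 (zip S phis)) 0)) ->
  (fun t => Ex P (fun w => f (ev (us t) w))) @ \oo --> Ex P' (fun w => f (ev us' w)).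
Proof.
move=> l0 le hf mus' sus' hE; apply: (hol_cvg_of_products_to kappa01 l0 le mus sus mus' sus' hf) => phis sp bp.
by rewrite hE//; exact: products_cvg.
Qed.

End line_limits.

(** * Blocks of coordinates with a common slope *)

Section blocks.
Variables (J : eqType) (al be : nat -> nat) (off : nat -> seq nat) (Js : seq J).

Definition blk l n : seq (nat * J) := [seq ((al l * n + be l + o)%N, j) | o <- off l, j <- Js].

Fixpoint blks i n := if i is i'.+1 then blks i' n ++ blk i' n else [::].

Fixpoint blks_size i := if i is i'.+1 then (blks_size i' + size (off i') * size Js)%N else 0%N.

(** The block at the moving time n + c t, as lines in t: n goes into the intercept and c into the
    slope. *)
Definition line_blk l c n : seq (nat * nat * J) :=
  [seq ((al l * c, al l * n + be l + o)%N, j) | o <- off l, j <- Js].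

Fixpoint line_blks i c n := if i is i'.+1 then line_blks i' c n ++ line_blk i' c n else [::].

Lemma size_blk l n : size (blk l n) = (size (off l) * size Js)%N.
Proof. exact: size_allpairs. Qed.

Lemma size_blks i n : size (blks i n) = blks_size i.
Proof. by elim: i => //= i IH; rewrite size_cat IH size_blk. Qed.

Lemma size_line_blks i c n : size (line_blks i c n) = blks_size i.
Proof. by elim: i => //= i IH; rewrite size_cat IH size_allpairs. Qed.

Lemma blk_shift l n : blk l n = shift (al l * n) (blk l 0).
Proof.
rewrite /shift /blk map_allpairs; apply: eq_allpairs => // o j; congr (_, _) => /=.
by rewrite muln0 add0n -addnA addnC.
Qed.

Lemma on_line_blks i c n t : [seq on_line t s | s <- line_blks i c n] = blks i (n + c * t).
Proof.
elim: i => //= i IH; rewrite map_cat IH; congr (_ ++ _).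
rewrite /blk /line_blk map_allpairs; apply: eq_allpairs => // o j; congr (_, _) => /=.
by rewrite mulnDr mulnA [(al i * n + al i * c * t)%N]addnC -!addnA.
Qed.

Lemma mem_line_blks i c n s : s \in line_blks i c n ->
  exists l, (l < i)%N /\ exists2 o, o \in off l & s.1 = (al l * c, al l * n + be l + o)%N.
Proof.
elim: i => //= i IH; rewrite mem_cat => /orP[/IH[l [li ho]]|].
  by exists l; split => //; exact: ltnW.
by move=> /allpairsP[[x j] [hx _ ->]] /=; exists i; split => //; exists x.
Qed.

Variables (k : nat) (D : seq nat).
Hypothesis al_incr : forall l l', (l < l')%N -> (l' < k)%N -> (al l < al l')%N.
Hypothesis off_D : forall l, (l < k)%N -> {subset off l <= D}.

Let al_inj l l' : (l < k)%N -> (l' < k)%N -> al l = al l' -> l = l'.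
Proof.
move=> lk l'k e; case: (ltngtP l l') => // h.
  by have := al_incr h l'k; rewrite e ltnn.
by have := al_incr h lk; rewrite e ltnn.
Qed.

(** Slopes of distinct blocks differ, so one slope class comes from one block and its intercepts lie
    in one translate of D. Two such families thus involve at most 2|D| times, exactly what the joint
    stationarity covers. *)
Lemma line_blks_class i c n A : (i <= k)%N -> (0 < c)%N -> exists a,
  {in line_blks i c n, forall s, s.1.1 = A -> s.1.2 \in [seq (a + d)%N | d <- D]}.
Proof.
move=> ik c0; have [[l [lk lA]]|nex] := pselect (exists l, (l < k)%N /\ (al l * c)%N = A).
  exists (al l * n + be l)%N => s /mem_line_blks[l' [l'i [x hx ->]]] /= l'A.
  have l'k := leq_trans l'i ik.
  have <- : l' = l.
    by apply: al_inj => //; apply/eqP; rewrite -(eqn_pmul2r c0) l'A lA.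
  by apply: map_f; exact: (off_D l'k).
exists 0%N => s /mem_line_blks[l' [l'i [x hx ->]]] /= l'A; exfalso; apply: nex.
by exists l'; split => //; exact: leq_trans ik.
Qed.

End blocks.

(** * Weighted summability under changes of the index *)

Section weighted_summability.
Variable R : realType.
Implicit Types a : nat -> R.

Lemma sum_blocks (F : nat -> R) (B N : nat) :
  \sum_(n < N * B) F n = \sum_(r < N) \sum_(j < B) F (r * B + j)%N.
Proof.
elim: N => [|N IH]; first by rewrite !big_ord0.
by rewrite mulSnr big_split_ord/= IH big_ord_recr.
Qed.

Lemma summable_divn a (B : nat) : (forall n, 0 <= a n) -> (0 < B)%N ->
  summable (fun n => n.+1%:R * a n) -> summable (fun n => n.+1%:R * a (n %/ B)%N).
Proof.
move=> a0 B0 [S hS]; exists (B%:R * B%:R * S) => N.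
apply: (@le_trans _ _ (\sum_(n < N * B) n.+1%:R * a (n %/ B)%N)).
  rewrite -(subnKC (leq_pmulr N B0)) big_split_ord/= lerDl.
  by apply: sumr_ge0 => i _; rewrite mulr_ge0.
rewrite (sum_blocks (fun n => n.+1%:R * a (n %/ B)%N)).
apply: (@le_trans _ _ (\sum_(r < N) B%:R * B%:R * (r.+1%:R * a r))); last first.
  by rewrite -mulr_sumr ler_wpM2l// mulr_ge0.
apply: ler_sum => r _; apply: (@le_trans _ _ (\sum_(j < B) B%:R * (r.+1%:R * a r))).
  apply: ler_sum => j _; rewrite divnMDl// divn_small// addn0 mulrA ler_wpM2r//.
  by rewrite -natrM ler_nat mulnS [(B * r)%N]mulnC addnC -addSn leq_add2r.
by rewrite sumr_const card_ord -[leLHS]mulr_natl !mulrA.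
Qed.

Lemma summable_subn a (c : nat) : (forall n, 0 <= a n) ->
  summable (fun n => n.+1%:R * a n) -> summable (fun n => n.+1%:R * a (n - c)%N).
Proof.
move=> a0 [S hS]; exists (\sum_(n < c) n.+1%:R * a 0%N + c.+1%:R * S) => N.
apply: (@le_trans _ _ (\sum_(n < c + N) n.+1%:R * a (n - c)%N)).
  rewrite addnC big_split_ord/= lerDl.
  by apply: sumr_ge0 => i _; rewrite mulr_ge0.
rewrite big_split_ord/=; apply: lerD.
  by apply: ler_sum => i _; rewrite (_ : (i - c = 0)%N)//; apply/eqP; rewrite subn_eq0 ltnW.
apply: (@le_trans _ _ (\sum_(r < N) c.+1%:R * (r.+1%:R * a r))); last first.
  by rewrite -mulr_sumr ler_wpM2l.
apply: ler_sum => r _; rewrite addKn mulrA ler_wpM2r// -natrM ler_nat mulSn.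
by rewrite -addnS addnC leq_add2l leq_pmulr.
Qed.

Lemma summable_muln a (B : nat) : (forall n, 0 <= a n) -> (0 < B)%N ->
  summable (fun n => n.+1%:R * a n) -> summable (fun n => n.+1%:R * a (B * n)%N).
Proof.
move=> a0 B0 [S hS]; exists S => N.
have := @sum_inj_tail R nat (iota 0 N) (fun n => (B * n)%N) (fun n => n.+1%:R * a n) 0 S.
move=> H; apply: le_trans (H _ (iota_uniq 0 N) _ _ _).
- rewrite -(big_mkord xpredT (fun n => n.+1%:R * a (B * n)%N)) /index_iota.
  rewrite subn0; apply: ler_sum => n _; rewrite ler_wpM2r// ler_nat ltnS leq_pmull//.
- by move=> h; rewrite mulr_ge0.
- by move=> x y _ _ /eqP; rewrite eqn_pmul2l// => /eqP.
- by move=> i _.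
- by move=> N'; under eq_bigl do rewrite leq0n; exact: hS.
Qed.

Lemma summable_unweight a : (forall n, 0 <= a n) -> summable (fun n => n.+1%:R * a n) -> summable a.
Proof. by move=> a0; apply: summable_le => n; rewrite ler_peMl// ler1n. Qed.

End weighted_summability.

Lemma uniform_bound (R : realType) (k : nat) (Q : nat -> R -> Prop) :
  (forall i C C', C <= C' -> Q i C -> Q i C') ->
  (forall i, (i < k)%N -> exists C, Q i C) -> exists2 C, 0 <= C & forall i, (i < k)%N -> Q i C.
Proof.
move=> mQ; elim: k => [|k IH] h; first by exists 0.
have [C C0 hC] := IH (fun i ik => h i (ltnW ik)); have [C' hC'] := h k (ltnSn k).
exists (Num.max C C'); first by rewrite le_max C0.
move=> i; rewrite ltnS leq_eqVlt => /orP[/eqP->|/hC]; last by apply: mQ; rewrite le_max lexx.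
by apply: mQ hC'; rewrite le_max lexx orbT.
Qed.

Lemma cvg0_comp_large (R : realType) (v : nat -> R) (phi : nat -> nat) (K : nat) :
  v @ \oo --> 0 -> (forall n, n <= phi n + K)%N -> (v \o phi) @ \oo --> 0.
Proof.
move=> /cvgrPdist_le v0 hphi; apply/cvgrPdist_le => eps eps0.
have [N _ hN] := v0 _ eps0; exists (N + K)%N => // n /= nN; apply: hN => /=.
by have := leq_trans nN (hphi n); rewrite leq_add2r.
Qed.

Lemma cvg_sum0 (R : realType) (I : Type) (s : seq I) (Q : pred I) (f : I -> nat -> R) :
  (forall i, Q i -> f i @ \oo --> 0) -> (fun n => \sum_(i <- s | Q i) f i n) @ \oo --> 0.
Proof.
move=> hf; elim: s => [|i s IH]; first by under eq_fun do rewrite big_nil; exact: cvg_cst.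
have [Qi|/negbTE Qi] := boolP (Q i); under eq_fun do rewrite big_cons Qi; last exact: IH.
by have h := cvgD (hf i Qi) IH; rewrite addr0 in h; exact: h.
Qed.

Lemma cvgn_ge0 (R : realType) (f : nat -> R) (l : R) : (forall n, 0 <= f n) -> f @ \oo --> l -> 0 <= l.
Proof.
move=> f0 cf; rewrite -(cvg_lim _ cf)//; apply: limr_ge; first exact: cvgP cf.
by apply: nearW.
Qed.

Lemma le_cvgn (R : realType) (f g : nat -> R) (l l' : R) : f @ \oo --> l -> g @ \oo --> l' ->
  (forall n, f n <= g n) -> l <= l'.
Proof.
move=> cf cg fg; rewrite -subr_ge0; apply: (cvgn_ge0 _ (cvgB cg cf)) => n.
by rewrite subr_ge0.
Qed.

Lemma exchange_square_sums (R : realType) (I I' J J' : Type) (r : seq I) (r' : seq I')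
    (s : seq J) (s' : seq J') (F : I -> I' -> J -> J' -> R) :
  \sum_(n <- r) \sum_(m <- r') \sum_(i <- s) \sum_(j <- s') F n m i j =
  \sum_(i <- s) \sum_(j <- s') \sum_(n <- r) \sum_(m <- r') F n m i j.
Proof.
under eq_bigr do rewrite exchange_big/=.
rewrite exchange_big/=; apply: eq_bigr => i _.
under eq_bigr do rewrite exchange_big/=.
by rewrite exchange_big.
Qed.

(** * Variance of sums of a function of k blocks *)

Section block_system.
Context {d : measure_display} {T : measurableType d} {R : realType}.
Variables (P : probability T R) (J : eqType) (xi : nat * J -> T -> R).
Variables (kappa lam e M : R) (N0 : nat) (u : nat -> R).
Variables (al be : nat -> nat) (off : nat -> seq nat) (Js : seq J) (k : nat) (D : seq nat).
Hypothesis kappa01 : 0 < kappa <= 1.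
Hypothesis lam0 : 0 <= lam.
Hypothesis lame : 2 * lam + 1 <= e.
Hypothesis M0 : 0 <= M.
Hypothesis mxi : forall k, mom P e M (xi k).
Hypothesis dec : decoupled P xi kappa lam N0 u.
Hypothesis u_ge0 : forall r, 0 <= u r.
Hypothesis u_sum : summable (fun n => n.+1%:R * u n).
Hypothesis al_gt0 : forall l, (l < k)%N -> (0 < al l)%N.
Hypothesis al_incr : forall l l', (l < l')%N -> (l' < k)%N -> (al l < al l')%N.
Hypothesis off_D : forall l, (l < k)%N -> {subset off l <= D}.
Hypothesis stat : forall ks a a',
  {in ks, forall q, q.1 \in [seq (a + x)%N | x <- D] ++ [seq (a' + x)%N | x <- D]} ->
  shift_invariant P xi kappa e ks.

Let u_cvg0 : u @ \oo --> 0.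
Proof. exact/summable_vanishes/summable_unweight. Qed.
Let e0 : 0 < e. Proof. by move: lam0 lame; lra. Qed.

Local Notation bks := (blks al be off Js).
Local Notation lbks := (line_blks al be off Js).

Lemma line_blks_stat i c n i' c' n' A : (i <= k)%N -> (i' <= k)%N -> (0 < c)%N -> (0 < c')%N ->
  shift_invariant P xi kappa e [seq on_line 0 s | s <- lbks i c n ++ lbks i' c' n' & s.1.1 == A].
Proof.
move=> ik i'k c0 c'0.
have [a ha] := @line_blks_class J al be off Js k D al_incr off_D i c n A ik c0.
have [a' ha'] := @line_blks_class J al be off Js k D al_incr off_D i' c' n' A i'k c'0.
apply: (stat (a := a) (a' := a')) => _ /mapP[s + ->]; rewrite mem_filter => /andP[/eqP sA].
rewrite /on_line /= muln0 add0n mem_cat [in X in _ -> X]mem_cat.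
by move=> /orP[/ha/(_ sA)->//|/ha'/(_ sA)->]; rewrite orbT.
Qed.

Lemma line_blks_slopes i c n : (i <= k)%N -> (0 < c)%N ->
  all (fun s => 0 < s.1.1 <= c * \sum_(l < k) al l)%N (lbks i c n).
Proof.
move=> ik c0; apply/allP => s /mem_line_blks[l [li [x hx ->]]] /=.
have lk := leq_trans li ik; rewrite muln_gt0 al_gt0// c0 mulnC leq_pmul2l//=.
by rewrite (bigD1 (Ordinal lk))//= leq_addr.
Qed.

Let slopes2 i c n i' c' n' : (i <= k)%N -> (i' <= k)%N -> (0 < c)%N -> (0 < c')%N ->
  all (fun s => 0 < s.1.1 <= (c + c') * \sum_(l < k) al l)%N (lbks i c n ++ lbks i' c' n').
Proof.
move=> ik i'k c0 c'0; rewrite all_cat; apply/andP; split.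
  apply: sub_all (line_blks_slopes n ik c0) => s /andP[-> h]/=.
  by rewrite (leq_trans h)// leq_mul2r leq_addr orbT.
apply: sub_all (line_blks_slopes n' i'k c'0) => s /andP[-> h]/=.
by rewrite (leq_trans h)// leq_mul2r leq_addl orbT.
Qed.

Lemma blks_line_cvg i c n i' c' n' f l C : (i <= k)%N -> (i' <= k)%N -> (0 < c)%N -> (0 < c')%N ->
  0 <= l -> l + 1 <= e -> hol kappa (blks_size off Js i + blks_size off Js i') l C f ->
  exists L : R, (fun t => Ex P (fun w => f (ev (xs xi (bks i (n + c * t)%N)) w ++
                                           ev (xs xi (bks i' (n' + c' * t)%N)) w))) @ \oo --> L.
Proof.
move=> ik i'k c0 c'0 l0 le hf.
have := @line_cvg _ _ _ P J xi kappa lam e M N0 u kappa01 lam0 lame M0 mxi dec u_cvg0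
  (lbks i c n ++ lbks i' c' n') _ (slopes2 n n' ik i'k c0 c'0)
  (fun A => line_blks_stat (n := n) (n' := n') (A := A) ik i'k c0 c'0) f l C l0 le.
rewrite size_cat !size_line_blks => /(_ hf)[L hL]; exists L.
rewrite (_ : (fun t => _) = (fun t => Ex P (fun w => f (ev (xs xi [seq on_line t s |
  s <- lbks i c n ++ lbks i' c' n']) w))))//; apply/funext => t.
by congr Ex; apply/funext => w; rewrite map_cat !on_line_blks /xs map_cat ev_cat.
Qed.


Hypothesis N0_ge : forall i, (i < k)%N -> (blks_size off Js i <= N0)%N.
Variables (Gf : seq R -> R) (C : R).
Hypothesis hG : hol kappa (blks_size off Js k) lam C Gf.

Local Notation bk := (blk al be off Js).
Local Notation nsz := (blks_size off Js).

(** Integrates out the last s blocks one after the other, each against its own law; by stationarity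
    time 0 stands for any time. *)
Fixpoint partial_integral s x :=
  if s is s'.+1 then Ex P (fun w => partial_integral s' (x ++ ev (xs xi (bk (k - s'.+1) 0)) w)) else Gf x.

Let gb i := partial_integral (k - i).

Let gb_step i x : (i < k)%N -> gb i x = Ex P (fun w => gb i.+1 (x ++ ev (xs xi (bk i 0)) w)).
Proof. by move=> ik; rewrite /gb -(subnSK ik) /= subnSK// subKn// ltnW. Qed.

Let size_xs_blk i n : size (xs xi (bk i n)) = (size (off i) * size Js)%N.
Proof. by rewrite size_map size_blk. Qed.

Let moms_xs ks : moms P e M (xs xi ks). Proof. exact: moms_map. Qed.

Let lam_e : lam <= e. Proof. by move: lam0 lame; lra. Qed.

Lemma partial_integral_hol : exists2 Cb, 0 <= Cb & forall i, (i < k.+1)%N -> hol kappa (nsz i) lam Cb (gb i).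
Proof.
apply: uniform_bound => [i C1 C2 C12|]; first exact: hol_weaken.
suff H s : (s <= k)%N -> exists C1, hol kappa (nsz (k - s)) lam C1 (gb (k - s)).
  by move=> i ik; have := H (k - i)%N (leq_subr _ _); rewrite subKn.
elim: s => [_|s IH sk]; first by exists C; rewrite subn0 /gb subnn.
have ik : (k - s.+1 < k)%N by rewrite ltn_subrL (leq_ltn_trans _ sk).
have [C1 h1] := IH (ltnW sk); move: h1; rewrite -(subnSK sk); set i := (k - s.+1)%N => h1.
exists (C1 * wtC (size (off i) * size Js) e M).
rewrite (_ : gb i = (fun x => Ex P (fun w => gb i.+1 (x ++ ev (xs xi (bk i 0)) w)))).
  exact: (hol_mean kappa01 lam0 h1 (size_xs_blk i 0) e0 lam_e (@moms_xs _)).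
by apply/funext => x; exact: gb_step.
Qed.

(** The analogue of a martingale difference: a function of blocks 0 to i whose average over block i
    vanishes; [select] forgets the last block. *)
Let gt i x := gb i.+1 x - gb i (select (iota 0 (nsz i)) x).

Let gt_hol : exists2 Ct, 0 <= Ct & forall i, (i < k)%N -> hol kappa (nsz i.+1) lam Ct (gt i).
Proof.
apply: uniform_bound => [i C1 C2 C12|i ik]; first exact: hol_weaken.
have [Cb _ hb] := partial_integral_hol.
exists (Cb + Cb * (nsz i).+1%:R `^ (lam + 1)); apply: holB => //; first exact: hb.
by apply: (hol_select kappa01 _ lam0 (size_iota _ _)); apply: hb; rewrite ltnS ltnW.
Qed.

Definition block_fun n w := Gf (ev (xs xi (bks k n)) w).

Let Gt i n w := gt i (ev (xs xi (bks i.+1 n)) w).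

Let ev_blks_step i n w : ev (xs xi (bks i.+1 n)) w = ev (xs xi (bks i n)) w ++ ev (xs xi (bk i n)) w.
Proof. by rewrite /= /xs map_cat ev_cat. Qed.

Let size_xs_bks i n : size (xs xi (bks i n)) = nsz i.
Proof. by rewrite size_map size_blks. Qed.

Let size_ev_bks i n w : size (ev (xs xi (bks i n)) w) = nsz i.
Proof. by rewrite size_ev size_xs_bks. Qed.

Let GtE i n w : Gt i n w = gb i.+1 (ev (xs xi (bks i.+1 n)) w) - gb i (ev (xs xi (bks i n)) w).
Proof. by rewrite /Gt /gt ev_blks_step select_catl// size_ev_bks. Qed.

Let Gt_sum n w : gb 0 [::] = 0 -> block_fun n w = \sum_(i < k) Gt i n w.
Proof.
move=> g0; have H i : gb i (ev (xs xi (bks i n)) w) = \sum_(l < i) Gt l n w.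
  by elim: i => [|i IH]; [rewrite big_ord0|rewrite big_ord_recr/= -IH GtE addrC subrK].
by rewrite -H /block_fun /gb subnn.
Qed.

Let c0 := (\sum_(l < k) (be l + \sum_(x <- off l) x))%N.

Let blk_time l n q : (l < k)%N -> q \in bk l n -> (al l * n <= q.1 <= al l * n + c0)%N.
Proof.
move=> lk /allpairsP[[x j] [hx _ ->]] /=; rewrite -addnA leq_addr leq_add2l /c0.
rewrite (bigD1 (Ordinal lk))//= -addnA leq_add2l (leq_trans _ (leq_addr _ _))//.
by rewrite (big_rem x)//= leq_addr.
Qed.

Let blks_time i n q : (i <= k)%N -> q \in bks i n ->
  exists2 l, (l < i)%N & (al l * n <= q.1 <= al l * n + c0)%N.
Proof.
elim: i => //= i IH ik; rewrite mem_cat => /orP[/IH[|l li h]|/(blk_time ik) h]; first exact: ltnW.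
  by exists l => //; exact: ltnW.
by exists i.
Qed.

(** [decoupling] with U the earlier blocks at the same n, W the i-th block and T0 = al_i n - 3r.
    Slopes are increasing integers, so earlier blocks sit before (al_i - 1) n + c0, whence the
    condition c0 + 3r <= n. *)
Let decouple nH i Ch : (i < k)%N -> exists2 K : R, 0 <= K & forall r n tH h, (0 < r)%N ->
  size tH = nH -> {in tH, forall q, q.1 + 3 * r <= al i * n}%N -> (c0 + 3 * r <= n)%N ->
  hol kappa nH lam Ch h -> `|Ex P (fun w => h (ev (xs xi tH) w) * Gt i n w)| <= K * u r.
Proof.
move=> ik; have [Cb Cb0 hb] := partial_integral_hol.
have [K K0 hK] := dec nH (size (off i) * size Js)%N (Num.max Cb Ch) (N0_ge ik).
exists K => // r n tH h r0 stH hT hn hh.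
have r3 : (3 * r <= al i * n)%N.
  by rewrite (leq_trans (leq_trans (leq_addl c0 _) hn))// leq_pmull// al_gt0.
have hh' : hol kappa nH lam (Num.max Cb Ch) h by apply: hol_weaken hh; rewrite // le_max lexx orbT.
have hb' : hol kappa (nsz i + size (off i) * size Js) lam (Num.max Cb Ch) (gb i.+1).
  by apply: hol_weaken (hb i.+1 _); rewrite // le_max lexx.
have := hK r (al i * n - 3 * r)%N tH (bks i n) (bk i n) h (gb i.+1) r0 stH
  (size_blks _ _ _ _ _ _) (size_blk _ _ _ _ _ _) _ _ _ hh' hb'.
have -> : (fun w => h (ev (xs xi tH) w) * (gb i.+1 (ev (xs xi (bks i n)) w ++ ev (xs xi (bk i n)) w) -
    Ex P (fun w' => gb i.+1 (ev (xs xi (bks i n)) w ++ ev (xs xi (bk i n)) w')))) =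
  (fun w => h (ev (xs xi tH) w) * Gt i n w).
  (* [gb i] averages over the block at time 0; stationarity moves that block to time n. *)
  apply/funext => w; rewrite GtE ev_blks_step; congr (_ * (_ - _)); rewrite gb_step// blk_shift.
  have hs := hol_section (u := ev (xs xi (bks i n)) w) lam0 (size_ev_bks i n w) (hb i.+1 ik).
  have := @stat (bk i 0) (be i) (be i) _ (al i * n)%N _ lam _ lam0 lam_e.
  rewrite size_blk => /(_ _ _ _ hs); apply=> q /allpairsP[[x j] [hx _ ->]] /=.
  by rewrite muln0 add0n mem_cat map_f// (off_D ik).
apply.
- by move=> q /hT h0; rewrite leq_subRL// addnC.
- move=> q /(blks_time (ltnW ik))[l li /andP[_ h0]]; rewrite leq_subRL//.
  apply: (@leq_trans (3 * r + (al l * n + c0))%N); first by rewrite leq_add2l.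
  rewrite addnCA (leq_trans (_ : _ <= al l * n + n)%N)//; first by rewrite leq_add2l addnC.
  by rewrite addnC -mulSn leq_mul2r al_incr ?orbT.
- by move=> q /(blk_time ik)/andP[h0 _]; rewrite subnK.
Qed.


Let Gt_sqr : exists2 K, 0 <= K & forall i, (i < k)%N -> forall n,
  l2 P (Gt i n) /\ Ex P (fun w => Gt i n w ^+ 2) <= K.
Proof.
have [Ct Ct0 ht] := gt_hol.
apply: uniform_bound => [i C1 C2 C12 h n|i ik].
  by have [? h1] := h n; split => //; exact: le_trans C12.
exists (2 * Ct * Ct * wtC (nsz i.+1) e M) => n.
have h := ht i ik; have le2 : lam + lam <= e by move: lame; lra.
have := holM lam0 lam0 h h => h2.
have [i2 E2] := hol_itg kappa01 (addr_ge0 lam0 lam0) h2 (size_xs_bks i.+1 n) e0 le2 (@moms_xs _).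
have E x : gt i x * gt i x = gt i x ^+ 2 by rewrite expr2.
split; first split.
- exact: (holder_measurable kappa01 lam0 h (size_xs_bks i.+1 n) (moms_mseq (@moms_xs _))).
- by move: i2; congr itg; apply/funext => w; rewrite E.
- apply: le_trans E2; rewrite le_eqVlt; apply/orP; left; apply/eqP; congr Ex; apply/funext => w.
  by rewrite E ger0_norm// sqr_ge0.
Qed.

Let lG i n : (i < k)%N -> l2 P (Gt i n).
Proof. by move=> ik; have [K _ h] := Gt_sqr; case: (h i ik n). Qed.

(** The condition h <= n separates the i-th block at time n from its own predecessors, and al_j m +
    h <= al_i n separates it from the other factor. *)
Let covariance_bound : exists v : nat -> R, [/\ forall h, 0 <= v h,
  summable (fun h => h.+1%:R * v h),
  forall i j n m h, (i < k)%N -> (j < k)%N -> (h <= n)%N -> (al j * m + h <= al i * n)%N ->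
    `|Ex P (fun w => Gt j m w * Gt i n w)| <= v h &
  forall i n, (i < k)%N -> `|Ex P (Gt i n)| <= v n].
Proof.
have [Ct Ct0 ht] := gt_hol; have [K2 K20 hK2] := Gt_sqr.
have [K K0 hK] : exists2 K, 0 <= K & forall i, (i < k)%N -> forall j, (j < k)%N ->
    forall r n tH h, (0 < r)%N ->
    size tH = nsz j.+1 -> {in tH, forall q, q.1 + 3 * r <= al i * n}%N -> (c0 + 3 * r <= n)%N ->
    hol kappa (nsz j.+1) lam Ct h -> `|Ex P (fun w => h (ev (xs xi tH) w) * Gt i n w)| <= K * u r.
  apply: uniform_bound => [i C1 C2 C12 h j jk r n tH h' *|i ik].
    by apply: (le_trans (h j jk r n tH h' _ _ _ _ _)) => //; rewrite ler_wpM2r.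
  have [K _ h] : exists2 K, 0 <= K & forall j, (j < k)%N -> forall r n tH h, (0 < r)%N ->
    size tH = nsz j.+1 -> {in tH, forall q, q.1 + 3 * r <= al i * n}%N -> (c0 + 3 * r <= n)%N ->
    hol kappa (nsz j.+1) lam Ct h -> `|Ex P (fun w => h (ev (xs xi tH) w) * Gt i n w)| <= K * u r.
    apply: uniform_bound => [j C1 C2 C12 h r n tH h' *|j jk].
      by apply: (le_trans (h r n tH h' _ _ _ _ _)) => //; rewrite ler_wpM2r.
    by have [K _ h] := @decouple (nsz j.+1) i Ct ik; exists K.
  by exists K.
have [K1 K10 hK1] : exists2 K, 0 <= K & forall i, (i < k)%N -> forall r n, (0 < r)%N ->
    (c0 + 3 * r <= n)%N -> `|Ex P (Gt i n)| <= K * u r.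
  apply: uniform_bound => [i C1 C2 C12 h r n *|i ik].
    by apply: (le_trans (h r n _ _)) => //; rewrite ler_wpM2r.
  have [K1 _ h] := @decouple 0 i `|1| ik; exists K1 => r n r0 rn.
  have := h r n [::] (fun=> 1) r0 erefl _ rn (hol_cst kappa 0 1 lam0).
  by under [X in Ex P X]eq_fun do rewrite mul1r; apply.
(* At r = 0 no decoupling is available, and second moments give the bound. *)
pose vv r := (K + K1) * u r + (if r == 0%N then 2 * K2 + 1 else 0).
have vv0 r : 0 <= vv r.
  by apply: addr_ge0; [apply: mulr_ge0 => //; exact: addr_ge0|case: ifP => // _; move: K20; lra].
(* Of a gap h, the amount c0 is lost to intercepts and offsets, and a third of the rest is the r of
   the decoupling. *)
exists (fun h => vv ((h - c0) %/ 3)%N); split=> //.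
- have svv : summable (fun n => n.+1%:R * vv n).
    rewrite (_ : (fun n => _) = (fun n => (K + K1) * (n.+1%:R * u n) + (if n == 0%N then 2 * K2 + 1 else 0))).
      apply: summableD; first by apply: summableZ => //; exact: addr_ge0.
      exists (2 * K2 + 1) => -[|N]; first by rewrite big_ord0; move: K20; lra.
      by rewrite big_ord_recl/= big1 ?addr0.
    by apply/funext => -[|n]; rewrite /vv /=; ring.
  by have := summable_subn c0 (fun n => vv0 (n %/ 3)%N) (summable_divn vv0 (ltn0Sn 2) svv).
- move=> i j n m h ik jk hn hmn; rewrite /vv; case: (posnP ((h - c0) %/ 3)%N) => [->|r0].
    have [l1 E1] := hK2 i ik n; have [l2' E2] := hK2 j jk m.
    rewrite (@le_trans _ _ (2 * K2 + 1))//; last first.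
      by rewrite lerDr mulr_ge0// addr_ge0.
    apply: (@le_trans _ _ (Ex P (fun w => Gt j m w ^+ 2 + Gt i n w ^+ 2))).
      apply: norm_Ex_le; [exact: l2M|by apply: itgD; [exact: l2'.2|exact: l1.2]|].
      by move=> w; have := normM_le_sqr (Gt j m w) (Gt i n w) ltr01; rewrite divr1 mul1r.
    by rewrite ExD; [move: E1 E2; lra|exact: l2'.2|exact: l1.2].
  rewrite addr0; have rh := third_gap r0.
  apply: (@le_trans _ _ (K * u ((h - c0) %/ 3)%N)); last by rewrite ler_wpM2r// lerDl.
  apply: (hK i ik j jk) => //; [exact: size_blks| |by rewrite addnC (leq_trans rh)|exact: ht].
  move=> q /(blks_time jk)[l lj /andP[_ qm]].
  rewrite (leq_trans _ hmn)//; apply: (@leq_trans (al l * m + c0 + 3 * ((h - c0) %/ 3))).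
    by rewrite leq_add2r.
  rewrite -addnA (addnC c0); apply: leq_add => //; rewrite leq_mul2r; apply/orP; right.
  by move: lj; rewrite ltnS leq_eqVlt => /orP[/eqP->//|lj]; rewrite ltnW// al_incr.
- move=> i n ik; rewrite /vv; case: (posnP ((n - c0) %/ 3)%N) => [->|r0].
    have [l1 E1] := hK2 i ik n.
    rewrite (@le_trans _ _ (2 * K2 + 1))//; last by rewrite lerDr mulr_ge0// addr_ge0.
    apply: (@le_trans _ _ (Ex P (fun w => Gt i n w ^+ 2 + 1))).
      apply: norm_Ex_le; [exact: l2_itg|by apply: itgD; [exact: l1.2|exact: itg_cst]|].
      move=> w; have := normM_le_sqr (Gt i n w) 1 ltr01.
      by rewrite divr1 mul1r mulr1 expr1n.
    by rewrite ExD ?Ex_cst; [move: E1 K20; lra|exact: l1.2|exact: itg_cst].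
  rewrite addr0; have rh := third_gap r0.
  apply: (@le_trans _ _ (K1 * u ((n - c0) %/ 3)%N)); last by rewrite ler_wpM2r// lerDr.
  by apply: (hK1 i ik) => //; rewrite addnC.
Qed.


Hypothesis mean0 : partial_integral k [::] = 0.
Variable c : nat -> R.
Hypothesis hc : forall h, (fun n => Ex P (fun w => block_fun n w * block_fun (n + h) w)) @ \oo --> c h.

Let b i j n m := Ex P (fun w => Gt i n w * Gt j m w).
(** Chosen above every slope; it bounds max(n,m) by A times the leading index and fixes the windows
    [AN, AN+N). *)
Let A := (\sum_(l < k) al l).+1.

Let al_A l : (l < k)%N -> (al l < A)%N.
Proof. by move=> lk; rewrite /A ltnS (bigD1 (Ordinal lk))//= leq_addr. Qed.

Let gE n w : block_fun n w = \sum_(i < k) Gt i n w.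
Proof. by apply: Gt_sum; rewrite /gb subn0. Qed.

Let gfE n : block_fun n = fun w => \sum_(i < k) Gt i n w.
Proof. by apply/funext => w; exact: gE. Qed.

Lemma block_fun_mean_cvg : (fun n => Ex P (block_fun n)) @ \oo --> 0.
Proof.
have [v [v0 sv _ hv1]] := covariance_bound.
rewrite (_ : (fun n => _) = (fun n => \sum_(i < k) Ex P (Gt i n))); last first.
  apply/funext => n; rewrite gfE (Ex_sum _ (f := fun (i : 'I_k) w => Gt i n w))// => i.
  exact/l2_itg/lG.
apply: (@cvg_sum0 _ _ _ xpredT (fun (i : 'I_k) n => Ex P (Gt i n))) => i _.
apply: (@squeeze_dist _ _ v) => [n|]; first by rewrite subr0; exact: hv1.
exact/summable_vanishes/summable_unweight.
Qed.

Lemma block_fun_l2 n : l2 P (block_fun n).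
Proof. by rewrite gfE; apply: (l2_sum _ (f := fun (i : 'I_k) w => Gt i n w)) => i; exact: lG. Qed.

Let bbE n m : Ex P (fun w => block_fun n w * block_fun m w) = \sum_(i < k) \sum_(j < k) b i j n m.
Proof.
rewrite !gfE (sqr_sum_Ex _ _ (f := fun (i : 'I_k) w => Gt i n w) (g := fun (i : 'I_k) w => Gt i m w))//;
  by move=> i; exact: lG.
Qed.

Let bC i j n m : b i j n m = b j i m n.
Proof. by congr Ex; apply/funext => w; rewrite mulrC. Qed.

(** This direction keeps al_i n - al_j m constant, and every time involved is affine in t, so
    [blks_line_cvg] applies. *)
Let b_line i j n m : (i < k)%N -> (j < k)%N ->
  exists l : R, (fun t => b i j (n + al j * t)%N (m + al i * t)%N) @ \oo --> l.
Proof.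
move=> ik jk; have [Ct Ct0 ht] := gt_hol.
have h := hol_cat_product kappa01 lam0 (ht i ik) (ht j jk).
have le : lam + lam + 1 <= e by move: lame; lra.
have [L hL] := blks_line_cvg n m ik jk (al_gt0 jk) (al_gt0 ik) (addr_ge0 lam0 lam0) le h.
exists L; rewrite (_ : (fun t => _) = (fun t => Ex P (fun w =>
  (fun x => gt i (select (iota 0 (nsz i.+1)) x) * gt j (select (iota (nsz i.+1) (nsz j.+1)) x))
  (ev (xs xi (bks i.+1 (n + al j * t)%N)) w ++ ev (xs xi (bks j.+1 (m + al i * t)%N)) w))))//.
apply/funext => t; congr Ex; apply/funext => w /=; rewrite select_catl; last exact: (@size_ev_bks i.+1).
by rewrite select_catr//; [exact: (@size_ev_bks i.+1)|exact: (@size_ev_bks j.+1)].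
Qed.

Section with_bound.
Variable v : nat -> R.
Hypothesis v0 : forall h, 0 <= v h.
Hypothesis sv : summable (fun h => h.+1%:R * v h).
Hypothesis hv : forall i j n m h, (i < k)%N -> (j < k)%N -> (h <= n)%N -> (al j * m + h <= al i * n)%N ->
    `|Ex P (fun w => Gt j m w * Gt i n w)| <= v h.
Hypothesis hv1 : forall i n, (i < k)%N -> `|Ex P (Gt i n)| <= v n.

Let psi n := v (n %/ A)%N.
Let psi0 n : 0 <= psi n. Proof. exact: v0. Qed.
Let spsi : summable (fun n => n.+1%:R * psi n). Proof. exact: summable_divn. Qed.

(** If al_j m <= al_i n, then max(n,m) <= A n. The gap fed to the covariance bound is the smaller of
    max(n,m)/A and al_i n - al_j m; v need not be monotone, so the sum of both values is kept. *)
Let b_dominated i j : (i < k)%N -> (j < k)%N -> dominated (b i j) psi v (al i) (al j).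
Proof.
have H i' j' n m : (i' < k)%N -> (j' < k)%N -> (al j' * m <= al i' * n)%N ->
    `|Ex P (fun w => Gt j' m w * Gt i' n w)| <= psi (maxn n m) + v (ndist (al i' * n) (al j' * m)).
  move=> ik jk hmn; have -> : ndist (al i' * n) (al j' * m) = (al i' * n - al j' * m)%N.
    by rewrite /ndist (_ : (al j' * m - al i' * n = 0)%N) ?addn0//; apply/eqP.
  have maxE : (maxn n m %/ A <= n)%N.
    rewrite -[leqRHS](@mulKn _ A)// leq_div2r// geq_max; apply/andP; split.
      by rewrite leq_pmull.
    rewrite (@leq_trans (al j' * m))//; first by rewrite leq_pmull// al_gt0.
    by rewrite (leq_trans hmn)// leq_mul2r ltnW ?orbT// al_A.
  have [h|h] := leqP (maxn n m %/ A) (al i' * n - al j' * m).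
    rewrite (le_trans (hv ik jk maxE _))//; last by rewrite /psi lerDl.
    by rewrite -(subnKC hmn) leq_add2l.
  rewrite (le_trans (hv (h := (al i' * n - al j' * m)%N) ik jk _ _))//.
  - exact: ltnW (leq_trans h maxE).
  - by rewrite subnKC.
  - by rewrite lerDr.
move=> ik jk n m; case/orP: (leq_total (al j * m) (al i * n)) => h.
  by rewrite bC; exact: H.
by rewrite maxnC ndistC; exact: H.
Qed.

Let S N w := \sum_(n < N) block_fun n w.
Let V2 N := Ex P (fun w => S N w ^+ 2).

Let lS N : l2 P (S N).
Proof. by apply: (l2_sum _ (f := fun (i : 'I_N) w => block_fun i w)) => i; exact: block_fun_l2. Qed.

Let window_Ex K N : Ex P (fun w => (\sum_(n < N) block_fun (K + n)%N w) ^+ 2) =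
  \sum_(i < k) \sum_(j < k) \sum_(n < N) \sum_(m < N) b i j (K + n)%N (K + m)%N.
Proof.
rewrite -exchange_square_sums; under eq_fun do rewrite expr2.
rewrite (sqr_sum_Ex _ _ (f := fun (i : 'I_N) w => block_fun (K + i) w)
  (g := fun (i : 'I_N) w => block_fun (K + i) w)); try by move=> i; exact: block_fun_l2.
by apply: eq_bigr => i _; apply: eq_bigr => j _; rewrite bbE.
Qed.

Let variance_density : exists sigma2 : R, sublinear (fun N => V2 N - N%:R * sigma2).
Proof.
have ap (p : 'I_k * 'I_k) : exists L : R, sublinear (fun N =>
    \sum_(n < N) \sum_(m < N) b p.1 p.2 n m - N%:R * L).
  case: p => i j; apply: (double_sum_density psi0 v0 spsi _ _ _ (b_dominated _ _)) => //.
  - exact: summable_unweight.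
  - exact: al_gt0.
  - exact: al_gt0.
  - by move=> n m; exact: b_line.
have [L hL] := choice ap; exists (\sum_(i < k) \sum_(j < k) L (i, j)).
rewrite (_ : (fun N => _) = (fun N => \sum_(i < k) \sum_(j < k)
   (\sum_(n < N) \sum_(m < N) b i j n m - N%:R * L (i, j)))).
  by apply: sublinear_sum => i; apply: sublinear_sum => j; exact: (hL (i, j)).
apply/funext => N; rewrite /V2 (window_Ex 0 N) mulr_sumr -sumrB; apply: eq_bigr => i _.
by rewrite mulr_sumr -sumrB.
Qed.

Let mean_bounded : exists C1 : R, forall N, `|Ex P (S N)| <= C1.
Proof.
have [C1 hC1] := summable_unweight v0 sv; exists (k%:R * C1) => N.
rewrite /S (Ex_sum _ (f := fun (i : 'I_N) w => block_fun i w)); last by move=> i; exact/l2_itg/block_fun_l2.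
apply: le_trans (ler_norm_sum _ _ _) _; apply: (@le_trans _ _ (k%:R * \sum_(n < N) v n)); last by rewrite ler_wpM2l.
rewrite mulr_sumr; apply: ler_sum => n _; rewrite gfE.
rewrite (Ex_sum _ (f := fun (i : 'I_k) w => Gt i n w)); last by move=> i; exact/l2_itg/lG.
apply: le_trans (ler_norm_sum _ _ _) _; apply: (@le_trans _ _ (\sum_(i < k) v n)).
  by apply: ler_sum => i _; exact: hv1.
by rewrite sumr_const card_ord mulr_natl.
Qed.

Let dd n m := \sum_(i < k) b i i n m.
Let psi' n := k%:R * psi n.
Let chi' h := \sum_(i < k) v (al i * h)%N.

Let ndist_mul a n m : ndist (a * n) (a * m) = (a * ndist n m)%N.
Proof. by rewrite /ndist -!mulnBr mulnDr. Qed.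

Let dd_dominated : dominated dd psi' chi' 1 1.
Proof.
move=> n m; rewrite !mul1n; apply: le_trans (ler_norm_sum _ _ _) _.
apply: (@le_trans _ _ (\sum_(i < k) (psi (maxn n m) + v (al i * ndist n m)%N))).
  by apply: ler_sum => i _; rewrite -ndist_mul; exact: b_dominated.
by rewrite big_split/= sumr_const card_ord /psi' mulr_natl.
Qed.

Let chi'0 h : 0 <= chi' h. Proof. exact: sumr_ge0. Qed.
Let psi'0 h : 0 <= psi' h. Proof. exact: mulr_ge0. Qed.

Let schi' : summable (fun h => h.+1%:R * chi' h).
Proof.
have H (s : seq 'I_k) : summable (fun h => h.+1%:R * \sum_(i <- s) v (al i * h)%N).
  elim: s => [|i s IH]; first by exists 0 => N; rewrite big1// => n _; rewrite big_nil mulr0.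
  apply: (summable_le _ (summableD (summable_muln v0 (al_gt0 (ltn_ord i)) sv) IH)) => n.
  by rewrite big_cons mulrDr.
exact: H.
Qed.

Let spsi' : summable (fun h => h.+1%:R * psi' h).
Proof. by apply: (summable_le _ (summableZ (ler0n R k) spsi)) => n; rewrite mulrCA. Qed.

(** At a fixed lag, the times al_i n and al_j (n+h) of distinct slopes drift apart at least like n,
    up to a constant. *)
Let off_vanishes i j h : (i < k)%N -> (j < k)%N -> i != j ->
  (fun n => b i j n (n + h)%N) @ \oo --> 0.
Proof.
move=> ik jk ij; have v_cvg := summable_vanishes v0 (summable_unweight v0 sv).
have psi_cvg := summable_vanishes psi0 (summable_unweight psi0 spsi).
apply: (@squeeze_dist _ _ (fun n => psi (maxn n (n + h)) + v (ndist (al i * n) (al j * (n + h))))).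
  by move=> n; rewrite subr0; exact: b_dominated.
rewrite -[X in _ --> X](addr0 0); apply: cvgD.
  apply: (cvg0_comp_large (phi := fun n => maxn n (n + h)) (K := 0) psi_cvg) => n.
  by rewrite addn0 leq_maxl.
apply: (cvg0_comp_large (phi := fun n => ndist (al i * n) (al j * (n + h))) (K := (al j * h)%N) v_cvg) => n.
have [lij|lij] : (al i < al j)%N \/ (al j < al i)%N.
    by move: ij; rewrite neq_ltn => /orP[h'|h']; [left|right]; exact: al_incr.
  rewrite /ndist -addnA (leq_trans _ (leq_addl _ _))// (leq_trans _ (leq_addr _ _))// mulnDr.
  rewrite -addnBAC ?leq_mul2r ?(ltnW lij) ?orbT// (leq_trans _ (leq_addr _ _))// -mulnBl.
  by rewrite leq_pmull// subn_gt0.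
rewrite /ndist -addnA mulnDr subnDA; set x := (al i * n - al j * n)%N.
have nx : (n <= x)%N by rewrite /x -mulnBl leq_pmull// subn_gt0.
by rewrite addnCA (leq_trans _ (leq_addl _ _))// (leq_trans nx)// addnC -leq_subLR.
Qed.

(** Cross terms disappear in the limit, so the limiting covariance c(h) is carried by the parts with
    i = j. *)
Let dd_cvg h : (fun n => dd n (n + h)%N) @ \oo --> c h.
Proof.
rewrite (_ : (fun n => _) = (fun n => Ex P (fun w => block_fun n w * block_fun (n + h) w) -
    \sum_(p : 'I_k * 'I_k | p.1 != p.2) b p.1 p.2 n (n + h)%N)).
  rewrite -[X in _ --> X]subr0; apply: cvgB; first exact: hc.
  by apply: cvg_sum0 => -[i j] /= ij; exact: off_vanishes.
apply/funext => n; rewrite bbE pair_bigA/= (bigID (fun p => p.1 == p.2))/= addrK.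
rewrite -(pair_big_dep xpredT (fun i j : 'I_k => i == j) (fun i j : 'I_k => b i j n (n + h)%N))/=.
by apply: eq_bigr => i _; rewrite (big_pred1 i)// => j; rewrite eq_sym.
Qed.

Let dd_cvg' h : (fun n => dd (n + h)%N n) @ \oo --> c h.
Proof.
rewrite (_ : (fun n => _) = (fun n => dd n (n + h)%N))//.
by apply/funext => n; apply: eq_bigr => i _; rewrite bC.
Qed.

Let c_le h : `|c h| <= chi' h.
Proof.
have psi_cvg := summable_vanishes psi'0 (summable_unweight psi'0 spsi').
have cv1 : (fun n => `|dd n (n + h)%N|) @ \oo --> `|c h| by apply: cvg_norm; exact: dd_cvg.
have cv2 : (fun n => psi' (n + h)%N + chi' h) @ \oo --> 0 + chi' h.
  apply: cvgD; last exact: cvg_cst.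
  by apply: (cvg0_comp_large (phi := fun n => (n + h)%N) (K := 0) psi_cvg) => n; rewrite addn0 leq_addr.
rewrite -[leRHS]add0r; apply: (le_cvgn cv1 cv2) => n.
have := dd_dominated n (n + h); rewrite !mul1n (maxn_idPr (leq_addr _ _)).
by rewrite /ndist (_ : (n - (n + h) = 0)%N) ?add0n ?addKn//; apply/eqP; rewrite subn_eq0 leq_addr.
Qed.

Let W N := Ex P (fun w => (\sum_(n < N) block_fun (A * N + n)%N w) ^+ 2).

(** On the window, the parts with i = j reproduce the double sum of c by [window_sum], and those
    with i != j stay bounded by [offdiagonal_window]. *)
Let W_density : exists s2 beta : R,
  (fun N => \sum_(n < N) \sum_(m < N) c (ndist n m) - N%:R * s2) @ \oo --> beta /\
  sublinear (fun N => W N - N%:R * s2).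
Proof.
have sc : summable (fun h => h%:R * `|c h|).
  apply: (summable_le _ schi') => h; apply: ler_pM => //; first by rewrite ler_nat.
have [s2 [beta cvB]] := stationary_double_sum sc; exists s2, beta; split=> //.
have h1 := window_sum A psi'0 chi'0 spsi' (summable_unweight chi'0 schi') dd_dominated dd_cvg dd_cvg'.
have h2 (p : 'I_k * 'I_k) : p.1 != p.2 -> exists C1 : R, forall N,
    `|\sum_(n < N) \sum_(m < N) b p.1 p.2 (A * N + n)%N (A * N + m)%N| <= C1.
  case: p => i j /= ij; apply: (offdiagonal_window psi0 v0 spsi sv _ _ _ _ _ (b_dominated _ _)) => //;
    try exact: al_gt0; try exact: al_A.
  have : (nat_of_ord i != j) by rewrite (inj_eq val_inj).
  rewrite !neq_ltn => /orP[h|h]; first by rewrite (al_incr h (ltn_ord j)).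
  by rewrite (al_incr h (ltn_ord i)) orbT.
rewrite (_ : (fun N => _) = (fun N => \sum_(n < N) \sum_(m < N)
     (dd (A * N + n)%N (A * N + m)%N - c (ndist n m)) +
   (\sum_(p : 'I_k * 'I_k | p.1 != p.2) (\sum_(n < N) \sum_(m < N) b p.1 p.2 (A * N + n)%N (A * N + m)%N) +
   (\sum_(n < N) \sum_(m < N) c (ndist n m) - N%:R * s2)))).
  apply: sublinearD => //; apply: sublinearD; last exact: cvg_is_sublinear cvB.
  have -> : (fun N => \sum_(p : 'I_k * 'I_k | p.1 != p.2) (\sum_(n < N) \sum_(m < N) b p.1 p.2 (A * N + n)%N (A * N + m)%N)) =
    (fun N => \sum_(p : 'I_k * 'I_k) if p.1 != p.2 then \sum_(n < N) \sum_(m < N) b p.1 p.2 (A * N + n)%N (A * N + m)%N else 0).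
    by apply/funext => N; rewrite [LHS]big_mkcond.
  apply: (sublinear_sum _ (f := fun (p : 'I_k * 'I_k) N => if p.1 != p.2 then
    \sum_(n < N) \sum_(m < N) b p.1 p.2 (A * N + n)%N (A * N + m)%N else 0)) => p.
  rewrite /=; have [hp|_] := boolP (p.1 != p.2); first by have [C1 hC1] := h2 p hp; exact: sublinear_bounded hC1.
  by apply: (@sublinear_bounded _ _ 0) => N; rewrite normr0.
apply/funext => N; rewrite /W window_Ex pair_bigA/= (bigID (fun p => p.1 == p.2))/=.
have -> : \sum_(p : 'I_k * 'I_k | p.1 == p.2) (\sum_(n < N) \sum_(m < N) b p.1 p.2 (A * N + n)%N (A * N + m)%N) =
   \sum_(n < N) \sum_(m < N) dd (A * N + n)%N (A * N + m)%N.
  rewrite -(pair_big_dep xpredT (fun i j : 'I_k => i == j)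
     (fun i j : 'I_k => \sum_(n < N) \sum_(m < N) b i j (A * N + n)%N (A * N + m)%N))/=.
  under eq_bigr => i _.
    rewrite (big_pred1 i); last by move=> j; rewrite eq_sym.
    over.
  rewrite exchange_big/=; apply: eq_bigr => n _; exact: exchange_big.
have -> : \sum_(n < N) \sum_(m < N) (dd (A * N + n)%N (A * N + m)%N - c (ndist n m)) =
  \sum_(n < N) \sum_(m < N) dd (A * N + n)%N (A * N + m)%N - \sum_(n < N) \sum_(m < N) c (ndist n m).
  by under eq_bigr do rewrite sumrB; rewrite sumrB.
by rewrite -!/(\sum_(i < _) _); ring.
Qed.

Let S_window K N w : S (K + N) w = S K w + \sum_(n < N) block_fun (K + n)%N w.
Proof. by rewrite /S big_split_ord. Qed.

Let l2W K N : l2 P (fun w => \sum_(n < N) block_fun (K + n)%N w).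
Proof. by apply: (l2_sum _ (f := fun (i : 'I_N) w => block_fun (K + i) w)) => i; exact: block_fun_l2. Qed.

Let W_le N : W N <= 2 * V2 (A * N + N) + 2 * V2 (A * N).
Proof.
have -> : W N = Ex P (fun w => (S (A * N + N) w + (-1) * S (A * N) w) ^+ 2).
  by congr Ex; apply/funext => w; rewrite S_window; ring.
apply: le_trans (Ex_sqrD_le (lS _) (l2Z (-1) (lS _))) _.
by under [X in _ + 2 * Ex P X]eq_fun do rewrite mulN1r sqrrN.
Qed.

Let V2_le (eta : R) N : 0 < eta -> V2 (A * N + N) <= (1 + eta) * V2 (A * N) + (1 + eta^-1) * W N.
Proof.
move=> eta0; rewrite /V2 /W -!ExZ; [|exact: (l2W _ _).2|exact: (lS _).2].
rewrite -ExD; [|by apply: itgZ; exact: (lS _).2|by apply: itgZ; exact: (l2W _ _).2].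
apply: le_Ex; first exact: (lS _).2.
  by apply: itgD; apply: itgZ; [exact: (lS _).2|exact: (l2W _ _).2].
move=> w; rewrite S_window; set x := S _ w; set y := \sum_(n < N) _.
have -> : (1 + eta) * x ^+ 2 + (1 + eta^-1) * y ^+ 2 =
  (x + y) ^+ 2 + (eta * x - y) ^+ 2 / eta by field; rewrite gt_eqF.
by rewrite lerDl divr_ge0// ?sqr_ge0// ltW.
Qed.

Let V2_ge0 N : 0 <= V2 N. Proof. by apply: Ex_ge0 => w; exact: sqr_ge0. Qed.
Let W_ge0 N : 0 <= W N. Proof. by apply: Ex_ge0 => w; exact: sqr_ge0. Qed.

(** With A as above, the window sum is S_((A+1)N) - S_(AN). Dividing its second-moment inequalities
    by N gives s2 <= 2(A+1) sigma2 + 2A sigma2 and (A+1) sigma2 <= (1+eta) A sigma2 + (1+1/eta) s2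
    for all eta > 0, so either limit vanishes with the other. The means of S_N are bounded, so
    second moments and variances share the same density. *)
Lemma block_variance_of_bounds : exists sigma2 s2 beta : R,
  [/\ (fun N => (Ex P (fun w => S N w ^+ 2) - Ex P (S N) ^+ 2) / N%:R) @ \oo --> sigma2,
      (fun N => \sum_(n < N) \sum_(m < N) c (ndist n m) - N%:R * s2) @ \oo --> beta &
      0 < sigma2 <-> 0 < s2].
Proof.
have [sigma2 hV] := variance_density; have [s2 [beta [hB hW]]] := W_density.
exists sigma2, s2, beta; split=> //.
  apply: sublinear_cvg; have [C1 hC1] := mean_bounded.
  rewrite (_ : (fun N => _) = (fun N => (V2 N - N%:R * sigma2) + (-1) * Ex P (S N) ^+ 2)).
    apply: sublinearD => //; apply: sublinearZ; apply: (@sublinear_bounded _ _ (C1 ^+ 2)) => N.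
    rewrite normrX; apply: lerXn2r => //; rewrite nnegrE//.
    exact: le_trans (hC1 N).
  by apply/funext => N; rewrite /V2; ring.
have cW := sublinear_cvg hW.
have cV (K : nat) : (fun N => V2 (K * N) / N%:R) @ \oo --> K%:R * sigma2.
  apply: sublinear_cvg; have := sublinear_comp K 0 hV; congr sublinear; apply/funext => N.
  by rewrite addn0 natrM; ring.
have sigma20 : 0 <= sigma2.
  by rewrite -[sigma2]mul1r; apply: (cvgn_ge0 _ (cV 1%N)) => n; rewrite divr_ge0.
have s20 : 0 <= s2 by apply: (cvgn_ge0 _ cW) => n; rewrite divr_ge0.
have EA N : (A * N + N = A.+1 * N)%N by rewrite mulSn addnC.
have A0 : 0 < A%:R :> R by rewrite ltr0n.
have AS : A.+1%:R = A%:R + 1 :> R by rewrite -natr1.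
have le1 : s2 <= 2 * (A.+1%:R * sigma2) + 2 * (A%:R * sigma2).
  have cg : (fun N => 2 * (V2 (A.+1 * N) / N%:R) + 2 * (V2 (A * N) / N%:R)) @ \oo -->
      2 * (A.+1%:R * sigma2) + 2 * (A%:R * sigma2) by apply: cvgD; apply: cvgMr; exact: cV.
  apply: (le_cvgn cW cg) => N.
  by rewrite -EA !mulrA -mulrDl ler_wpM2r ?invr_ge0//; exact: W_le.
have le2 eta : 0 < eta -> A.+1%:R * sigma2 <= (1 + eta) * (A%:R * sigma2) + (1 + eta^-1) * s2.
  move=> eta0.
  have cg : (fun N => (1 + eta) * (V2 (A * N) / N%:R) + (1 + eta^-1) * (W N / N%:R)) @ \oo -->
      (1 + eta) * (A%:R * sigma2) + (1 + eta^-1) * s2 by apply: cvgD; apply: cvgMr.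
  apply: (le_cvgn (cV A.+1) cg) => N.
  by rewrite -EA !mulrA -mulrDl ler_wpM2r ?invr_ge0//; exact: V2_le.
split=> h.
  rewrite lt_neqAle s20 andbT eq_sym; apply/eqP => z.
  (* With s2 = 0 and eta = 1/(2A) the inequality reads (A+1) sigma2 <= A sigma2 + sigma2/2,
     impossible for sigma2 > 0. *)
  have := le2 (2 * A%:R)^-1; rewrite invr_gt0 mulr_gt0// => /(_ isT).
  rewrite z mulr0 addr0 AS.
  have -> : (1 + (2 * A%:R)^-1) * (A%:R * sigma2) = A%:R * sigma2 + sigma2 / 2 by field; rewrite gt_eqF.
  by rewrite mulrDl mul1r; lra.
rewrite lt_neqAle sigma20 andbT eq_sym; apply/eqP => z.
by move: le1; rewrite z !mulr0; move: h; lra.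
Qed.

End with_bound.

Theorem block_variance : exists sigma2 s2 beta : R,
  [/\ (fun N => (Ex P (fun w => (\sum_(n < N) block_fun n w) ^+ 2) -
                 Ex P (fun w => \sum_(n < N) block_fun n w) ^+ 2) / N%:R) @ \oo --> sigma2,
      (fun N => \sum_(n < N) \sum_(m < N) c (ndist n m) - N%:R * s2) @ \oo --> beta &
      0 < sigma2 <-> 0 < s2].
Proof. by have [v [v0 sv hv hv1]] := covariance_bound; exact: (block_variance_of_bounds v0 sv hv hv1). Qed.

End block_system.

(** * Vector norms and series of extended reals *)

Section vectors.
Variables (R : realType) (wp : nat).
Implicit Types x z : wp.-tuple R.

Lemma sum_sqr_le (s : seq R) : \sum_(a <- s) a ^+ 2 <= (\sum_(a <- s) `|a|) ^+ 2.
Proof.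
elim: s => [|a s IH]; first by rewrite !big_nil expr0n.
rewrite !big_cons; have s0 : 0 <= \sum_(a <- s) `|a| by exact: sumr_ge0.
rewrite -[a ^+ 2]real_normK ?num_real//; have := normr_ge0 a.
by move: (\sum_(a <- s) `|a|) (\sum_(a <- s) a ^+ 2) (`|a|) IH s0 => x y b; nra.
Qed.

Lemma norm_tnth_le_vnorm x j : `|tnth x j| <= vnorm x.
Proof.
rewrite -sqrtr_sqr /vnorm ler_wsqrtr// (bigD1 j)//= lerDl.
by apply: sumr_ge0 => i _; exact: sqr_ge0.
Qed.

Lemma norm_tnth_le_vdist x z j : `|tnth x j - tnth z j| <= vdist x z.
Proof.
rewrite -sqrtr_sqr /vdist ler_wsqrtr// (bigD1 j)//= lerDl.
by apply: sumr_ge0 => i _; exact: sqr_ge0.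
Qed.

Lemma sqrt_sum_sqr_le (f : 'I_wp -> R) : Num.sqrt (\sum_j f j ^+ 2) <= \sum_j `|f j|.
Proof.
have s0 : 0 <= \sum_j `|f j| by exact: sumr_ge0.
rewrite -[leRHS]ger0_norm// -sqrtr_sqr ler_wsqrtr//.
by have := sum_sqr_le [seq f j | j <- index_enum 'I_wp]; rewrite !big_map.
Qed.

Lemma vnorm_le_sum x : vnorm x <= \sum_(a <- x) `|a|.
Proof. by rewrite big_tuple; exact: sqrt_sum_sqr_le. Qed.

Lemma vdist_le_sum x z : vdist x z <= \sum_(j < wp) `|tnth x j - tnth z j|.
Proof. exact: sqrt_sum_sqr_le. Qed.

Lemma measurable_sqrt_sum_sqr d (T : measurableType d) (f : 'I_wp -> T -> R) :
  (forall j, measurable_fun setT (f j)) ->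
  measurable_fun setT (fun w => Num.sqrt (\sum_j f j w ^+ 2)).
Proof.
move=> mf; rewrite (_ : (fun w => _) = (fun w => (\sum_j f j w ^+ 2) `^ 2^-1)); last first.
  by apply/funext => w; rewrite powR12_sqrt// sumr_ge0// => i _; exact: sqr_ge0.
apply: (measurableT_comp (f := @powR R ^~ 2^-1)); first exact: measurable_powR.
by apply: measurable_sum => j; exact: measurable_funX.
Qed.

End vectors.

Lemma summable_of_nneseries (R : realType) (a : nat -> \bar R) : (forall n, 0 <= a n)%E ->
  (\sum_(1 <= n <oo) ((n%:R)%:E * a n) < +oo)%E ->
  (forall n, (0 < n)%N -> a n \is a fin_num) /\ summable (fun n => n%:R * fine (a n)).
Proof.
move=> a0; set S := (X in (X < _)%E) => Sy.
have t0 n : (0 <= (n%:R)%:E * a n)%E by apply: mule_ge0 => //; rewrite lee_fin.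
have le N : (\sum_(1 <= n < N) ((n%:R)%:E * a n) <= S)%E by apply: nneseries_lim_ge.
have fa n : (0 < n)%N -> a n \is a fin_num.
  move=> n0; rewrite ge0_fin_numE// ltey; apply/eqP => an.
  have := le n.+1; rewrite big_nat_recr//= an gt0_muley ?lte_fin ?ltr0n//.
  rewrite addey; last by rewrite -ltNye (lt_le_trans ltNy0)// sume_ge0.
  by rewrite leye_eq => /eqP E; rewrite E ltxx in Sy.
split=> //.
have S0 : (0 <= S)%E by apply: nneseries_ge0 => n _ _.
exists (fine S) => N; rewrite -lee_fin fineK ?ge0_fin_numE//.
apply: le_trans (le N); case: N => [|N]; first by rewrite big_ord0 big_geq.
rewrite big_ord_recl mul0r add0r big_add1/= big_mkord.
rewrite -sumEFin le_eqVlt; apply/orP; left; apply/eqP; apply: eq_bigr => n _.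
by rewrite EFinM fineK// fa.
Qed.

(** A padding for the coefficients ϖ(r) and beta(r)^delta, which may vanish while the Young
    inequalities divide by their bounds. *)
Lemma summable_positive (R : realType) : exists eps : nat -> R, (forall n, 0 < eps n) /\
  summable (fun n => n.+1%:R * eps n).
Proof.
exists (fun n => (2 ^+ n)^-1 / n.+1%:R); split=> [n|].
  by rewrite divr_gt0// invr_gt0 exprn_gt0.
exists 2 => N; rewrite -(@lerD2r _ (2 * (2 ^+ N)^-1)).
rewrite (_ : \sum_(n < N) _ = \sum_(n < N) (2 ^+ n)^-1); last first.
  by apply: eq_bigr => n _; rewrite mulrCA divff ?mulr1.
rewrite (_ : _ + _ = 2) ?lerDl ?mulr_ge0 ?invr_ge0 ?exprn_ge0//.
elim: N => [|N IH]; first by rewrite big_ord0 expr0 invr1 mulr1 add0r.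
by rewrite big_ord_recr/= exprS -[RHS]IH; field; rewrite expf_neq0.
Qed.

Lemma summable_succ_weight (R : realType) (x : nat -> R) : (forall n, 0 <= x n) ->
  summable (fun n => n%:R * x n) -> summable (fun n => n.+1%:R * x n).
Proof.
move=> x0 sx; have s1 : summable (fun n : nat => if n == 0%N then x 0%N else 0).
  by exists (x 0%N) => -[|N]; rewrite ?big_ord0// big_ord_recl/= big1 ?addr0.
apply: (summable_le _ (summableD (summableZ (ler0n R 2) sx) s1)) => -[|n].
  by rewrite mul0r mulr0 add0r mul1r.
rewrite addr0 mulrA ler_wpM2r// -natrM ler_nat; lia.
Qed.

(** * Decoupling for the coordinates of X *)

Section process.
Context {d : measure_display} {Omega : measurableType d} {R : realType} {wp : nat}.
Variables (P : probability Omega R) (X : nat -> Omega -> wp.-tuple R).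
Variables (Fam : \bar int -> \bar int -> set (set Omega)).
Variables (kappa p q delta m iot : R) (N0 : nat).
Hypothesis mX : forall n, measurable_fun setT (X n).
Hypothesis Fam_sigma : forall a b, sigma_algebra setT (Fam a b) /\ Fam a b `<=` measurable.
Hypothesis Fam_mono : forall a b a' b', (a' <= a)%E -> (b <= b')%E -> Fam a b `<=` Fam a' b'.
Hypothesis marginal : forall n (A : set (wp.-tuple R)), measurable A ->
  P (X n @^-1` A) = P (X 0%N @^-1` A).
Hypothesis kappa01 : 0 < kappa <= 1.
Hypothesis iot0 : 0 < iot.
Hypothesis p1 : 1 <= p.
Hypothesis q1 : 1 <= q.
Hypothesis delta0 : 0 < delta.
Hypothesis m0 : 0 < m.
Hypothesis delta_lt : delta < kappa - N0%:R / p.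
Hypothesis varpi_sum : (\sum_(1 <= n <oo) ((n%:R)%:E * varpi P Fam q p n) < +oo)%E.
Hypothesis beta_sum : (\sum_(1 <= r <oo) ((r%:R)%:E * poweR (beta P Fam X q r) delta) < +oo)%E.
Hypothesis gamma_m : (gammaX P X m < +oo)%E.
Hypothesis gamma_q : (gammaX P X (2 * q * iot) < +oo)%E.
Hypothesis exponents : p^-1 + (iot + 2) / m + delta / q <= 2^-1.

Definition coordinate (k : nat * 'I_wp) w : R := tnth (X k.1 w) k.2.
(** Both moments are finite by assumption: m serves the conditions coming from Young's inequality,
    and 2 q iota the L^q bound of the chaining increments. *)
Definition moment_exponent : R := Num.max m (2 * q * iot).
Local Notation e := moment_exponent.

Let p0 : 0 < p. Proof. exact: lt_le_trans ltr01 p1. Qed.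
Let q0 : 0 < q. Proof. exact: lt_le_trans ltr01 q1. Qed.
Let pos1 : 0 < p^-1. Proof. by rewrite invr_gt0. Qed.
Let pos2 : 0 < (iot + 2) / m. Proof. by rewrite divr_gt0// addr_gt0. Qed.
Let pos3 : 0 < delta / q. Proof. by rewrite divr_gt0. Qed.
Let p_gt1 : 1 < p.
Proof. by rewrite -invf_lt1//; move: exponents pos2 pos3; lra. Qed.
Let delta_lt_q : delta < q.
Proof. by rewrite -[q]mul1r -ltr_pdivrMr//; move: exponents pos1 pos2; lra. Qed.
Let delta_le_kappa : delta <= kappa.
Proof. by have : 0 <= N0%:R / p by [rewrite divr_ge0// ltW]; move: delta_lt; lra. Qed.
Let em : m <= e. Proof. by rewrite /e le_max lexx. Qed.
Let e0 : 0 < e. Proof. exact: lt_le_trans em. Qed.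
(** The exponent inequality of the assumption solved for m; dropping one or the other negative term
    yields the two moment conditions of [decoupling]. *)
Let iot_m : 2 * iot + 4 <= m * (1 - 2 * p^-1 - 2 * (delta / q)).
Proof.
have : (iot + 2) / m <= (1 - 2 * p^-1 - 2 * (delta / q)) / 2 by move: exponents; lra.
by rewrite ler_pdivrMr//; move: (_ - _) => x; lra.
Qed.
Let lam1 : (2 * iot + 4) * (p / (p - 1)) <= e.
Proof.
apply: le_trans em; have p10 : 0 < p - 1 by rewrite subr_gt0.
rewrite mulrA ler_pdivrMr// -ler_pdivlMr//.
have -> : m * (p - 1) / p = m * (1 - p^-1) by field; rewrite gt_eqF.
by apply: le_trans iot_m _; rewrite ler_pM2l//; move: pos1 pos3; lra.
Qed.
Let lam2 : (2 * iot + 4) / (1 - delta / q) <= e.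
Proof.
apply: le_trans em; have d0 : 0 < 1 - delta / q by rewrite subr_gt0 ltr_pdivrMr// mul1r.
rewrite ler_pdivrMr//.
by apply: le_trans iot_m _; rewrite ler_pM2l//; move: pos1 pos3; lra.
Qed.
Let lam3 : iot * q <= e.
Proof.
have h : 2 * q * iot <= e by rewrite /e le_max lexx orbT.
by apply: le_trans h; have : 0 <= iot * q by [rewrite mulr_ge0 ?ltW]; rewrite mulrC; lra.
Qed.
Lemma moment_exponent_ge : 2 * iot + 4 <= e.
Proof.
apply: le_trans em; apply: le_trans iot_m _; rewrite ger_pMr//.
by move: pos1 pos3; lra.
Qed.

Lemma measurable_coordinate k : measurable_fun setT (coordinate k).
Proof.
apply: (measurableT_comp (f := fun x : wp.-tuple R => tnth x k.2)) => //.
exact: measurable_tnth.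
Qed.

Let measurable_vnorm : measurable_fun setT (@vnorm R wp).
Proof. by apply: measurable_sqrt_sum_sqr => j; exact: measurable_tnth. Qed.

Let gamma_itg theta : 0 < theta -> (gammaX P X theta < +oo)%E ->
  itg P (fun w => vnorm (X 0%N w) `^ theta).
Proof.
move=> t0; rewrite /gammaX => g.
have mf : measurable_fun setT (fun x : wp.-tuple R => vnorm x `^ theta).
  by apply: (measurableT_comp (f := @powR R ^~ theta)) => //; exact: measurable_powR.
have E := @ge0_integral_pushforward _ _ _ _ R (X 0%N) (mX 0) P setT (fun x => (vnorm x `^ theta)%:E)
  measurableT _ _.
rewrite E in g; last 2 first.
- exact/measurable_EFinP.
- by move=> x _; rewrite lee_fin powR_ge0.
rewrite preimage_setT in g.
apply/integrableP; split.
  by apply/measurable_EFinP; exact: (measurableT_comp mf).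
under eq_integral do rewrite /= ger0_norm ?powR_ge0//.
rewrite ltey; apply/eqP => h; move: g; rewrite (_ : (\int[P]_x _)%E = +oo%E)//.
by rewrite eqy_poweR// ?invr_gt0// ltxx.
Qed.

Lemma coordinate_moments : exists2 M, 0 <= M & forall k, mom P e M (coordinate k).
Proof.
have vi : itg P (fun w => vnorm (X 0%N w) `^ e).
  rewrite /e; case: (leP m (2 * q * iot)) => _; last exact: gamma_itg.
  by apply: gamma_itg => //; rewrite !mulr_gt0.
exists (Ex P (fun w => vnorm (X 0%N w) `^ e)); first by apply: Ex_ge0 => w; exact: powR_ge0.
move=> [t j]; have le w : `|tnth (X 0%N w) j| `^ e <= vnorm (X 0%N w) `^ e.
  by apply: ler_powRl => //; [exact: ltW|exact: norm_tnth_le_vnorm].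
have mf : measurable_fun setT (fun x : wp.-tuple R => `|tnth x j| `^ e).
  by apply: measurable_norm_powR; exact: measurable_tnth.
have i0 : itg P ((fun x => `|tnth x j| `^ e) \o X 0%N).
  apply: (itg_dominated _ vi) => [|w]; first exact: measurableT_comp.
  by rewrite /= ger0_norm ?powR_ge0.
have [E i1] := eq_law_Ex (mX t) (mX 0) mf (@marginal t) i0.
split; first exact: measurable_coordinate.
- exact: i1.
- apply: le_trans (le_Ex i0 vi le); rewrite -E; exact: lexx.
Qed.


Let varpi_sets_ge0 Gs Hs : sigma_algebra setT Gs -> Gs `<=` measurable -> sigma_algebra setT Hs ->
  (0 <= varpi_sets P q p Gs Hs)%E.
Proof.
move=> sG Gm sH; have [h hh] := cexp_exists sG Gm (itg_cst P 0).
apply: (@le_trans _ _ (Lnorm P p%:E (fun w => (h w - fine ('E_P[fun=> 0]))%:E))); first exact: Lnorm_ge0.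
apply: ereal_sup_ubound; exists (fun=> 0), h; split=> //.
  by apply/(GmeasurableP sH); exact: measurable_cst.
apply: Lnorm_le => //; rewrite normr0 powR0 ?gt_eqF//; first exact: itg_cst.
by rewrite Ex_cst powR_ge0.
Qed.

Let varpi_ge n k : (varpi_sets P q p (Fam -oo%E (k%:Z)%:E) (Fam ((k + n)%N%:Z)%:E +oo%E) <= varpi P Fam q p n)%E.
Proof. by apply: ereal_sup_ubound; exists k. Qed.

Let varpi_ge0 n : (0 <= varpi P Fam q p n)%E.
Proof.
apply: le_trans (varpi_ge n 0); have [? ?] := Fam_sigma -oo%E (0%:Z)%:E.
by apply: varpi_sets_ge0 => //; case: (Fam_sigma ((0 + n)%N%:Z)%:E +oo%E).
Qed.

(** The approximants are versions of E(X(k) | F_{k-r,k+r}), coordinate by coordinate: conditional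
    Jensen ([cexp_powR]) preserves their moments, and together they compete in the supremum defining
    beta_q(r). The rate u is ϖ(r) + beta(r)^delta plus padding. *)
Theorem coordinate_decoupled : exists M u, [/\ 0 <= M, forall k, mom P e M (coordinate k),
  decoupled P coordinate kappa iot N0 u, forall r, 0 <= u r & summable (fun n => n.+1%:R * u n)].
Proof.
have [M M0 mom_xi] := coordinate_moments; have [eps [eps0 seps]] := summable_positive R.
have [vfin vsum] := summable_of_nneseries varpi_ge0 varpi_sum.
have [bfin bsum] := summable_of_nneseries (fun r => poweR_ge0 _ _) beta_sum.
pose vr n := fine (varpi P Fam q p n) + eps n.
pose wr r := fine (poweR (beta P Fam X q r) delta) + eps r.
have fv0 n : 0 <= fine (varpi P Fam q p n) by apply: fine_ge0.
have fb0 n : 0 <= fine (poweR (beta P Fam X q n) delta) by apply/fine_ge0/poweR_ge0.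
have vr0 r : 0 < vr r by apply: ltr_wpDl.
have wr0 r : 0 < wr r by apply: ltr_wpDl.
exists M, (fun r => vr r + wr r); split=> //; last 2 first.
- by move=> r; apply: addr_ge0; exact: ltW.
- have := summableD (summableD (summable_succ_weight fv0 vsum) seps)
    (summableD (summable_succ_weight fb0 bsum) seps).
  by congr summable; apply/funext => n; rewrite /vr /wr !mulrDr.
have mproc : mixing_process P coordinate Fam p q delta e M vr wr.
  split=> // r r0; split=> //.
    have ex k : exists h, cexp_version P (Fam (k.1%:Z - r%:Z)%:E (k.1%:Z + r%:Z)%:E) (coordinate k) h.
      have [sF Fm] := Fam_sigma (k.1%:Z - r%:Z)%:E (k.1%:Z + r%:Z)%:E.
      apply: (cexp_exists sF Fm); have [mc ic _] := mom_xi k; apply: itg_moment ic => //.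
      by move: moment_exponent_ge iot0; lra.
    have [xr hxr] := choice ex; exists xr => -[t j].
    have [Gm [ci cE]] := hxr (t, j); have [sF Fm] := Fam_sigma (t%:Z - r%:Z)%:E (t%:Z + r%:Z)%:E.
    have [mc ic Ec] := mom_xi (t, j).
    have e1 : 1 < e by move: moment_exponent_ge iot0; lra.
    have [i2 E2] := cexp_powR sF Fm e1 mc ic (hxr (t, j)).
    have mxr j' : measurable_fun setT (xr (t, j')).
      by apply: (Gmeasurable_measurable Fm); case: (hxr (t, j')).
    pose H w := [tuple xr (t, j') w | j' < wp].
    have le : (Lnorm P q%:E (fun w => (vdist (X t w) (H w))%:E) <= beta P Fam X q r)%E.
      apply: ereal_sup_ubound; exists t, H; split=> // j'.
      rewrite (_ : (fun w => tnth (H w) j') = xr (t, j')); first exact: (hxr (t, j')).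
      by apply/funext => w; rewrite tnth_mktuple.
    have b0 : (0 <= beta P Fam X q r)%E by apply: le_trans le; exact: Lnorm_ge0.
    have bf : beta P Fam X q r \is a fin_num.
      rewrite ge0_fin_numE// ltey; apply/eqP => b; have := bfin r r0.
      by rewrite b eqy_poweR.
    have bE : (beta P Fam X q r <= (wr r `^ delta^-1)%:E)%E.
      have := fb0 r; rewrite /wr; move: bf b0 (eps0 r); case: (beta P Fam X q r) => //= b _.
      rewrite lee_fin => b0 epr pb0.
      rewrite lee_fin -[X in X <= _]powRr1// -[X in _ `^ X](mulfV (_ : delta != 0)) ?gt_eqF// powRrM.
      by apply: ler_powRl; [rewrite invr_ge0 ltW|exact: pb0|rewrite lerDl ltW].
    have mD : measurable_fun setT (fun w => vdist (X t w) (H w)).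
      rewrite /vdist; apply: measurable_sqrt_sum_sqr => j'; apply: measurable_funB.
        exact: (measurable_coordinate (t, j')).
      by rewrite (_ : (fun w => tnth (H w) j') = xr (t, j'))//; apply/funext => w; rewrite tnth_mktuple.
    have [iD ED] := Lnorm_leP mD q0 (powR_ge0 _ _) (le_trans le bE).
    have leD w : `|coordinate (t, j) w - xr (t, j) w| `^ q <= `|vdist (X t w) (H w)| `^ q.
      apply: ler_powRl => //; first exact: ltW.
      rewrite (le_trans _ (ler_norm _))//.
      by rewrite -[xr (t, j) w](tnth_mktuple (fun j' => xr (t, j') w)); exact: norm_tnth_le_vdist.
    have iC : itg P (fun w => `|coordinate (t, j) w - xr (t, j) w| `^ q).
      apply: (itg_dominated _ iD) => [|w]; last by rewrite ger0_norm ?powR_ge0.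
      by apply: measurable_norm_powR; exact: measurable_funB.
    split; [split; [exact: mxr|exact: i2|exact: le_trans E2 Ec]|exact: Gm|exact: iC|].
    by apply: le_trans (le_Ex iC iD leD) _; rewrite (le_trans ED)// -powRrM mulrC.
  move=> t g C C0 Hg gi gE.
  have [s1 m1] := Fam_sigma -oo%E (t%:Z)%:E; have [s2 m2] := Fam_sigma ((t + r)%N%:Z)%:E +oo%E.
  apply: (varpi_sets_version s1 m1 s2 m2 p1 q1 (ltW (vr0 r)) C0 _ Hg gi gE).
  apply: le_trans (varpi_ge r t) _.
  by rewrite -[leLHS]fineK ?vfin// lee_fin lerDl ltW.
have N0k : N0%:R / p < kappa by move: delta_lt delta0; lra.
move=> nH nU nW C nUN.
exists `|decouplingC kappa p q e M nH nU nW iot C|; first exact: normr_ge0.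
move=> r T0 tH tU tW h f r0 sH sU sW HT UT WT hh hf.
apply: le_trans (decoupling mproc kappa01 p_gt1 q1 delta0 delta_le_kappa delta_lt_q e0 M0
  (ltW iot0) lam1 lam2 lam3 _ r0 sH sU sW HT UT WT hh hf) _.
  by apply: le_lt_trans N0k; rewrite ler_wpM2r ?invr_ge0 ?(ltW p0)// ler_nat.
by apply: ler_wpM2r (ler_norm _); apply: addr_ge0; exact: ltW.
Qed.

End process.

(** Reduction to joint laws at sorted times: a list of coordinates in any order, with repetitions,
    is a function of the values of X at its distinct times, and translation keeps the gaps between
    them. *)
Lemma stationary_shift_invariant d (Omega : measurableType d) (R : realType) (wp : nat)
    (P : probability Omega R) (X : nat -> Omega -> wp.-tuple R) (kappa e M : R) (Nd : nat) :
  (forall n, measurable_fun setT (X n)) ->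
  (forall (kk : nat) (ns ms : kk.-tuple nat), (kk <= Nd)%N ->
     sorted leq ns -> sorted leq ms ->
     (forall j, (j.+1 < kk)%N ->
        (nth 0 ns j.+1 - nth 0 ns j = nth 0 ms j.+1 - nth 0 ms j)%N) ->
     forall A : set (kk.-tuple (wp.-tuple R)), measurable A ->
       P ((fun w => map_tuple (fun n => X n w) ns) @^-1` A)
       = P ((fun w => map_tuple (fun n => X n w) ms) @^-1` A)) ->
  0 < kappa <= 1 -> 0 < e -> 0 <= M -> (forall k, mom P e M (coordinate X k)) ->
  forall ks ts, {in ks, forall k, k.1 \in ts} -> (size ts <= Nd)%N ->
  shift_invariant P (coordinate X) kappa e ks.
Proof.
move=> mX joint kappa01 e0 M0 mxi ks ts hks sts s C l f l0 le hf.
(* Removing repetitions keeps the number of times within the range of the stationarity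
   hypothesis. *)
pose tau := sort leq (undup [seq k.1 | k <- ks]).
have stau : (size tau <= Nd)%N.
  rewrite size_sort (leq_trans _ sts)//; apply: uniq_leq_size; first exact: undup_uniq.
  by move=> t; rewrite mem_undup => /mapP[k kin ->]; exact: hks.
have taus : sorted leq tau by apply: sort_sorted; exact: leq_total.
pose ns := in_tuple tau; pose ms := map_tuple (fun t => (t + s)%N) ns.
have mss : sorted leq ms.
  by apply: homo_sorted taus => x y xy; rewrite leq_add2r.
have gaps j : (j.+1 < size tau)%N -> (nth 0 ns j.+1 - nth 0 ns j = nth 0 ms j.+1 - nth 0 ms j)%N.
  by move=> jt; rewrite /= !(nth_map 0%N)// ?subnDr// ltnW.
pose x0 : wp.-tuple R := [tuple 0 | _ < wp].
pose us : seq ((size tau).-tuple (wp.-tuple R) -> R) :=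
  [seq (fun y : (size tau).-tuple (wp.-tuple R) => tnth (nth x0 y (index k.1 tau)) k.2) | k <- ks].
have mus : mseq us.
  move=> i; have [ik|ik] := ltnP i (size ks); last first.
    by rewrite nth_default ?size_map//; exact: measurable_cst.
  have [k0 _] : exists k0 : nat * 'I_wp, True by case: (ks) ik => // k0 ? _; exists k0.
  rewrite (nth_map k0)//; set k := nth k0 ks i.
  have kt : (index k.1 tau < size tau)%N.
    by rewrite index_mem mem_sort mem_undup map_f// mem_nth.
  rewrite (_ : (fun y : (size tau).-tuple (wp.-tuple R) => _) =
     (fun y => tnth (tnth y (Ordinal kt)) k.2)); last by apply/funext => y; rewrite (tnth_nth x0).
  apply: (measurableT_comp (f := fun x : wp.-tuple R => tnth x k.2)); exact: measurable_tnth.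
pose U (zs : (size tau).-tuple nat) w := map_tuple (fun n => X n w) zs.
have mU zs : measurable_fun setT (U zs).
  apply/measurable_fun_tnthP => i; rewrite (_ : _ \o _ = X (tnth zs i)); first exact: mX.
  by apply/funext => w; rewrite /= tnth_map.
have mf : measurable_fun setT (fun y => f (ev us y)).
  by apply: (holder_measurable kappa01 l0 hf) mus; rewrite size_map.
have Ens w : f (ev (xs (coordinate X) ks) w) = f (ev us (U ns w)).
  rewrite /ev /us /xs -!map_comp; congr f; apply/eq_in_map => k kin /=.
  have kt : k.1 \in tau by rewrite mem_sort mem_undup map_f.
  by rewrite (nth_map 0%N) ?index_mem// nth_index.
have Ems w : f (ev (xs (coordinate X) (shift s ks)) w) = f (ev us (U ms w)).
  rewrite /ev /us /xs /shift -!map_comp; congr f; apply/eq_in_map => k kin /=.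
  have kt : k.1 \in tau by rewrite mem_sort mem_undup map_f.
  by rewrite (nth_map 0%N) ?size_map ?index_mem// (nth_map 0%N) ?index_mem// nth_index.
under eq_fun do rewrite Ems; under [in RHS]eq_fun do rewrite Ens.
have ins : itg P ((fun y => f (ev us y)) \o U ns).
  rewrite (_ : _ \o _ = (fun w => f (ev (xs (coordinate X) ks) w))).
    have [] := hol_itg kappa01 l0 hf (size_map _ _) e0 le (moms_map e0 M0 ks mxi) => //.
  by apply/funext => w; rewrite /= Ens.
have law A : measurable A -> P (U ms @^-1` A) = P (U ns @^-1` A).
  by move=> mA; symmetry; apply: joint.
by have [] := eq_law_Ex (mU ms) (mU ns) mf law ins.
Qed.

(** * Slopes and offsets of the linear polynomials *)

(** Affinity gives f(n) + n f(0) = n f(1) + f(0) in the naturals; a decreasing f would violate this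
    at n = f(0) + 1, where it would have to be negative. *)
Lemma linear_values (f : nat -> nat) (pol : {poly rat}) : size pol = 2%N ->
  (forall n, ((f n)%:R : rat) = pol.[n%:R]) ->
  (f 0 < f 1)%N /\ forall n, f n = ((f 1 - f 0) * n + f 0)%N.
Proof.
move=> sp fE; have pE x : pol.[x] = pol`_0 + pol`_1 * x.
  by rewrite horner_coef sp !big_ord_recl big_ord0 /= expr0 mulr1 addr0 expr1.
have a0 : pol`_1 != 0.
  have : lead_coef pol != 0 by rewrite lead_coef_eq0 -size_poly_gt0 sp.
  by rewrite lead_coefE sp.
have E n : (f n + n * f 0 = n * f 1 + f 0)%N.
  by apply/eqP; rewrite -(eqr_nat rat) !natrD !natrM !fE !pE; apply/eqP; ring.
have ne : f 0 != f 1.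
  rewrite -(eqr_nat rat) !fE !pE mulr0 mulr1 -subr_eq0 addr0 opprD addrA subrr sub0r oppr_eq0.
  exact: a0.
have lt01 : (f 0 < f 1)%N.
  rewrite ltn_neqAle ne leqNgt; apply/negP => h.
  have := E (f 0).+1; have : ((f 0).+1 * f 1 <= (f 0).+1 * (f 0).-1)%N.
    by rewrite leq_mul2l -ltnS prednK ?h// (leq_ltn_trans _ h).
  case: (f 0) h => // b _ /=; move: (f b.+2) (f 1) => x y; nia.
split=> // n; have := E n; rewrite -[in (n * f 1)%N](subnK (ltnW lt01)) mulnDr addnAC => /eqP.
by rewrite eqn_add2r => /eqP ->; rewrite mulnC.
Qed.

Section indices.
Variables (ell k : nat) (qp : nat -> {poly rat}) (qf : nat -> nat -> nat).
Hypothesis ell1 : (1 <= ell)%N.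
Hypothesis qfE : forall i n, (1 <= i <= ell)%N -> ((qf i n)%:R : rat) = (qp i).[n%:R].
Hypothesis qf_lt : exists N, forall n, (N <= n)%N -> forall i, (1 <= i < ell)%N -> (qf i n < qf i.+1 n)%N.
Hypothesis k_le : (1 <= k <= lhat qf ell)%N.
Hypothesis linear : forall i, (1 <= i <= ell)%N -> (size (qp i) == 2%N) = (i <= rr qf ell k)%N.

Local Notation r := (rr qf ell).
Local Notation rl := (rlist qf ell).

Let rE s : (s <= lhat qf ell)%N -> r s = nth 0%N (0%N :: rcons rl ell) s.
Proof.
rewrite /rr /lhat; case: s => [|s] //=; rewrite ltnS leq_eqVlt nth_rcons => /orP[/eqP->|sl].
  by rewrite ltnn eqxx nth_default.
by rewrite sl; apply: set_nth_default.
Qed.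

Let r_sorted : sorted ltn (0%N :: rcons rl ell).
Proof.
have s1 : sorted ltn rl by apply: sorted_filter; [exact: ltn_trans|exact: iota_ltn_sorted].
have rb x : x \in rl -> (0 < x < ell)%N.
  by rewrite mem_filter mem_iota => /andP[_]; rewrite add1n prednK.
rewrite /= rcons_path; apply/andP; split.
  rewrite path_min_sorted//; apply/allP => x /rb /andP[//].
case E : rl => [|y s] //=.
by have := rb (last y s); rewrite E mem_last => /(_ isT)/andP[].
Qed.

Lemma r_incr s s' : (s < s')%N -> (s' <= lhat qf ell)%N -> (r s < r s')%N.
Proof.
move=> ss' s'l; rewrite !rE//; last exact: leq_trans (ltnW ss') s'l.
apply: (sorted_ltn_nth ltn_trans) => //; rewrite inE /= size_rcons ltnS -/(lhat qf ell)//.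
exact: leq_trans (ltnW ss') s'l.
Qed.

Lemma r0 : r 0 = 0%N. Proof. by []. Qed.

Lemma r_le_ell s : (s <= lhat qf ell)%N -> (r s <= ell)%N.
Proof.
rewrite leq_eqVlt => /orP[/eqP->|sl].
  by rewrite /rr /lhat nth_default.
have := r_incr sl (leqnn _); rewrite [r (lhat _ _)](_ : _ = ell) => [/ltnW//|].
by rewrite /rr /lhat nth_default.
Qed.

Let k_lhat : (k <= lhat qf ell)%N. Proof. by case/andP: k_le. Qed.
Let rk_ell : (r k <= ell)%N. Proof. exact: r_le_ell. Qed.

Definition slope i := (qf i 1 - qf i 0)%N.

Let values i : (0 < i)%N -> (i <= r k)%N -> (qf i 0 < qf i 1)%N /\
  forall n, qf i n = (slope i * n + qf i 0)%N.
Proof.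
move=> i0 ik; have il : (1 <= i <= ell)%N by rewrite i0 (leq_trans ik).
by apply: linear_values (fun n => qfE n il); apply/eqP; rewrite linear.
Qed.

(** Since q_i < q_(i+1) eventually, slopes cannot decrease. A jump of the slope makes the difference
    diverge and thus ends a block; equal slopes leave a positive constant difference. *)
Let slope_step i : (0 < i)%N -> (i < r k)%N ->
  (slope i < slope i.+1)%N /\ qdiverge qf i \/
  [/\ slope i = slope i.+1, (qf i 0 < qf i.+1 0)%N & ~ qdiverge qf i].
Proof.
move=> i0 ik; have [_ v1] := values i0 (ltnW ik); have [_ v2] := values (ltn0Sn i) ik.
have [N hN] := qf_lt; have ii : (1 <= i < ell)%N by rewrite i0 (leq_trans ik).
have lt n : (N <= n)%N -> (slope i * n + qf i 0 < slope i.+1 * n + qf i.+1 0)%N.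
  by move=> nN; rewrite -v1 -v2 hN.
move: (slope i) (slope i.+1) (qf i 0) (qf i.+1 0) v1 v2 lt => a a' b b' v1 v2 lt.
case: (ltngtP a a') => aa'; [left|exfalso|right].
- split=> // M; exists (M + b)%N => n nM; rewrite v1 v2.
  have : (a.+1 * n <= a' * n)%N by rewrite leq_mul2r aa' orbT.
  rewrite mulSn; move: nM; move: (a * n)%N (a' * n)%N => x y; clear; lia.
- have := lt (N + b')%N (leq_addr _ _).
  have : (a'.+1 * (N + b') <= a * (N + b'))%N by rewrite leq_mul2r aa' orbT.
  rewrite mulSn; move: (a * _)%N (a' * _)%N => x y; clear; lia.
- split=> //; first by have := lt N (leqnn _); rewrite aa' ltn_add2l.
  move=> /(_ (b' - b).+1)[N' hN']; have := hN' N' (leqnn _).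
  by rewrite v1 v2 aa' subnDl ltnn.
Qed.

Let boundary s : (0 < s)%N -> (s < lhat qf ell)%N -> qdiverge qf (r s).
Proof.
case: s => // s _; rewrite /lhat ltnS => sl.
have : nth ell rl s \in rl by exact: mem_nth.
by rewrite /rr /= mem_filter => /andP[/asboolP].
Qed.

Let interior s i : (s < lhat qf ell)%N -> (r s < i)%N -> (i < r s.+1)%N -> (i < ell)%N -> ~ qdiverge qf i.
Proof.
move=> sl si is1 il di; have irl : i \in rl.
  rewrite mem_filter; apply/andP; split; first exact/asboolP.
  by rewrite mem_iota add1n prednK// il (leq_ltn_trans _ si).
have jl : (index i rl < size rl)%N by rewrite index_mem.
have ri : r (index i rl).+1 = i by rewrite /rr /= nth_index.
have jle : ((index i rl).+1 < lhat qf ell)%N by rewrite /lhat ltnS.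
case: (leqP (index i rl).+1 s) => h.
  have : (r (index i rl).+1 <= r s)%N.
    by move: h; rewrite leq_eqVlt => /orP[/eqP->//|h]; exact/ltnW/r_incr/ltnW.
  by rewrite ri leqNgt si.
have : (r s.+1 <= r (index i rl).+1)%N.
  by move: h; rewrite leq_eqVlt => /orP[/eqP->//|h]; exact/ltnW/r_incr/ltnW.
by rewrite ri leqNgt is1.
Qed.

Section block.
Variable l : nat.
Hypothesis lk : (l < k)%N.
Let ll : (l < lhat qf ell)%N. Proof. exact: leq_trans lk k_lhat. Qed.
Let rl1 : (r l < r l.+1)%N. Proof. exact: r_incr. Qed.
Let rlk : (r l.+1 <= r k)%N.
Proof. by move: lk; rewrite leq_eqVlt => /orP[/eqP->//|h]; exact/ltnW/r_incr. Qed.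

Lemma blen_gt0 : (0 < blen qf ell l.+1)%N. Proof. by rewrite /blen subn_gt0. Qed.

Let in_block j : (j < blen qf ell l.+1)%N -> (r l + j.+1 <= r l.+1)%N.
Proof. by rewrite /blen /= => h; rewrite -leq_subRL// ltnW. Qed.

Let block_step j : (j.+1 < blen qf ell l.+1)%N ->
  slope (r l + j.+1) = slope (r l + j.+2) /\ (qf (r l + j.+1) 0 < qf (r l + j.+2) 0)%N.
Proof.
move=> h; have h1 : (r l + j.+1 < r l.+1)%N by rewrite -addnS; exact: in_block.
have pos : (0 < r l + j.+1)%N by rewrite addnS.
have := slope_step pos (leq_trans h1 rlk); rewrite -addnS => -[[_ dv]|[-> ? _]//].
exfalso; apply: (interior ll _ h1 _ dv); first by rewrite addnS ltnS leq_addr.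
exact: leq_trans h1 (leq_trans rlk rk_ell).
Qed.

Let block_values j : (j < blen qf ell l.+1)%N ->
  slope (r l + j.+1) = slope (r l).+1 /\ (qf (r l).+1 0 + j <= qf (r l + j.+1) 0)%N.
Proof.
elim: j => [|j IH] h; first by rewrite addn1 addn0.
have [e1 h1] := IH (ltnW h); have [e2 h2] := block_step h; split; first by rewrite -e2 e1.
by rewrite addnS (leq_ltn_trans h1).
Qed.

Lemma block_valueE j n : (j < blen qf ell l.+1)%N ->
  qf (r l + j.+1) n = (slope (r l).+1 * n + qf (r l).+1 0 + doff qf ell l.+1 j)%N.
Proof.
move=> h; have [e1 h1] := block_values h.
have pos : (0 < r l + j.+1)%N by rewrite addnS.
have [_ ->] := values pos (leq_trans (in_block h) rlk).
by rewrite e1 -addnA /doff /= subnKC// (leq_trans _ h1)// leq_addr.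
Qed.

Lemma doff_Dhat j : (j < blen qf ell l.+1)%N -> doff qf ell l.+1 j \in Dhat qf ell.
Proof.
move=> h; rewrite /Dhat mem_undup; apply/allpairsPdep; exists l, (r l + j.+1)%N.
rewrite !mem_iota /= add0n ll; split=> //.
rewrite addnS ltnS leq_addr /= -addnS; move: h; rewrite /blen /= => h.
by rewrite !addSn !ltnS ?addnS ltn_add2l.
Qed.

(** Distinctness bounds the length of a block by |D|, on which the dimension count of the assumption
    rests. *)
Lemma doff_uniq : uniq [seq doff qf ell l.+1 j | j <- iota 0 (blen qf ell l.+1)].
Proof.
have H j j' : (j < j')%N -> (j' < blen qf ell l.+1)%N -> (doff qf ell l.+1 j < doff qf ell l.+1 j')%N.
  elim: j' => // j' IH; rewrite ltnS leq_eqVlt => /orP[/eqP<-|jj'] h; last first.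
    apply: (ltn_trans (IH jj' (ltnW h))); have [_ h2] := block_step h.
    have [_ h1] := block_values (ltnW h).
    by rewrite /doff /= ltn_sub2r// (leq_ltn_trans _ h2)// (leq_trans _ h1)// leq_addr.
  have [_ h2] := block_step h; have [_ h1] := block_values (ltnW h).
  by rewrite /doff /= ltn_sub2r// (leq_ltn_trans _ h2)// (leq_trans _ h1)// leq_addr.
rewrite map_inj_in_uniq ?iota_uniq// => j j'; rewrite !mem_iota !add0n /= => jb j'b e.
case: (ltngtP j j') => // h.
  by have := H _ _ h j'b; rewrite e ltnn.
by have := H _ _ h jb; rewrite e ltnn.
Qed.

Lemma slope_gt0 : (0 < slope (r l).+1)%N.
Proof.
by rewrite subn_gt0; case: (values (ltn0Sn (r l)) (leq_trans rl1 rlk)).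
Qed.

Lemma slope_incr1 : (l.+1 < k)%N -> (slope (r l).+1 < slope (r l.+1).+1)%N.
Proof.
move=> l1k; have b0 := blen_gt0.
have hb : ((blen qf ell l.+1).-1 < blen qf ell l.+1)%N by rewrite prednK.
have [e1 _] := block_values hb.
have e2 : (r l + (blen qf ell l.+1).-1.+1 = r l.+1)%N by rewrite prednK// /blen subnKC// ltnW.
rewrite -e1 e2; have r1k : (r l.+1 < r k)%N by exact: r_incr.
have [[]//|[_ _ nd]] := slope_step (leq_ltn_trans (leq0n _) rl1) r1k.
by exfalso; apply: nd; apply: boundary => //; exact: leq_trans l1k k_lhat.
Qed.

End block.

Lemma slope_incr l l' : (l < l')%N -> (l' < k)%N -> (slope (r l).+1 < slope (r l').+1)%N.
Proof.
elim: l' => // l' IH; rewrite ltnS leq_eqVlt => /orP[/eqP->|ll'] l'k; first exact: slope_incr1 (ltnW l'k) l'k.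
exact: ltn_trans (IH ll' (ltnW l'k)) (slope_incr1 (ltnW l'k) l'k).
Qed.

Lemma iota_blocks i : (i <= k)%N ->
  iota 1 (r i) = flatten [seq [seq (r l + j.+1)%N | j <- iota 0 (blen qf ell l.+1)] | l <- iota 0 i].
Proof.
elim: i => [//|i IH] ik; have -> : iota 0 i.+1 = iota 0 i ++ [:: i] by rewrite -[in LHS]addn1 iotaD.
rewrite map_cat flatten_cat -IH; last exact: ltnW.
rewrite /= cats0.
have ri : (r i <= r i.+1)%N by apply/ltnW/r_incr => //; exact: leq_trans k_lhat.
rewrite -{1}(subnKC ri) iotaD; congr (_ ++ _).
by rewrite addnC iotaDl (iotaDl 1 0) -map_comp.
Qed.

End indices.

(** * Independence of sigma-algebras and expectations of products *)

Section independence.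
Context {d : measure_display} {T : measurableType d} {R : realType}.
Variables (P : probability T R) (Gs : nat -> set (set T)) (s : seq nat).
Hypothesis sG : forall i, sigma_algebra setT (Gs i).
Hypothesis Gm : forall i, Gs i `<=` measurable.
Hypothesis us : uniq s.
Hypothesis ind : forall E : nat -> set T, (forall i, Gs i (E i)) ->
  P (\bigcap_(i in [set` s]) E i) = (\prod_(i <- s) P (E i))%E.

Let prod_indic (E : nat -> set T) (s' : seq nat) w :
  \prod_(i <- s') \1_(E i) w = \1_(\bigcap_(i in [set` s']) E i) w :> R.
Proof.
elim: s' => [|i s' IH]; first by rewrite big_nil set_nil bigcap_set0 indicT.
rewrite big_cons IH (_ : \bigcap_(j in [set` i :: s']) E j = E i `&` \bigcap_(j in [set` s']) E j) ?indicI//.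
apply/seteqP; split=> x /=; last first.
  by move=> [xi xs] j /=; rewrite inE => /orP[/eqP->//|]; exact: xs.
move=> h; split; first by apply: h; rewrite /= inE eqxx.
by move=> j js; apply: h; rewrite /= inE (_ : j \in s') ?orbT.
Qed.

Let norm_prod1 (h : nat -> T -> R) (s' : seq nat) w : (forall i w, `|h i w| <= 1) ->
  `|\prod_(i <- s') h i w| <= 1.
Proof. by move=> h1; rewrite normr_prod; apply: prodr_ile1 => i; rewrite normr_ge0 h1. Qed.

Let measurable_indic (E : set T) : measurable E -> measurable_fun setT (\1_E : T -> R).
Proof. by move=> mE; exact: measurable_indic. Qed.

(** Indicators are exchanged for bounded functions one index at a time, by induction on the part
    already exchanged. *)
Let independent_split s1 s2 (h : nat -> T -> R) (E : nat -> set T) : s = s1 ++ s2 ->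
  (forall i, Gmeasurable (Gs i) (h i)) -> (forall i w, `|h i w| <= 1) -> (forall i, Gs i (E i)) ->
  Ex P (fun w => \prod_(i <- s1) h i w * \prod_(i <- s2) \1_(E i) w) =
  \prod_(i <- s1) Ex P (h i) * \prod_(i <- s2) Ex P \1_(E i).
Proof.
elim/last_ind: s1 s2 E => [|s1 x IH] s2 E.
  move=> /= ss _ _ GE; rewrite big_nil mul1r.
  under eq_fun do rewrite big_nil mul1r prod_indic.
  have mE i : measurable (E i) by apply: Gm (GE i).
  rewrite Ex_indic; last by rewrite bigcap_seq; apply: bigsetI_measurable => i _.
  rewrite -ss ind// ss (_ : (\prod_(i <- s2) P (E i))%E = (\prod_(i <- s2) Ex P \1_(E i))%:E)//.
  elim: (s2) => [|i s' IH']; first by rewrite !big_nil.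
  by rewrite !big_cons IH' EFinM Ex_indic// fineK// fin_num_measure.
move=> ss Gh h1 GE; rewrite -cats1 in ss *; rewrite -catA in ss.
have xs2 : x \notin s2.
  by move: us; rewrite ss cat_uniq => /and3P[_ _] /= /andP[].
have mh i : measurable_fun setT (h i) by apply: (Gmeasurable_measurable (@Gm i)); exact: Gh.
have mE i : measurable (E i) by apply: Gm (GE i).
pose W w := \prod_(i <- s1) h i w * \prod_(i <- s2) (\1_(E i) w : R).
pose c := \prod_(i <- s1) Ex P (h i) * \prod_(i <- s2) Ex P \1_(E i).
have mW : measurable_fun setT W.
  apply: measurable_funM; first exact: measurable_prod.
  by apply: measurable_prod => i _; exact: measurable_indic.
have W1 w : `|W w| <= 1.
  rewrite normrM mulr_ile1//; first exact: norm_prod1.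
  by apply: (norm_prod1 (h := fun i => \1_(E i))) => i w'; rewrite indicE; case: (_ \in _); rewrite ?normr1 ?normr0.
have iW : itg P W by apply: itg_bounded W1.
(* The product W of the other factors has the constant c as conditional expectation given [Gs x];
   the pull-out property then puts [h x] in place of an indicator. *)
have key B : Gs x B -> Ex P (fun w => \1_B w * W w) = Ex P (fun w => \1_B w * c).
  move=> GB; pose E' i := if i == x then B else E i.
  have GE' i : Gs i (E' i) by rewrite /E'; case: eqP => [->|].
  have := IH (x :: s2) E' ss Gh h1 GE'.
  have e2 (F : set T -> R) : \prod_(i <- s2) F (E' i) = \prod_(i <- s2) F (E i).
    by apply: eq_big_seq => i is2; rewrite /E'; case: eqP => // ix; rewrite -ix is2 in xs2.
  have E'x : E' x = B by rewrite /E' eqxx.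
  rewrite [X in _ = _ * X]big_cons E'x (e2 (fun A => Ex P \1_A)).
  rewrite (_ : (fun w => \prod_(i <- s1) h i w * _) = (fun w => \1_B w * W w)); last first.
    by apply/funext => w; rewrite big_cons E'x (e2 (fun A => \1_A w)) /W; ring.
  move=> ->; rewrite (_ : (fun w => \1_B w * c) = (fun w => c * \1_B w)); last by apply/funext => w; rewrite mulrC.
  rewrite ExZ; first by rewrite /c; ring.
  by apply: (@itg_bounded _ _ _ _ _ 1); [exact: measurable_indic (Gm GB)|move=> w; rewrite indicE; case: (_ \in _); rewrite ?normr1 ?normr0].
have cW : cexp_version P (Gs x) W (fun=> c).
  split; first by apply/(GmeasurableP (sG x)); exact: measurable_cst.
  split; first exact: itg_cst.
  move=> B GB; have mB := Gm GB; have := key B GB; rewrite !Ex_indicM// => E0.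
  have fin f : itg P f -> (\int[P]_(w in B) (f w)%:E)%E \is a fin_num.
    by move=> fi; apply: integrable_fin_num => //; apply: integrableS fi.
  by rewrite -[LHS]fineK ?fin//; [rewrite -E0 fineK// fin|exact: itg_cst].
have := cexp_pullout (sG x) (@Gm x) iW cW (Gh x) (h1 x) => E0.
rewrite !big_cat !big_seq1 /=.
rewrite (_ : (fun w => _) = (fun w => h x w * W w)); last first.
  by apply/funext => w; rewrite big_cat big_seq1 /W /=; ring.
rewrite -E0 (_ : (fun w => h x w * c) = (fun w => c * h x w)); last by apply/funext => w; rewrite mulrC.
rewrite ExZ; first by rewrite /c; ring.
exact: itg_bounded (h1 x).
Qed.

Lemma independent_product (h : nat -> T -> R) :
  (forall i, Gmeasurable (Gs i) (h i)) -> (forall i w, `|h i w| <= 1) ->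
  Ex P (fun w => \prod_(i <- s) h i w) = \prod_(i <- s) Ex P (h i).
Proof.
move=> Gh h1; have GT i : Gs i setT by have [G0 GC _] := sG i; rewrite -(setD0 setT); exact: GC.
have := @independent_split s [::] h (fun=> setT) (esym (cats0 s)) Gh h1 GT.
by rewrite big_nil mulr1 => <-; congr Ex; apply/funext => w; rewrite big_nil mulr1.
Qed.

End independence.

(** * Flat coordinates for lists of vectors *)

Section flattening.
Variables (R : realType) (wp : nat).
Implicit Types (x z : seq R) (ts : seq (wp.-tuple R)).

(** Left inverse of flattening on lists of n vectors; the default 0 makes it total, so G becomes a
    function on flat lists, where the class [hol] lives. *)
Fixpoint unflatten n x : seq (wp.-tuple R) :=
  if n is n'.+1 then [tuple nth 0 x j | j < wp] :: unflatten n' (drop wp x) else [::].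

Lemma size_unflatten n x : size (unflatten n x) = n.
Proof. by elim: n x => //= n IH x; rewrite IH. Qed.

Lemma flattenK ts : unflatten (size ts) (flatten [seq tval t | t <- ts]) = ts.
Proof.
elim: ts => //= t ts IH; rewrite drop_size_cat ?size_tuple// IH; congr (_ :: _).
apply: eq_from_tnth => j; rewrite tnth_mktuple nth_cat size_tuple ltn_ord.
by rewrite -tnth_nth.
Qed.

Lemma sdist_nth x z : size x = size z ->
  sdist x z = \sum_(i < size x) `|nth 0 x i - nth 0 z i|.
Proof.
move=> s; rewrite /sdist (big_nth (0, 0)) size_zip s minnn big_mkord.
by apply: eq_bigr => i _; rewrite nth_zip//= s.
Qed.

Let wt_drop x : wt (drop wp x) <= wt x.
Proof. by rewrite -{2}(cat_take_drop wp x); exact: wt_catr. Qed.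

Lemma vnorm_unflatten n x (iota : R) : 0 <= iota -> size x = (n * wp)%N ->
  \sum_(t <- unflatten n x) vnorm t `^ iota <= n%:R * wt x `^ iota.
Proof.
move=> i0; elim: n x => [|n IH] x sx /=; first by rewrite big_nil mul0r.
rewrite big_cons -natr1 mulrDl mul1r [leRHS]addrC; apply: lerD.
  apply: ler_powRl => //; first exact: sqrtr_ge0.
  apply: le_trans (vnorm_le_sum _) _; apply: (@le_trans _ _ (wt (take wp x))); last first.
    by rewrite -{2}(cat_take_drop wp x); exact: wt_catl.
  rewrite (_ : tval _ = take wp x).
    by rewrite /wt lerDr.
  apply: (@eq_from_nth _ 0); first by rewrite size_tuple size_takel// sx mulSn leq_addr.
  move=> i; rewrite size_tuple => iw; rewrite nth_take//.
  by rewrite -[i]/(nat_of_ord (Ordinal iw)) -tnth_nth tnth_mktuple.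
apply: le_trans (IH _ _) _; first by rewrite size_drop sx mulSn addKn.
rewrite ler_wpM2l//; apply: ler_powRl => //; exact: ltW (wt_gt0 _).
Qed.

Lemma vdist_unflatten n x z (kappa : R) : 0 <= kappa -> size x = (n * wp)%N -> size z = (n * wp)%N ->
  \sum_(pr <- zip (unflatten n x) (unflatten n z)) vdist pr.1 pr.2 `^ kappa <= n%:R * sdist x z `^ kappa.
Proof.
move=> k0; elim: n x z => [|n IH] x z sx sz /=; first by rewrite big_nil mul0r.
have stx : size (take wp x) = wp by rewrite size_takel// sx mulSn leq_addr.
have stz : size (take wp z) = wp by rewrite size_takel// sz mulSn leq_addr.
have E : sdist x z = sdist (take wp x) (take wp z) + sdist (drop wp x) (drop wp z).
  by rewrite -sdist_cat ?stx ?stz// !cat_take_drop.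
have d1 := sdist_ge0 (take wp x) (take wp z); have d2 := sdist_ge0 (drop wp x) (drop wp z).
rewrite big_cons -natr1 mulrDl mul1r [leRHS]addrC; apply: lerD.
  apply: ler_powRl => //; first exact: sqrtr_ge0.
  rewrite (le_trans (vdist_le_sum _ _))// E (@le_trans _ _ (sdist (take wp x) (take wp z)))// ?lerDl//.
  rewrite sdist_nth ?stx ?stz// le_eqVlt; apply/orP; left; apply/eqP; apply: eq_bigr => j _ /=.
  by rewrite !tnth_mktuple !nth_take.
apply: le_trans (IH _ _ _ _) _; try by rewrite size_drop ?sx ?sz mulSn addKn.
by rewrite ler_wpM2l//; apply: ler_powRl => //; rewrite E lerDr.
Qed.

Lemma holder_growth_hol n (K iota kappa : R) (G : seq (wp.-tuple R) -> R) :
  0 < K -> 0 < iota -> 0 < kappa <= 1 -> holder_growth n K iota kappa G ->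
  exists C, hol kappa (n * wp) iota C (fun x => G (unflatten n x)).
Proof.
move=> K0 iota0 /andP[k0 _] [hd hg]; have n0 : 0 <= n%:R :> R by [].
exists (K * (2 * n%:R + 1) * (n%:R + 1)); split=> [x z sx sz|x sx]; last first.
  rewrite (le_trans (hg _ (size_unflatten _ _)))// -!mulrA ler_pM2l//.
  have h := vnorm_unflatten (ltW iota0) sx; have w1 := wt_powR_ge1 x (ltW iota0).
  move: h w1 n0; move: (\sum_(_ <- _) _) (wt x `^ iota) (n%:R) => a b c h w1 n0.
  have : 0 <= c * b by rewrite mulr_ge0// (le_trans _ w1).
  have : 0 <= c * (c * b) by rewrite !mulr_ge0// (le_trans _ w1).
  move=> h1 h2; have -> : (2 * c + 1) * ((c + 1) * b) = 2 * (c * (c * b)) + 3 * (c * b) + b by ring.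
  by move: h w1 h1 h2; lra.
rewrite (le_trans (hd _ _ (size_unflatten _ _) (size_unflatten _ _)))//.
have hx := vnorm_unflatten (ltW iota0) sx; have hz := vnorm_unflatten (ltW iota0) sz.
have hD := vdist_unflatten (ltW k0) sx sz.
have W1 : 1 <= (wt x + wt z) `^ iota.
  apply: le_trans (wt_powR_ge1 x (ltW iota0)) _; apply: ler_powRl; [exact: ltW|exact: ltW (wt_gt0 _)|].
  by rewrite lerDl ltW// wt_gt0.
have Wx : wt x `^ iota <= (wt x + wt z) `^ iota.
  by apply: ler_powRl; [exact: ltW|exact: ltW (wt_gt0 _)|rewrite lerDl ltW// wt_gt0].
have Wz : wt z `^ iota <= (wt x + wt z) `^ iota.
  by apply: ler_powRl; [exact: ltW|exact: ltW (wt_gt0 _)|rewrite lerDr ltW// wt_gt0].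
set W := (_ + _) `^ iota in W1 Wx Wz *; set D := sdist x z `^ kappa in hD *.
have D0 : 0 <= D by exact: powR_ge0.
have S1 : 1 + \sum_(xi <- unflatten n x) vnorm xi `^ iota + \sum_(zi <- unflatten n z) vnorm zi `^ iota
    <= (2 * n%:R + 1) * W.
  have : n%:R * wt x `^ iota <= n%:R * W by rewrite ler_wpM2l.
  have : n%:R * wt z `^ iota <= n%:R * W by rewrite ler_wpM2l.
  by rewrite mulrDl mul1r -mulrA; lra.
apply: (@le_trans _ _ (K * ((2 * n%:R + 1) * W) * (n%:R * D))).
  apply: ler_pM => //.
  - apply: mulr_ge0; first exact: ltW.
    by apply: addr_ge0; [apply: addr_ge0 => //|]; apply: sumr_ge0 => t _; exact: powR_ge0.
  - by apply: sumr_ge0 => t _; exact: powR_ge0.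
  - by rewrite ler_pM2l.
have -> : K * ((2 * n%:R + 1) * W) * (n%:R * D) = K * (2 * n%:R + 1) * (n%:R * (W * D)) by ring.
have c0 : 0 <= K * (2 * n%:R + 1) by apply: mulr_ge0; [exact: ltW|move: n0; lra].
rewrite -[leRHS]mulrA -[leRHS]mulrA; apply: ler_wpM2l => //.
by rewrite mulrDl mul1r lerDl mulr_ge0// (le_trans _ W1).
Qed.

End flattening.

Lemma measurable_nth_tuple d (T : measurableType d) n (x0 : T) i :
  measurable_fun setT (fun y : n.-tuple T => nth x0 y i).
Proof.
have [h|h] := ltnP i n.
  rewrite (_ : (fun y : n.-tuple T => _) = (fun y => tnth y (Ordinal h))); first exact: measurable_tnth.
  by apply/funext => y; rewrite (tnth_nth x0).
rewrite (_ : (fun y : n.-tuple T => _) = fun=> x0); first exact: measurable_cst.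
by apply/funext => y; rewrite nth_default// size_tuple.
Qed.

Lemma eq_big_all (R : realType) (I : Type) (p Q Q' : pred I) (F F' : I -> R) (L : seq I) :
  all p L -> (forall l, p l -> Q l = Q' l) -> (forall l, p l -> Q l -> F l = F' l) ->
  \prod_(l <- L | Q l) F l = \prod_(l <- L | Q' l) F' l.
Proof.
move=> + hQ hF; elim: L => [|l L IH /= /andP[pl aL]]; first by rewrite !big_nil.
rewrite !big_cons IH// -hQ//; case: (boolP (Q l)) => // Ql.
by rewrite hF.
Qed.

(** * The independent block processes *)

Section block_processes.
Context {d : measure_display} {Omega : measurableType d} {R : realType} {wp : nat}.
Variables (P : probability Omega R) (X : nat -> Omega -> wp.-tuple R).
Variables (qf : nat -> nat -> nat) (ell k : nat).
Context {d' : measure_display} {Omega' : measurableType d'}.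
Variables (P' : probability Omega' R)
  (Y : forall i : nat, nat -> Omega' -> (blen qf ell i).-tuple (wp.-tuple R)).
Variables (al be : nat -> nat).
Hypothesis mX : forall n, measurable_fun setT (X n).
Hypothesis mY : forall i n, measurable_fun setT (Y i n).
Hypothesis lawY : forall i, (1 <= i <= k)%N ->
  forall (mm : nat) (ns : mm.-tuple nat) (A : set (mm.-tuple ((blen qf ell i).-tuple (wp.-tuple R)))),
    measurable A ->
    P' ((fun w => map_tuple (fun n => Y i n w) ns) @^-1` A)
    = P ((fun w => map_tuple (fun n => blockX qf ell X i n w) ns) @^-1` A).
Hypothesis indY : indep_processes P' qf ell k Y.
Hypothesis al_gt0 : forall l, (l < k)%N -> (0 < al l)%N.
Hypothesis al_incr : forall l l', (l < l')%N -> (l' < k)%N -> (al l < al l')%N.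

(* a spec (l, n, j, c) names coordinate c of entry j of the (l+1)-st block at time n *)
Let spec := (nat * nat * nat * 'I_wp)%type.
Implicit Type s : spec.

Definition spec_block s : nat := s.1.1.1.
Definition spec_time s : nat := (al (spec_block s) * s.1.1.2 + be (spec_block s))%N.
Definition spec_entry s : nat := s.1.2.
Definition spec_valid s := (spec_block s < k)%N && (spec_entry s < blen qf ell (spec_block s).+1)%N.

(** The coordinate of X with the same law, as a line in t; the factor 1 matches the speed c = 1 in
    [line_blks]. *)
Definition spec_line s : nat * nat * 'I_wp :=
  ((al (spec_block s) * 1, spec_time s + doff qf ell (spec_block s).+1 (spec_entry s))%N, s.2).

Let x0 : wp.-tuple R := [tuple 0 | _ < wp].
Let y0 i : (blen qf ell i).-tuple (wp.-tuple R) := [tuple x0 | _ < blen qf ell i].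

Definition spec_Y s (w : Omega') : R :=
  tnth (nth x0 (Y (spec_block s).+1 (spec_time s) w) (spec_entry s)) s.2.

(** A single measurable function that reads the entry off a tuple of blocks, whether these come from
    Y or from X; equality of laws then transfers expectations. *)
Let spec_of i mm (ns : mm.-tuple nat) s (y : mm.-tuple ((blen qf ell i).-tuple (wp.-tuple R))) : R :=
  tnth (nth x0 (nth (y0 i) y (index (spec_time s) ns)) (spec_entry s)) s.2.

Let measurable_spec_of i mm (ns : mm.-tuple nat) s : measurable_fun setT (@spec_of i mm ns s).
Proof.
apply: (measurableT_comp (f := fun x : wp.-tuple R => tnth x s.2)); first exact: measurable_tnth.
apply: (measurableT_comp (f := fun y : (blen qf ell i).-tuple (wp.-tuple R) => nth x0 y (spec_entry s))).
  exact: measurable_nth_tuple.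
exact: measurable_nth_tuple.
Qed.

Let UY i mm (ns : mm.-tuple nat) w := map_tuple (fun n => Y i n w) ns.
Let UX i mm (ns : mm.-tuple nat) w := map_tuple (fun n => blockX qf ell X i n w) ns.

Let measurable_map_tuple dd (T : measurableType dd) dd' (T' : measurableType dd')
  (V : nat -> T -> T') mm (ns : mm.-tuple nat) : (forall n, measurable_fun setT (V n)) ->
  measurable_fun setT (fun w => map_tuple (fun n => V n w) ns).
Proof.
move=> mV; apply/measurable_fun_tnthP => i; rewrite (_ : _ \o _ = V (tnth ns i)); first exact: mV.
by apply/funext => w; rewrite /= tnth_map.
Qed.

Let measurable_UY i mm ns : measurable_fun setT (@UY i mm ns).
Proof. exact: (measurable_map_tuple ns (@mY i)). Qed.

Let measurable_UX i mm ns : measurable_fun setT (@UX i mm ns).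
Proof.
apply: measurable_map_tuple => n; apply/measurable_fun_tnthP => j.
rewrite (_ : _ \o _ = X (n + doff qf ell i j)%N); first exact: mX.
by apply/funext => w; rewrite /= tnth_mktuple.
Qed.

Let spec_of_Y mm (ns : mm.-tuple nat) s w : spec_time s \in tval ns ->
  spec_of (i := (spec_block s).+1) ns s (UY (spec_block s).+1 ns w) = spec_Y s w.
Proof.
by move=> tn; rewrite /spec_of /UY /= (nth_map 0%N) ?index_mem// nth_index.
Qed.

Let spec_of_X mm (ns : mm.-tuple nat) s w : spec_time s \in tval ns -> spec_valid s ->
  spec_of (i := (spec_block s).+1) ns s (UX (spec_block s).+1 ns w) = coordinate X (on_line 0 (spec_line s)) w.
Proof.
move=> tn /andP[_ jb]; rewrite /spec_of /UX /= (nth_map 0%N) ?index_mem// nth_index//.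
rewrite -[spec_entry s]/(nat_of_ord (Ordinal jb)) -tnth_nth tnth_mktuple /=.
by rewrite /coordinate /on_line /= muln0 add0n.
Qed.

Lemma spec_Y_mom e M s : (forall q, mom P e M (coordinate X q)) -> spec_valid s -> mom P' e M (spec_Y s).
Proof.
move=> mxi vs; have lk : (spec_block s < k)%N by case/andP: vs.
have [mq iq Eq] := mxi (on_line 0 (spec_line s)).
pose ns := [tuple spec_time s]; have tn : spec_time s \in tval ns by rewrite inE eqxx.
have mg : measurable_fun setT (fun y => `|spec_of (i := (spec_block s).+1) ns s y| `^ e).
  by apply: measurable_norm_powR; exact: measurable_spec_of.
have EX : (fun y => `|spec_of (i := (spec_block s).+1) ns s y| `^ e) \o UX (spec_block s).+1 ns =
   (fun w => `|coordinate X (on_line 0 (spec_line s)) w| `^ e).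
  by apply/funext => w; rewrite /= spec_of_X.
have EY : (fun y => `|spec_of (i := (spec_block s).+1) ns s y| `^ e) \o UY (spec_block s).+1 ns =
   (fun w => `|spec_Y s w| `^ e).
  by apply/funext => w; rewrite /= spec_of_Y.
have := eq_law_Ex (@measurable_UY _ _ ns) (@measurable_UX _ _ ns) mg (@lawY (spec_block s).+1 lk _ ns).
rewrite EX EY => /(_ iq)[EE iY]; split; [|exact: iY|by rewrite EE].
have := measurableT_comp (@measurable_spec_of (spec_block s).+1 _ ns s) (@measurable_UY _ _ ns).
by congr measurable_fun; apply/funext => w; rewrite /= spec_of_Y.
Qed.

Let prod_by_block (F : spec * (R -> R) -> R) (L : seq (spec * (R -> R))) :
  all (fun l => spec_block l.1 < k)%N L ->
  \prod_(l <- L) F l = \prod_(i <- iota 1 k) \prod_(l <- L | (spec_block l.1).+1 == i) F l.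
Proof.
elim: L => [_|l L IH /= /andP[lk aL]].
  by rewrite big_nil big1// => i _; rewrite big_nil.
rewrite big_cons IH//.
rewrite [RHS](_ : _ = \prod_(i <- iota 1 k) ((if (spec_block l.1).+1 == i then F l else 1) *
    \prod_(l <- L | (spec_block l.1).+1 == i) F l)); last first.
  by apply: eq_bigr => i _; rewrite big_cons; case: ifP => // _; rewrite mul1r.
rewrite big_split/=; congr (_ * _).
rewrite (bigD1_seq (spec_block l.1).+1)/= ?iota_uniq ?mem_iota ?add1n ?ltnS//.
by rewrite eqxx big1 ?mulr1// => i; rewrite eq_sym => /negbTE->.
Qed.

(** Line limits are indexed by slopes and independence by blocks; slopes carried by no block
    contribute the factor 1. *)
Let prod_slopes (a : nat -> R) (N : nat) : (forall l, (l < k)%N -> (al l <= N)%N) ->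
  (forall A, (forall l, (l < k)%N -> al l != A) -> a A = 1) ->
  \prod_(A < N) a A.+1 = \prod_(i <- iota 1 k) a (al i.-1).
Proof.
move=> alN a1.
rewrite -(big_mkord xpredT (fun A => a A.+1)) -(big_add1 _ _ 0 N.+1 xpredT a)/= /index_iota subSS subn0.
have inj : {in iota 1 k &, injective (fun i => al i.-1)}.
  move=> i j; rewrite !mem_iota !add1n !ltnS => /andP[i0 ik] /andP[j0 jk] e.
  case: (ltngtP i j) => // h.
    by have := @al_incr i.-1 j.-1; rewrite -ltnS !prednK// e ltnn => /(_ h jk).
  by have := @al_incr j.-1 i.-1; rewrite -ltnS !prednK// e ltnn => /(_ h ik).
rewrite -[RHS](big_map (fun i => al i.-1) xpredT a).
rewrite (bigID (fun A => A \in [seq al i.-1 | i <- iota 1 k]))/= [X in _ * X]big1 ?mulr1; last first.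
  move=> A nA; apply: a1 => l lk; apply: contra nA => /eqP <-.
  by apply/mapP; exists l.+1; rewrite // mem_iota add1n !ltnS.
rewrite -big_filter; apply: perm_big; apply: uniq_perm.
- by rewrite filter_uniq// iota_uniq.
- by rewrite map_inj_in_uniq// iota_uniq.
move=> A; rewrite mem_filter mem_iota; case: (boolP (A \in _)) => //= /mapP[i].
rewrite mem_iota add1n !ltnS => /andP[i0 ik] ->; have ik' : (i.-1 < k)%N by rewrite prednK.
by rewrite al_gt0// alN.
Qed.

(** Independence of the Y^(i) factors the expectation over blocks, each factor has the law of the
    matching block of X, and blocks correspond to slopes. This is the product that
    [line_product_cvg] finds in the limit. *)
Lemma spec_product (S : seq spec) (phis : seq (R -> R)) (N : nat) : all spec_valid S ->
  size phis = size S -> blips phis -> (forall l, (l < k)%N -> (al l <= N)%N) ->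
  Ex P' (fun w => bprod phis (ev [seq spec_Y s | s <- S] w)) =
  \prod_(A < N) Ex P (line_product (coordinate X) (line_class A.+1 (zip [seq spec_line s | s <- S] phis)) 0).
Proof.
move=> vS sp bp alN; pose L := zip S phis.
have vL : all (fun l => spec_valid l.1) L.
  by rewrite -(all_map fst spec_valid) [X in all _ X](_ : _ = S)//; apply: unzip1_zip; rewrite sp.
have bL : blips (unzip2 L) by rewrite unzip2_zip// sp.
have E1 w : bprod phis (ev [seq spec_Y s | s <- S] w) = \prod_(l <- L) l.2 (spec_Y l.1 w).
  rewrite /L /bprod /ev; elim: (S) (phis) => [|s S' IH] [|phi phis'] /=; rewrite ?big_nil//.
  by rewrite !big_cons IH.
pose ns := in_tuple [seq spec_time s | s <- S].
pose h i w := \prod_(l <- L | (spec_block l.1).+1 == i) l.2 (spec_Y l.1 w).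
pose g i (y : (size [seq spec_time s | s <- S]).-tuple ((blen qf ell i).-tuple (wp.-tuple R))) :=
  \prod_(l <- L | (spec_block l.1).+1 == i) l.2 (spec_of ns l.1 y).
have tL : all (fun l => spec_valid l.1 && (spec_time l.1 \in tval ns)) L.
  have : all (fun s => spec_valid s && (spec_time s \in tval ns)) S.
    by apply/allP => s sS; rewrite (allP vS)//= map_f.
  by rewrite -[X in all _ X](unzip1_zip (t := phis)) ?sp// all_map.
have bounded (Q : pred (spec * (R -> R))) (F : spec -> R) : `|\prod_(l <- L | Q l) l.2 (F l.1)| <= 1.
  elim: (L) bL => [|l L' IH] b1; first by rewrite big_nil normr1.
  have [[_ [Lc _ bl]] b2] := blips_behead b1; rewrite big_cons; case: ifP => _; last exact: IH.
  by rewrite normrM mulr_ile1// ?IH//; case: (bl (F l.1) 0).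
have mgen i mm (ns0 : mm.-tuple nat) : measurable_fun setT
    (fun y => \prod_(l <- L | (spec_block l.1).+1 == i) l.2 (@spec_of i mm ns0 l.1 y)).
  elim: (L) bL => [|l L' IH] b1.
    by under eq_fun do rewrite big_nil; exact: measurable_cst.
  have [[ml _] b2] := blips_behead b1.
  have [e|/negbTE e] := boolP ((spec_block l.1).+1 == i); under eq_fun do rewrite big_cons e; last exact: IH.
  by apply: measurable_funM; [exact: (measurableT_comp ml (@measurable_spec_of i mm ns0 l.1))|exact: IH].
have mg i : measurable_fun setT (g i) by exact: mgen.
have hE i w : h i w = g i (UY i ns w).
  apply: (eq_big_all tL) => // l /andP[_ tl] /eqP <-; by rewrite spec_of_Y.
(* Generated by block i at the finitely many times in use, so the product rule for cylinder events
   applies to it directly. *)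
pose Gs i := preimage_set_system setT (UY i ns) measurable.
have sG i : sigma_algebra setT (Gs i) by apply: sigma_algebra_preimage; exact: sigma_algebra_measurable.
have Gm i : Gs i `<=` measurable by move=> _ [B mB <-]; exact: measurable_UY.
have Gh i : Gmeasurable (Gs i) (h i).
  move=> B mB; exists (g i @^-1` B); first by rewrite -[X in measurable X]setTI; exact: mg.
  by rewrite setTI; apply/seteqP; split=> w /=; rewrite hE.
have ind E : (forall i, Gs i (E i)) ->
    P' (\bigcap_(i in [set` iota 1 k]) E i) = (\prod_(i <- iota 1 k) P' (E i))%E.
  move=> GE; pose A i := sval (cid2 (GE i)).
  have mA i : measurable (A i) by rewrite /A; case: (cid2 (GE i)).
  have EA i : E i = UY i ns @^-1` A i by rewrite /A; case: (cid2 (GE i)) => B _ /=; rewrite setTI.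
  have := indY ns mA; rewrite (_ : \bigcap_(i in [set i : nat | (1 <= i <= k)%N]) _ =
      \bigcap_(i in [set` iota 1 k]) E i).
    by move=> ->; apply: eq_bigr => i _; rewrite EA.
  apply/seteqP; split=> w /= hw i /=.
    by rewrite mem_iota add1n ltnS => ik; rewrite EA; exact: hw.
  by move=> ik; have := hw i; rewrite /= mem_iota add1n ltnS => /(_ ik); rewrite EA.
under eq_fun do rewrite E1.
rewrite (_ : (fun w => _) = (fun w => \prod_(i <- iota 1 k) h i w)); last first.
  by apply/funext => w; apply: prod_by_block; apply: sub_all vL => l /andP[].
rewrite (independent_product sG Gm (iota_uniq _ _) ind Gh (fun i w => bounded _ (fun s => spec_Y s w))).
have zE : zip [seq spec_line s | s <- S] phis = [seq (spec_line l.1, l.2) | l <- L].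
  rewrite /L; elim: (S) (phis) => [|s S' IH] [|phi phis']//=; by rewrite IH.
have al_inj i j : (i < k)%N -> (j < k)%N -> al i = al j -> i = j.
  move=> ik jk e; case: (ltngtP i j) => // hij.
    by have := al_incr hij jk; rewrite e ltnn.
  by have := al_incr hij ik; rewrite e ltnn.
have classE A w : line_product (coordinate X) (line_class A (zip [seq spec_line s | s <- S] phis)) 0 w =
    \prod_(l <- L | al (spec_block l.1) == A) l.2 (coordinate X (on_line 0 (spec_line l.1)) w).
  rewrite /line_product /line_class big_filter zE big_map; apply: eq_bigl => l /=.
  by rewrite muln1.
pose a A := Ex P (line_product (coordinate X) (line_class A (zip [seq spec_line s | s <- S] phis)) 0).
rewrite (@prod_slopes a N alN); last first.
  move=> A nA; rewrite /a (_ : line_product _ _ _ = fun=> 1) ?Ex_cst//.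
  apply/funext => w; rewrite classE; transitivity (\prod_(l <- L | pred0 l) (1 : R)).
    apply: (eq_big_all vL) => l /andP[lk _]; first by apply/negbTE/nA.
    by move=> e; have := nA _ lk; rewrite e.
  by rewrite big_pred0.
apply: eq_big_seq => i; rewrite mem_iota add1n ltnS => ik.
have [i0 ik'] : (0 < i)%N /\ (i.-1 < k)%N by case/andP: ik => i0 ik; split=> //; rewrite prednK.
have gX w : g i (UX i ns w) = line_product (coordinate X) (line_class (al i.-1) (zip [seq spec_line s | s <- S] phis)) 0 w.
  rewrite classE; apply: (eq_big_all tL) => l /andP[vl tl].
    apply/eqP/eqP => [<-//|e]; rewrite -(prednK i0); congr _.+1; apply: al_inj => //.
    by case/andP: vl.
  by move=> /eqP <-; rewrite spec_of_X.
have ig : itg P (g i \o UX i ns).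
  apply: (@itg_bounded _ _ _ _ _ 1); first exact: (measurableT_comp (mg i) (@measurable_UX i _ ns)).
  by move=> w /=; rewrite gX classE; exact: (bounded _ (fun s => coordinate X (on_line 0 (spec_line s)) w)).
have [EE _] := eq_law_Ex (@measurable_UY i _ ns) (@measurable_UX i _ ns) (mg i) (lawY ik ns) ig.
rewrite (_ : h i = g i \o UY i ns) ?EE; last by apply/funext => w; exact: hE.
by rewrite /a; congr Ex; apply/funext => w; exact: gX.
Qed.

End block_processes.

Section coordinates.
Variables (R : realType) (wp : nat) (x0 : wp.-tuple R).

Lemma coords_flatten (ts : seq (wp.-tuple R)) :
  [seq tnth (nth x0 ts j) c | j <- iota 0 (size ts), c <- enum 'I_wp] = flatten [seq tval t | t <- ts].
Proof.
rewrite -[in RHS](mkseq_nth x0 ts) /mkseq -map_comp; congr flatten.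
by apply: eq_map => j /=; rewrite map_tnth_enum.
Qed.

Lemma map_tval_tuple d (Omega : measurableType d) (X : nat -> Omega -> wp.-tuple R) (qf : nat -> nat -> nat) ell i n w :
  [seq tval t | t <- @blockX R wp d Omega qf ell X i n w] =
  [seq tval (X (n + doff qf ell i j)%N w) | j <- iota 0 (blen qf ell i)].
Proof. by rewrite /blockX /= -map_comp -val_enum_ord -map_comp. Qed.

Lemma ev_blk_flatten (Omega : Type) (X : nat -> Omega -> wp.-tuple R) al be off l n w :
  [seq tnth (X k.1 w) k.2 | k <- blk al be off (enum 'I_wp) l n] =
  flatten [seq tval (X (al l * n + be l + o)%N w) | o <- off l].
Proof.
rewrite /blk map_allpairs; congr flatten.
by apply: eq_map => o /=; rewrite map_tnth_enum.
Qed.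

Lemma nth_allpairs (A B U : Type) (Q : U -> Prop) (f : A -> B -> U) (dflt : U) (s : seq A) (t : seq B) i :
  Q dflt -> (forall a b, Q (f a b)) -> Q (nth dflt [seq f a b | a <- s, b <- t] i).
Proof.
move=> Qd Qf; elim: s i => [|a s IH] i; first by rewrite nth_nil.
rewrite /= nth_cat; case: ifP => _; last exact: IH.
by elim: t i {IH} => [|b t IH] [|i] //=.
Qed.

Lemma size_flatten_tuples (acc : seq (wp.-tuple R)) :
  size (flatten [seq tval x | x <- acc]) = (size acc * wp)%N.
Proof. by elim: acc => //= x acc IH; rewrite size_cat size_tuple IH mulSn. Qed.

End coordinates.

(** * The linear polynomials as a block system *)

Section linear_system.
Context {R : realType} {d : measure_display} {Omega : measurableType d} {P : probability Omega R}.
Context {wp : nat} {X : nat -> Omega -> wp.-tuple R}.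
Context {ell k : nat} {qp : nat -> {poly rat}} {qf : nat -> nat -> nat}.
Context {iot kappa e M : R} {u : nat -> R} {G : seq (wp.-tuple R) -> R} {C : R}.
Context {d' : measure_display} {Omega' : measurableType d'} {P' : probability Omega' R}.
Context {Y : forall i : nat, nat -> Omega' -> (blen qf ell i).-tuple (wp.-tuple R)}.
Hypothesis mX : forall n, measurable_fun setT (X n).
Hypothesis ell1 : (1 <= ell)%N.
Hypothesis qfE : forall i n, (1 <= i <= ell)%N -> ((qf i n)%:R : rat) = (qp i).[n%:R].
Hypothesis qf_lt : exists N, forall n, (N <= n)%N -> forall i, (1 <= i < ell)%N -> (qf i n < qf i.+1 n)%N.
Hypothesis k_le : (1 <= k <= lhat qf ell)%N.
Hypothesis linear : forall i, (1 <= i <= ell)%N -> (size (qp i) == 2%N) = (i <= rr qf ell k)%N.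
Hypothesis iot0 : 0 < iot.
Hypothesis kappa01 : 0 < kappa <= 1.
Hypothesis iot_e : 2 * iot + 1 <= e.
Hypothesis M0 : 0 <= M.
Hypothesis mxi : forall q, mom P e M (coordinate X q).
Hypothesis dec : decoupled P (coordinate X) kappa iot ((lhat qf ell).-1 * size (Dhat qf ell) * wp) u.
Hypothesis u_ge0 : forall r, 0 <= u r.
Hypothesis u_sum : summable (fun n => n.+1%:R * u n).
Hypothesis stat0 : forall ks ts, {in ks, forall q, q.1 \in ts} -> (size ts <= 2 * size (Dhat qf ell))%N ->
  shift_invariant P (coordinate X) kappa e ks.

Local Notation r := (rr qf ell).
Local Notation D := (Dhat qf ell).
Let al l := slope qf (r l).+1.
Let be (t l : nat) := qf (r l).+1 t.
Let off l := [seq doff qf ell l.+1 j | j <- iota 0 (blen qf ell l.+1)].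
Let Js := enum 'I_wp.
Let x0 : wp.-tuple R := [tuple 0 | _ < wp].
Let nsz := blks_size off Js.
Let e0 : 0 < e. Proof. by move: iot0 iot_e; lra. Qed.
Let lhk : (k <= lhat qf ell)%N. Proof. by case/andP: k_le. Qed.
Let al_gt0 l : (l < k)%N -> (0 < al l)%N.
Proof. by move=> lk; exact: (slope_gt0 ell1 qfE k_le linear lk). Qed.
Let al_incr l l' : (l < l')%N -> (l' < k)%N -> (al l < al l')%N.
Proof. by move=> ll l'k; exact: (slope_incr ell1 qfE qf_lt k_le linear). Qed.
Let off_D l : (l < k)%N -> {subset off l <= D}.
Proof.
move=> lk x /mapP[j]; rewrite mem_iota add0n => /andP[_ jb] ->.
exact: (doff_Dhat k_le lk jb).
Qed.
Let u_cvg0 : u @ \oo --> 0. Proof. exact/summable_vanishes/summable_unweight. Qed.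

Let stat ks a a' : {in ks, forall q, q.1 \in [seq (a + x)%N | x <- D] ++ [seq (a' + x)%N | x <- D]} ->
  shift_invariant P (coordinate X) kappa e ks.
Proof. by move=> h; apply: stat0 h _; rewrite size_cat !size_map mul2n addnn. Qed.

Let size_off l : size (off l) = blen qf ell l.+1. Proof. by rewrite size_map size_iota. Qed.

Let blkr l : (l < k)%N -> (r l.+1 = r l + blen qf ell l.+1)%N.
Proof.
by move=> lk; rewrite /blen subnKC//; apply/ltnW/r_incr => //; exact: leq_trans lk lhk.
Qed.

Let nszE i : (i <= k)%N -> nsz i = (r i * wp)%N.
Proof.
elim: i => [|i IH] ik; first by rewrite /nsz r0 mul0n.
by rewrite /nsz/= -/nsz IH ?(ltnW ik)// size_off size_enum_ord blkr// mulnDl.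
Qed.

(** At most lhat - 1 blocks precede a given one, each with at most |D| vectors of dimension wp: this
    is the dimension d of the assumption. *)
Let N0_ge i : (i < k)%N -> (nsz i <= (lhat qf ell).-1 * size D * wp)%N.
Proof.
move=> ik; have H j : (j <= k)%N -> (nsz j <= j * (size D * wp))%N.
  elim: j => // j IH jk; rewrite /nsz/= -/nsz mulSn addnC leq_add ?IH ?(ltnW jk)//.
  rewrite size_off size_enum_ord leq_mul2r; apply/orP; right; rewrite -size_off.
  by apply: uniq_leq_size; [exact: (doff_uniq ell1 qfE qf_lt k_le linear jk)|exact: off_D].
rewrite (leq_trans (H i (ltnW ik)))// -mulnA leq_mul2r; apply/orP; right.
by rewrite -ltnS prednK ?(leq_trans ik)// (leq_ltn_trans _ (leq_trans ik lhk)).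
Qed.

Let Gf x := G (unflatten wp (r k) x).
Hypothesis hG : hol kappa (r k * wp) iot C Gf.
Let hG' : hol kappa (nsz k) iot C Gf. Proof. by rewrite nszE. Qed.

Let valE t n l j : (l < k)%N -> (j < blen qf ell l.+1)%N ->
  qf (r l + j.+1) (n + t) = (al l * n + be t l + doff qf ell l.+1 j)%N.
Proof.
move=> lk jb; rewrite (block_valueE ell1 qfE qf_lt k_le linear lk _ jb) mulnDr -!addnA; congr (_ + _)%N.
rewrite addnA; congr (_ + _)%N.
have b0 : (0 < blen qf ell l.+1)%N by exact: leq_ltn_trans jb.
have := block_valueE ell1 qfE qf_lt k_le linear lk t b0.
by rewrite /be addn1 => ->; rewrite /doff /= addn1 subnn addn0.
Qed.

Let ev_blks t n i w : (i <= k)%N -> ev (xs (coordinate X) (blks al (be t) off Js i n)) w =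
  flatten [seq tval (X (qf j (n + t)) w) | j <- iota 1 (r i)].
Proof.
move=> ik; rewrite (iota_blocks ell1 k_le ik) map_flatten -map_comp.
elim: i ik => [//|i IH] ik; have -> : iota 0 i.+1 = iota 0 i ++ [:: i] by rewrite -[in LHS]addn1 iotaD.
have -> : xs (coordinate X) (blks al (be t) off Js i.+1 n) = xs (coordinate X) (blks al (be t) off Js i n) ++
    xs (coordinate X) (blk al (be t) off Js i n) by rewrite /xs -map_cat.
rewrite ev_cat IH; last exact: ltnW.
rewrite map_cat !flatten_cat; congr (_ ++ _); rewrite /= !cats0 /ev /xs -map_comp.
rewrite (ev_blk_flatten X al (be t) off i n w) /off -!map_comp; congr flatten.
by apply/eq_in_map => j; rewrite mem_iota add0n => /andP[_ jb] /=; rewrite valE.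
Qed.

Let block_funE t n w : block_fun (coordinate X) al (be t) off Js k Gf n w =
  G [seq X (qf i (n + t)) w | i <- iota 1 (r k)].
Proof.
rewrite /block_fun /Gf ev_blks//; congr G.
have := flattenK [seq X (qf i (n + t)) w | i <- iota 1 (r k)].
by rewrite size_map size_iota -map_comp.
Qed.


Local Notation pint t := (partial_integral P (coordinate X) al (be t) off Js k Gf).

(** Each law nu_i is the law of a block of X, so an integral against it is an expectation; matching
    the two recursions turns the centring hypothesis on G into the vanishing of the full partial
    integral. *)
Let iint_partial_integral t s acc : (s <= k)%N -> size acc = r (k - s) ->
  iint qf ell (nu P qf ell X) G s (k - s).+1 acc = (pint t s (flatten [seq tval x | x <- acc]))%:E.
Proof.
have [Cb _ hb] := partial_integral_hol al (be t) kappa01 (ltW iot0) iot_e M0 mxi hG'.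
elim: s acc => [|s IH] acc sk sacc.
  by rewrite /= subn0 in sacc *; rewrite /Gf -sacc flattenK.
set l := (k - s.+1)%N in sacc *; have lk : (l < k)%N by rewrite ltn_subrL (leq_ltn_trans _ sk).
have El : (k - s = l.+1)%N by rewrite /l subnSK.
set fa := flatten _.
pose phi (y : (blen qf ell l.+1).-tuple (wp.-tuple R)) := pint t s (fa ++ flatten [seq tval x | x <- y]).
have IHy y : iint qf ell (nu P qf ell X) G s l.+2 (acc ++ tval y) = (phi y)%:E.
  have := IH (acc ++ tval y) (ltnW sk); rewrite El => ->; last by rewrite size_cat sacc size_tuple blkr.
  by rewrite map_cat flatten_cat.
rewrite (_ : iint _ _ _ _ _ _ _ = (\int[nu P qf ell X l.+1]_y (phi y)%:E)%E); last first.
  by rewrite /=; congr (integral _ _ _); apply/funext => y; exact: IHy.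
pose us : seq ((blen qf ell l.+1).-tuple (wp.-tuple R) -> R) :=
  [seq (fun y => tnth (nth x0 (tval y) j) c) | j <- iota 0 (blen qf ell l.+1), c <- Js].
have evus y : ev us y = flatten [seq tval x | x <- tval y].
  rewrite -(coords_flatten x0) size_tuple /ev /us map_allpairs; exact: eq_allpairs.
have mus : mseq us.
  move=> i; apply: (nth_allpairs (Q := fun v => measurable_fun setT v)) => [|j c]; first exact: measurable_cst.
  apply: (measurableT_comp (f := fun x : wp.-tuple R => tnth x c)); first exact: measurable_tnth.
  exact: measurable_nth_tuple.
have ks : (k - l.+1 = s)%N by rewrite -El subKn// ltnW.
have hp : hol kappa (nsz l + size (off l) * size Js) iot Cb (pint t s).
  by have := hb l.+1; rewrite ltnS ks => /(_ lk).
have sfa : size fa = nsz l by rewrite /fa size_flatten_tuples sacc nszE// ltnW.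
have hs := hol_section (ltW iot0) sfa hp.
have mphi : measurable_fun setT phi.
  rewrite (_ : phi = fun y => pint t s (fa ++ ev us y)); last by apply/funext => y; rewrite evus.
  by apply: (holder_measurable kappa01 (ltW iot0) hs) => //; rewrite size_allpairs size_iota size_off.
pose k0 := blk al (fun=> 0%N) off Js l 0.
have E0 w : phi (blockX qf ell X l.+1 0 w) = pint t s (fa ++ ev (xs (coordinate X) k0) w).
  rewrite /phi map_tval_tuple /ev /xs -map_comp (ev_blk_flatten X al (fun=> 0%N) off l 0 w) /off -map_comp.
  congr (pint t s (fa ++ flatten _)); apply: eq_map => j /=.
  by rewrite muln0 !add0n.
have mX0 : measurable_fun setT (blockX qf ell X l.+1 0).
  apply/measurable_fun_tnthP => j; rewrite (_ : _ \o _ = X (0 + doff qf ell l.+1 j)%N); first exact: mX.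
  by apply/funext => w; rewrite /= tnth_mktuple.
have i0 : itg P (fun w => phi (blockX qf ell X l.+1 0 w)).
  rewrite (_ : (fun w => _) = (fun w => pint t s (fa ++ ev (xs (coordinate X) k0) w))); last first.
    by apply/funext => w; exact: E0.
  have [] := hol_itg kappa01 (ltW iot0) hs (us := xs (coordinate X) k0) _ e0 _ (moms_map e0 M0 k0 mxi) => //.
    by rewrite size_map size_blk.
  by move: iot_e iot0; lra.
rewrite /nu (integral_pushforward mX0 (f := EFin \o phi)) ?preimage_setT//; last first.
  exact/measurable_EFinP.
rewrite (integral_Ex i0); congr EFin.
under [X in Ex P X]eq_fun do rewrite E0.
rewrite /= -/l.
(* nu_i is taken at time 0, while the block in [partial_integral] starts at [be t l]; stationarity
   absorbs the translation. *)
have -> : blk al (be t) off Js l 0 = shift (be t l) k0.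
  rewrite /k0 /blk /shift map_allpairs; apply: eq_allpairs => // o j; congr (_, _) => /=.
  by rewrite muln0 !add0n addnC.
have SI : shift_invariant P (coordinate X) kappa e k0.
  apply: (@stat k0 0 0) => q0 /allpairsP[[a j] [ha _ ->]] /=; rewrite muln0 !add0n mem_cat.
  by apply/orP; left; apply/mapP; exists a; rewrite ?add0n//; exact: (off_D lk).
symmetry; apply: (SI (be t l) (Cb * wt fa `^ iot) iot (fun x => pint t s (fa ++ x)) (ltW iot0)).
  by move: iot_e iot0; lra.
by rewrite size_blk.
Qed.

Hypothesis mean0 : iint qf ell (nu P qf ell X) G k 1 [::] = 0%E.

Let pint0 t : pint t k [::] = 0.
Proof.
have := @iint_partial_integral t k [::] (leqnn k); rewrite subnn => /(_ erefl) /=.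
by rewrite mean0 => -[].
Qed.

Hypothesis mY : forall i n, measurable_fun setT (Y i n).
Hypothesis lawY : forall i, (1 <= i <= k)%N ->
  forall (mm : nat) (ns : mm.-tuple nat) (A : set (mm.-tuple ((blen qf ell i).-tuple (wp.-tuple R)))),
    measurable A ->
    P' ((fun w => map_tuple (fun n => Y i n w) ns) @^-1` A)
    = P ((fun w => map_tuple (fun n => blockX qf ell X i n w) ns) @^-1` A).
Hypothesis indY : indep_processes P' qf ell k Y.

Let ybl l n : seq (nat * nat * nat * 'I_wp) := [seq (l, n, j, c) | j <- iota 0 (blen qf ell l.+1), c <- Js].
Let ybls i n := flatten [seq ybl l n | l <- iota 0 i].
Let ys n := [seq spec_Y Y al (be 0) s | s <- ybls k n].
Let gg n w := G [seq X (qf i n) w | i <- iota 1 (r k)].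
Let Z n w := G (flatten [seq tval (Y i (qf (r i.-1).+1 n) w) | i <- iota 1 k]).

Let ybls_line i n : [seq spec_line qf ell al (be 0) s | s <- ybls i n] = line_blks al (be 0) off Js i 1 n.
Proof.
elim: i => [//|i IH]; rewrite /ybls; have -> : iota 0 i.+1 = iota 0 i ++ [:: i] by rewrite -[in LHS]addn1 iotaD.
rewrite map_cat flatten_cat map_cat IH /= cats0; congr (_ ++ _).
by rewrite /ybl /line_blk /off map_allpairs allpairs_mapl.
Qed.

Let ybls_valid n : all (spec_valid qf ell k) (ybls k n).
Proof.
apply/allP => s /flattenP[_ /mapP[l + ->]]; rewrite mem_iota add0n => /andP[_ lk].
move=> /allpairsP[[j c] [jb _ ->]]; rewrite /spec_valid /spec_block /spec_entry /= lk.
by move: jb; rewrite /= mem_iota add0n => /andP[].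
Qed.

Let size_ys n : size (ys n) = nsz k.
Proof. by rewrite size_map -(size_map (spec_line qf ell al (be 0))) ybls_line size_line_blks. Qed.

Let valE0 l n : (l < k)%N -> qf (r l).+1 n = (al l * n + be 0 l)%N.
Proof.
move=> lk; have := valE 0 n lk (blen_gt0 ell1 k_le lk); rewrite addn0 addn1 => ->.
by rewrite /doff /= addn1 subnn addn0.
Qed.

Let ZE n w : Z n w = Gf (ev (ys n) w).
Proof.
have E i : (i <= k)%N -> ev [seq spec_Y Y al (be 0) s | s <- ybls i n] w =
    flatten [seq tval x | x <- flatten [seq tval (Y i (qf (r i.-1).+1 n) w) | i <- iota 1 i]].
  elim: i => [//|i IH] ik; rewrite /ybls; have -> : iota 0 i.+1 = iota 0 i ++ [:: i] by rewrite -[in LHS]addn1 iotaD.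
  have -> : iota 1 i.+1 = iota 1 i ++ [:: i.+1] by rewrite -[X in iota 1 X]addn1 iotaD add1n.
  rewrite !map_cat !flatten_cat !map_cat ev_cat IH ?(ltnW ik)// flatten_cat; congr (_ ++ _).
  rewrite /= !cats0 -(coords_flatten x0) size_tuple /ev /ybl -!map_comp map_allpairs.
  apply: eq_allpairs => // j c /=.
  by rewrite /spec_Y /spec_time /spec_block /spec_entry /= -valE0.
have S j : (j <= k)%N -> size (flatten [seq tval (Y i (qf (r i.-1).+1 n) w) | i <- iota 1 j]) = r j.
  elim: j => [//|i IH] ik.
  have -> : iota 1 i.+1 = iota 1 i ++ [:: i.+1] by rewrite -[X in iota 1 X]addn1 iotaD add1n.
  by rewrite map_cat flatten_cat size_cat IH ?(ltnW ik)//= cats0 size_tuple blkr.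
by rewrite /Gf /ys E// -(S k)// flattenK.
Qed.

Let moms_ys n : moms P' e M (ys n).
Proof.
move=> i; have [ik|ik] := ltnP i (size (ybls k n)); last first.
  by rewrite nth_default ?size_map//; exact: mom_cst0.
have [s0 _] : exists s0 : nat * nat * nat * 'I_wp, True by case: (ybls k n) ik => // s0 ? _; exists s0.
rewrite (nth_map s0)//; apply: (spec_Y_mom al (be 0) mX mY lawY mxi).
by apply: (allP (ybls_valid n)); exact: mem_nth.
Qed.

(** Far along the diagonal the two lists of blocks behave jointly like the Y-blocks at n0 and n1:
    equal slopes at both times keep their joint law, and different slopes become independent. *)
Let pair_limit f l C0 n0 n1 : 0 <= l -> l + 1 <= e -> hol kappa (nsz k + nsz k) l C0 f ->
  (fun t => Ex P (fun w => f (ev (xs (coordinate X) (blks al (be 0) off Js k (n0 + t))) w ++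
                              ev (xs (coordinate X) (blks al (be 0) off Js k (n1 + t))) w))) @ \oo -->
  Ex P' (fun w => f (ev (ys n0) w ++ ev (ys n1) w)).
Proof.
move=> l0 le hf; pose Sl := line_blks al (be 0) off Js k 1 n0 ++ line_blks al (be 0) off Js k 1 n1.
pose S := ybls k n0 ++ ybls k n1.
have SE : [seq spec_line qf ell al (be 0) s | s <- S] = Sl by rewrite map_cat !ybls_line.
pose N := (\sum_(l < k) al l)%N.
have slo n : all (fun s => 0 < s.1.1 <= N)%N (line_blks al (be 0) off Js k 1 n).
  by have := line_blks_slopes (be 0) off Js al_gt0 n (leqnn k) (ltn0Sn 0); rewrite mul1n.
have slopes : all (fun s => 0 < s.1.1 <= N)%N Sl by rewrite all_cat !slo.
have st A : shift_invariant P (coordinate X) kappa e [seq on_line 0 s | s <- Sl & s.1.1 == A].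
  exact: (line_blks_stat al_incr off_D stat).
have sz : size Sl = (nsz k + nsz k)%N by rewrite size_cat !size_line_blks.
rewrite -sz in hf.
have := @line_cvg_to _ _ _ P _ (coordinate X) kappa iot e M _ u kappa01 (ltW iot0) iot_e M0 mxi dec u_cvg0
  Sl N slopes st _ _ P' (ys n0 ++ ys n1) f l C0 l0 le hf (moms_cat (moms_ys n0) (moms_ys n1)).
rewrite size_cat !size_ys sz => /(_ erefl) H.
have E1 : (fun w => f (ev (ys n0 ++ ys n1) w)) = (fun w => f (ev (ys n0) w ++ ev (ys n1) w)).
  by apply/funext => w; rewrite ev_cat.
have E2 t : (fun w => f (ev (xs (coordinate X) [seq on_line t s | s <- Sl]) w)) =
   (fun w => f (ev (xs (coordinate X) (blks al (be 0) off Js k (n0 + t))) w ++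
                ev (xs (coordinate X) (blks al (be 0) off Js k (n1 + t))) w)).
  apply/funext => w; rewrite /Sl map_cat !on_line_blks !mul1n; congr f.
  by rewrite /xs map_cat ev_cat.
under eq_fun do rewrite -E2; rewrite -E1; apply: H => phis sp bp.
rewrite -SE (_ : ys n0 ++ ys n1 = [seq spec_Y Y al (be 0) s | s <- S]); last by rewrite map_cat.
apply: (spec_product (be 0) mX mY lawY indY al_gt0 al_incr) => //.
- by rewrite all_cat !ybls_valid.
- by rewrite sp -sz -SE size_map.
- by move=> l' lk; rewrite /N (bigD1 (Ordinal lk))//= leq_addr.
Qed.

Let ggE n w : gg n w = Gf (ev (xs (coordinate X) (blks al (be 0) off Js k n)) w).
Proof. by rewrite -/(block_fun _ _ _ _ _ _ _ _ _) block_funE addn0. Qed.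

Let size_ev_blks t n w : size (ev (xs (coordinate X) (blks al (be t) off Js k n)) w) = nsz k.
Proof. by rewrite size_ev size_map size_blks. Qed.

Let cross_limit n0 n1 : (fun t => Ex P (fun w => gg (n0 + t) w * gg (n1 + t) w)) @ \oo -->
  Ex P' (fun w => Z n0 w * Z n1 w).
Proof.
have hp := hol_cat_product kappa01 (ltW iot0) hG' hG'.
have le : iot + iot + 1 <= e by move: iot_e; lra.
have H := @pair_limit _ _ _ n0 n1 (addr_ge0 (ltW iot0) (ltW iot0)) le hp.
rewrite (_ : Ex P' _ = Ex P' (fun w => (fun x => Gf (select (iota 0 (nsz k)) x) *
    Gf (select (iota (nsz k) (nsz k)) x)) (ev (ys n0) w ++ ev (ys n1) w))); last first.
  by congr Ex; apply/funext => w /=; rewrite select_catl ?select_catr ?size_ev ?size_ys// -!ZE.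
rewrite (_ : (fun t => _) = (fun t => Ex P (fun w => (fun x => Gf (select (iota 0 (nsz k)) x) *
    Gf (select (iota (nsz k) (nsz k)) x)) (ev (xs (coordinate X) (blks al (be 0) off Js k (n0 + t))) w ++
      ev (xs (coordinate X) (blks al (be 0) off Js k (n1 + t))) w))))//.
apply/funext => t; congr Ex; apply/funext => w /=.
by rewrite select_catl ?select_catr ?size_ev_blks// -!ggE.
Qed.

Let mean_limit n0 : (fun t => Ex P (gg (n0 + t))) @ \oo --> Ex P' (Z n0).
Proof.
have hp := hol_select kappa01 (nsz k + nsz k) (ltW iot0) (size_iota 0 (nsz k)) hG'.
have le : iot + 1 <= e by move: iot_e iot0; lra.
have H := @pair_limit _ _ _ n0 n0 (ltW iot0) le hp.
rewrite (_ : Ex P' _ = Ex P' (fun w => (fun x => Gf (select (iota 0 (nsz k)) x))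
    (ev (ys n0) w ++ ev (ys n0) w))); last first.
  by congr Ex; apply/funext => w /=; rewrite select_catl ?size_ev ?size_ys// -ZE.
rewrite (_ : (fun t => _) = (fun t => Ex P (fun w => (fun x => Gf (select (iota 0 (nsz k)) x))
  (ev (xs (coordinate X) (blks al (be 0) off Js k (n0 + t))) w ++
      ev (xs (coordinate X) (blks al (be 0) off Js k (n0 + t))) w))))//.
apply/funext => t; congr Ex; apply/funext => w /=.
by rewrite select_catl ?size_ev_blks// -ggE.
Qed.

Let ZEf n : Z n = (fun w => Gf (ev (ys n) w)). Proof. by apply/funext => w; exact: ZE. Qed.

Let lZ n : l2 P' (Z n).
Proof.
rewrite ZEf; have le : iot + iot <= e by move: iot_e; lra.
have h2 := holM (ltW iot0) (ltW iot0) hG' hG'.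
have [i2 _] := hol_itg kappa01 (addr_ge0 (ltW iot0) (ltW iot0)) h2 (size_ys n) e0 le (@moms_ys n).
split; first exact: (holder_measurable kappa01 (ltW iot0) hG' (size_ys n) (moms_mseq (@moms_ys n))).
by move: i2; congr itg; apply/funext => w; rewrite expr2.
Qed.

(** The mean of G_(n+t) tends to that of Z_n by [mean_limit], and to 0 by the telescoping
    decomposition. *)
Let EZ n : Ex P' (Z n) = 0.
Proof.
have h : (fun t => Ex P (gg t)) @ \oo --> 0.
  have := block_fun_mean_cvg kappa01 (ltW iot0) iot_e M0 mxi dec u_ge0 u_sum al_gt0 al_incr off_D stat N0_ge hG' (pint0 0).
  congr (_ @ \oo --> 0); apply/funext => t; congr Ex; apply/funext => w.
  by rewrite block_funE addn0.
have h2 := cvg0_comp_large (phi := fun t => (n + t)%N) (K := 0%N) h (fun t => leq_trans (leq_addl n t) (leq_addr 0 _)).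
by apply: (cvgn_unique (@mean_limit n)); exact: h2.
Qed.

Let c h := Ex P' (fun w => Z 0 w * Z h w).

Let gg_cvg h : (fun t => Ex P (fun w => gg t w * gg (t + h) w)) @ \oo --> c h.
Proof.
rewrite (_ : (fun t => _) = (fun t => Ex P (fun w => gg (0 + t) w * gg (h + t) w))).
  exact: cross_limit.
by apply/funext => t; congr Ex; apply/funext => w; rewrite add0n addnC.
Qed.

(** Shifting t by n does not change the limit of E G_t G_(t+m-n), so the covariances of Z depend on
    the lag only. *)
Let cZ n m : Ex P' (fun w => Z n w * Z m w) = c (ndist n m).
Proof.
wlog nm : n m / (n <= m)%N.
  move=> H; have [/H//|/ltnW/H] := leqP n m; rewrite ndistC => <-.
  by congr Ex; apply/funext => w; rewrite mulrC.
rewrite /ndist (_ : (n - m = 0)%N) ?add0n; last by apply/eqP.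
have h := @cross_limit n m; apply/esym; apply: (cvgn_unique (@gg_cvg (m - n))).
apply: (@cvg_shift _ (fun t => Ex P (fun w => gg t w * gg (t + (m - n)) w)) n).
rewrite (_ : (fun t => _) = (fun t => Ex P (fun w => gg (n + t) w * gg (m + t) w)))//.
apply/funext => t; congr Ex; apply/funext => w.
by rewrite (addnC t n) -[in RHS](subnKC nm) addnAC.
Qed.

Lemma linear_system_conclusion : exists sigma2 s2 : R,
  [/\ (fun N : nat => 'V_P[fun w => (\sum_(1 <= n < N.+1) gg n w)%R] * (N%:R^-1)%:E)%E @ \oo --> sigma2%:E,
      (fun N : nat => 'V_P'[fun w => (\sum_(1 <= n < N.+1) Z n w)%R] * (N%:R^-1)%:E)%E @ \oo --> s2%:E,
      (0 < sigma2 <-> 0 < s2) &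
      (0 < s2 <-> ~ exists V : nat -> Omega' -> R, weakly_stationary P' V /\
         forall n : nat, {ae P', forall w, Z n w = V n.+1 w - V n w})].
Proof.
(* The sums start at n = 1, so the block functions with origin 1 are used; by stationarity of Z the
   limiting covariances are unchanged. *)
have hc h : (fun n => Ex P (fun w => block_fun (coordinate X) al (be 1) off Js k Gf n w *
    block_fun (coordinate X) al (be 1) off Js k Gf (n + h) w)) @ \oo --> c h.
  rewrite -(_ : Ex P' (fun w => Z 1 w * Z (1 + h)%N w) = c h); last first.
    by rewrite cZ /ndist addKn (_ : (1 - (1 + h) = 0)%N)//; apply/eqP; rewrite subn_eq0 leq_addr.
  rewrite (_ : (fun n => _) = (fun n => Ex P (fun w => gg (1 + n) w * gg (1 + h + n) w))).
    exact: cross_limit.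
  apply/funext => n; congr Ex; apply/funext => w.
  by rewrite !block_funE /gg !addn1 !add1n addSn (addnC h).
have [sigma2 [s2 [beta [hs hB pos]]]] := block_variance kappa01 (ltW iot0) iot_e M0 mxi dec u_ge0 u_sum
  al_gt0 al_incr off_D stat N0_ge hG' (pint0 1) hc.
exists sigma2, s2; split=> //; last exact: (coboundary_criterion lZ EZ cZ hB).
- have lg n : l2 P (block_fun (coordinate X) al (be 1) off Js k Gf n).
    exact: (block_fun_l2 kappa01 (ltW iot0) iot_e M0 mxi hG' (pint0 1)).
  have lS N : l2 P (fun w => \sum_(n < N) block_fun (coordinate X) al (be 1) off Js k Gf n w).
    by apply: (l2_sum _ (f := fun (i : 'I_N) w => block_fun (coordinate X) al (be 1) off Js k Gf i w)).
  have SE N : (fun w => (\sum_(1 <= n < N.+1) gg n w)%R) =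
      (fun w => \sum_(n < N) block_fun (coordinate X) al (be 1) off Js k Gf n w).
    apply/funext => w; rewrite big_add1 /= big_mkord; apply: eq_bigr => n _.
    by rewrite block_funE addn1.
  have VE N : ('V_P[fun w => (\sum_(1 <= n < N.+1) gg n w)%R] * (N%:R^-1)%:E)%E =
    ((Ex P (fun w => (\sum_(n < N) block_fun (coordinate X) al (be 1) off Js k Gf n w) ^+ 2) -
      Ex P (fun w => \sum_(n < N) block_fun (coordinate X) al (be 1) off Js k Gf n w) ^+ 2) / N%:R)%:E.
    by rewrite SE /variance (covariance_Ex (lS N) (lS N)) -EFinM -expr2; under [in RHS]eq_fun do rewrite expr2.
  under eq_fun do rewrite VE.
  by apply: cvg_EFin => //; apply: nearW.
- have lS N : l2 P' (fun w => \sum_(n < N) Z n.+1 w).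
    exact: (l2_sum _ (f := fun (i : 'I_N) w => Z i.+1 w)).
  have SE N : (fun w => (\sum_(1 <= n < N.+1) Z n w)%R) = (fun w => \sum_(n < N) Z n.+1 w).
    by apply/funext => w; rewrite big_add1 /= big_mkord.
  have VE N : ('V_P'[fun w => (\sum_(1 <= n < N.+1) Z n w)%R] * (N%:R^-1)%:E)%E =
    ((\sum_(n < N) \sum_(m < N) c (ndist n m)) / N%:R)%:E.
    rewrite SE /variance (covariance_Ex (lS N) (lS N)) -EFinM; congr (_ / _)%:E.
    rewrite (sqr_sum_Ex _ _ (f := fun (i : 'I_N) w => Z i.+1 w) (g := fun (i : 'I_N) w => Z i.+1 w))//.
    rewrite (Ex_sum _ (f := fun (i : 'I_N) w => Z i.+1 w)); last by move=> i; exact: l2_itg.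
    rewrite [X in _ - X * _]big1 ?mul0r ?subr0//.
    by apply: eq_bigr => i _; apply: eq_bigr => j _; rewrite cZ /ndist !subSS.
  under eq_fun do rewrite VE.
  by apply: cvg_EFin; [apply: nearW|exact: (coboundary_variance_cvg hB)].
Qed.

End linear_system.

Theorem theorem2p4
  (R : realType) (d : measure_display) (Omega : measurableType d)
  (P : probability Omega R)
  (wp : nat) (X : nat -> Omega -> wp.-tuple R)
  (Fam : \bar int -> \bar int -> set (set Omega))
  (ell : nat) (qp : nat -> {poly rat}) (qf : nat -> nat -> nat)
  (F : seq (wp.-tuple R) -> R) (K iot kappa : R)
  (p q delta m : R)
  (k : nat) (G : seq (wp.-tuple R) -> R)
  (d' : measure_display) (Omega' : measurableType d') (P' : probability Omega' R)
  (Y : forall i : nat, nat -> Omega' -> (blen qf ell i).-tuple (wp.-tuple R)) :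
  (* ---- General Setup ---- *)
  (0 < wp)%N ->
  (forall n, measurable_fun setT (X n)) ->
  (forall a b, sigma_algebra setT (Fam a b) /\ Fam a b `<=` measurable) ->
  (forall a b a' b', (a' <= a)%E -> (b <= b')%E -> Fam a b `<=` Fam a' b') ->
  (* the polynomials q_1, ..., q_ell *)
  (1 <= ell)%N ->
  (forall i, (1 <= i <= ell)%N -> (1 < size (qp i))%N) ->
  (forall i n, (1 <= i <= ell)%N -> ((qf i n)%:R : rat) = (qp i).[n%:R]) ->
  (exists N, forall n, (N <= n)%N -> forall i, (1 <= i < ell)%N -> (qf i n < qf i.+1 n)%N) ->
  (* stationarity *)
  (forall n (A : set (wp.-tuple R)), measurable A ->
     P (X n @^-1` A) = P (X 0%N @^-1` A)) ->
  (forall (kk : nat) (ns ms : kk.-tuple nat), (kk <= 2 * size (Dhat qf ell))%N ->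
     sorted leq ns -> sorted leq ms ->
     (forall j, (j.+1 < kk)%N ->
        (nth 0 ns j.+1 - nth 0 ns j = nth 0 ms j.+1 - nth 0 ms j)%N) ->
     forall A : set (kk.-tuple (wp.-tuple R)), measurable A ->
       P ((fun w => map_tuple (fun n => X n w) ns) @^-1` A)
       = P ((fun w => map_tuple (fun n => X n w) ms) @^-1` A)) ->
  (* F *)
  0 < K -> 0 < iot -> 0 < kappa <= 1 ->
  holder_growth ell K iot kappa F ->
  (* ---- Assumption 2.1, with the strengthened summability conditions ---- *)
  1 <= p -> 1 <= q -> 0 < delta -> 0 < m ->
  delta < kappa - ((lhat qf ell).-1 * size (Dhat qf ell) * wp)%N%:R / p ->
  (\sum_(1 <= n <oo) ((n%:R)%:E * varpi P Fam q p n) < +oo)%E ->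
  (\sum_(1 <= r <oo) ((r%:R)%:E * poweR (beta P Fam X q r) delta) < +oo)%E ->
  (gammaX P X m < +oo)%E ->
  (gammaX P X (2 * q * iot) < +oo)%E ->
  p^-1 + (iot + 2) / m + delta / q <= 2^-1 ->
  (* ---- q_1 linear; q_1, ..., q_{r_k} are exactly the linear q_i ---- *)
  size (qp 1%N) = 2%N ->
  (1 <= k <= lhat qf ell)%N ->
  (forall i, (1 <= i <= ell)%N -> (size (qp i) == 2%N) = (i <= rr qf ell k)%N) ->
  (* ---- G ---- *)
  holder_growth (rr qf ell k) K iot kappa G ->
  iint qf ell (nu P qf ell X) G k 1 [::] = 0%E ->
  (* ---- the processes Y^(1), ..., Y^(k) ---- *)
  (forall i n, measurable_fun setT (Y i n)) ->
  (forall i, (1 <= i <= k)%N ->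
     forall (mm : nat) (ns : mm.-tuple nat)
            (A : set (mm.-tuple ((blen qf ell i).-tuple (wp.-tuple R)))),
       measurable A ->
       P' ((fun w => map_tuple (fun n => Y i n w) ns) @^-1` A)
       = P ((fun w => map_tuple (fun n => blockX qf ell X i n w) ns) @^-1` A)) ->
  indep_processes P' qf ell k Y ->
  let Gn := fun (n : nat) (w : Omega) =>
    G [seq X (qf i n) w | i <- iota 1 (rr qf ell k)] in
  let Z := fun (n : nat) (w : Omega') =>
    G (flatten [seq tval (Y i (qf (rr qf ell i.-1).+1 n) w) | i <- iota 1 k]) in
  let Sigma := fun (N : nat) (w : Omega') => \sum_(1 <= n < N.+1) Z n w in
  exists sigma2 s2 : R,
    [/\ (fun N : nat => 'V_P[fun w => (\sum_(1 <= n < N.+1) Gn n w)%R] * (N%:R^-1)%:E)%E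
          @ \oo --> sigma2%:E,
        (fun N : nat => 'V_P'[Sigma N] * (N%:R^-1)%:E)%E @ \oo --> s2%:E,
        (0 < sigma2 <-> 0 < s2) &
        (0 < s2 <->
           ~ exists V : nat -> Omega' -> R,
               weakly_stationary P' V /\
               forall n : nat, {ae P', forall w, Z n w = V n.+1 w - V n w})].
Proof.
move=> _ mX FamS FamM ell1 _ qfE qflt marg joint K0 iot0 kappa01 _ p1 q1 delta0 m0 dlt vsum bsum gm gq.
move=> expo _ klh lin hG iint0 mY lawY indY Gn Z Sigma.
have [M [u [M0 mxi dec u0 us]]] := coordinate_decoupled mX FamS FamM marg kappa01 iot0 p1 q1 delta0 m0
  dlt vsum bsum gm gq expo.
have [C hC] := holder_growth_hol K0 iot0 kappa01 hG.
have e4 : 2 * iot + 4 <= moment_exponent q m iot by exact: (moment_exponent_ge p1 q1 delta0 m0 expo).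
have e1 : 2 * iot + 1 <= moment_exponent q m iot by move: e4; lra.
have e0 : 0 < moment_exponent q m iot by move: e4 iot0; lra.
have stat := stationary_shift_invariant mX joint kappa01 e0 M0 mxi.
exact: (linear_system_conclusion mX ell1 qfE qflt klh lin iot0 kappa01 e1 M0 mxi dec u0 us stat hC iint0 mY lawY indY).
Qed.
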